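(* Let $d\ge 2$, let $U\subset\mathbb{R}^d$ be a bounded open set and let $B_R(x_0)$ be an open ball with $\overline U\subset B_R(x_0)$. Let $p\in(d,\infty)$, $\mathbf H\in L^p(U,\mathbb{R}^d)$ and $h\in L^p(U)$ with $\|\mathbf H\|\le h$ a.e. in $U$ ($\mathbf H$ and $h$ are extended by zero to $\mathbb{R}^d$). Let $A=(a_{ij})_{1\le i,j\le d}$ be a (possibly non-symmetric) matrix of measurable functions on $\mathbb{R}^d$ such that for some constants $M>0$, $\lambda>0$, $$\max_{1\le i,j\le d}|a_{ij}(x)|\le M,\qquad \langle A(x)\xi,\xi\rangle\ge\lambda\|\xi\|^2\quad\text{for a.e. }x\in\mathbb{R}^d\text{ and all }\xi\in\mathbb{R}^d.$$ Let $\theta\in[0,\infty)$ be a constant and let $c\in L^s(U)$ with $c\ge 0$ a.e. in $U$, where $s\in(1,\infty)$ if $d=2$ and $s:=\frac d2$ if $d\ge3$. Let $g\in L^2(U)$, $T\in(0,\infty)$, and let $\mathbf u\in C([0,\infty);L^2(U))\cap L^2(0,T;H^{1,2}_0(U))$ be the (unique) weak solution, described in the context, of $$u_t-\operatorname{div}(A\nabla u)+\langle\mathbf H,\nabla u\rangle+(c+\theta)u=0\ \text{in }U\times(0,T),\quad u=0\ \text{on }\partial U\times[0,T],\quad u=g\ \text{on }U\times\{t=0\}.$$ Let $K_1\ge1$ be the constant described in the context, which depends only on $d,\lambda,M,R,p$ and $\|h\|_{L^p(U)}$. Then the following hold. (i) $$\|\mathbf u\|_{L^2(0,T;H^{1,2}_0(U))}\le\left(\frac{K_1}{2\lambda}\right)^{1/2}\|g\|_{L^2(U)}.$$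 (ii) $$\|\mathbf u(t)\|_{L^2(U)}\le K_1^{1/2}e^{-\kappa t}\|g\|_{L^2(U)}\quad\text{for all }t\in(0,\infty),\qquad\text{where }\ \kappa:=\theta+\frac{d^2\lambda}{4K_1(d-1)^2|U|^{2/d}}.$$ (iii) Let $r\in[1,\infty)$. If $g\in L^2(U)\cap L^r(U)$, then $\mathbf u\in C([0,\infty);L^r(U))$ and $$\|\mathbf u(t)\|_{L^r(U)}\le K_1^{1/r}e^{-\theta t}\|g\|_{L^r(U)}\quad\text{for all }t\in(0,\infty).$$ Moreover, if $g\in L^\infty(U)$, then $$\|\mathbf u(t)\|_{L^\infty(U)}\le e^{-\theta t}\|g\|_{L^\infty(U)}\quad\text{for all }t\in(0,\infty).$$
   Context: Notation. $\|\cdot\|$ and $\langle\cdot,\cdot\rangle$ are the Euclidean norm and inner product on $\mathbb{R}^d$; $B_r(x_0)$ is the open ball; $|U|$ is the Lebesgue measure of $U$. $H^{1,2}(U)$ is the usual Sobolev space, $H^{1,2}_0(U)$ is the closure of $C_0^\infty(U)$ in $H^{1,2}(U)$, normed by $\|u\|_{H^{1,2}_0(U)}:=\|\nabla u\|_{L^2(U)}$, and $H^{-1,2}(U)$ is its dual; $\langle\cdot,\cdot\rangle_{H^{-1,2}(U)}$ is the duality pairing, and $L^2(U)$ is embedded in $H^{-1,2}(U)$ through the $L^2(U)$ inner product. $L^2(0,T;X)$ is the Bochner space with norm $(\int_0^T\|\mathbf u(t)\|_X^2dt)^{1/2}$. The statement $\mathbf u'\in L^2(0,T;H^{-1,2}(U))$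 means that there is $\mathbf u'\in L^2(0,T;H^{-1,2}(U))$ with $\int_0^T\mathbf u'(t)\eta(t)dt=-\int_0^T\mathbf u(t)\eta'(t)dt$ in $H^{-1,2}(U)$ for all $\eta\in C_0^\infty((0,T))$. Weak solution. For $T\in(0,\infty)$ and $g\in L^2(U)$, $\mathbf u$ is a weak solution of the initial-boundary value problem on $(0,T)$ if: (1) $\mathbf u\in L^2(0,T;H^{1,2}_0(U))$ and $\mathbf u'\in L^2(0,T;H^{-1,2}(U))$; (2) for all $v\in H^{1,2}_0(U)$ and a.e. $t\in(0,T)$, $$\langle\mathbf u'(t),v\rangle_{H^{-1,2}(U)}+\int_U\langle A\nabla\mathbf u(t),\nabla v\rangle+\langle\mathbf H,\nabla\mathbf u(t)\rangle v+(c+\theta)\mathbf u(t)v\,dx=0;$$ (3) $\lim_{t\to0+}\mathbf u(t)=g$ in $L^2(U)$. (Such $\mathbf u$ has a version in $C([0,T];L^2(U))$, with which it is identified.) The function $\mathbf u$ of the claim is the unique $\mathbf u\in C([0,\infty);L^2(U))$ with $\mathbf u(0)=g$ whose restriction to $(0,T')$ is a weak solution on $(0,T')$ for every $T'\in(0,\infty)$; such a function exists. The constant $K_1$. Under the stated hypotheses on $U,B_R(x_0),\mathbf H,h,A$, it is known that for any $x_1\in U$ there exists $\rho\in H^{1,2}(B_{4R}(x_0))\cap C(B_{4R}(x_0))$ with $\rho>0$ on $B_{4R}(x_0)$, $\rho(x_1)=1$ and $$\int_{B_{4R}(x_0)}\langle A^T\nabla\rho+\rho\mathbf H,\nabla\varphi\rangle\,dx=0\quad\text{for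 all }\varphi\in C_0^\infty(B_{4R}(x_0)),\qquad( * )$$ and that (by an elliptic Harnack inequality) there is a constant $K_1\ge1$ depending only on $d,\lambda,M,R,p,\|h\|_{L^p(U)}$ such that every such $\rho$ satisfies $$\max_{\overline B_{3R}(x_0)}\rho\le K_1\min_{\overline B_{3R}(x_0)}\rho,\quad\text{hence}\quad 1\le\frac{\max_{\overline U}\rho}{\min_{\overline U}\rho}\le K_1 .$$ Here ''depending only on'' means that the same $K_1$ works for all data $(U,x_0,x_1,A,\mathbf H,h)$ satisfying the hypotheses with the same values of $d,\lambda,M,R,p,\|h\|_{L^p(U)}$. $K_1$ denotes this constant. *)

(* Defs.v *)
From HB Require Import structures.
From mathcomp Require Import all_boot all_order all_algebra.
From mathcomp Require Import all_classical all_reals all_analysis.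
Set Implicit Arguments.
Unset Strict Implicit.
Unset Printing Implicit Defensive.
Import Order.TTheory GRing.Theory Num.Theory.
Import numFieldNormedType.Exports.
Local Open Scope classical_set_scope.
Local Open Scope ring_scope.

(* The sigma-algebra on 'rV[R]_n is generated by the coordinate projections: it
   is the Borel sigma-algebra of R^n. *)
Definition rV_display : measure_display.
Proof. exact: default_measure_display. Qed.

Section measurable_rV.
Context {R : realType} {n : nat}.

Definition rV_coord (i : 'I_n) (x : 'rV[R]_n) : measurableTypeR R := x ord0 i.

Let rV_set0 : g_sigma_preimage rV_coord set0.
Proof. exact: sigma_algebra0. Qed.

Let rV_setC A : g_sigma_preimage rV_coord A -> g_sigma_preimage rV_coord (~` A).
Proof. exact: sigma_algebraC. Qed.

Let rV_bigcup (F : (set 'rV[R]_n)^nat) :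
  (forall i, g_sigma_preimage rV_coord (F i)) ->
  g_sigma_preimage rV_coord (\bigcup_i (F i)).
Proof. exact: sigma_algebra_bigcup. Qed.

HB.instance Definition _ :=
  @isMeasurable.Build rV_display 'rV[R]_n (g_sigma_preimage rV_coord)
    rV_set0 rV_setC rV_bigcup.

Lemma measurable_rV_coord (i : 'I_n) :
  measurable_fun [set: 'rV[R]_n] (rV_coord i).
Proof.
move=> _ Y mY; rewrite setTI; apply: sub_sigma_algebra => /=.
rewrite -bigcup_seq/=; exists i => /=; first by rewrite mem_index_enum.
by exists Y => //; rewrite setTI.
Qed.

Lemma measurable_fun_rVP d (T : measurableType d) (f : T -> 'rV[R]_n) :
  (forall i, measurable_fun [set: T] (rV_coord i \o f)) ->
  measurable_fun [set: T] f.
Proof.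
move=> mf _ A mA; rewrite setTI.
have : (g_sigma_preimage (fun i => rV_coord i \o f)) (f @^-1` A).
  by rewrite g_sigma_preimage_comp; exists A => //; rewrite setTI.
apply: smallest_sub; first exact: sigma_algebra_measurable.
rewrite -bigcup_seq; apply: bigcup_sub => i _ B [C mC <-]; exact: mf.
Qed.

End measurable_rV.

(* Lebesgue measure on R^n, as the n-fold product of the one-dimensional one;
   lebesgue_rV_box gives its value on products of measurable sets. *)
Section lebesgue_rV.
Context {R : realType}.

Definition rV_cons {n : nat} (p : measurableTypeR R * 'rV[R]_n) : 'rV[R]_n.+1 :=
  row_mx (const_mx p.1 : 'rV_1) p.2.

Definition rV_uncons {n : nat} (x : 'rV[R]_n.+1) : measurableTypeR R * 'rV[R]_n :=
  ((x : 'rV_(1 + n)) ord0 ord0, rsubmx (x : 'rV_(1 + n))).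

Lemma rV_consK {n : nat} : cancel (@rV_cons n) rV_uncons.
Proof.
move=> [a x]; rewrite /rV_uncons /rV_cons /= row_mxKr; congr pair.
have -> : (ord0 : 'I_(1 + n)) = lshift n ord0 by apply: val_inj.
by rewrite row_mxEl mxE.
Qed.

Lemma measurable_rV_cons {n : nat} : measurable_fun setT (@rV_cons n).
Proof.
apply: measurable_fun_rVP => i.
have -> : i = unsplit (fintype.split (i : 'I_(1 + n))) by rewrite splitK.
case: (fintype.split _) => j /=.
  rewrite (_ : _ \o _ = fst); first exact: measurable_fst.
  apply/funext => -[a x].
  by apply: etrans (row_mxEl (const_mx a) x ord0 j) _; rewrite mxE.
rewrite (_ : _ \o _ = rV_coord j \o snd); last first.
  apply/funext => -[a x]; exact: (row_mxEr (const_mx a) x ord0 j).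
by apply: measurableT_comp => //; exact: measurable_rV_coord.
Qed.

Lemma measurable_rV_uncons {n : nat} : measurable_fun setT (@rV_uncons n).
Proof.
apply/measurable_fun_pairP; split => /=.
  exact: (@measurable_rV_coord R n.+1 ord0).
apply: measurable_fun_rVP => j.
rewrite (_ : _ \o _ = rV_coord (rshift 1 j)); first exact: measurable_rV_coord.
by apply/funext => x; rewrite /rV_coord /= mxE.
Qed.

Section step.
Context {n : nat} (m : {sigma_finite_measure set 'rV[R]_n -> \bar R}).

Definition lebesgue_step (A : set 'rV[R]_n.+1) : \bar R :=
  (@lebesgue_measure R \x m)%E (rV_cons @^-1` A).

Let preim_measurable A : measurable A -> measurable (@rV_cons n @^-1` A).
Proof. by move=> mA; rewrite -[X in measurable X]setTI; exact: measurable_rV_cons. Qed.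

Let lebesgue_step0 : lebesgue_step set0 = 0%E.
Proof. by rewrite /lebesgue_step preimage_set0 measure0. Qed.

Let lebesgue_step_ge0 A : (0 <= lebesgue_step A)%E.
Proof. exact: measure_ge0. Qed.

Let lebesgue_step_sigma_additive : semi_sigma_additive lebesgue_step.
Proof.
move=> F mF tF mUF; rewrite /lebesgue_step preimage_bigcup.
apply: measure_semi_sigma_additive.
- by move=> k; exact: preim_measurable.
- apply/trivIsetP => /= i j _ _ ij; rewrite -preimage_setI.
  by move/trivIsetP : tF => /(_ _ _ _ _ ij) ->//; rewrite preimage_set0.
- by rewrite -preimage_bigcup; exact: preim_measurable.
Qed.

HB.instance Definition _ := isMeasure.Build _ _ _
  lebesgue_step lebesgue_step0 lebesgue_step_ge0 lebesgue_step_sigma_additive.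

Let lebesgue_step_sigma_finite : sigma_finite setT lebesgue_step.
Proof.
have /sigma_finiteP[F [TF ndF Foo]] := sigma_finiteT (@lebesgue_measure R).
have /sigma_finiteP[G [TG ndG Goo]] := sigma_finiteT m.
exists (fun k => @rV_uncons n @^-1` (F k `*` G k)).
  rewrite -preimage_bigcup; apply/esym; rewrite -subTset => x _ /=.
  have [k _ Fk] : (\bigcup_k F k) (rV_uncons x).1 by rewrite -TF.
  have [l _ Gl] : (\bigcup_k G k) (rV_uncons x).2 by rewrite -TG.
  exists (maxn k l) => //; split.
  - by move: Fk; exact/subsetPset/ndF/leq_maxl.
  - by move: Gl; exact/subsetPset/ndG/leq_maxr.
move=> k; have [mF Fk] := Foo k; have [mG Gk] := Goo k; split.
  rewrite -[X in measurable X]setTI; apply: measurable_rV_uncons => //.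
  exact: measurableX.
rewrite /lebesgue_step -comp_preimage (_ : _ \o _ = id); last first.
  by apply/funext => p; exact: rV_consK.
by rewrite preimage_id product_measure1E// lte_mul_pinfty// ge0_fin_numE.
Qed.

HB.instance Definition _ := Measure_isSigmaFinite.Build _ _ _ lebesgue_step
  lebesgue_step_sigma_finite.

End step.

Fixpoint lebesgue_rV (n : nat) : {sigma_finite_measure set 'rV[R]_n -> \bar R} :=
  if n is n'.+1 then lebesgue_step (lebesgue_rV n') else \d_(0 : 'rV[R]_0).

Lemma rV_cons0 n a (x : 'rV[R]_n) : rV_cons (a, x) ord0 ord0 = a.
Proof.
have -> : (ord0 : 'I_n.+1) = lshift n (ord0 : 'I_1) by apply: val_inj.
by apply: etrans (row_mxEl (const_mx a) x ord0 ord0) _; rewrite mxE.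
Qed.

Lemma rV_consS n a (x : 'rV[R]_n) i :
  rV_cons (a, x) ord0 (lift ord0 i) = x ord0 i.
Proof.
have -> : lift ord0 i = rshift 1 i by apply: val_inj.
exact: (row_mxEr (const_mx a) x ord0 i).
Qed.

Lemma lebesgue_rV_box n (A : 'I_n -> set (measurableTypeR R)) :
  (forall i, measurable (A i)) ->
  lebesgue_rV n [set x | forall i, A i (x ord0 i)] =
  (\prod_(i < n) lebesgue_measure (A i))%E.
Proof.
elim: n A => [|n IHn] A mA /=.
  by rewrite big_ord0 diracE mem_set// => -[].
rewrite /lebesgue_step big_ord_recl -IHn; last by move=> i; exact: mA.
have mB : measurable [set x : 'rV[R]_n | forall i, A (lift ord0 i) (x ord0 i)].
  rewrite [X in measurable X](_ : _ =
      \bigcap_(i in [set: 'I_n]) (rV_coord i @^-1` A (lift ord0 i))).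
    apply: fin_bigcap_measurable => // i _.
    rewrite -[X in measurable X]setTI.
    by apply: measurable_rV_coord => //; exact: mA.
  by apply/seteqP; split => x /= Ax i => [_|]; exact: Ax.
rewrite -product_measure1E//.
congr (_ _); apply/seteqP; split => -[a x] /=.
  move=> Aax; split; first by have := Aax ord0; rewrite rV_cons0.
  by move=> i; have := Aax (lift ord0 i); rewrite rV_consS.
move=> [Aa Ax] i; case: (unliftP ord0 i) => [j|] ->.
  by rewrite rV_consS.
by rewrite rV_cons0.
Qed.

End lebesgue_rV.

(* The library norm on 'rV[R]_d is the sup norm: the Euclidean structure is
   spelled out.  Both norms induce the same topology, so open, closure, compact
   and continuity are the library's. *)
Section euclidean.
Context {R : realType} {d : nat}.

Definition dotp (x y : 'rV[R]_d) : R := \sum_(i < d) x ord0 i * y ord0 i.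

Definition enorm (x : 'rV[R]_d) : R := Num.sqrt (dotp x x).

Definition eball (x0 : 'rV[R]_d) (r : R) : set 'rV[R]_d :=
  [set x | enorm (x - x0) < r].

(* A xi for a row vector xi, i.e. (A xi)_i = \sum_j a_ij xi_j. *)
Definition mxact (A : 'M[R]_d) (xi : 'rV[R]_d) : 'rV[R]_d := xi *m A^T.

End euclidean.

Section test_functions.
Context {R : realType}.

Fixpoint Ck {d : nat} (k : nat) (f : 'rV[R]_d -> R) : Prop :=
  continuous f /\
  if k is k'.+1 then
    forall i : 'I_d, (forall x, derivable f x (delta_mx ord0 i)) /\
                     Ck k' ('D_(delta_mx ord0 i) f)
  else True.

Definition test_function {d : nat} (U : set 'rV[R]_d) (phi : 'rV[R]_d -> R) :=
  (forall k, Ck k phi) /\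
  exists K : set 'rV[R]_d,
    [/\ compact K, K `<=` U & forall x, ~ K x -> phi x = 0].

Definition cgrad {d : nat} (phi : 'rV[R]_d -> R) (x : 'rV[R]_d) : 'rV[R]_d :=
  \row_(i < d) 'D_(delta_mx ord0 i) phi x.

Definition time_test_function (T : R) (eta : R -> R) :=
  (forall k t, derivable (derive1n k eta) t 1) /\
  exists K : set R,
    [/\ compact K, K `<=` `]0, T[ & forall t, ~ K t -> eta t = 0].

End test_functions.

(* Elements of function spaces over U are represented by functions on the whole
   of R^d, of which only the values on U, up to a null set, matter.
   ae_measurable is measurability with respect to the completed (Lebesgue)
   sigma-algebra; the library integral and Lnorm take the correct value on such
   functions. *)
Section Lp.
Context {R : realType} {d : nat}.
Local Notation mu := (@lebesgue_rV R d).

Definition ae_measurable (U : set 'rV[R]_d) (f : 'rV[R]_d -> R) :=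
  exists2 g : 'rV[R]_d -> measurableTypeR R, measurable_fun setT g &
    {ae mu, forall x, U x -> f x = g x}.

Definition zext {V : zmodType} (U : set 'rV[R]_d) (f : 'rV[R]_d -> V) :
  'rV[R]_d -> V := patch (fun=> 0) U f.

Definition Lpnorm (U : set 'rV[R]_d) (p : \bar R) (f : 'rV[R]_d -> R) : \bar R :=
  'N[mu]_p [EFin \o zext U f]%E.

Definition in_Lp (U : set 'rV[R]_d) (p : \bar R) (f : 'rV[R]_d -> R) :=
  ae_measurable U f /\ (Lpnorm U p f < +oo)%E.

Definition in_Lp_vec (U : set 'rV[R]_d) (p : \bar R)
    (F : 'rV[R]_d -> 'rV[R]_d) :=
  (forall i, ae_measurable U (fun x => F x ord0 i)) /\
  (Lpnorm U p (enorm \o F) < +oo)%E.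

(* u : [0, oo) -> L^r(U) is continuous; u t is irrelevant for t < 0. *)
Definition continuous_Lp (U : set 'rV[R]_d) (r : \bar R)
    (u : R -> 'rV[R]_d -> R) :=
  (forall t, 0 <= t -> in_Lp U r (u t)) /\
  (forall t, 0 <= t ->
    Lpnorm U r (u s \- u t) @[s --> within [set s | 0 <= s] (nbhs t)] --> 0%E).

End Lp.

Section sobolev.
Context {R : realType} {d : nat}.
Implicit Types U : set 'rV[R]_d.
Local Notation mu := (@lebesgue_rV R d).

Definition is_weak_grad U (u : 'rV[R]_d -> R) (G : 'rV[R]_d -> 'rV[R]_d) :=
  forall phi, test_function U phi -> forall i : 'I_d,
    \int[mu]_(x in U) (u x * 'D_(delta_mx ord0 i) phi x) =
    - \int[mu]_(x in U) (G x ord0 i * phi x).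

Definition H12 U (u : 'rV[R]_d -> R) :=
  in_Lp U 2%:E u /\ exists2 G, in_Lp_vec U 2%:E G & is_weak_grad U u G.

(* A representative of the weak gradient (which is unique a.e. on U) of a
   function in H^{1,2}(U). *)
Definition grad U (u : 'rV[R]_d -> R) : 'rV[R]_d -> 'rV[R]_d :=
  xget (fun=> 0) [set G | in_Lp_vec U 2%:E G /\ is_weak_grad U u G].

Definition H12norm U (u : 'rV[R]_d -> R) : \bar R :=
  ((Lpnorm U 2%:E u ^+ 2 + Lpnorm U 2%:E (enorm \o grad U u) ^+ 2) `^ 2^-1)%E.

Definition H10 U (u : 'rV[R]_d -> R) :=
  H12 U u /\
  exists2 phi : nat -> 'rV[R]_d -> R, (forall n, test_function U (phi n)) &
    H12norm U (u \- phi n) @[n --> \oo] --> 0%E.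

Definition H10norm U (u : 'rV[R]_d -> R) : \bar R :=
  Lpnorm U 2%:E (enorm \o grad U u).

(* An element of the dual is a functional on all functions, of which only the
   values on H^{1,2}_0(U) matter; the bound makes it invariant under a.e.
   equality. *)
Definition Hm1 U (F : ('rV[R]_d -> R) -> R) :=
  (forall (a : R) v w, H10 U v -> H10 U w ->
    F (fun x => a * v x + w x) = a * F v + F w) /\
  exists C : R, forall v, H10 U v -> (`|F v|%:E <= C%:E * H10norm U v)%E.

Definition Hm1norm U (F : ('rV[R]_d -> R) -> R) : \bar R :=
  ereal_sup [set `|F v|%:E | v in [set v | H10 U v /\ (H10norm U v <= 1)%E]].

Definition L2_to_Hm1 U (f : 'rV[R]_d -> R) : ('rV[R]_d -> R) -> R :=
  fun v => \int[mu]_(x in U) (f x * v x).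

End sobolev.

(* \sum_i 1_(sf_set i) * sf_val i *)
Record simple_fun {R : realType} {Z : Type} := SimpleFun {
  sf_size : nat ;
  sf_set : 'I_sf_size -> set (measurableTypeR R) ;
  sf_val : 'I_sf_size -> Z -> R }.
Arguments simple_fun : clear implicits.
Arguments sf_set {R Z} s i : rename.
Arguments sf_val {R Z} s i : rename.

(* Bochner theory on a time interval D of finite length, for the space X of real
   functions on Z normed by N (modulo functions of norm 0).  Both H^{1,2}_0(U)
   and H^{-1,2}(U) are instances. *)
Section bochner.
Context {R : realType} {Z : Type}.
Variables (X : set (Z -> R)) (N : (Z -> R) -> \bar R) (D : set R).
Local Notation mu := (@lebesgue_measure R).

Definition sf_valid (s : simple_fun R Z) :=
  forall i, measurable (sf_set s i) /\ X (sf_val s i).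

Definition sf_eval (s : simple_fun R Z) (t : R) : Z -> R :=
  fun z => \sum_(i < sf_size s) \1_(sf_set s i) t * sf_val s i z.

Definition sf_integral (s : simple_fun R Z) : Z -> R :=
  fun z => \sum_(i < sf_size s) fine (mu (sf_set s i `&` D)) * sf_val s i z.

Definition sf_approx (s : nat -> simple_fun R Z) (w : R -> Z -> R) :=
  (forall n, sf_valid (s n)) /\
  {ae mu, forall t, D t ->
    N (sf_eval (s n) t \- w t) @[n --> \oo] --> 0%E}.

Definition strongly_measurable (w : R -> Z -> R) :=
  {ae mu, forall t, D t -> X (w t)} /\ exists s, sf_approx s w.

Definition bochner_L2norm (w : R -> Z -> R) : \bar R :=
  'N[mu]_(2%:E) [patch (fun=> 0) D (fun t => N (w t))]%E.

Definition bochner_L2 (w : R -> Z -> R) :=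
  strongly_measurable w /\ (bochner_L2norm w < +oo)%E.

Definition is_bochner_integral (w : R -> Z -> R) (I : Z -> R) :=
  X I /\ exists s, [/\ sf_approx s w,
    (\int[mu]_(t in D) N (sf_eval (s n) t \- w t)%R)%E @[n --> \oo] --> 0%E &
    N (sf_integral (s n) \- I) @[n --> \oo] --> 0%E].

End bochner.

Section equation.
Context {R : realType} {d : nat}.
Implicit Types (U : set 'rV[R]_d) (A : 'rV[R]_d -> 'M[R]_d)
  (H : 'rV[R]_d -> 'rV[R]_d) (c g h : 'rV[R]_d -> R).
Local Notation mu := (@lebesgue_rV R d).

Definition L2_H10 U (T : R) : set (R -> 'rV[R]_d -> R) :=
  bochner_L2 (H10 U) (H10norm U) `]0, T[.

Definition L2_H10norm U (T : R) : (R -> 'rV[R]_d -> R) -> \bar R :=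
  bochner_L2norm (H10norm U) `]0, T[.

Definition L2_Hm1 U (T : R) : set (R -> ('rV[R]_d -> R) -> R) :=
  bochner_L2 (Hm1 U) (Hm1norm U) `]0, T[.

Definition is_time_derivative U (T : R) (u : R -> 'rV[R]_d -> R)
    (u' : R -> ('rV[R]_d -> R) -> R) :=
  forall eta, time_test_function T eta ->
  exists I J : ('rV[R]_d -> R) -> R,
    [/\ is_bochner_integral (Hm1 U) (Hm1norm U) `]0, T[
          (fun t v => eta t * u' t v) I,
        is_bochner_integral (Hm1 U) (Hm1norm U) `]0, T[
          (fun t v => derive1 eta t * L2_to_Hm1 U (u t) v) J &
        forall v, H10 U v -> I v = - J v].

Definition weak_solution U A H c (theta : R) g (T : R)
    (u : R -> 'rV[R]_d -> R) :=
  [/\ L2_H10 U T u,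
      exists u', [/\ L2_Hm1 U T u', is_time_derivative U T u u' &
        forall v, H10 U v ->
        {ae @lebesgue_measure R, forall t, t \in `]0, T[ ->
          u' t v +
          \int[mu]_(x in U)
            (dotp (mxact (A x) (grad U (u t) x)) (grad U v x) +
             dotp (H x) (grad U (u t) x) * v x +
             (c x + theta) * u t x * v x) = 0}] &
      Lpnorm U 2%:E (u t \- g) @[t --> 0^'+] --> 0%E].

Definition global_weak_solution U A H c (theta : R) g
    (u : R -> 'rV[R]_d -> R) :=
  [/\ continuous_Lp U 2%:E u,
      {ae mu, forall x, U x -> u 0 x = g x} &
      forall T, 0 < T -> weak_solution U A H c theta g T u].

Definition structural_hypotheses (lambda M r p : R) U (x0 : 'rV[R]_d) A H h :=
  [/\ open U, bounded_set U & closure U `<=` eball x0 r] /\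
  [/\ in_Lp_vec U p%:E H, in_Lp U p%:E h &
      {ae mu, forall x, U x -> enorm (H x) <= h x}] /\
  (forall i j, ae_measurable setT (fun x => A x i j)) /\
  {ae mu, forall x,
    (forall i j, `|A x i j| <= M) /\
    (forall xi, lambda * enorm xi ^+ 2 <= dotp (mxact (A x) xi) xi)}.

(* The integral identity is the weak form of div (A^T grad rho + rho H) = 0 on
   the ball of radius 4 r, with H extended by zero outside U. *)
Definition is_rho (r : R) U (x0 : 'rV[R]_d) A H (x1 : 'rV[R]_d)
    (rho : 'rV[R]_d -> R) :=
  let B := eball x0 (4 * r) in
  [/\ H12 B rho,
      (forall x, B x -> {for x, continuous rho}),
      (forall x, B x -> 0 < rho x),
      rho x1 = 1 &
      forall phi, test_function B phi ->
        \int[mu]_(x in B)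
          dotp (mxact (A x)^T (grad B rho x) + rho x *: zext U H x)
               (cgrad phi x) = 0].

(* The same K1 serves for all data with the given values of d, lambda, M, r, p
   and Nh = ||h||_{L^p(U)}: for such data a rho exists, and every rho satisfies
   the Harnack inequality max rho <= K1 * min rho on the closed ball of radius
   3 r (sup and inf are attained, rho being continuous there). *)
Definition is_K1 (lambda M r p : R) (Nh : \bar R) (K1 : R) :=
  1 <= K1 /\
  forall U x0 A H h, structural_hypotheses lambda M r p U x0 A H h ->
    Lpnorm U p%:E h = Nh ->
    forall x1, U x1 ->
      (exists rho, is_rho r U x0 A H x1 rho) /\
      (forall rho, is_rho r U x0 A H x1 rho ->
        let C := closure (eball x0 (3 * r)) in
        sup (rho @` C) <= K1 * inf (rho @` C)).

End equation.
Arguments is_K1 {R} d lambda M r p Nh K1.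

(* Main.v *)
(* The weight [rho] solves the adjoint equation, so testing the equation for
   [w = e^(theta t) u] with [rho * Phi'(w)] turns the drift into a term that cancels and leaves
   [d/dt \int rho Phi(w) + lambda \int rho Phi''(w) |grad w|^2 <= 0] for every smooth convex [Phi]
   with [Phi' 0 = 0].  Quadratic [Phi], with the Poincare inequality, gives (i) and (ii); the
   hinges [(|w| - a)^+] give (iii), since [|y|^q] is an increasing limit of positive combinations
   of hinges and [|w| <= a] means that the integral of the hinge at [a] vanishes.  Comparing
   [rho] with a constant costs the factor [K1], but nothing for q = +oo. *)
Require Import Defs.
From HB Require Import structures.
From mathcomp Require Import all_boot all_order all_algebra.
From mathcomp Require Import all_classical all_reals all_analysis.
From mathcomp Require Import measurable_realfun lebesgue_integral_under ring lra.
Set Implicit Arguments.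
Unset Strict Implicit.
Unset Printing Implicit Defensive.
Import Order.TTheory GRing.Theory Num.Theory.
Import numFieldNormedType.Exports.
Local Open Scope classical_set_scope.
Local Open Scope ring_scope.

Local Notation testf := test_function.
Local Notation nbhs_ge0 t := (within [set s | 0 <= s] (nbhs t)).
Local Notation mfun := (measurable_fun setT).
Local Notation mcomp := measurableT_comp.
Local Notation mfunM := measurable_funM.
Local Notation mfunB := measurable_funB.
Local Notation mindic := measurable_indic.
Local Notation mEFinP := measurable_EFinP.
Local Notation mitv := measurable_itv.
Local Notation mcst := measurable_cst.
Local Notation mnormr := (@normr_measurable _ _).
Local Notation RintZl := (RintegralZl _ measurableT).
Local Notation RintD := (RintegralD measurableT).
Local Notation RintB := (RintegralB measurableT).

(** The equation can be tested only with functions that do not depend on time, whereas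
    [rho * Phi'(w t)] does, and the time derivative of [w] is only a functional. Convexity replaces
    the chain rule: the increment of [\int rho Phi(w)] over [[t - h, t]] is at most the pairing of
    [w t - w (t - h)] with the test function frozen at [t], that is, minus the integral over [r] in
    [[t - h, t]] of the bilinear form at [w r]. Passing from [w r] to [w t] costs their H^1
    distance, small on average since the curve is close, in L^2 in time, to a continuous curve in
    H^1_0. Because the gradient of [rho] is only square integrable, [Phi'] is kept bounded; squares
    and powers are limits of such profiles. An element of H^1_0 is handled as a pair of a Borel
    function on the whole space and its gradient, limits of test functions and of their derivatives;
    the chosen gradients and a.e. classes of the statement are met only when translating to and from
    such pairs. The Poincare constant [|U|^(1/d)] comes from the Loomis-Whitney inequality, and the
    factor in [kappa] then only needs [d <= 2 (d - 1)]. *)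

(** * Integrability and dominated convergence for real-valued functions *)

Section real_integrable.
Context {disp} {T : measurableType disp} {R : realType}.
Variable mu : {measure set T -> \bar R}.
Implicit Types (f g h : T -> R).

(** Always over the whole space: a function on [U] is carried as its extension by zero and a time
    interval enters as a factor [\1_D], so no domain of integration has to be tracked. *)
Definition intg f := mu.-integrable setT (EFin \o f).

Lemma intg_meas f : intg f -> mfun f.
Proof. by move=> /measurable_int /mEFinP. Qed.

Lemma intg_le f g : mfun f -> (forall x, `|f x| <= g x) ->
 intg g -> intg f.
Proof.
move=> mf fg ig; apply: le_integrable ig => //.
 exact/mEFinP.
by move=> x _ /=; rewrite lee_fin (le_trans (fg x))// ler_norm.
Qed.

Lemma intgD f g : intg f -> intg g -> intg (fun x => f x + g x).
Proof. exact: integrableD. Qed.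

Lemma intgB f g : intg f -> intg g -> intg (fun x => f x - g x).
Proof. exact: integrableB. Qed.

Lemma intgZ a f : intg f -> intg (fun x => a * f x).
Proof. exact: integrableZl. Qed.

Lemma intg_abs f : intg f -> intg (fun x => `|f x|).
Proof. exact: integrable_norm. Qed.

Lemma intg0 : intg (fun=> 0).
Proof. exact: integrable0. Qed.

Lemma intg_sum I (r : seq I) (P : pred I) (F : I -> T -> R) :
 (forall i, P i -> intg (F i)) -> intg (fun x => \sum_(i <- r | P i) F i x).
Proof.
move=> iF.
have -> : (fun x => \sum_(i <- r | P i) F i x) =
   (fun x => \sum_(i <- r) (if P i then F i x else 0)).
 by apply/funext => x; rewrite big_mkcond.
elim: r => [|i r IH]; first by under eq_fun do rewrite big_nil; exact: intg0.
under eq_fun do rewrite big_cons; apply: intgD => //.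
by case Pi: (P i); [exact: iF|exact: intg0].
Qed.

Lemma Rint_sum I (r : seq I) (P : pred I) (F : I -> T -> R) :
 (forall i, P i -> intg (F i)) ->
 \int[mu]_x (\sum_(i <- r | P i) F i x) = \sum_(i <- r | P i) \int[mu]_x F i x.
Proof.
move=> iF; elim: r => [|i r IH].
 by rewrite big_nil; under eq_Rintegral do rewrite big_nil; rewrite Rintegral_cst// mul0r.
rewrite big_cons; under eq_Rintegral do rewrite big_cons.
case: ifP => // Pi; rewrite RintegralD//; [by rewrite IH|exact: iF|].
exact: intg_sum.
Qed.

Lemma intg_bmul (b : T -> R) f (C : R) : mfun b -> (forall x, `|b x| <= C) ->
 intg f -> intg (fun x => b x * f x).
Proof.
move=> mb bC jf; apply: (@intg_le _ (fun x => C * `|f x|)).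
- by apply: mfunM => //; exact: intg_meas.
- by move=> x; rewrite normrM ler_wpM2r.
- exact/intgZ/intg_abs.
Qed.

Lemma Rint_ge0 f : (forall x, 0 <= f x) -> 0 <= \int[mu]_x f x.
Proof. by move=> f0; exact: Rintegral_ge0. Qed.

Lemma Rint_le f g : intg f -> intg g -> (forall x, f x <= g x) ->
 \int[mu]_x f x <= \int[mu]_x g x.
Proof. by move=> *; exact: le_Rintegral. Qed.

Lemma Rint_lem f g : mfun f -> intg g ->
 (forall x, 0 <= f x <= g x) -> \int[mu]_x f x <= \int[mu]_x g x.
Proof.
move=> mf ig fg; apply: Rint_le => //; last by move=> x; have /andP[] := fg x.
by apply: intg_le ig => // x; have /andP[f0 ?] := fg x; rewrite ger0_norm.
Qed.

Lemma ae_eq_Rint f g : mfun f -> mfun g ->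
 {ae mu, forall x, f x = g x} -> \int[mu]_x f x = \int[mu]_x g x.
Proof.
move=> mf mg fg; congr fine; apply: ae_eq_integral => //; try exact/mEFinP.
by apply: filterS fg => x /= ->.
Qed.

Lemma intg_le_ae f g : mfun f -> {ae mu, forall x, `|f x| <= g x} ->
 intg g -> intg f.
Proof.
move=> mf fg ig; have mg := intg_meas ig.
apply/integrableP; split; first exact/mEFinP.
move/integrableP : ig => [_]; apply: le_lt_trans.
apply: ae_ge0_le_integral => //=.
- exact/mEFinP/mcomp.
- exact/mEFinP/mcomp.
- apply: filterS fg => x fgx _.
 by rewrite lee_fin (le_trans fgx)// ler_norm.
Qed.

Lemma ae_eq_intg f g : mfun g ->
 {ae mu, forall x, f x = g x} -> intg f -> intg g.
Proof.
move=> mg fg jf; apply: (@intg_le_ae _ (fun x => `|f x|)) => //.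
 by apply: filterS fg => x ->.
exact: intg_abs.
Qed.

Lemma Rint_eq0_ae f : intg f -> (forall x, 0 <= f x) -> \int[mu]_x f x = 0 ->
 {ae mu, forall x, f x = 0}.
Proof.
move=> jf f0 If0.
have : (\int[mu]_x `|(f x)%:E| = 0)%E.
 under eq_integral do rewrite gee0_abs ?lee_fin//.
 by rewrite -[LHS]fineK ?integrable_fin_num//; congr EFin.
move/ae_eq_integral_abs => /(_ measurableT).
have mf : mfun (EFin \o f) by apply/mEFinP; exact: intg_meas.
move=> /(_ mf); apply: filterS => x /=.
by move=> /(_ I) [].
Qed.

Lemma Rdct_ae (f_ : nat -> T -> R) f g : (forall n, mfun (f_ n)) ->
 mfun f -> intg g ->
 {ae mu, forall x, (f_ ^~ x) @ \oo --> f x} ->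
 (forall n, {ae mu, forall x, `|f_ n x| <= g x}) ->
 (fun n => \int[mu]_x f_ n x) @ \oo --> (\int[mu]_x f x).
Proof.
move=> mf_ mf ig ff fg.
have fg' : {ae mu, forall x n, `|f_ n x| <= g x} by exact: ae_foralln.
have ffE : {ae mu, forall x, setT x -> (fun n => (f_ n x)%:E) @ \oo --> (f x)%:E}.
 by apply: filterS ff => x h _; apply/cvg_EFin => //; exact: nearW.
have fgE : {ae mu, forall x n, setT x -> (`|(f_ n x)%:E| <= (g x)%:E)%E}.
 by apply: filterS fg' => x h n _ /=; rewrite lee_fin.
have [jf _ H] := @dominated_convergence _ T R mu setT measurableT
 (fun n => EFin \o f_ n) (EFin \o f) (EFin \o g)
 (fun n => proj2 (mEFinP _ _) (mf_ n))
 (proj2 (mEFinP _ _) mf) ffE ig fgE.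
have -> : (fun n => \int[mu]_x f_ n x) = fine \o (fun n => (\int[mu]_x (f_ n x)%:E)%E) by [].
apply: fine_cvg.
rewrite /Rintegral fineK; last exact: integrable_fin_num.
exact: H.
Qed.

Lemma Rdct (f_ : nat -> T -> R) f g : (forall n, mfun (f_ n)) ->
 intg g -> (forall x, (f_ ^~ x) @ \oo --> f x) ->
 (forall n x, `|f_ n x| <= g x) ->
 (fun n => \int[mu]_x f_ n x) @ \oo --> (\int[mu]_x f x).
Proof.
move=> mf_ ig ff fg; apply: (@Rdct_ae _ _ g) => //.
- apply: (measurable_fun_cvg mf_) => x _; exact: ff.
- exact: aeW.
- by move=> n; apply: aeW.
Qed.

End real_integrable.

(** * Square integrable functions: inner product, norm and convergence *)

Section L2.
Context {disp} {T : measurableType disp} {R : realType}.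
Variable mu : {measure set T -> \bar R}.
Implicit Types (f g h : T -> R).
Notation intg := (intg mu).

(** Plain functions instead of classes: [nr] is a seminorm, and limits for [L2cvg] are unique up to
    null sets. *)
Definition L2 f := mfun f /\ intg (fun x => f x ^+ 2).
Definition ip f g := \int[mu]_x (f x * g x).
Definition nr f := Num.sqrt (ip f f).

Lemma L2_meas f : L2 f -> mfun f. Proof. by case. Qed.

Lemma L2_mul f g : L2 f -> L2 g -> intg (fun x => f x * g x).
Proof.
move=> [mf jf] [mg jg]; apply: intg_le (intgD jf jg) => [|x].
 exact: mfunM.
by rewrite ler_norml; apply/andP; split; nra.
Qed.

Lemma L2_sq f : L2 f -> intg (fun x => f x * f x).
Proof. by move=> ?; exact: L2_mul. Qed.

Lemma L2D f g : L2 f -> L2 g -> L2 (fun x => f x + g x).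
Proof.
move=> Lf Lg; split; first by apply: measurable_funD; exact: L2_meas.
under eq_fun do rewrite sqrrD.
apply: intgD; last by case: Lg.
apply: intgD; first by case: Lf.
by under eq_fun do rewrite -mulr_natl; apply: intgZ; exact: L2_mul.
Qed.

Lemma L2Z a f : L2 f -> L2 (fun x => a * f x).
Proof.
move=> [mf jf]; split; first exact: mfunM.
by under eq_fun do rewrite exprMn; exact: intgZ.
Qed.

Lemma L2N f : L2 f -> L2 (fun x => - f x).
Proof. by move=> /(L2Z (-1)); under eq_fun do rewrite mulN1r. Qed.

Lemma L2B f g : L2 f -> L2 g -> L2 (fun x => f x - g x).
Proof. by move=> Lf Lg; apply: L2D => //; exact: L2N. Qed.

Lemma L2_0 : L2 (fun=> 0).
Proof. by split => //; under eq_fun do rewrite expr0n/=; exact: intg0. Qed.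

Lemma L2_sum I (r : seq I) (P : pred I) (F : I -> T -> R) :
 (forall i, P i -> L2 (F i)) -> L2 (fun x => \sum_(i <- r | P i) F i x).
Proof.
move=> iF.
have -> : (fun x => \sum_(i <- r | P i) F i x) =
   (fun x => \sum_(i <- r) (if P i then F i x else 0)).
 by apply/funext => x; rewrite big_mkcond.
elim: r => [|i r IH]; first by under eq_fun do rewrite big_nil; exact: L2_0.
under eq_fun do rewrite big_cons; apply: L2D => //.
by case Pi: (P i); [exact: iF|exact: L2_0].
Qed.

Lemma L2_le f g : mfun f -> (forall x, `|f x| <= `|g x|) ->
 L2 g -> L2 f.
Proof.
move=> mf fg [mg jg]; split => //; apply: intg_le jg.
 exact: measurable_funX.
by move=> x; rewrite normrX -(real_normK (num_real (g x))) lerXn2r// nnegrE.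
Qed.

Lemma L2_abs f : L2 f -> L2 (fun x => `|f x|).
Proof.
move=> Lf; apply: L2_le (Lf) => [|x]; last by rewrite normr_id.
by apply: mcomp => //; exact: L2_meas.
Qed.

Lemma L2_bmul (b : T -> R) f (C : R) : mfun b ->
 (forall x, `|b x| <= C) -> L2 f -> L2 (fun x => b x * f x).
Proof.
move=> mb bC Lf; apply: (@L2_le _ (fun x => C * f x)); last exact: L2Z.
 by apply: mfunM => //; exact: L2_meas.
move=> x; rewrite !normrM ler_wpM2r//.
by rewrite (le_trans (bC x))// ler_norm.
Qed.

Lemma ipC f g : ip f g = ip g f.
Proof. by apply: eq_Rintegral => x _; rewrite mulrC. Qed.

Lemma ipDl f g h : L2 f -> L2 g -> L2 h ->
 ip (fun x => f x + g x) h = ip f h + ip g h.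
Proof.
move=> *; rewrite -RintegralD//; [|exact: L2_mul..].
by apply: eq_Rintegral => x _; rewrite mulrDl.
Qed.

Lemma ipZl a f h : L2 f -> L2 h -> ip (fun x => a * f x) h = a * ip f h.
Proof.
move=> *; rewrite -RintegralZl//; [|exact: L2_mul..].
by apply: eq_Rintegral => x _; rewrite mulrA.
Qed.

Lemma ipNl f h : L2 f -> L2 h -> ip (fun x => - f x) h = - ip f h.
Proof.
move=> Lf Lh; rewrite -mulN1r -ipZl//.
by apply: eq_Rintegral => x _; rewrite mulN1r.
Qed.

Lemma ipBl f g h : L2 f -> L2 g -> L2 h ->
 ip (fun x => f x - g x) h = ip f h - ip g h.
Proof. by move=> *; rewrite ipDl ?ipNl//; exact: L2N. Qed.

Lemma ipDr f g h : L2 f -> L2 g -> L2 h ->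
 ip h (fun x => f x + g x) = ip h f + ip h g.
Proof. by move=> *; rewrite ipC ipDl// ipC (ipC g). Qed.

Lemma ipZr a f h : L2 f -> L2 h -> ip h (fun x => a * f x) = a * ip h f.
Proof. by move=> *; rewrite ipC ipZl// ipC. Qed.

Lemma ip_ge0 f : 0 <= ip f f.
Proof. by apply: Rint_ge0 => x; rewrite -expr2 sqr_ge0. Qed.

Lemma nr_ge0 f : 0 <= nr f. Proof. exact: sqrtr_ge0. Qed.
Hint Resolve nr_ge0 : core.

Lemma nr_sq f : nr f ^+ 2 = ip f f.
Proof. by rewrite sqr_sqrtr// ip_ge0. Qed.

Lemma nr_sqE f : nr f ^+ 2 = \int[mu]_x (f x ^+ 2).
Proof. by rewrite nr_sq; apply: eq_Rintegral => x _; rewrite expr2. Qed.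

(** Cauchy-Schwarz, from the sign of the quadratic [ip (f + t g) (f + t g)] in [t] at its
    minimum. *)
Lemma ip_le f g : L2 f -> L2 g -> `|ip f g| <= nr f * nr g.
Proof.
move=> Lf Lg.
have H t : 0 <= ip f f + 2 * t * ip f g + t ^+ 2 * ip g g.
 have := ip_ge0 (fun x => f x + t * g x).
 have Lt := L2Z t Lg; have LD := L2D Lf Lt.
 rewrite ipDl// !ipDr// !ipZl// !ipZr//.
 by rewrite (ipC g f) => h; nra.
have Hsq : ip f g ^+ 2 <= ip f f * ip g g.
 have f0 := ip_ge0 f; have g0 := ip_ge0 g.
 have [g0'|g0'] := eqVneq (ip g g) 0.
 rewrite g0' mulr0; have [->|n0] := eqVneq (ip f g) 0; first by rewrite expr0n.
 (* With [ip g g = 0] the quadratic is affine in [t]; a nonzero slope would let it take the value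
    [-1], which happens at this [t]. *)
 have := H (- (ip f f + 1) / (2 * ip f g)); rewrite g0' mulr0 addr0.
 have -> : 2 * (- (ip f f + 1) / (2 * ip f g)) * ip f g = - (ip f f + 1) by field.
 by move=> ?; lra.
 have gp : 0 < ip g g by rewrite lt_neqAle eq_sym g0'.
 have := H (- ip f g / ip g g).
 have -> : ip f f + 2 * (- ip f g / ip g g) * ip f g + (- ip f g / ip g g) ^+ 2 * ip g g
   = (ip f f * ip g g - ip f g ^+ 2) / ip g g by field.
 by rewrite pmulr_lge0 ?invr_gt0// subr_ge0.
rewrite -ler_sqr ?nnegrE ?mulr_ge0//.
by rewrite exprMn !nr_sq -normrX ger0_norm ?sqr_ge0.
Qed.

Lemma nrD f g : L2 f -> L2 g -> nr (fun x => f x + g x) <= nr f + nr g.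
Proof.
move=> Lf Lg; rewrite -ler_sqr ?nnegrE ?addr_ge0//.
rewrite nr_sq; have LD := L2D Lf Lg; rewrite ipDl// !ipDr//.
have := ip_le Lf Lg; rewrite ler_norml => /andP[_ h].
by rewrite (ipC g f) sqrrD !nr_sq; lra.
Qed.

Lemma nrZ a f : L2 f -> nr (fun x => a * f x) = `|a| * nr f.
Proof.
move=> Lf; apply/eqP; rewrite -(@eqrXn2 _ 2)//; last by rewrite mulr_ge0.
by rewrite exprMn !nr_sq ipZl ?ipZr//; [rewrite mulrA real_normK ?num_real// expr2|exact: L2Z].
Qed.

Lemma eq_nr f g : f =1 g -> nr f = nr g.
Proof. by move=> /funext ->. Qed.

Lemma nrN f : nr (fun x => - f x) = nr f.
Proof. by congr Num.sqrt; apply: eq_Rintegral => x _; rewrite mulrNN. Qed.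

Lemma nrBC f g : nr (fun x => f x - g x) = nr (fun x => g x - f x).
Proof. by rewrite -nrN; apply: eq_nr => x; rewrite opprB. Qed.

Lemma nrB f g : L2 f -> L2 g -> nr (fun x => f x - g x) <= nr f + nr g.
Proof. by move=> Lf Lg; rewrite (le_trans (nrD Lf (L2N Lg)))// nrN. Qed.

Lemma nr_triB f g h : L2 f -> L2 g -> L2 h ->
 nr (fun x => f x - h x) <= nr (fun x => f x - g x) + nr (fun x => g x - h x).
Proof.
move=> Lf Lg Lh; apply: le_trans (nrD (L2B Lf Lg) (L2B Lg Lh)).
by rewrite le_eqVlt; apply/orP; left; apply/eqP/eq_nr => x; rewrite addrA subrK.
Qed.

Lemma nr_le f g : mfun f -> L2 g -> (forall x, `|f x| <= `|g x|) ->
 nr f <= nr g.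
Proof.
move=> mf Lg fg; rewrite ler_wsqrtr//; apply: Rint_lem; last 1 first.
- by move=> x; rewrite -!expr2 sqr_ge0 -(real_normK (num_real (f x)))
 -(real_normK (num_real (g x))) lerXn2r// nnegrE.
- exact: mfunM.
- exact: L2_mul.
Qed.

Lemma nr0 : nr (fun=> 0) = 0.
Proof.
rewrite /nr /ip; under eq_Rintegral do rewrite mulr0.
by rewrite Rintegral_cst// mul0r sqrtr0.
Qed.

Lemma nr_sum I (r : seq I) (P : pred I) (F : I -> T -> R) :
 (forall i, P i -> L2 (F i)) ->
 nr (fun x => \sum_(i <- r | P i) F i x) <= \sum_(i <- r | P i) nr (F i).
Proof.
move=> iF; elim: r => [|i r IH].
 by rewrite big_nil (_ : (fun=> _) = fun=> 0) ?nr0//; apply/funext => x; rewrite big_nil.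
rewrite big_cons; case Pi: (P i).
 rewrite (_ : (fun x => _) = fun x => F i x + \sum_(i <- r | P i) F i x); last first.
 by apply/funext => x; rewrite big_cons Pi.
 by apply: le_trans (nrD (iF _ Pi) (L2_sum r iF)) _; rewrite lerD2l.
rewrite (_ : (fun x => _) = fun x => \sum_(i <- r | P i) F i x)//.
by apply/funext => x; rewrite big_cons Pi.
Qed.

Lemma ae_eq_nr f g : mfun f -> mfun g ->
 {ae mu, forall x, f x = g x} -> nr f = nr g.
Proof.
move=> mf mg fg; congr Num.sqrt; apply: ae_eq_Rint; try exact: mfunM.
by apply: filterS fg => x ->.
Qed.

Lemma ae_eq_L2 f g : mfun g ->
 {ae mu, forall x, f x = g x} -> L2 f -> L2 g.
Proof.
move=> mg fg [mf jf]; split => //; apply: ae_eq_intg jf.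
 exact: measurable_funX.
by apply: filterS fg => x ->.
Qed.

Lemma nr_eq0_ae f : L2 f -> nr f = 0 -> {ae mu, forall x, f x = 0}.
Proof.
move=> Lf nf0.
have : {ae mu, forall x, f x ^+ 2 = 0}.
 apply: Rint_eq0_ae; first by case: Lf.
 by move=> x; rewrite sqr_ge0.
 by rewrite -nr_sqE nf0 expr0n.
by apply: filterS => x /eqP; rewrite sqrf_eq0 => /eqP.
Qed.

Definition L2cvg (f_ : nat -> T -> R) f :=
 (fun n => nr (fun x => f_ n x - f x)) @ \oo --> (0 : R).

Lemma cvg0_le (a b : nat -> R) : (forall n, `|a n| <= b n) ->
 b @ \oo --> (0 : R) -> a @ \oo --> (0 : R).
Proof.
move=> ab b0; apply/cvgr0Pnorm_le => e e0.
move/cvgr0Pnorm_le : b0 => /(_ e e0); apply: filterS => n.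
by apply: le_trans; rewrite (le_trans (ab n))// ler_norm.
Qed.

Lemma L2cvg_nr (f_ : nat -> T -> R) f : (forall n, L2 (f_ n)) -> L2 f ->
 L2cvg f_ f -> (fun n => nr (f_ n)) @ \oo --> nr f.
Proof.
move=> Lf_ Lf ff; apply/cvgrPdist_le => e e0.
move/cvgr0Pnorm_le : ff => /(_ e e0); apply: filterS => n.
rewrite ger0_norm// distrC => h; rewrite (le_trans _ h)//.
have H1 := nrD (L2B (Lf_ n) Lf) Lf; have H2 := nrD (L2B Lf (Lf_ n)) (Lf_ n).
rewrite (@eq_nr _ (f_ n)) in H1; last by move=> x; rewrite subrK.
rewrite (@eq_nr _ f) in H2; last by move=> x; rewrite subrK.
rewrite nrBC in H2.
by rewrite ler_norml; apply/andP; split; lra.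
Qed.

Lemma L2cvg_ip (f_ : nat -> T -> R) f g : (forall n, L2 (f_ n)) -> L2 f -> L2 g ->
 L2cvg f_ f -> (fun n => ip (f_ n) g) @ \oo --> ip f g.
Proof.
move=> Lf_ Lf Lg ff; apply/subr_cvg0.
apply: (@cvg0_le _ (fun n => nr (fun x => f_ n x - f x) * nr g)).
 by move=> n; rewrite -ipBl//; apply: ip_le => //; exact: L2B.
by rewrite -(mul0r (nr g)); apply: cvgMl.
Qed.

Lemma L2cvgD (f_ g_ : nat -> T -> R) f g : (forall n, L2 (f_ n)) -> L2 f ->
 (forall n, L2 (g_ n)) -> L2 g -> L2cvg f_ f -> L2cvg g_ g ->
 L2cvg (fun n x => f_ n x + g_ n x) (fun x => f x + g x).
Proof.
move=> Lf_ Lf Lg_ Lg ff gg.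
apply: (@cvg0_le _ (fun n => nr (fun x => f_ n x - f x) + nr (fun x => g_ n x - g x))).
 move=> n; rewrite ger0_norm//.
 rewrite -[X in X <= _]/(nr (fun x => f_ n x + g_ n x - (f x + g x))).
 rewrite (@eq_nr _ (fun x => (f_ n x - f x) + (g_ n x - g x))); last by move=> x; ring.
 by apply: nrD; exact: L2B.
by rewrite -(addr0 0); exact: cvgD.
Qed.

Lemma L2cvgZ a (f_ : nat -> T -> R) f : (forall n, L2 (f_ n)) -> L2 f ->
 L2cvg f_ f -> L2cvg (fun n x => a * f_ n x) (fun x => a * f x).
Proof.
move=> Lf_ Lf ff.
apply: (@cvg0_le _ (fun n => `|a| * nr (fun x => f_ n x - f x))).
 move=> n; rewrite ger0_norm//.
 under [X in X <= _]eq_nr do rewrite -mulrBr.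
 by rewrite nrZ//; exact: L2B.
by rewrite -(mulr0 `|a|); exact: cvgMr.
Qed.

Lemma L2cvg_bmul (b : T -> R) (C : R) (f_ : nat -> T -> R) f :
 mfun b -> (forall x, `|b x| <= C) ->
 (forall n, L2 (f_ n)) -> L2 f ->
 L2cvg f_ f -> L2cvg (fun n x => b x * f_ n x) (fun x => b x * f x).
Proof.
move=> mb bC Lf_ Lf ff.
apply: (@cvg0_le _ (fun n => `|C| * nr (fun x => f_ n x - f x))).
 move=> n; rewrite ger0_norm// -[`|C|]normr_id -nrZ; last exact: L2B.
 apply: nr_le; last 2 first.
 - exact/L2Z/L2B.
 - move=> x; rewrite -mulrBr !normrM normr_id ler_wpM2r//.
 by rewrite (le_trans (bC x))// ler_norm.
 apply: mfunB; apply: mfunM => //; exact: L2_meas.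
by rewrite -(mulr0 `|C|); exact: cvgMr.
Qed.

(* Split [g] at height [K]: the bounded part pairs with [k_ n] in L2, the rest is
 small uniformly in [n] since [k_ n] is bounded. *)
Lemma bounded_L2cvg_weighted (k_ : nat -> T -> R) (C : R) g :
 (forall n, L2 (k_ n)) -> (forall n x, 0 <= k_ n x <= C) ->
 L2cvg k_ (fun=> 0) -> intg g -> (forall x, 0 <= g x) ->
 (fun n => \int[mu]_x (k_ n x * g x)) @ \oo --> (0 : R).
Proof.
move=> Lk kC k0 jg g0.
have mg := intg_meas jg.
have mk n := L2_meas (Lk n).
have jkg n : intg (fun x => k_ n x * g x).
 apply: (@intg_bmul _ _ _ _ _ _ C) => // x.
 by have /andP[? ?] := kC n x; rewrite ger0_norm.
pose gK (K : nat) x := Num.min (g x) K%:R.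
have mgK K : mfun (gK K) by exact: measurable_minr.
have gK0 K x : 0 <= gK K x by rewrite le_min g0 ler0n.
have gKg K x : gK K x <= g x by rewrite ge_min lexx.
have jgK K : intg (gK K) by apply: intg_le jg => // x; rewrite ger0_norm.
have LgK K : L2 (gK K).
 split => //; apply: (@intg_le _ _ _ _ _ (fun x => K%:R * g x)); last exact: intgZ.
 exact: measurable_funX.
 move=> x; rewrite ger0_norm ?sqr_ge0// expr2 ler_pM//.
 by rewrite ge_min lexx orbT.
have tail : (fun K => \int[mu]_x (g x - gK K x)) @ \oo --> (0 : R).
 have -> : (0 : R) = \int[mu]_x (fun=> 0) (x : T) by rewrite Rintegral_cst// mul0r.
 apply: (@Rdct _ _ _ _ _ _ g) => //.
 - by move=> n; exact: mfunB.
 - move=> x; apply/cvgr0Pnorm_le => e e0.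
 near=> n; rewrite /gK (_ : Num.min _ _ = g x) ?subrr ?normr0 ?ltW//.
 apply/min_idPl; near: n; exact: nbhs_infty_ger.
 - by move=> n x; rewrite ger0_norm ?subr_ge0// gerBl.
apply/cvgr0Pnorm_le => e e0.
have e2 : 0 < e / 2 by rewrite divr_gt0.
have [K _ HK] : \forall K \near \oo, C * \int[mu]_x (g x - gK K x) <= e / 2.
 have : (fun K => C * \int[mu]_x (g x - gK K x)) @ \oo --> (0 : R).
 by rewrite -(mulr0 C); exact: cvgMr.
 move/cvgr0Pnorm_le => /(_ _ e2).
 apply: filterS => K; exact/le_trans/ler_norm.
have {}HK := HK K (leqnn K).
have : (fun n => ip (k_ n) (gK K)) @ \oo --> (0 : R).
 have -> : (0 : R) = ip (fun=> 0) (gK K).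
 by rewrite /ip; under eq_Rintegral do rewrite mul0r; rewrite Rintegral_cst// mul0r.
 by apply: L2cvg_ip => //; exact: L2_0.
move/cvgr0Pnorm_le => /(_ _ e2); apply: filterS => n hn.
rewrite ger0_norm; last by apply: Rint_ge0 => x; rewrite mulr_ge0//; have /andP[] := kC n x.
have -> : \int[mu]_x (k_ n x * g x) =
 ip (k_ n) (gK K) + \int[mu]_x (k_ n x * (g x - gK K x)).
 rewrite -RintegralD//; last 2 first.
 - exact: L2_mul.
 - under eq_fun do rewrite mulrBr; apply: intgB => //; exact: L2_mul.
 by apply: eq_Rintegral => x _; ring.
rewrite (splitr e) lerD//; first exact: le_trans (ler_norm _) hn.
apply: le_trans HK; rewrite -RintegralZl//; last exact: intgB.
apply: Rint_lem.
- by apply: mfunM => //; exact: mfunB.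
- by apply: intgZ; exact: intgB.
- move=> x; have /andP[? ?] := kC n x.
 by rewrite mulr_ge0 ?subr_ge0//= ler_wpM2r// subr_ge0.
Unshelve. all: end_near. Qed.

End L2.
#[global] Hint Resolve nr_ge0 : core.

(** * Smooth functions of one real variable *)

Section smooth1.
Context {R : realType}.
Implicit Types (f g : R -> R).

(** The derivative is existentially quantified, so a closure property only has to exhibit a
    candidate. Level 0 asks for nothing: continuity comes from differentiability one level up. *)
Fixpoint C1k (k : nat) f : Prop :=
 if k is k'.+1 then
 exists2 f' : R -> R, (forall x : R, is_derive x 1 f (f' x)) & C1k k' f'
 else True.

Definition smooth f := forall k, C1k k f.

Lemma C1k_ext k f g : f =1 g -> C1k k f -> C1k k g.
Proof. by move=> /funext ->. Qed.

Lemma C1kW k f : C1k k.+1 f -> C1k k f.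
Proof.
elim: k f => // k IH f [f' df f'k]; exists f' => //.
exact: IH.
Qed.

Lemma C1k_cst k c : C1k k (fun=> c).
Proof.
elim: k c => // k IH c; exists (fun=> 0) => //.
by move=> x; exact: is_derive_cst.
Qed.

Lemma C1k_id k : C1k k id.
Proof.
case: k => // k; exists (fun=> 1); last exact: C1k_cst.
by move=> x; exact: is_derive_id.
Qed.

Lemma C1kD k f g : C1k k f -> C1k k g -> C1k k (fun x => f x + g x).
Proof.
elim: k f g => // k IH f g [f' df f'k] [g' dg g'k].
exists (fun x => f' x + g' x); last exact: IH.
by move=> x; exact: is_deriveD.
Qed.

Lemma C1kN k f : C1k k f -> C1k k (fun x => - f x).
Proof.
elim: k f => // k IH f [f' df f'k]; exists (fun x => - f' x); last exact: IH.
by move=> x; exact: is_deriveN.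
Qed.

Lemma C1kB k f g : C1k k f -> C1k k g -> C1k k (fun x => f x - g x).
Proof. by move=> *; apply: C1kD => //; exact: C1kN. Qed.

Lemma C1kM k f g : C1k k f -> C1k k g -> C1k k (fun x => f x * g x).
Proof.
elim: k f g => // k IH f g fk gk.
have fk1 := C1kW fk; have gk1 := C1kW gk.
move: fk gk => [f' df f'k] [g' dg g'k].
exists (fun x => f x * g' x + g x * f' x); last by apply: C1kD; exact: IH.
by move=> x; exact: is_deriveM.
Qed.

Lemma C1kX k f n : C1k k f -> C1k k (fun x => f x ^+ n).
Proof.
move=> fk; elim: n => [|n IH].
 by apply: C1k_ext (C1k_cst k 1) => x; rewrite expr0.
by apply: C1k_ext (C1kM fk IH) => x; rewrite exprS.
Qed.

Lemma C1k_comp k f g : C1k k f -> C1k k g -> C1k k (f \o g).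
Proof.
elim: k f g => // k IH f g fk gk.
have gk1 := C1kW gk.
move: fk gk => [f' df f'k] [g' dg g'k].
exists (fun x => f' (g x) * g' x); last by apply: C1kM => //; exact: (IH _ _ f'k gk1).
by move=> x; exact: is_derive1_comp.
Qed.

Lemma C1kV k f : (forall x, f x != 0) -> C1k k f -> C1k k (fun x => (f x)^-1).
Proof.
move=> f0; elim: k => // k IH fk.
have fV := IH (C1kW fk).
move: fk => [f' df f'k].
exists (fun x => - ((f x)^-1 * (f x)^-1 * f' x)); last first.
 by apply: C1kN; apply: C1kM => //; exact: C1kM.
move=> x; have h := is_deriveV (f0 x) (df x); apply: is_derive_eq.
by rewrite /GRing.scale/= -exprVn expr2 mulNr.
Qed.

Lemma smooth_continuous f : smooth f -> continuous f.
Proof.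
move=> /(_ 1%N) [f' df _] x; apply: differentiable_continuous.
by apply/derivable1_diffP; have [] := df x.
Qed.

(** The form in which [time_test_function] asks for smoothness. *)
Lemma smooth_derive1n f n x : smooth f -> derivable (derive1n n f) x 1.
Proof.
move=> /(_ n.+1); elim: n f => [|n IH] f [f' df f'k].
 by have [] := df x.
rewrite derive1Sn (_ : derive1 f = f'); first exact: IH.
by apply/funext => y; rewrite derive1E; have [_ ->] := df y.
Qed.

Lemma smooth_derive f : smooth f -> smooth (derive1 f) /\ (forall x : R, is_derive x 1 f (derive1 f x)).
Proof.
move=> sf.
have df x : derivable f x 1 by have [f' df _] := sf 1%N; have [] := df x.
split => [k|x].
 have [f' df' f'k] := sf k.+1.
 rewrite (_ : derive1 f = f')//.
 by apply/funext => y; rewrite derive1E; have [_ ->] := df' y.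
by rewrite derive1E; exact: DeriveDef.
Qed.

Lemma derive_lipschitz f (f' : R -> R) (L : R) :
 (forall x : R, is_derive x 1 f (f' x)) -> (forall x, `|f' x| <= L) ->
 forall x y, `|f x - f y| <= L * `|x - y|.
Proof.
move=> df f'L x y.
wlog xy : x y / x < y.
 move=> H; have [xy|yx|->] := ltgtP x y; first exact: H.
 by rewrite distrC [X in _ * X]distrC; exact: H.
 by rewrite !subrr normr0 mulr0.
have cf : {within `[x, y], continuous f}.
 apply: continuous_subspaceT => z; apply: differentiable_continuous.
 by apply/derivable1_diffP; have [] := df z.
rewrite distrC (distrC x).
have [c _ ->] : exists2 c, c \in `]x, y[%R & f y - f x = f' c * (y - x).
 by apply: MVT => // z _; exact: df.
by rewrite normrM ler_wpM2r.
Qed.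

End smooth1.

(** * Smooth bumps and smooth steps *)

Section bumps.
Context {R : realType}.

(** All the functions [x^(-m) exp(-1/x)] at once: the derivative of one is a combination of two
    others, so a single induction on the order of differentiation covers the whole family. *)
Definition flat (m : nat) (x : R) : R := if 0 < x then x ^- m * expR (- x^-1) else 0.

Lemma flat_ge0 m x : 0 <= flat m x.
Proof.
by rewrite /flat; case: ifP => // x0; rewrite mulr_ge0 ?expR_ge0// invr_ge0 exprn_ge0// ltW.
Qed.

Lemma flat_gt0 m x : 0 < x -> 0 < flat m x.
Proof. by rewrite /flat => x0; rewrite x0 mulr_gt0 ?expR_gt0// invr_gt0 exprn_gt0. Qed.

Lemma flat_le0 m x : x <= 0 -> flat m x = 0.
Proof. by rewrite /flat ltNge => ->. Qed.

(** From [y^(m+2) / (m+2)! <= exp y] at [y = 1/x]. A quadratic bound is what makes the derivative at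
    the origin vanish. *)
Lemma flat_le m x : 0 < x -> flat m x <= m.+2`!%:R * x ^+ 2.
Proof.
move=> x0; rewrite /flat x0 expRN.
have y0 : 0 <= x^-1 by rewrite invr_ge0 ltW.
have := expR_ge1Dxn m.+1 y0 => h.
have {}h : x^-1 ^+ m.+2 / m.+2`!%:R <= expR x^-1 by rewrite (le_trans _ h)// lerDr.
have fp : 0 < (m.+2`!%:R : R) by rewrite ltr0n fact_gt0.
have xp : 0 < x^-1 ^+ m.+2 by rewrite exprn_gt0 ?invr_gt0.
have {}h : (expR x^-1)^-1 <= m.+2`!%:R * x ^+ m.+2.
 rewrite (_ : _ * _ = (x^-1 ^+ m.+2 / m.+2`!%:R)^-1); last by rewrite invf_div exprVn invrK.
 by rewrite lef_pV2 ?posrE ?expR_gt0// divr_gt0.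
rewrite mulrC ler_pdivrMr ?exprn_gt0//.
by rewrite -mulrA -exprD addnC addn2.
Qed.

Lemma is_derive0_quadratic (f : R -> R) (C : R) :
 (forall x, `|f x| <= C * x ^+ 2) -> is_derive (0 : R) (1 : R) f 0.
Proof.
move=> fC.
have f0 : f 0 = 0.
 by apply/eqP; rewrite -normr_le0 (le_trans (fC 0))// expr0n mulr0.
have C0 : 0 <= C by have := fC 1; rewrite expr1n mulr1; exact: le_trans.
have H : h^-1 *: ((f \o shift 0) (h *: 1) - f 0) @[h --> 0^'] --> (0 : R).
 apply/cvgr0Pnorm_le => e e0; near=> h.
 have h0 : h != 0 by near: h; exact: nbhs_dnbhs_neq.
 rewrite f0 subr0 /= addr0 /GRing.scale/= mulr1 normrM normfV.
 rewrite ler_pdivrMl ?normr_gt0// (le_trans (fC h))//.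
 rewrite -[h ^+ 2]ger0_norm ?sqr_ge0// normrX expr2 mulrA [leRHS]mulrC ler_wpM2r//.
 have : `|h| <= e / (C + 1).
 by near: h; apply: dnbhs0_le; rewrite divr_gt0// ltr_wpDl.
 rewrite ler_pdivlMr ?ltr_wpDl// => hh.
 by apply: le_trans hh; rewrite mulrC ler_wpM2l// lerDl.
split; first by apply/cvg_ex; exists 0.
exact: cvg_lim.
Unshelve. all: end_near. Qed.

Lemma is_derive_flat m (x : R) :
 is_derive x 1 (flat m) (flat m.+2 x - m%:R * flat m.+1 x).
Proof.
have [x0|x0|->] := ltgtP x 0.
- rewrite !flat_le0 ?(ltW x0)// mulr0 subrr.
 apply: (@near_eq_is_derive _ _ _ (fun=> 0 : R)) => //.
 by near=> y; rewrite flat_le0// ltW//; near: y; exact: lt_nbhsl.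
- have xn0 : x != 0 by rewrite gt_eqF.
 apply: (@near_eq_is_derive _ _ _ (fun y : R => y^-1 ^+ m * expR (- y^-1))) => //.
 + near=> y; rewrite /flat; have -> : 0 < y by near: y; exact: lt_nbhsr.
 by rewrite exprVn.
 + have dV : is_derive x 1 (fun y : R => y^-1) (- x ^- 2).
  have h := @is_deriveV R id x 1 1 xn0 (is_derive_id _ _).
  by apply: is_derive_eq; rewrite /GRing.scale/= mulr1.
 have dE : is_derive x 1 (fun y => expR (- y^-1)) (expR (- x^-1) * x ^- 2).
  have dN : is_derive x 1 (fun y : R => - y^-1) (x ^- 2).
  by have := is_deriveN dV; rewrite opprK.
  exact: (is_derive1_comp (is_derive_expR _) dN).
 have dX : is_derive x 1 (fun y : R => y^-1 ^+ m) (m%:R * x^-1 ^+ m.-1 * (- x ^- 2)).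
  have := is_deriveX m dV; rewrite exprfctE => h; apply: is_derive_eq.
  by rewrite /GRing.scale/= -mulr_natl mulr1.
 have := is_deriveM dX dE; move=> h; apply: is_derive_eq.
 rewrite /flat x0 /GRing.scale/= -!exprVn.
 case: m {dX h} => [|m]/=; first by rewrite !mul0r !mulr0 addr0 subr0 expr0 mul1r mulrC.
 by rewrite !exprS; ring.
- rewrite !flat_le0// mulr0 subrr.
 apply: (@is_derive0_quadratic _ m.+2`!%:R) => y.
 rewrite ger0_norm ?flat_ge0//; have [y0|y0] := ltP 0 y; first exact: flat_le.
 by rewrite flat_le0// mulr_ge0 ?sqr_ge0// ler0n.
Unshelve. all: end_near. Qed.

Lemma smooth_flat m : smooth (flat m).
Proof.
move=> k; elim: k m => // k IH m.
exists (fun x => flat m.+2 x - m%:R * flat m.+1 x); first exact: is_derive_flat.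
by apply: C1kB; [exact: IH|apply: C1kM; [exact: C1k_cst|exact: IH]].
Qed.

Lemma smooth_affine (f : R -> R) a b : smooth f -> smooth (fun x => f (a * x + b)).
Proof.
move=> sf k; apply: (@C1k_comp _ _ f (fun x => a * x + b)) => //.
by apply: C1kD; [apply: C1kM; [exact: C1k_cst|exact: C1k_id]|exact: C1k_cst].
Qed.

Definition bump (x : R) := flat 0 (x + 1) * flat 0 (1 - x).

Lemma smooth_bump : smooth bump.
Proof.
move=> k; apply: C1kM.
 by apply: C1k_ext (smooth_affine 1 1 (smooth_flat 0) k) => x; rewrite mul1r.
apply: C1k_ext (smooth_affine (-1) 1 (smooth_flat 0) k) => x.
by rewrite mulN1r addrC.
Qed.

Lemma bump_ge0 x : 0 <= bump x. Proof. by rewrite mulr_ge0 ?flat_ge0. Qed.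

Lemma bump_gt0 x : `|x| < 1 -> 0 < bump x.
Proof. by rewrite ltr_norml => /andP[? ?]; rewrite mulr_gt0// flat_gt0//; lra. Qed.

Lemma bump_eq0 x : 1 <= `|x| -> bump x = 0.
Proof.
rewrite ler_normr => /orP[x1|x1].
 by rewrite /bump (flat_le0 _ (_ : 1 - x <= 0)) ?mulr0//; lra.
by rewrite /bump (flat_le0 _ (_ : x + 1 <= 0)) ?mul0r//; lra.
Qed.

Definition step (x : R) := flat 0 x / (flat 0 x + flat 0 (1 - x)).

Lemma step_den_gt0 x : 0 < flat 0 x + flat 0 (1 - x).
Proof.
have [x0|x0] := ltP 0 x; first by rewrite ltr_pwDl ?flat_gt0// flat_ge0.
by rewrite ltr_wpDl ?flat_ge0// flat_gt0//; lra.
Qed.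

Lemma smooth_step : smooth step.
Proof.
move=> k; apply: C1kM; first exact: smooth_flat.
apply: C1kV; first by move=> x; rewrite gt_eqF// step_den_gt0.
apply: C1kD; first exact: smooth_flat.
apply: C1k_ext (smooth_affine (-1) 1 (smooth_flat 0) k) => x.
by rewrite mulN1r addrC.
Qed.

Lemma step_ge0 x : 0 <= step x.
Proof. by rewrite divr_ge0 ?flat_ge0// ltW// step_den_gt0. Qed.

Lemma step_le1 x : step x <= 1.
Proof. by rewrite ler_pdivrMr ?step_den_gt0// mul1r lerDl flat_ge0. Qed.

Lemma step_le0 x : x <= 0 -> step x = 0.
Proof. by move=> x0; rewrite /step flat_le0// mul0r. Qed.

Lemma step_ge1 x : 1 <= x -> step x = 1.
Proof.
move=> x1; rewrite /step (flat_le0 _ (_ : 1 - x <= 0)) ?addr0; last by lra.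
by rewrite divff// gt_eqF// flat_gt0//; lra.
Qed.

Lemma flat0_nd x y : x <= y -> flat 0 x <= flat 0 y.
Proof.
move=> xy; have [x0|x0] := ltP 0 x; last by rewrite (flat_le0 _ x0) flat_ge0.
have y0 := lt_le_trans x0 xy.
rewrite /flat x0 y0 !expr0 !invr1 !mul1r ler_expR lerN2.
by rewrite lef_pV2 ?posrE.
Qed.

Lemma step_nd x y : x <= y -> step x <= step y.
Proof.
move=> xy; rewrite ler_pdivrMr ?step_den_gt0// mulrAC ler_pdivlMr ?step_den_gt0//.
have := flat0_nd xy; have : flat 0 (1 - y) <= flat 0 (1 - x) by apply: flat0_nd; lra.
have := flat_ge0 0 x; have := flat_ge0 0 y.
have := flat_ge0 0 (1 - x); have := flat_ge0 0 (1 - y).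
move: (flat 0 x) (flat 0 y) (flat 0 (1 - x)) (flat 0 (1 - y)) => a b c e *.
by nra.
Qed.

End bumps.

Lemma is_derive_conv {R : numFieldType} {V W : normedModType R} (f : V -> W)
 (x v : V) (a b : W) : is_derive x v f a -> a = b -> is_derive x v f b.
Proof. by move=> ? <-. Qed.

(** * The smoothed absolute value *)

Section smoothed_abs.
Context {R : realType}.
Variable e : R.
Hypothesis e0 : 0 < e.

(** It serves at both ends of the range of [e]: it tends to [|x|] as [e] tends to 0, and
    [e * sabs x - e^2] tends to [x^2 / 2] as [e] tends to infinity. *)
Definition sabs (x : R) := Num.sqrt (e ^+ 2 + x ^+ 2).

Let arg_gt0 x : 0 < e ^+ 2 + x ^+ 2.
Proof. by rewrite ltr_pwDl ?exprn_gt0// sqr_ge0. Qed.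

Lemma sabs_gt0 x : 0 < sabs x.
Proof. by rewrite sqrtr_gt0. Qed.

Lemma sabs_sq x : sabs x ^+ 2 = e ^+ 2 + x ^+ 2.
Proof. by rewrite sqr_sqrtr// ltW. Qed.

Lemma sabs_neq0 x : sabs x != 0. Proof. by rewrite gt_eqF// sabs_gt0. Qed.

Lemma sabs_ge x : `|x| <= sabs x.
Proof.
rewrite -ler_sqr ?nnegrE ?normr_ge0 ?(ltW (sabs_gt0 _))//.
by rewrite real_normK ?num_real// sabs_sq lerDr sqr_ge0.
Qed.

Lemma sabs_gee x : e <= sabs x.
Proof.
rewrite -ler_sqr ?nnegrE ?(ltW (sabs_gt0 _)) ?(ltW e0)//.
by rewrite sabs_sq lerDl sqr_ge0.
Qed.

Lemma sabs_le x : sabs x <= `|x| + e.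
Proof.
rewrite -ler_sqr ?nnegrE ?addr_ge0 ?(ltW (sabs_gt0 _)) ?(ltW e0)//.
rewrite sabs_sq sqrrD real_normK ?num_real//.
have : 0 <= `|x| * e by rewrite mulr_ge0// ltW.
by rewrite -mulr_natl => ?; lra.
Qed.

Lemma is_derive_sabs (x : R) : is_derive x 1 sabs (x / sabs x).
Proof.
have d1 : is_derive x 1 (fun y : R => e ^+ 2 + y ^+ 2) (2 * x).
 have d2 : is_derive x 1 (fun y : R => y ^+ 2) (2 * x).
 have := is_deriveX 2 (is_derive_id x 1); rewrite exprfctE => h.
 by apply: is_derive_conv h _; rewrite /GRing.scale/= mulr1 expr1.
 have h := is_deriveD (is_derive_cst (e ^+ 2) x 1) d2.
 by apply: is_derive_eq; rewrite add0r.
have h := @is_derive1_comp R Num.sqrt (fun y => e ^+ 2 + y ^+ 2) x _ _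
 (is_derive1_sqrt (arg_gt0 x)) d1.
apply: is_derive_eq; rewrite -/(sabs x) -[in LHS]mulr_natl.
by field; rewrite sabs_neq0.
Qed.

(** The derivative of [1 / sabs] is a polynomial in [x] and [1 / sabs], so the induction never
    leaves this function. *)
Lemma C1k_sabsV k : C1k k (fun x => (sabs x)^-1).
Proof.
elim: k => // k IH.
exists (fun x => - (x * (sabs x)^-1 ^+ 3)).
 move=> x; have h := is_deriveV (sabs_neq0 x) (is_derive_sabs x).
 by apply: is_derive_eq; rewrite /GRing.scale/=; field; rewrite sabs_neq0.
by apply: C1kN; apply: C1kM; [exact: C1k_id|exact: C1kX].
Qed.

Definition dsabs (x : R) := x / sabs x.
Definition ddsabs (x : R) := e ^+ 2 * (sabs x)^-1 ^+ 3.

Lemma smooth_dsabs : smooth dsabs.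
Proof. by move=> k; apply: C1kM; [exact: C1k_id|exact: C1k_sabsV]. Qed.

Lemma is_derive_dsabs (x : R) : is_derive x 1 dsabs (ddsabs x).
Proof.
have dV : is_derive x 1 (fun x => (sabs x)^-1) (- (x * (sabs x)^-1 ^+ 3)).
 have h := is_deriveV (sabs_neq0 x) (is_derive_sabs x).
 by apply: is_derive_eq; rewrite /GRing.scale/=; field; rewrite sabs_neq0.
have h := is_deriveM (is_derive_id x 1) dV.
apply: is_derive_eq; rewrite /GRing.scale/= /ddsabs.
have := sabs_sq x; have := sabs_neq0 x; move: (sabs x) => S S0 S2.
have -> : e ^+ 2 = S ^+ 2 - x ^+ 2 by rewrite S2; ring.
by field.
Qed.

Lemma dsabs_le1 x : `|dsabs x| <= 1.
Proof.
rewrite normrM normfV (gtr0_norm (sabs_gt0 x)) ler_pdivrMr ?sabs_gt0// mul1r.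
exact: sabs_ge.
Qed.

Lemma ddsabs_ge0 x : 0 <= ddsabs x.
Proof. by rewrite mulr_ge0 ?sqr_ge0// exprn_ge0// invr_ge0 ltW// sabs_gt0. Qed.

Lemma ddsabs_le x : ddsabs x <= e^-1.
Proof.
have S0 := sabs_gt0 x; have Se := sabs_gee x.
have : (sabs x)^-1 <= e^-1 by rewrite lef_pV2 ?posrE.
have V0 : 0 <= (sabs x)^-1 by rewrite invr_ge0 ltW.
move=> hV; have h : (sabs x)^-1 ^+ 3 <= e^-1 ^+ 3.
 by rewrite lerXn2r// nnegrE invr_ge0 ltW.
rewrite (le_trans (ler_wpM2l (sqr_ge0 e) h))//.
by rewrite le_eqVlt; apply/orP; left; apply/eqP; field; rewrite gt_eqF.
Qed.

(** The third derivative is [-3 e^2 x / sabs^5]; the bounds [|x| <= sabs] and [e <= sabs] leave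
    [3 / e^2]. *)
Lemma ddsabs_lipschitz x y : `|ddsabs x - ddsabs y| <= 3 / e ^+ 2 * `|x - y|.
Proof.
have dd (z : R) : is_derive z 1 ddsabs (- (3 * e ^+ 2 * z * (sabs z)^-1 ^+ 5)).
 have dV : is_derive z 1 (fun x => (sabs x)^-1) (- (z * (sabs z)^-1 ^+ 3)).
 have h := is_deriveV (sabs_neq0 z) (is_derive_sabs z).
 by apply: is_derive_eq; rewrite /GRing.scale/=; field; rewrite sabs_neq0.
 have h3 := is_deriveX 3 dV; rewrite exprfctE in h3.
 have h := is_deriveZ (e ^+ 2) h3.
 by apply: is_derive_conv h _; rewrite /GRing.scale/=; ring.
apply: (derive_lipschitz dd) => z.
have S0 := sabs_gt0 z; have Se := sabs_gee z; have zS := sabs_ge z.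
have eV : (sabs z)^-1 <= e^-1 by rewrite lef_pV2 ?posrE.
have V0 : 0 <= (sabs z)^-1 by rewrite invr_ge0 ltW.
have E3 : 0 <= 3 * e ^+ 2 by rewrite mulr_ge0 ?sqr_ge0.
have -> : `|- (3 * e ^+ 2 * z * (sabs z)^-1 ^+ 5)| =
   3 * e ^+ 2 * `|z| * (sabs z)^-1 ^+ 5.
 rewrite normrN normrM; congr (_ * _); last exact/ger0_norm/exprn_ge0.
 by rewrite normrM; congr (_ * _); exact: ger0_norm.
have h4 : (sabs z)^-1 ^+ 4 <= e^-1 ^+ 4.
 by rewrite lerXn2r// nnegrE invr_ge0 ltW.
have h1 : `|z| * (sabs z)^-1 <= 1 by rewrite ler_pdivrMr// mul1r.
have -> : 3 * e ^+ 2 * `|z| * (sabs z)^-1 ^+ 5 =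
 3 * e ^+ 2 * ((`|z| * (sabs z)^-1) * (sabs z)^-1 ^+ 4) by rewrite !exprS; ring.
have -> : 3 / e ^+ 2 = 3 * e ^+ 2 * (1 * e^-1 ^+ 4) by field; rewrite gt_eqF.
have h5 : `|z| / sabs z * (sabs z)^-1 ^+ 4 <= 1 * e^-1 ^+ 4.
 by apply: ler_pM => //; rewrite ?mulr_ge0 ?exprn_ge0.
by apply: ler_wpM2l h5.
Qed.

End smoothed_abs.

(** * Calculus of [Ck] functions of several variables *)

Section Ck_rV.
Context {R : realType} {d : nat}.
Implicit Types (f g : 'rV[R]_d -> R).
Notation e_ i := (delta_mx ord0 i : 'rV[R]_d).

Definition Cinf f := forall k, Ck k f.

Lemma Ck_intro k f : continuous f ->
 (forall i, exists2 f' : 'rV[R]_d -> R,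
  (forall x, is_derive x (e_ i) f (f' x)) & Ck k f') -> Ck k.+1 f.
Proof.
move=> cf H; split => // i; have [f' df f'k] := H i; split.
 by move=> x; have [] := df x.
by rewrite (_ : 'D_(e_ i) f = f')//; apply/funext => x; have [_ ->] := df x.
Qed.

Lemma Ck_elim k f : Ck k.+1 f -> [/\ continuous f,
 (forall i x, is_derive x (e_ i) f ('D_(e_ i) f x)) &
 forall i, Ck k ('D_(e_ i) f)].
Proof.
move=> [cf H]; split => // i; last by have [] := H i.
by move=> x; have [df _] := H i; split.
Qed.

Lemma Ck_continuous k f : Ck k f -> continuous f.
Proof. by case: k => [[]|k []]. Qed.

Lemma CkW k f : Ck k.+1 f -> Ck k f.
Proof.
elim: k f => [f [] //|k IH f] /Ck_elim[cf df f'k].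
by apply: Ck_intro => // i; exists ('D_(e_ i) f) => //; exact: IH.
Qed.

Lemma Ck_cst k (c : R) : Ck k (fun _ : 'rV[R]_d => c).
Proof.
elim: k c => [c|k IH c]; first by split => //; exact: cst_continuous.
apply: Ck_intro; first exact: cst_continuous.
by move=> i; exists (fun=> 0) => // x; exact: is_derive_cst.
Qed.

Lemma is_derive_coord (i : 'I_d) (x v : 'rV[R]_d) :
 is_derive x v (fun y : 'rV[R]_d => y ord0 i) (v ord0 i).
Proof.
have H : h^-1 *: (((fun y : 'rV[R]_d => y ord0 i) \o shift x) (h *: v) - x ord0 i)
 @[h --> 0^'] --> v ord0 i.
 apply: cvg_near_cst; near=> h.
 have h0 : h != 0 by near: h; exact: nbhs_dnbhs_neq.
 by rewrite /= !mxE addrK /GRing.scale/= mulKf.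
split; first by apply/cvg_ex; exists (v ord0 i).
exact: cvg_lim H.
Unshelve. all: end_near. Qed.

Lemma continuous_coord (i : 'I_d) : continuous (fun y : 'rV[R]_d => y ord0 i).
Proof. exact: coord_continuous. Qed.

Lemma Ck_coord k (i : 'I_d) : Ck k (fun y : 'rV[R]_d => y ord0 i).
Proof.
case: k => [|k]; first by split => //; exact: continuous_coord.
apply: Ck_intro; first exact: continuous_coord.
move=> j; exists (fun=> e_ j ord0 i); last exact: Ck_cst.
by move=> x; exact: is_derive_coord.
Qed.

Lemma CkD k f g : Ck k f -> Ck k g -> Ck k (fun x => f x + g x).
Proof.
elim: k f g => [f g [cf _] [cg _]|k IH f g].
 by split => // x; exact: (cvgD (cf x) (cg x)).
move=> /Ck_elim[cf df f'k] /Ck_elim[cg dg g'k].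
apply: Ck_intro; first by move=> x; exact: (cvgD (cf x) (cg x)).
move=> i; exists (fun x => 'D_(e_ i) f x + 'D_(e_ i) g x); last exact: IH.
by move=> x; exact: is_deriveD.
Qed.

Lemma CkM k f g : Ck k f -> Ck k g -> Ck k (fun x => f x * g x).
Proof.
elim: k f g => [f g [cf _] [cg _]|k IH f g fk gk].
 by split => // x; exact: (cvgM (cf x) (cg x)).
have fk1 := CkW fk; have gk1 := CkW gk.
move: fk gk => /Ck_elim[cf df f'k] /Ck_elim[cg dg g'k].
apply: Ck_intro; first by move=> x; exact: (cvgM (cf x) (cg x)).
move=> i; exists (fun x => f x * 'D_(e_ i) g x + g x * 'D_(e_ i) f x).
 by move=> x; exact: is_deriveM.
by apply: CkD; exact: IH.
Qed.

Lemma CkZ k c f : Ck k f -> Ck k (fun x => c * f x).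
Proof. by move=> fk; apply: CkM => //; exact: Ck_cst. Qed.

Lemma Ck_prod k I (r : seq I) (F : I -> 'rV[R]_d -> R) :
 (forall i, Ck k (F i)) -> Ck k (fun x => \prod_(i <- r) F i x).
Proof.
move=> Fk; elim: r => [|i r IH].
 by under eq_fun do rewrite big_nil; exact: Ck_cst.
by under eq_fun do rewrite big_cons; exact: CkM.
Qed.

(** Only a directional derivative of [f] is at hand, so the chain rule is pulled back to the line
    through [x] in the direction [v], where the rule for one variable applies. *)
Lemma is_derive_comp1 (g : R -> R) f (x v : 'rV[R]_d) (dg df : R) :
 is_derive (f x) 1 g dg -> is_derive x v f df -> is_derive x v (g \o f) (dg * df).
Proof.
move=> Hg [fx <-].
pose F h := f (h *: v + x).
have dF : is_derive (0 : R) 1 F ('D_v f x).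
 split; first by have [H _] := derivable1P f x v; exact: (H fx).
 rewrite /derive; set g1 := fun h => h^-1 *: _; set g2 := fun h => h^-1 *: _.
 suff -> : g1 = g2 by [].
 apply/funext => h /=; rewrite /g1 /g2 /F /= !addr0 scale0r add0r.
 by rewrite /GRing.scale/= mulr1.
have F0 : F 0 = f x by rewrite /F scale0r add0r.
rewrite -F0 in Hg.
have [H1 H2] := is_derive1_comp Hg dF.
split; first by have [_ H] := derivable1P (g \o f) x v; exact: (H H1).
rewrite -H2 /derive; set g1 := fun h => h^-1 *: _; set g2 := fun h => h^-1 *: _.
suff -> : g1 = g2 by [].
apply/funext => h /=; rewrite /g1 /g2 /F /= !addr0 scale0r add0r.
by rewrite /GRing.scale/= mulr1.
Qed.

Lemma Ck_comp k (g : R -> R) f : smooth g -> Ck k f -> Ck k (g \o f).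
Proof.
elim: k g f => [|k IH] g f sg fk.
 case: fk => cf _; split => // x.
 by apply: continuous_comp; [exact: cf|exact: smooth_continuous].
have fk1 := CkW fk.
move: fk => /Ck_elim[cf df f'k].
have [sg' dg] := smooth_derive sg.
apply: Ck_intro.
 by move=> x; apply: continuous_comp; [exact: cf|exact: smooth_continuous].
move=> i; exists (fun x => (derive1 g \o f) x * 'D_(e_ i) f x).
 by move=> x; exact: is_derive_comp1.
by apply: CkM => //; exact: IH.
Qed.

Lemma Cinf_derive f i : Cinf f -> Cinf ('D_(e_ i) f).
Proof. by move=> fi k; have /Ck_elim[_ _] := fi k.+1; exact. Qed.

Lemma Cinf_is_derive f i x : Cinf f -> is_derive x (e_ i) f ('D_(e_ i) f x).
Proof. by move=> /(_ 1%N)/Ck_elim[]. Qed.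

End Ck_rV.

(** * Open sets and continuous functions are Borel *)

Section borel_rV.
Context {R : realType} {n : nat}.
Notation V := 'rV[R]_n.

Lemma measurable_coord d (T : measurableType d) (f : T -> V) (i : 'I_n) :
 mfun f -> mfun (fun x => f x ord0 i : R).
Proof. by move=> mf; apply: (mcomp (@measurable_rV_coord R n i)). Qed.

Lemma measurable_ballrV (x : V) e : measurable (ball x e).
Proof.
have [e0|e0] := ltP 0 e; last first.
 rewrite (_ : ball _ _ = set0)//; apply/seteqP; split => // y.
 by rewrite -ball_normE /ball_/= => h; have := le_lt_trans (normr_ge0 _) h; rewrite ltNge e0.
rewrite (_ : ball x e = \bigcap_(i in [set: 'I_n]) (rV_coord i @^-1` ball (x ord0 i) e)).
 apply: fin_bigcap_measurable => // i _; rewrite -[X in measurable X]setTI.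
 by apply: measurable_rV_coord => //; exact: measurable_ball.
apply/seteqP; split => y /=.
 by move=> [_ H] i _; exact: H.
move=> H; split => // i j; rewrite (ord1 i); exact: (H j).
Qed.

(** The sigma-algebra is generated by the coordinates, so an open set is written as a countable
    union of balls with rational centres and radii [1/(k+1)]. Undecodable indices and balls that
    leave [U] contribute the empty set. *)
Lemma open_meas (U : set V) : open U -> measurable U.
Proof.
move=> oU.
pose B (q : 'rV[rat]_n) (k : nat) : set V := ball (map_mx ratr q : V) k.+1%:R^-1.
pose F (m : nat) : set V := if unpickle m is Some (q, k) then
 (if `[< B q k `<=` U >] then B q k else set0) else set0.
have -> : U = \bigcup_m F m.
 apply/seteqP; split => [x Ux|x [m _]]; last first.
 by rewrite /F; case: unpickle => [[q k]|//]; case: asboolP => // h; exact: h.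
 have /nbhs_ballP[e /= e0 eU] : nbhs x U by exact: open_nbhs_nbhs.
 (* Twice the radius must be below [e]: the rational centre is within [1/(k+1)] of [x], and the ball
    around it has that same radius. *)
 have [k ke] : exists k : nat, k.+1%:R^-1 < e / 2.
 have [k _ /(_ k (leqnn k))] : \forall k \near \oo, k.+1%:R^-1 < e / 2.
  have e2 : 0 < e / 2 by rewrite divr_gt0.
  exact: (near_infty_natSinv_lt (PosNum e2)).
 by exists k.
 have k0 : 0 < k.+1%:R^-1 :> R by rewrite invr_gt0.
 have /choice[q Hq] : forall i, exists q : rat, ball (x ord0 i) k.+1%:R^-1 (ratr q : R).
 move=> i; have : x ord0 i - k.+1%:R^-1 < x ord0 i + k.+1%:R^-1.
  by rewrite ltrD2l gtrN.
 move=> /rat_in_itvoo[q]; rewrite in_itv/= => /andP[q1 q2]; exists q.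
 by rewrite /ball/= ltr_distlC q1 q2.
 have Bx : B (\row_i q i) k x.
 split => // i j; rewrite !mxE (ord1 i); apply: ball_sym; exact: Hq.
 have BU : B (\row_i q i) k `<=` U.
 move=> y By; apply: eU; apply: (@le_ball _ _ _ (k.+1%:R^-1 + k.+1%:R^-1)).
  by rewrite (splitr e) ltW// ltrD.
 by apply: (ball_triangle _ By); exact: ball_sym.
 exists (pickle (\row_i q i, k)) => //; rewrite /F pickleK.
 by case: asboolP.
apply: bigcup_measurable => m _; rewrite /F; case: unpickle => [[q k]|//].
by case: ifP => // _; exact: measurable_ballrV.
Qed.

Lemma continuous_measurable_rV (f : V -> R) : continuous f -> mfun f.
Proof.
move=> /continuousP cf; apply: (measurability _ (RGenOpens.measurableE R)).
move=> _ [_ [a [b ->] <-]]; rewrite setTI; apply: open_meas.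
exact/cf/interval_open.
Qed.

End borel_rV.

(** * Slicing and translation invariance of Lebesgue measure *)

Section rV_integral.
Context {R : realType}.
Notation mu n := (@lebesgue_rV R n).
Notation leb := (@lebesgue_measure R).
Open Scope ereal_scope.

Lemma ge0_integral_rVS n (f : 'rV[R]_n.+1 -> \bar R) : mfun f ->
 (forall x, 0 <= f x) ->
 \int[mu n.+1]_x f x = \int[leb]_a \int[mu n]_y f (rV_cons (a, y)).
Proof.
move=> mf f0.
have E : \int[mu n.+1]_x f x = \int[pushforward (leb \x mu n) (@rV_cons R n)]_x f x.
 by apply: eq_measure_integral; first exact: measurable_rV_cons.
rewrite E ge0_integral_pushforward//; last first.
 exact: measurable_rV_cons.
rewrite preimage_setT fubini_tonelli1//; last by move=> x; exact: f0.
by apply: mcomp => //; exact: measurable_rV_cons.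
Qed.

Lemma measurable_rV_cons_fst n (f : 'rV[R]_n.+1 -> \bar R) : mfun f ->
 (forall x, 0 <= f x) ->
 mfun (fun a : measurableTypeR R => \int[mu n]_y f (rV_cons (a, y))).
Proof.
move=> mf f0.
apply: (@measurable_fun_fubini_tonelli_F _ _ _ _ R (mu n) (f \o @rV_cons R n)); last first.
 by move=> x; exact: f0.
by apply: mcomp => //; exact: measurable_rV_cons.
Qed.

Lemma measurable_rV_cons_snd n (f : 'rV[R]_n.+1 -> \bar R) a : mfun f ->
 mfun (fun y => f (rV_cons (a, y))).
Proof.
move=> mf.
have mc : mfun (f \o @rV_cons R n).
 by apply: mcomp => //; exact: measurable_rV_cons.
exact: (measurable_fun_pair2 a mc).
Qed.

(** The image of Lebesgue measure under a translation agrees with it on half-open intervals, hence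
    everywhere by uniqueness. *)
Lemma ge0_integral_translation1 (f : R -> \bar R) (h : R) :
 mfun (f : measurableTypeR R -> \bar R) -> (forall x, 0 <= f x) ->
 \int[leb]_x f (x + h)%R = \int[leb]_x f x.
Proof.
move=> mf f0.
have mh : mfun ((fun x => x + h)%R : measurableTypeR R -> measurableTypeR R).
 by apply: measurable_funD => //; exact: mcst.
have -> : \int[leb]_x f (x + h)%R = \int[pushforward leb ((fun x => x + h)%R : measurableTypeR R -> measurableTypeR R)]_x f x.
 by rewrite ge0_integral_pushforward//.
apply: eq_measure_integral => A mA _.
apply/esym; apply: (@lebesgue_measure_unique R (pushforward leb ((fun x => x + h)%R : measurableTypeR R -> measurableTypeR R))) => // X [[a b]] _ <- /=.
rewrite /pushforward.
rewrite (_ : _ @^-1` _ = `](a - h)%R, (b - h)%R]%classic).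
 rewrite !lebesgue_measure_itv/= !lte_fin ltrD2r.
 by case: ifP => // _; rewrite -!EFinD; congr EFin; ring.
by apply/seteqP; split => x /=; rewrite !in_itv/= ltrBlDr lerBrDr.
Qed.

Lemma rV_consD n a b (x y : 'rV[R]_n) : (rV_cons (a, x) + rV_cons (b, y) = rV_cons ((a + b)%R, (x + y)%R))%R.
Proof.
apply/rowP => i; rewrite mxE; case: (unliftP ord0 i) => [j|] ->.
 by rewrite !rV_consS mxE.
by rewrite !rV_cons0.
Qed.

Lemma rV_consE n (x : 'rV[R]_n.+1) : rV_cons (rV_uncons x) = x.
Proof.
apply/rowP => i; case: (unliftP ord0 i) => [j|] ->.
 by rewrite /rV_uncons rV_consS mxE; congr (x _ _); apply: val_inj.
by rewrite rV_cons0 /rV_uncons /=; congr (x _ _); apply: val_inj.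
Qed.

Lemma measurable_rVD d (T : measurableType d) n (f g : T -> 'rV[R]_n) :
 mfun f -> mfun g ->
 mfun (fun x => f x + g x)%R.
Proof.
move=> mf mg; apply: measurable_fun_rVP => i.
rewrite (_ : _ \o _ = (fun x => f x ord0 i + g x ord0 i)%R).
 by apply: measurable_funD; exact: measurable_coord.
by apply/funext => x; rewrite /rV_coord /= mxE.
Qed.

Lemma ge0_integral_translation n (f : 'rV[R]_n -> \bar R) h :
 mfun f -> (forall x, 0 <= f x) ->
 \int[mu n]_x f (x + h)%R = \int[mu n]_x f x.
Proof.
elim: n f h => [|n IH] f h mf f0.
 by apply: eq_integral => x _; congr f; apply/rowP => -[].
have mfh : mfun (fun x : 'rV[R]_n.+1 => f (x + h)%R).
 by apply: (mcomp mf); apply: measurable_rVD => //; exact: mcst.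
apply: etrans (ge0_integral_rVS mfh (fun x => f0 (x + h)%R)) _.
apply: etrans (esym (ge0_integral_rVS mf f0)).
rewrite -{1}(rV_consE h); case: (rV_uncons h) => b k.
under eq_integral => a _.
 under eq_integral do rewrite rV_consD.
 rewrite (IH (fun y => f (rV_cons (a + b, y))) k)%R//; last exact: measurable_rV_cons_snd.
 over.
rewrite (ge0_integral_translation1 (f := fun a => \int[mu n]_y f (rV_cons (a, y))))//.
- exact: measurable_rV_cons_fst.
- by move=> a; exact: integral_ge0.
Qed.

Lemma lebesgue_rV_ball_fin n (x : 'rV[R]_n) e : mu n (ball x e) < +oo.
Proof.
have [e0|e0] := ltP 0%R e; last first.
 rewrite (_ : ball _ _ = set0) ?measure0//; apply/seteqP; split => // y.
 by rewrite -ball_normE /ball_/= => h; have := le_lt_trans (normr_ge0 _) h; rewrite ltNge e0.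
rewrite (_ : ball x e = [set y | forall i, ball (x ord0 i) e (y ord0 i)]).
 rewrite (lebesgue_rV_box (A := fun i => ball (x ord0 i) e)); last first.
 by move=> i; exact: measurable_ball.
 rewrite ltey_eq; apply/orP; left.
 elim/big_ind: _ => //; first exact: fin_numM.
 by move=> i _; rewrite lebesgue_measure_ball// ltW.
by apply/seteqP; split => [y [_ H] i|y H]; [exact: H|split => // i j; rewrite (ord1 i); exact: H].
Qed.

Lemma lebesgue_rV_bounded_fin n (U : set 'rV[R]_n) : measurable U -> bounded_set U ->
 mu n U < +oo.
Proof.
move=> mU [M [_ /(_ (M + 1)%R)]]; rewrite ltrDl ltr01 => /(_ isT) H.
apply: (@le_lt_trans _ _ (mu n (ball 0%R (M + 2)%R))); last exact: lebesgue_rV_ball_fin.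
apply: le_measure; rewrite ?inE//; first exact: measurable_ballrV.
move=> x /H /= xM; rewrite -ball_normE /ball_/= sub0r normrN.
by rewrite (le_lt_trans xM)// ltrD2l ltr1n.
Qed.

End rV_integral.

(** * Test functions and convolution *)

Section test_functions_theory.
Context {R : realType} {d : nat}.
Notation V := 'rV[R]_d.
Notation mu := (@lebesgue_rV R d).
Notation e_ i := (delta_mx ord0 i : V).
Implicit Types (U : set V) (phi psi : V -> R).

Lemma compact_closed_rV (K : set V) : compact K -> closed K.
Proof. by apply: compact_closed; exact: norm_hausdorff. Qed.

Lemma derive_off_closed (K : set V) phi i x : closed K ->
 (forall x, ~ K x -> phi x = 0) -> ~ K x -> 'D_(e_ i) phi x = 0.
Proof.
move=> cK phi0 nKx.
rewrite (@near_eq_derive _ _ _ phi (fun=> 0)).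
- by rewrite derive_cst.
- have : nbhs x (~` K) by apply: open_nbhs_nbhs; split => //; exact: closed_openC.
 by apply: filterS => y; exact: phi0.
Qed.

Lemma test_Cinf U phi : testf U phi -> Cinf phi. Proof. by case. Qed.

Lemma test_continuous U phi : testf U phi -> continuous phi.
Proof. by move=> [/(_ 0%N) h _]; exact: Ck_continuous h. Qed.

Lemma test_off U phi x : testf U phi -> ~ U x -> phi x = 0.
Proof. by move=> [_ [K [_ KU K0]]] nUx; apply: K0 => /KU. Qed.

Lemma test_derive U phi i : testf U phi -> testf U ('D_(e_ i) phi).
Proof.
move=> [phii [K [cK KU K0]]]; split; first exact: Cinf_derive.
by exists K; split => // x; apply: derive_off_closed => //; exact: compact_closed_rV.
Qed.

Lemma test_is_derive U phi i x : testf U phi ->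
 is_derive x (e_ i) phi ('D_(e_ i) phi x).
Proof. by case=> ? _; exact: Cinf_is_derive. Qed.

Lemma test_subset U W phi : U `<=` W -> testf U phi -> testf W phi.
Proof.
move=> UW [phii [K [cK KU K0]]]; split => //; exists K; split => //.
exact: subset_trans UW.
Qed.

Lemma testM U f phi : Cinf f -> testf U phi ->
 testf U (fun x => f x * phi x).
Proof.
move=> fi [phii [K [cK KU K0]]]; split; first by move=> k; exact: CkM.
by exists K; split => // x /K0 ->; rewrite mulr0.
Qed.

Lemma testZ U (c : R) phi : testf U phi -> testf U (fun x => c * phi x).
Proof. by apply: testM => k; exact: Ck_cst. Qed.

Lemma testD U phi psi : testf U phi -> testf U psi ->
 testf U (fun x => phi x + psi x).
Proof.
move=> [phii [K [cK KU K0]]] [psii [L [cL LU L0]]]; split.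
 by move=> k; exact: CkD.
exists (K `|` L); split; first exact: compactU.
 by move=> x [/KU|/LU].
by move=> x nKL; rewrite K0 ?L0 ?addr0// => h; apply: nKL; [right|left].
Qed.

Lemma test0 U : testf U (fun=> 0).
Proof.
split; first by move=> k; exact: Ck_cst.
by exists set0; split => //; exact: compact0.
Qed.

Lemma test_comp U (b : R -> R) phi : smooth b -> b 0 = 0 -> testf U phi ->
 testf U (b \o phi).
Proof.
move=> sb b0 [phii [K [cK KU K0]]]; split; first by move=> k; exact: Ck_comp.
by exists K; split => // x /K0 /= ->.
Qed.

Lemma test_bounded U phi : testf U phi -> exists C : R, forall x, `|phi x| <= C.
Proof.
move=> tphi; have cphi := test_continuous tphi.
move: tphi => [phii [K [cK KU K0]]].
have : compact (phi @` K).
 by apply: continuous_compact => //; exact: continuous_subspaceT.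
move=> /compact_bounded [M [_ /(_ (M + 1)%R)]].
rewrite ltrDl ltr01 => /(_ isT) H.
exists (`|M + 1|) => x; have [Kx|nKx] := pselect (K x).
 by rewrite (le_trans (H _ _)) ?ler_norm//; exists x.
by rewrite K0// normr0.
Qed.

Lemma test_meas U phi : testf U phi -> mfun phi.
Proof. by move=> /test_continuous; exact: continuous_measurable_rV. Qed.

Lemma intg_indicU (B : set V) : measurable B -> (mu B < +oo)%E ->
 intg mu (\1_B : V -> R).
Proof.
move=> mB fB; apply/integrableP; split; first exact/mEFinP.
under eq_integral do rewrite /= ger0_norm//.
by rewrite integral_indic// setIT.
Qed.

Lemma intg_bounded_support (f : V -> R) (B : set V) (C : R) :
 mfun f -> measurable B -> (mu B < +oo)%E ->
 (forall x, `|f x| <= C) -> (forall x, ~ B x -> f x = 0) -> intg mu f.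
Proof.
move=> mf mB Bfin fC f0.
apply: (@intg_le _ _ _ _ _ (fun x => C * \1_B x)) => //.
 move=> x; have [Bx|nBx] := pselect (B x).
 by rewrite indicE mem_set// mulr1.
 by rewrite f0// normr0 indicE memNset// mulr0.
apply: intgZ; exact: intg_indicU.
Qed.

Lemma test_support U phi : testf U phi -> exists B : set V,
 [/\ measurable B, (mu B < +oo)%E & forall x, ~ B x -> phi x = 0].
Proof.
move=> [phii [K [cK KU K0]]]; have mK : measurable K.
 rewrite -[K]setCK.
 exact: measurableC (open_meas (closed_openC (compact_closed_rV cK))).
exists K; split => //.
by apply: lebesgue_rV_bounded_fin => //; exact: compact_bounded.
Qed.

Lemma test_intg U phi : testf U phi -> intg mu phi.
Proof.
move=> tphi; have [C phiC] := test_bounded tphi; have [B [mB fB B0]] := test_support tphi.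
by apply: (@intg_bounded_support _ B C) => //; exact: test_meas tphi.
Qed.

Lemma test_L2 U phi : testf U phi -> L2 mu phi.
Proof.
move=> tphi; split; first exact: test_meas tphi.
under eq_fun do rewrite expr2.
by apply: (@test_intg U); apply: testM => //; exact: test_Cinf tphi.
Qed.

(** Dominated convergence is a statement on sequences; this turns it into continuity with respect to
    a point of the space. *)
Lemma seq_cvg_rV (f : V -> R) (p : V) (l : R) :
 (forall u : nat -> V, u @ \oo --> p -> f (u n) @[n --> \oo] --> l) ->
 f x @[x --> p] --> l.
Proof.
move=> H; apply: contrapT => nH.
have FF : ProperFilter (nbhs p) := nbhs_pfilter p.
have [e e0 He] : exists2 e : R, 0 < e &
 forall r : R, 0 < r -> exists2 x, ball p r x & e < `|l - f x|.
 apply: contrapT => nE; apply: nH; apply/cvgrPdist_le => e e0.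
 apply: contrapT => nN; apply: nE; exists e => // r r0.
 apply: contrapT => nX; apply: nN.
 suff : nbhs p [set x | `|l - f x| <= e] by [].
 apply/nbhs_ballP; exists r => // x pr /=.
 by rewrite leNgt; apply/negP => hx; apply: nX; exists x.
have k0 (k : nat) : 0 < k.+1%:R^-1 :> R by rewrite invr_gt0.
have /choice[u Hu] : forall k : nat, exists x, ball p k.+1%:R^-1 x /\ e < `|l - f x|.
 by move=> k; have [x ? ?] := He _ (k0 k); exists x.
have up : u @ \oo --> p.
 apply/cvg_ballP => r r0; near=> k.
 have [+ _] := Hu k; apply: le_ball; apply: ltW.
 by near: k; exact: (near_infty_natSinv_lt (PosNum r0)).
have /cvgrPdist_le/(_ _ e0) [k _ /(_ k (leqnn k))] := H u up.
by have [_] := Hu k; rewrite ltNge => /negbTE ->.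
Unshelve. all: end_near. Qed.

Lemma measurable_sub_rV (x : V) : mfun (fun y : V => y - x).
Proof.
apply: measurable_rVD; first exact: measurable_id.
exact: (mcst (- x : V)).
Qed.

Lemma intg_conv_arg (f K : V -> R) x : intg mu f -> testf setT K ->
 intg mu (fun y => f y * K (y - x)).
Proof.
move=> jf tK; have [C KC] := test_bounded tK.
under eq_fun do rewrite mulrC.
apply: (@intg_bmul _ _ _ _ _ _ C) => //.
apply: mcomp; first exact: test_meas tK.
exact: measurable_sub_rV.
Qed.

(** The kernel is reflected, [K (y - x)]: a derivative in [x] then falls on the kernel with a minus
    sign, which the integration by parts in the definition of a weak gradient cancels. *)
Definition convol (f K : V -> R) (x : V) := \int[mu]_y (f y * K (y - x)).

Lemma convol_continuous (f K : V -> R) : intg mu f -> testf setT K ->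
 continuous (convol f K).
Proof.
move=> jf tK x; have [C KC] := test_bounded tK; have cK := test_continuous tK.
apply: seq_cvg_rV => u ux.
apply: (@Rdct _ _ _ _ _ _ (fun y => C * `|f y|)).
- by move=> n; apply: intg_meas (intg_conv_arg _ jf tK).
- exact/intgZ/intg_abs.
- move=> y; apply: cvgMr.
 apply: (@cvg_comp _ _ _ (fun n => y - u n) K _ (nbhs (y - x))); last exact: cK.
 by apply: cvgB ux; exact: cvg_cst.
- by move=> n y; rewrite normrM mulrC ler_wpM2r.
Qed.

Lemma is_derive_convol (f K : V -> R) i x : intg mu f -> testf setT K ->
 is_derive x (e_ i) (convol f K) (- convol f ('D_(e_ i) K) x).
Proof.
move=> jf tK; have tDK := test_derive i tK.
have [C DKC] := test_bounded tDK.
pose F (h : R) (y : V) := f y * K (y - (h *: e_ i + x)).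
have dF (h : R) y : is_derive h 1 (F ^~ y) (- (f y * 'D_(e_ i) K (y - (h *: e_ i + x)))).
 have d1 : is_derive h 1 (fun h : R => K (y - (h *: e_ i + x)))
  (- 'D_(e_ i) K (y - (h *: e_ i + x))).
 have [dK eK] := test_is_derive i (y - (h *: e_ i + x)) tK.
 have /cvg_ex[l Hl] := dK.
 have lE : 'D_(e_ i) K (y - (h *: e_ i + x)) = l by exact: cvg_lim Hl.
 (* The difference quotient in [h] with increment [k] is minus that of [K] with increment [-k]. *)
 have Hl' : k^-1 *: (((fun h : R => K (y - (h *: e_ i + x))) \o shift h) (k *: (1 : R))
   - K (y - (h *: e_ i + x))) @[k --> 0^'] --> - l.
  have E : (fun k : R => k^-1 *: (((fun h : R => K (y - (h *: e_ i + x))) \o shift h) (k *: (1 : R))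
   - K (y - (h *: e_ i + x)))) =
   (fun k => - ((k^-1 *: ((K \o shift (y - (h *: e_ i + x))) (k *: e_ i) - K (y - (h *: e_ i + x)))))) \o -%R.
  apply/funext => k /=; rewrite invrN scaleNr opprK; congr (_ *: (K _ - _)).
  by apply/rowP => j; rewrite !mxE [k%:A]mulr1; ring.
  rewrite E; apply: cvg_comp; last exact: (cvgN Hl).
  move=> A; rewrite /dnbhs /within/= => /nbhs_ballP[r r0 HA].
  apply/nbhs_ballP; exists r => // z; rewrite -ball_normE /ball_/= sub0r => zr z0.
  apply: HA; last by rewrite oppr_eq0.
  by rewrite -ball_normE /ball_/= sub0r normrN.
 split; first by apply/cvg_ex; exists (- l).
 by rewrite lE; exact: cvg_lim Hl'.
 have := is_deriveM (is_derive_cst (f y) h 1) d1.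
 move=> H; apply: is_derive_conv H _.
 by rewrite /GRing.scale/= mulr0 addr0 mulrN.
have intF h : mu.-integrable setT (EFin \o F h) by exact: intg_conv_arg.
have Ia : `]-1, 1[%classic (0 : R) by rewrite /= in_itv/=; apply/andP; split; lra.
have := @cvg_differentiation_under_integral R _ _ mu F setT measurableT 0 (-1) 1 Ia
 (fun h _ => intF h)
 (fun h y _ _ => @ex_derive _ _ _ _ _ _ _ (dF h y))
 (fun y => C * `|f y|).
have G0 y : 0 <= C * `|f y| by rewrite mulr_ge0// (le_trans _ (DKC 0)).
move=> /(_ G0 (intgZ _ (intg_abs jf))).
have Gub (h : R) (y : V) : `]-1, 1[%classic h -> [set: V] y -> `|partial1of2 F h y| <= C * `|f y|.
 move=> _ _; rewrite /partial1of2 derive1E; have [_ ->] := dF h y.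
 by rewrite normrN normrM mulrC ler_wpM2r.
move=> /(_ Gub) H.
have {}H : h^-1 *: ((convol f K \o shift x) (h *: e_ i) - convol f K x) @[h --> 0^'] -->
 - convol f ('D_(e_ i) K) x.
 have E : - convol f ('D_(e_ i) K) x = \int[mu]_y partial1of2 F 0 y.
 rewrite -mulN1r -RintegralZl//; last exact: (intg_conv_arg x jf tDK).
 apply: eq_Rintegral => y _; rewrite /partial1of2 derive1E.
 by have [_ ->] := dF 0 y; rewrite scale0r add0r mulN1r.
 have EF h : convol f K (h *: e_ i + x) = \int[mu]_y F h y by [].
 have EF0 : convol f K x = \int[mu]_y F 0 y.
 by rewrite -EF scale0r add0r.
 rewrite E EF0; apply: cvg_trans H; apply: near_eq_cvg; apply: nearW => h /=.
 by rewrite addr0 EF.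
split; first by apply/cvg_ex; exists (- convol f ('D_(e_ i) K) x).
exact: cvg_lim H.
Qed.

Lemma convol_Cinf (f K : V -> R) : intg mu f -> testf setT K -> Cinf (convol f K).
Proof.
move=> jf tK k; elim: k K tK => [|k IH] K tK; first by split => //; exact: convol_continuous.
apply: Ck_intro; first exact: convol_continuous.
move=> i; exists (fun x => - convol f ('D_(e_ i) K) x).
 by move=> x; exact: is_derive_convol.
have := CkZ (-1) (IH _ (test_derive i tK)).
by under eq_fun do rewrite mulN1r.
Qed.

End test_functions_theory.

(** * Mollifiers and their contraction properties *)

Section mollifier.
Context {R : realType} {d : nat}.
Notation V := 'rV[R]_d.
Notation mu := (@lebesgue_rV R d).
Implicit Types (f g K : V -> R).

(** The converse of [open_meas]: it lets a monotone class argument that starts from open sets reach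
    every measurable set. *)
Lemma measurable_sub_open (A : set V) : measurable A -> <<s setT, @open V >> A.
Proof.
apply: smallest_sub; first exact: smallest_sigma_algebra.
rewrite -bigcup_seq; apply: bigcup_sub => i _ _ [C mC <-].
have mf : mfun
 (rV_coord i : g_sigma_algebraType (@open V) -> measurableTypeR R).
 apply: (measurability _ (RGenOpens.measurableE R)).
 move=> _ [_ [a [b ->] <-]]; rewrite setTI; apply: sub_sigma_algebra.
 have /continuousP := @continuous_coord R d i; apply; exact: interval_open.
exact: mf.
Qed.

Lemma Rint_translation f h : mfun f ->
 \int[mu]_x f (x + h) = \int[mu]_x f x.
Proof.
move=> mf; have mE : mfun (EFin \o f) by exact/mEFinP.
rewrite /Rintegral; congr fine; rewrite integralE [RHS]integralE; congr (_ - _)%E.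
 have := ge0_integral_translation h (measurable_funepos mE) (fun x => funepos_ge0 _ x).
 by move=> <-; apply: eq_integral => x _; rewrite !funeposE.
have := ge0_integral_translation h (measurable_funeneg mE) (fun x => funeneg_ge0 _ x).
by move=> <-; apply: eq_integral => x _; rewrite !funenegE.
Qed.

Lemma measurable_comp_add f h : mfun f ->
 mfun (fun x : V => f (x + h)).
Proof.
move=> mf; apply: (mcomp mf).
by apply: measurable_rVD => //; exact: mcst.
Qed.

Lemma intg_translation f h : intg mu f -> intg mu (fun x => f (x + h)).
Proof.
move=> jf; have mf := intg_meas jf.
apply/integrableP; split; first by apply/mEFinP; exact: measurable_comp_add.
move/integrableP : jf => [_]; rewrite -(ge0_integral_translation h)//.
by apply: mcomp => //; exact/mEFinP.
Qed.

Lemma convolE f K x : intg mu f -> testf setT K ->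
 convol f K x = \int[mu]_z (f (z + x) * K z).
Proof.
move=> jf tK; rewrite /convol -(Rint_translation x).
 by apply: eq_Rintegral => z _; rewrite addrK.
exact: intg_meas (intg_conv_arg x jf tK).
Qed.

(** A product over the coordinates, so that it is positive exactly on the ball of radius [1/(k+1)]
    for the sup norm, the norm of ['rV[R]_d]. *)
Definition pbump (k : nat) (z : V) : R := \prod_(i < d) bump (k.+1%:R * z ord0 i).

Lemma pbump_ge0 k z : 0 <= pbump k z.
Proof. by apply: prodr_ge0 => i _; exact: bump_ge0. Qed.

Lemma pbump_off k z : ~ ball 0 k.+1%:R^-1 z -> pbump k z = 0.
Proof.
move=> nb; have [i Hi] : exists i, 1 <= `|k.+1%:R * z ord0 i|.
 apply: contrapT => /forallNP H; apply: nb; split; first by rewrite invr_gt0.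
 move=> i j; rewrite (ord1 i) !mxE /ball/= sub0r normrN.
 have /negP := H j; rewrite -ltNge normrM ger0_norm// mulrC -ltr_pdivlMr//.
 by rewrite mul1r.
by rewrite /pbump (bigD1 i)//= bump_eq0// mul0r.
Qed.

Lemma pbump_gt0 k z : ball 0 k.+1%:R^-1 z -> 0 < pbump k z.
Proof.
move=> [_ H]; apply: prodr_gt0 => i _; apply: bump_gt0.
have := H ord0 i; rewrite !mxE /ball/= sub0r normrN => h.
by rewrite normrM ger0_norm// mulrC -ltr_pdivlMr// mul1r.
Qed.

Lemma test_pbump k : testf setT (pbump k).
Proof.
split.
 move=> n; apply: Ck_prod => i.
 apply: (@Ck_comp _ _ n bump (fun z : V => k.+1%:R * z ord0 i)); first exact: smooth_bump.
 by apply: CkZ; exact: Ck_coord.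
exists [set z : V | forall i, `[- k.+1%:R^-1, k.+1%:R^-1]%classic (z ord0 i)]; split => //.
 have H := @rV_compact R d (fun=> `[- k.+1%:R^-1, k.+1%:R^-1]%classic)
 (fun _ => @segment_compact _ _ _).
 exact: H.
move=> z H; apply: pbump_off => -[_ h]; apply: H => i.
have := h ord0 i; rewrite !mxE /ball/= sub0r normrN => /ltW.
by rewrite ler_norml in_itv.
Qed.

Definition mass k : R := \int[mu]_z pbump k z.

Lemma lebesgue_rV_ball_gt0 (x : V) e : 0 < e -> (0 < mu (ball x e))%E.
Proof.
move=> e0; rewrite (_ : ball x e = [set y | forall i, ball (x ord0 i) e (y ord0 i)]).
 rewrite (lebesgue_rV_box (A := fun i => ball (x ord0 i) e)); last first.
 by move=> i; exact: measurable_ball.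
 elim/big_ind: _ => //; first by move=> a b; exact: mule_gt0.
 by move=> i _; rewrite lebesgue_measure_ball ?ltW// lte_fin mulrn_wgt0.
by apply/seteqP; split => [y [_ H] i|y H]; [exact: H|split => // i j; rewrite (ord1 i); exact: H].
Qed.

Lemma mass_gt0 k : 0 < mass k.
Proof.
rewrite lt_neqAle Rint_ge0 ?andbT; last exact: pbump_ge0.
apply/eqP => /esym m0.
have [N [mN N0 HN]] := Rint_eq0_ae (test_intg (test_pbump k)) (@pbump_ge0 k) m0.
have k0 : 0 < k.+1%:R^-1 :> R by rewrite invr_gt0.
have := lebesgue_rV_ball_gt0 (0 : V) k0.
suff : mu (ball (0 : V) k.+1%:R^-1) = 0%E by move=> ->; rewrite ltxx.
apply: (subset_measure0 _ mN) N0; first exact: measurable_ballrV.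
apply: subset_trans HN => z bz /= h.
by have := pbump_gt0 bz; rewrite h ltxx.
Qed.

Definition moll k (z : V) : R := (mass k)^-1 * pbump k z.

Lemma test_moll k : testf setT (moll k).
Proof. by apply: testZ; exact: test_pbump. Qed.

Lemma moll_ge0 k z : 0 <= moll k z.
Proof. by rewrite mulr_ge0 ?pbump_ge0// invr_ge0 ltW// mass_gt0. Qed.

Lemma moll_off k z : ~ ball 0 k.+1%:R^-1 z -> moll k z = 0.
Proof. by move=> h; rewrite /moll pbump_off// mulr0. Qed.

Lemma moll_meas k : mfun (moll k).
Proof. exact: test_meas (test_moll k). Qed.

Lemma Rint_moll k : \int[mu]_z moll k z = 1.
Proof.
rewrite RintegralZl//; last exact: test_intg (test_pbump k).
by rewrite mulVf// gt_eqF// mass_gt0.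
Qed.

Lemma int_moll k : (\int[mu]_z (moll k z)%:E = 1)%E.
Proof.
rewrite -[LHS]fineK; last exact: integrable_fin_num (test_intg (test_moll k)).
by rewrite -/(Rintegral _ _ _) Rint_moll.
Qed.

Definition conv k f := convol f (moll k).

Lemma conv_Cinf k f : intg mu f -> Cinf (conv k f).
Proof. by move=> jf; apply: convol_Cinf => //; exact: test_moll. Qed.

Lemma conv_meas k f : intg mu f -> mfun (conv k f).
Proof.
move=> jf; apply: continuous_measurable_rV.
by have := @Ck_continuous _ _ 0 _ (conv_Cinf k jf 0).
Qed.

Lemma intg_conv_argE k f x : intg mu f -> intg mu (fun z => f (z + x) * moll k z).
Proof.
move=> jf; have := intg_conv_arg 0 (intg_translation x jf) (test_moll k).
by under eq_fun do rewrite subr0.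
Qed.

Lemma convE k f x : intg mu f -> conv k f x = \int[mu]_z (f (z + x) * moll k z).
Proof. by move=> jf; apply: convolE => //; exact: test_moll. Qed.

(** After exchanging the integrals, translation invariance removes [z] from the inner one and the
    mollifier has mass 1. The L^1 and L^2 contraction bounds both integrate a pointwise inequality
    against this identity. *)
Lemma tonelli_moll k f : mfun f -> (forall x, 0 <= f x) ->
 (\int[mu]_x \int[mu]_z (f (z + x) * moll k z)%:E = \int[mu]_x (f x)%:E)%E.
Proof.
move=> mf f0.
have m2 : mfun (fun p : V * V => (f (p.2 + p.1) * moll k p.2)%:E).
 apply/mEFinP/mfunM.
 apply: (mcomp mf); apply: measurable_rVD; first exact: measurable_snd.
 exact: measurable_fst.
 by apply: (mcomp (@moll_meas k)); exact: measurable_snd.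
rewrite (sfinite_Fubini mu mu (fun p : V * V => (f (p.2 + p.1) * moll k p.2)%:E))//=; last first.
 by move=> p; rewrite lee_fin mulr_ge0// moll_ge0.
under eq_integral => z _.
 under eq_integral => x _ do rewrite mulrC EFinM.
 rewrite ge0_integralZl_EFin//; last 3 first.
 - by move=> x _; rewrite lee_fin.
 - apply/mEFinP; under eq_fun do rewrite addrC; exact: measurable_comp_add.
 - exact: moll_ge0.
 under eq_integral do rewrite addrC.
 rewrite (ge0_integral_translation (f := EFin \o f))//; last exact/mEFinP.
 over.
rewrite ge0_integralZr//.
- by rewrite int_moll mul1e.
- by apply/mEFinP; exact: moll_meas.
- by move=> z _; rewrite lee_fin moll_ge0.
- by apply: integral_ge0 => x _; rewrite lee_fin.
Qed.

Lemma conv_norm_le k f x : intg mu f ->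
 `|conv k f x| <= \int[mu]_z (`|f (z + x)| * moll k z).
Proof.
move=> jf; rewrite convE//.
apply: le_trans (le_normr_Rintegral _ _) _ => //; first exact: intg_conv_argE.
rewrite le_eqVlt; apply/orP; left; apply/eqP; apply: eq_Rintegral => z _.
by rewrite normrM (ger0_norm (moll_ge0 _ _)).
Qed.

Lemma intg_conv k f : intg mu f -> intg mu (conv k f) /\
 \int[mu]_x `|conv k f x| <= \int[mu]_x `|f x|.
Proof.
move=> jf; have ja := intg_abs jf.
have H : (\int[mu]_x `|conv k f x|%:E <= \int[mu]_x `|f x|%:E)%E.
 rewrite -(tonelli_moll k (f := fun x => `|f x|))//; last exact: intg_meas ja.
 apply: ge0_le_integral => //.
 - apply/mEFinP/mcomp => //; exact: conv_meas.
 - have := @measurable_fun_fubini_tonelli_F _ _ V V R mu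
  (fun p : V * V => (`|f (p.2 + p.1)| * moll k p.2)%:E).
 apply; last by move=> p; rewrite lee_fin mulr_ge0// moll_ge0.
 apply/mEFinP/mfunM.
  apply: (mcomp (intg_meas ja)).
  apply: measurable_rVD; first exact: measurable_snd.
  exact: measurable_fst.
 by apply: (mcomp (@moll_meas k)); exact: measurable_snd.
 - move=> x _; have := conv_norm_le k x jf; rewrite -lee_fin => /le_trans; apply.
 rewrite /Rintegral fineK//.
 exact: integrable_fin_num (intg_conv_argE k x ja).
have jc : intg mu (conv k f).
 apply/integrableP; split; first by apply/mEFinP; exact: conv_meas.
 apply: le_lt_trans H _; move/integrableP : ja => [_].
 by under eq_integral do rewrite /= normr_id.
split => //; rewrite -lee_fin /Rintegral !fineK//.
- exact: integrable_fin_num ja.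
- exact: integrable_fin_num (intg_abs jc).
Qed.

Lemma convB k f g x : intg mu f -> intg mu g ->
 conv k (fun x => f x - g x) x = conv k f x - conv k g x.
Proof.
move=> jf jg; have tm := test_moll k.
rewrite -RintegralB//; [|exact: intg_conv_arg..].
by apply: eq_Rintegral => y _; rewrite mulrBl.
Qed.

Lemma convZ k f a x : intg mu f -> conv k (fun x => a * f x) x = a * conv k f x.
Proof.
move=> jf; have tm := test_moll k.
rewrite -RintegralZl//; last exact: intg_conv_arg.
by apply: eq_Rintegral => y _; rewrite mulrA.
Qed.

(* Jensen for the probability density [moll k], from [0 <= \int (f - a)^2 moll]
 at the mean [a]. *)
Lemma L2_conv k f : intg mu f -> L2 mu f ->
 L2 mu (conv k f) /\ nr mu (conv k f) <= nr mu f.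
Proof.
move=> jf Lf; have jf2 : intg mu (fun x => f x ^+ 2) by case: Lf.
have J x : conv k f x ^+ 2 <= \int[mu]_z (f (z + x) ^+ 2 * moll k z).
 have i1 := intg_conv_argE k x jf; have i2 := intg_conv_argE k x jf2.
 have i0 := test_intg (test_moll k).
 pose a := conv k f x.
 have : 0 <= \int[mu]_z ((f (z + x) - a) ^+ 2 * moll k z).
 by apply: Rint_ge0 => z; rewrite mulr_ge0 ?sqr_ge0// moll_ge0.
 have -> : \int[mu]_z ((f (z + x) - a) ^+ 2 * moll k z) =
 \int[mu]_z (f (z + x) ^+ 2 * moll k z) - a ^+ 2.
 transitivity (\int[mu]_z ((f (z + x) ^+ 2 * moll k z - (2 * a) * (f (z + x) * moll k z))
  + a ^+ 2 * moll k z)).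
  by apply: eq_Rintegral => z _; ring.
 rewrite RintegralD//; [|by apply: intgB => //; exact: intgZ|exact: intgZ].
 rewrite RintegralB//; [|exact: intgZ].
 rewrite (RintegralZl (2 * a) measurableT i1) (RintegralZl (a ^+ 2) measurableT i0).
 by rewrite Rint_moll -convE// -/a; ring.
 by rewrite subr_ge0.
have H : (\int[mu]_x (conv k f x ^+ 2)%:E <= \int[mu]_x (f x ^+ 2)%:E)%E.
 rewrite -(tonelli_moll k (f := fun x => f x ^+ 2))//; last 2 first.
 - exact: intg_meas jf2.
 - by move=> x; rewrite sqr_ge0.
 apply: ge0_le_integral => //.
 - by move=> x _; rewrite lee_fin sqr_ge0.
 - apply/mEFinP/measurable_funX; exact: conv_meas.
 - have := @measurable_fun_fubini_tonelli_F _ _ V V R mu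
  (fun p : V * V => (f (p.2 + p.1) ^+ 2 * moll k p.2)%:E).
 apply; last by move=> p; rewrite lee_fin mulr_ge0 ?sqr_ge0// moll_ge0.
 apply/mEFinP/mfunM.
  apply: (mcomp (intg_meas jf2)).
  apply: measurable_rVD; first exact: measurable_snd.
  exact: measurable_fst.
 by apply: (mcomp (@moll_meas k)); exact: measurable_snd.
 - move=> x _; have := J x; rewrite -lee_fin => /le_trans; apply.
 rewrite /Rintegral fineK//.
 exact: integrable_fin_num (intg_conv_argE k x jf2).
have Lc : L2 mu (conv k f).
 split; first exact: conv_meas.
 apply/integrableP; split; first by apply/mEFinP/measurable_funX; exact: conv_meas.
 under eq_integral do rewrite /= ger0_norm ?sqr_ge0//.
 apply: le_lt_trans H _; move/integrableP : jf2 => [_].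
 by under eq_integral do rewrite /= ger0_norm ?sqr_ge0//.
split => //; rewrite -ler_sqr ?nnegrE// !nr_sqE -lee_fin /Rintegral !fineK//.
- exact: integrable_fin_num jf2.
- by apply: integrable_fin_num => //; case: Lc.
Qed.

End mollifier.

(** * Convergence of mollifications in L^1 and L^2 *)

Section mollification_convergence.
Context {R : realType} {d : nat}.
Notation V := 'rV[R]_d.
Notation mu := (@lebesgue_rV R d).
Implicit Types (f g : V -> R) (U O : set V).

(** The class of functions for which mollification converges in L^1. It is a linear space closed
    under L^1 limits, so it grows from indicators of open sets to Borel sets, simple functions and
    all integrable functions. *)
Definition ccvg f := intg mu f /\
 (fun k => \int[mu]_x `|conv k f x - f x|) @ \oo --> (0 : R).

Lemma intg_convB k f : intg mu f -> intg mu (fun x => conv k f x - f x).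
Proof. by move=> jf; apply: intgB => //; have [] := intg_conv k jf. Qed.

Lemma ccvgB f g : ccvg f -> ccvg g -> ccvg (fun x => f x - g x).
Proof.
move=> [jf cf] [jg cg]; split; first exact: intgB.
have : (fun k => \int[mu]_x `|conv k f x - f x| + \int[mu]_x `|conv k g x - g x|) @ \oo
 --> (0 : R) by rewrite -[X in _ --> X]addr0; exact: cvgD.
apply: cvg0_le => k; rewrite ger0_norm; last exact: Rint_ge0.
have i1 := intg_abs (intg_convB k jf); have i2 := intg_abs (intg_convB k jg).
rewrite -RintegralD//; apply: Rint_le; [|exact: intgD|].
- by apply: intg_abs; apply: intg_convB; exact: intgB.
- by move=> x; rewrite convB// (le_trans _ (ler_normB _ _))//; rewrite le_eqVlt;
 apply/orP; left; apply/eqP; congr (`|_|); ring.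
Qed.

Lemma ccvgZ f a : ccvg f -> ccvg (fun x => a * f x).
Proof.
move=> [jf cf]; split; first exact: intgZ.
have : (fun k => `|a| * \int[mu]_x `|conv k f x - f x|) @ \oo --> (0 : R).
 by rewrite -(mulr0 `|a|); exact: cvgMr.
apply: cvg0_le => k; rewrite ger0_norm; last exact: Rint_ge0.
rewrite -RintegralZl//; last exact/intg_abs/intg_convB.
rewrite le_eqVlt; apply/orP; left; apply/eqP; apply: eq_Rintegral => x _.
by rewrite convZ// -mulrBr normrM.
Qed.

Lemma ccvg_lim f (g_ : nat -> V -> R) : intg mu f -> (forall n, ccvg (g_ n)) ->
 (fun n => \int[mu]_x `|f x - g_ n x|) @ \oo --> (0 : R) -> ccvg f.
Proof.
move=> jf Pg fg; split => //; apply/cvgr0Pnorm_le => e e0.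
have e3 : 0 < e / 3 by rewrite divr_gt0.
move/cvgr0Pnorm_le : fg => /(_ _ e3)[n _ /(_ n (leqnn n)) fgn].
have [jg cg] := Pg n.
move/cvgr0Pnorm_le : cg => /(_ _ e3); apply: filterS => k hk.
rewrite ger0_norm; last exact: Rint_ge0.
have jfg : intg mu (fun x => f x - g_ n x) by exact: intgB.
have [jc hc] := intg_conv k jfg.
have i1 := intg_abs jc; have i2 := intg_abs (intg_convB k jg); have i3 := intg_abs jfg.
apply: (@le_trans _ _ (\int[mu]_x ((`|conv k (fun x => f x - g_ n x) x| + `|conv k (g_ n) x - g_ n x|)
 + `|f x - g_ n x|))).
 apply: Rint_le; [exact/intg_abs/intg_convB|by apply: intgD => //; exact: intgD|].
 move=> x; rewrite convB//.
 have -> : conv k f x - f x = (conv k f x - conv k (g_ n) x) +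
  (conv k (g_ n) x - g_ n x) - (f x - g_ n x) by ring.
 by rewrite (le_trans (ler_normB _ _))// lerD2r ler_normD.
rewrite RintegralD//; last exact: intgD.
rewrite RintegralD//.
have h2 := le_trans (ler_norm _) hk; have h3 := le_trans (ler_norm _) fgn.
have -> : e = e / 3 + e / 3 + e / 3 by field.
rewrite !lerD//; exact: le_trans h3.
Qed.

Lemma Rint_conv k f : intg mu f -> (forall x, 0 <= f x) ->
 \int[mu]_x conv k f x = \int[mu]_x f x.
Proof.
move=> jf f0; rewrite /Rintegral; congr fine.
rewrite -(tonelli_moll k (f := f))//; last exact: intg_meas jf.
apply: eq_integral => x _; rewrite convE// /Rintegral fineK//.
exact: integrable_fin_num (intg_conv_argE k x jf).
Qed.

(** Since the mollified indicator lies between 0 and 1, its distance to [\1_O] is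
    [\1_O + conv - 2 conv \1_O], and the first two terms have the same integral. It remains to pass
    to the limit in the last one, where convergence is needed only at points of the open set. *)
Lemma ccvg_open O : open O -> (mu O < +oo)%E -> ccvg (\1_O).
Proof.
move=> oO fO; have mO := open_meas oO.
have jO := intg_indicU mO fO; split => //.
have g0 k x : 0 <= conv k (\1_O) x.
 by rewrite convE//; apply: Rint_ge0 => z; rewrite mulr_ge0// moll_ge0.
have O1 x : \1_O x <= 1 :> R by rewrite indicE; case: (_ \in _).
have g1 k x : conv k (\1_O) x <= 1.
 rewrite convE// -(@Rint_moll R d k); apply: Rint_le.
 - exact: intg_conv_argE.
 - exact: test_intg (test_moll k).
 - by move=> z; rewrite ler_piMl ?moll_ge0.
have mc k := conv_meas k jO.
have jOg k : intg mu (fun x => conv k (\1_O) x * \1_O x).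
 by apply: (@intg_bmul _ _ _ _ _ _ 1) => // x; rewrite ger0_norm.
have E k : \int[mu]_x `|conv k (\1_O) x - \1_O x| =
 2 * \int[mu]_x \1_O x - 2 * \int[mu]_x (conv k (\1_O) x * \1_O x).
 have [jc _] := intg_conv k jO.
 transitivity (\int[mu]_x (\1_O x + conv k (\1_O) x - 2 * (conv k (\1_O) x * \1_O x))).
 apply: eq_Rintegral => x _; rewrite indicE.
 case: (x \in O) => /=.
  by rewrite ler0_norm ?subr_le0//; ring.
 by rewrite subr0 ger0_norm//; ring.
 rewrite RintegralB//; [|exact: intgD|exact: intgZ].
 rewrite RintegralD// Rint_conv// (RintegralZl 2 measurableT (jOg k)).
 by ring.
under eq_fun do rewrite E.
rewrite -(subrr (2 * \int[mu]_x \1_O x)); apply: cvgB; first exact: cvg_cst.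
apply: cvgMr; apply: (@Rdct _ _ _ _ _ _ (\1_O)) => //.
- by move=> k; exact: mfunM.
- move=> x; have [xO|xO] := pselect (O x); last first.
 by rewrite indicE memNset//=; under eq_fun do rewrite mulr0; exact: cvg_cst.
 have /nbhs_ballP[r /= r0 rO] : nbhs x O by exact: open_nbhs_nbhs.
 apply: cvg_near_cst; near=> k.
 rewrite indicE mem_set//= mulr1 convE// -(@Rint_moll R d k).
 apply: eq_Rintegral => z _; have [bz|nbz] := pselect (ball (0 : V) k.+1%:R^-1 z).
 rewrite indicE mem_set ?mul1r//; apply: rO.
 have kr : k.+1%:R^-1 <= r.
  by apply: ltW; near: k; exact: (near_infty_natSinv_lt (PosNum r0)).
 have := le_ball kr bz; rewrite -!ball_normE /ball_/= sub0r.
 by rewrite opprD addrCA subrr addr0.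
 by rewrite moll_off// mulr0.
- by move=> k x; rewrite ger0_norm ?mulr_ge0// ler_piMl.
Unshelve. all: end_near. Qed.

(** Cutting by a ball keeps all measures finite, so the sets with this property are stable under
    differences and increasing unions: a lambda system that contains the open sets. *)
Lemma ccvg_ball (B : set V) m : measurable B -> ccvg (\1_(B `&` ball (0 : V) m%:R)).
Proof.
move=> mB; pose Q := ball (0 : V) m%:R.
have mQ : measurable Q := measurable_ballrV _ _.
have fI (A : set V) : measurable A -> (mu (A `&` Q) < +oo)%E.
 move=> mA; apply: le_lt_trans (lebesgue_rV_ball_fin (0 : V) m%:R).
 by apply: le_measure; rewrite ?inE//; exact: measurableI.
have jI (A : set V) : measurable A -> intg mu (\1_(A `&` Q)).
 by move=> mA; apply: intg_indicU; [exact: measurableI|exact: fI].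
pose H : set (set V) := [set A | measurable A /\ ccvg (\1_(A `&` Q))].
suff : H B by case.
have := measurable_sub_open mB; apply: lambda_system_subset => //.
- by move=> X Y oX oY; exact: openI.
- split => //.
 + split => //; rewrite setTI; apply: ccvg_open; first exact: ball_open.
 by have := fI _ measurableT; rewrite setTI.
 + move=> X Y XY [mX cX] [mY cY]; split; first exact: measurableD.
 have := ccvgB cX cY; congr ccvg; apply/funext => x.
 rewrite !indicE; have [xQ|xQ] := pselect (Q x); last first.
  by rewrite !(memNset (A := _ `&` Q)) ?subrr//; move=> [].
 have E (A : set V) : (x \in A `&` Q) = (x \in A) by rewrite in_setI (mem_set xQ) andbT.
 rewrite !E in_setD; have [Yx|nYx] := boolP (x \in Y); last by rewrite subr0 andbT.
 have -> : x \in X by move: Yx; rewrite !inE; exact: XY.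
 by rewrite subrr.
 + move=> F ndF HF; have mF i : measurable (F i) by have [] := HF i.
 have mU : measurable (\bigcup_i F i) by exact: bigcup_measurable.
 split => //; apply: (@ccvg_lim _ (fun n => \1_(F n `&` Q))).
 * exact: jI.
 * by move=> n; have [] := HF n.
 * have -> : (0 : R) = \int[mu]_x (fun=> 0) (x : V) by rewrite Rintegral_cst// mul0r.
  apply: (@Rdct _ _ _ _ _ _ (\1_((\bigcup_i F i) `&` Q))); last 2 first.
  - move=> x; have [[Ux Qx]|nUQ] := pselect (((\bigcup_i F i) `&` Q) x); last first.
   rewrite (_ : (fun n => _) = fun=> 0); first exact: cvg_cst.
   apply/funext => n; rewrite !indicE memNset// memNset ?subrr ?normr0//.
   by move=> [Fx Qx]; apply: nUQ; split => //; exists n.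
  move: (Ux) => [N _ FNx]; apply: cvg_near_cst; near=> n.
  rewrite !indicE mem_set ?mem_set ?subrr ?normr0//; split => //.
  have /subsetPset : (F N <= F n)%O by apply: ndF; near: n; exact: nbhs_infty_ge.
  exact.
  - move=> n x; rewrite normr_id !indicE.
  have [[Fx Qx]|nF] := pselect ((F n `&` Q) x).
   by rewrite !mem_set ?subrr ?normr0//; split => //; exists n.
  by rewrite (memNset nF) subr0 ger0_norm.
  - move=> n; apply: mcomp => //; apply: mfunB.
   by apply: mindic; exact: measurableI.
  by apply: mindic; exact: measurableI.
  - exact: jI.
- move=> O oO; split; first exact: open_meas.
 apply: ccvg_open; last by apply: fI; exact: open_meas.
 by apply: openI => //; exact: ball_open.
Unshelve. all: end_near. Qed.

Lemma ccvg_indic (B : set V) : measurable B -> (mu B < +oo)%E -> ccvg (\1_B).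
Proof.
move=> mB fB.
apply: (@ccvg_lim _ (fun m => \1_(B `&` ball (0 : V) m%:R))).
- exact: intg_indicU.
- by move=> m; exact: ccvg_ball.
have -> : (0 : R) = \int[mu]_x (fun=> 0) (x : V) by rewrite Rintegral_cst// mul0r.
apply: (@Rdct _ _ _ _ _ _ (\1_B)); last 2 first.
- move=> x; have [Bx|nB] := pselect (B x); last first.
 rewrite (_ : (fun n => _) = fun=> 0); first exact: cvg_cst.
 by apply/funext => n; rewrite !indicE memNset// memNset ?subrr ?normr0// => -[].
 apply: cvg_near_cst; near=> m; rewrite !indicE mem_set// mem_set ?subrr ?normr0//.
 split => //; rewrite -ball_normE /ball_/= sub0r normrN; near: m.
 exact: nbhs_infty_gtr.
- move=> n x; rewrite normr_id !indicE.
 have [[Bx Qx]|nB] := pselect ((B `&` ball (0 : V) n%:R) x).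
 by rewrite !mem_set ?subrr ?normr0//; split.
 by rewrite (memNset nB) subr0 ger0_norm.
- move=> n; apply: mcomp => //; apply: mfunB => //.
 by apply: mindic; apply: measurableI => //; exact: measurable_ballrV.
- exact: intg_indicU.
Unshelve. all: end_near. Qed.

Lemma ccvgD f g : ccvg f -> ccvg g -> ccvg (fun x => f x + g x).
Proof.
move=> cf /(ccvgZ (-1)) /(ccvgB cf); congr ccvg.
by apply/funext => x; rewrite mulN1r opprK.
Qed.

Import HBSimple.

Lemma ccvg_sfun (s : {sfun V >-> R}) : intg mu (s : V -> R) -> ccvg s.
Proof.
move=> js.
have P0 : ccvg (fun=> 0).
 have f0 : (mu set0 < +oo)%E by rewrite measure0 ltry.
 have := ccvgZ 0 (ccvg_indic measurable0 f0).
 by congr ccvg; apply/funext => x; rewrite mul0r.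
have Py y : ccvg (fun x => y * \1_(s @^-1` [set y]) x).
 have [->|y0] := eqVneq y 0.
 by move: P0; congr ccvg; apply/funext => x; rewrite mul0r.
 have mA : measurable (s @^-1` [set y]) by exact: measurable_sfunP.
 apply: ccvgZ; apply: ccvg_indic => //.
 have : intg mu (\1_(s @^-1` [set y])).
 apply: (@intg_le _ _ _ _ _ (fun x => `|y|^-1 * `|s x|)); last exact/intgZ/intg_abs.
  exact: mindic.
 move=> x; rewrite indicE; have [/= xA|_] := boolP (x \in _); last first.
  by rewrite normr0 mulr_ge0 ?invr_ge0.
 by move: xA; rewrite inE/= => ->; rewrite mulVf ?normr1// normr_eq0.
 move/integrableP => [_]; under eq_integral do rewrite /= ger0_norm//.
 by rewrite integral_indic// setIT.
have E : (s : V -> R) = (fun x => \sum_(y <- finmap.enum_fset (fset_set (range s))) y * \1_(s @^-1` [set y]) x).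
 by apply/funext => x; rewrite fimfunE fsbig_finite.
rewrite E; elim: (finmap.enum_fset (fset_set (range s))) => [|y r IH].
 by move: P0; congr ccvg; apply/funext => x; rewrite big_nil.
have := ccvgD (Py y) IH; congr ccvg; apply/funext => x.
by rewrite big_cons.
Qed.

Lemma ccvg_intg f : intg mu f -> ccvg f.
Proof.
move=> jf; have [g_ [jg _ fg]] := approximation_sfun_integrable measurableT jf.
apply: (@ccvg_lim _ (fun n => g_ n : V -> R)) => //.
 by move=> n; apply: ccvg_sfun; exact: jg.
have jfg n : intg mu (fun x => f x - g_ n x) by apply: intgB => //; exact: jg.
have E n : (\int[mu]_x `|f x - g_ n x|)%:E = (\int[mu]_x `|(f x)%:E - (g_ n x)%:E|)%E.
 by rewrite /Rintegral fineK//; exact: integrable_fin_num (intg_abs (jfg n)).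
have : (fun n => (\int[mu]_x `|f x - g_ n x|)%:E) @ \oo --> 0%E.
 by under eq_fun do rewrite E.
by move/fine_cvg.
Qed.

(** For [f] truncated at height [K], the squared L^2 distance is at most [2 K] times the L^1
    distance, already known to vanish. The truncation error is controlled because mollification
    contracts L^2. *)
Lemma conv_L2cvg f : intg mu f -> L2 mu f -> L2cvg mu (fun k => conv k f) f.
Proof.
move=> jf Lf; have mf := L2_meas Lf.
pose t (K : nat) x := Num.max (- K%:R) (Num.min (f x) K%:R) : R.
have mt K : mfun (t K).
 by apply: measurable_maxr => //; exact: measurable_minr.
have tf K x : `|t K x| <= `|f x|.
 rewrite /t; have K0 : 0 <= K%:R :> R by [].
 have [fK|fK] := leP (f x) K%:R; last first.
 have f0 : 0 <= f x by rewrite (le_trans K0)// ltW.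
 rewrite (max_idPr _) ?(le_trans _ K0) ?oppr_le0// !ger0_norm// ltW//.
 have [fN|fN] := leP (- K%:R) (f x); first by [].
 rewrite normrN ger0_norm// ltr0_norm; first by rewrite lerNr ltW.
 by rewrite (lt_le_trans fN)// oppr_le0.
have tK K x : `|t K x| <= K%:R.
 rewrite ler_norml /t le_max lexx/= ge_max ge_min lexx orbT andbT.
 by rewrite (le_trans _ (ler0n _ K))// oppr_le0.
have jt K : intg mu (t K).
 by apply: (@intg_le _ _ _ _ _ (fun x => `|f x|)) => //; exact: intg_abs.
have Lt K : L2 mu (t K) by exact: L2_le Lf.
have tcvg : L2cvg mu t f.
 rewrite /L2cvg.
 have : (fun K => nr mu (fun x => t K x - f x) ^+ 2) @ \oo --> (0 : R).
 have -> : (0 : R) = \int[mu]_x (fun=> 0) (x : V) by rewrite Rintegral_cst// mul0r.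
 under eq_fun do rewrite nr_sqE.
 apply: (@Rdct _ _ _ _ _ _ (fun x => 4 * f x ^+ 2)); last 2 first.
 - move=> x; apply: cvg_near_cst; near=> K.
  have fK : `|f x| <= K%:R by near: K; exact: nbhs_infty_ger.
  move: fK; rewrite ler_norml => /andP[f1 f2].
  by rewrite /t (min_idPl f2) (max_idPr f1) subrr expr0n.
 - move=> K x; rewrite ger0_norm ?sqr_ge0// -real_normK ?num_real//.
  have h : `|t K x - f x| <= 2 * `|f x|.
  by rewrite (le_trans (ler_normB _ _))// mulr2n mulrDl mul1r lerD2r.
  rewrite (_ : 4 * f x ^+ 2 = (2 * `|f x|) ^+ 2).
  by rewrite lerXn2r ?nnegrE ?mulr_ge0.
  by rewrite exprMn real_normK ?num_real//; ring.
 - by move=> K; apply: measurable_funX; exact: mfunB.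
 - by apply: intgZ; case: Lf.
 move/cvgr0Pnorm_le => H; apply/cvgr0Pnorm_le => e e0.
 have := H (e ^+ 2) (exprn_gt0 2 e0); apply: filterS => K.
 have n0 := nr_ge0 mu (fun x => t K x - f x).
 rewrite (ger0_norm (sqr_ge0 _)) (ger0_norm n0) => h.
 by rewrite -ler_sqr ?nnegrE// ltW.
rewrite /L2cvg; apply/cvgr0Pnorm_le => e e0.
have e3 : 0 < e / 3 by rewrite divr_gt0.
move/cvgr0Pnorm_le : tcvg => /(_ _ e3)[K _ /(_ K (leqnn K)) hK].
rewrite ger0_norm ?nr_ge0// in hK.
have [_ ct] := ccvg_intg (jt K).
have : (fun k => (2 * K%:R) * \int[mu]_x `|conv k (t K) x - t K x|) @ \oo --> (0 : R).
 by rewrite -[X in _ --> X](mulr0 (2 * K%:R)); exact: cvgMr.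
move/cvgr0Pnorm_le => /(_ _ (exprn_gt0 2 e3)); apply: filterS => k hk.
rewrite ger0_norm ?nr_ge0//.
have [Lc cb] := L2_conv k jf Lf; have [Lct ctb] := L2_conv k (jt K) (Lt K).
have jd : intg mu (fun x => f x - t K x) by exact: intgB.
have Ld : L2 mu (fun x => f x - t K x) by exact: L2B.
have [Lcd cdb] := L2_conv k jd Ld.
have h2 : nr mu (fun x => conv k (t K) x - t K x) <= e / 3.
 rewrite -ler_sqr ?nnegrE ?nr_ge0//; last exact: ltW.
 apply: le_trans (le_trans (ler_norm _) hk).
 have ct1 x : `|conv k (t K) x| <= K%:R.
 apply: le_trans (conv_norm_le _ _ (jt K)) _.
 have -> : K%:R = \int[mu]_z (K%:R * moll k z).
  rewrite RintegralZl//; last exact: test_intg (test_moll k).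
  by rewrite Rint_moll mulr1.
 apply: Rint_le.
 - exact: intg_conv_argE (intg_abs (jt K)).
 - by apply: intgZ; exact: test_intg (test_moll k).
 - by move=> z; rewrite ler_wpM2r// moll_ge0.
 rewrite nr_sqE -RintegralZl//; last exact/intg_abs/intg_convB.
 apply: Rint_le.
 - by have [] := L2B Lct (Lt K).
 - by apply: intgZ; apply: intg_abs; exact: intg_convB.
 - move=> x; rewrite -real_normK ?num_real// expr2 ler_wpM2r//.
 by rewrite (le_trans (ler_normB _ _))// mulr2n mulrDl mul1r lerD.
have := nrD Lcd (L2B (L2B Lct (Lt K)) Ld).
rewrite (@eq_nr _ _ _ _ _ (fun x => conv k f x - f x)); last first.
 by move=> x /=; rewrite convB//; ring.
have := nrB (L2B Lct (Lt K)) Ld.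
have : nr mu (fun x => f x - t K x) <= e / 3 by rewrite nrBC.
move=> h3 h4 h5; have -> : e = e / 3 + (e / 3 + e / 3) by field.
apply: le_trans h5 _; apply: lerD; first exact: le_trans cdb h3.
by apply: le_trans h4 _; exact: lerD.
Unshelve. all: end_near. Qed.

End mollification_convergence.

(** * Composition with Lipschitz functions in L^2 *)

Section L2_composition.
Context {disp} {T : measurableType disp} {R : realType}.
Variable mu : {measure set T -> \bar R}.
Implicit Types (f g v : T -> R).

Lemma lipschitz_meas (b : R -> R) (L : R) :
 (forall x y, `|b x - b y| <= L * `|x - y|) -> mfun b.
Proof.
move=> bL; apply: continuous_measurable_fun => x; apply/cvgrPdist_le => e e0.
have L1 : 0 < `|L| + 1 by rewrite ltr_wpDl.
near=> y; rewrite (le_trans (bL x y))//.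
have : `|x - y| <= e / (`|L| + 1).
 by near: y; apply: cvgr_dist_le; [exact: cvg_id|rewrite divr_gt0].
rewrite ler_pdivlMr// => h; apply: le_trans h.
by rewrite mulrC ler_wpM2l// (le_trans (ler_norm _))// lerDl.
Unshelve. all: end_near. Qed.

Lemma nr_comp_le (b : R -> R) (L : R) f v : 0 <= L ->
 (forall x y, `|b x - b y| <= L * `|x - y|) -> L2 mu f -> L2 mu v ->
 nr mu (fun x => b (f x) - b (v x)) <= L * nr mu (fun x => f x - v x).
Proof.
move=> L0 bL Lf Lv; have mb := lipschitz_meas bL.
rewrite -[X in X * _](ger0_norm L0) -nrZ; last exact: L2B.
apply: nr_le; last 2 first.
- by apply: L2Z; exact: L2B.
- by move=> x; rewrite normrM (ger0_norm L0).
by apply: mfunB; apply: (mcomp mb); [exact: L2_meas Lf|exact: L2_meas Lv].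
Qed.

Lemma L2_comp (b : R -> R) (L : R) v : b 0 = 0 ->
 (forall x y, `|b x - b y| <= L * `|x - y|) -> L2 mu v -> L2 mu (b \o v).
Proof.
move=> b0 bL Lv; have mb := lipschitz_meas bL.
apply: (@L2_le _ _ _ _ _ (fun x => L * v x)); last exact: L2Z.
 by apply: (mcomp mb); exact: L2_meas Lv.
move=> x /=; have := bL (v x) 0; rewrite b0 !subr0 => /le_trans; apply.
by rewrite normrM ler_wpM2r// ler_norm.
Qed.

Lemma L2cvg_comp (b : R -> R) (L : R) (f_ : nat -> T -> R) v : 0 <= L ->
 (forall x y, `|b x - b y| <= L * `|x - y|) -> (forall n, L2 mu (f_ n)) -> L2 mu v ->
 L2cvg mu f_ v -> L2cvg mu (fun n => b \o f_ n) (b \o v).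
Proof.
move=> L0 bL Lf Lv fv.
have : (fun n => L * nr mu (fun x => f_ n x - v x)) @ \oo --> (0 : R).
 by rewrite -(mulr0 L); exact: cvgMr.
by apply: cvg0_le => n; rewrite ger0_norm ?nr_ge0//; exact: nr_comp_le.
Qed.

(** A product of two L^2 convergent factors need not converge in L^2. Here the squares of
    [b (f_ n) - b v] are bounded and vanish in L^2, so they vanish when integrated against the
    integrable weight [g^2]. *)
Lemma L2cvg_comp_mul (b : R -> R) (C L : R) (f_ : nat -> T -> R) v g : 0 <= L ->
 (forall x, `|b x| <= C) -> (forall x y, `|b x - b y| <= L * `|x - y|) ->
 (forall n, L2 mu (f_ n)) -> L2 mu v -> L2 mu g -> L2cvg mu f_ v ->
 L2cvg mu (fun n x => b (f_ n x) * g x) (fun x => b (v x) * g x).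
Proof.
move=> L0 bC bL Lf Lv Lg fv.
have mb := lipschitz_meas bL.
have C0 : 0 <= C by rewrite (le_trans _ (bC 0)).
have mbf n : mfun (fun x => b (f_ n x)).
 by apply: (mcomp mb); exact: (L2_meas (Lf n)).
have mbv : mfun (fun x => b (v x)).
 by apply: (mcomp mb); exact: L2_meas Lv.
pose k n x := (b (f_ n x) - b (v x)) ^+ 2.
have dC n x : `|b (f_ n x) - b (v x)| <= 2 * C.
 by rewrite (le_trans (ler_normB _ _))// mulr2n mulrDl mul1r lerD.
have kle n x : `|k n x| <= `|2 * C * L * (f_ n x - v x)|.
 rewrite /k normrX expr2 normrM (ger0_norm (_ : 0 <= 2 * C * L)) ?mulr_ge0//.
 by rewrite -(mulrA (2 * C)) ler_pM.
have mk n : mfun (k n) by apply: measurable_funX; exact: mfunB.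
have Lk n : L2 mu (k n) by apply: L2_le (kle n) _ => //; apply: L2Z; exact: L2B.
have k0 : L2cvg mu k (fun=> 0).
 have : (fun n => (2 * C * L) * nr mu (fun x => f_ n x - v x)) @ \oo --> (0 : R).
 by rewrite -[X in _ --> X](mulr0 (2 * C * L)); exact: cvgMr.
 apply: cvg0_le => n; rewrite ger0_norm ?nr_ge0//.
 rewrite (@eq_nr _ _ _ _ _ (k n)); last by move=> x; rewrite subr0.
 rewrite -[2 * C * L]ger0_norm ?mulr_ge0// -nrZ; last exact: L2B.
 by apply: nr_le => //; apply: L2Z; exact: L2B.
have jg : intg mu (fun x => g x ^+ 2) by case: Lg.
have k4 n x : 0 <= k n x <= 4 * C ^+ 2.
 rewrite /k sqr_ge0/= -real_normK ?num_real//.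
 rewrite (_ : 4 * C ^+ 2 = (2 * C) ^+ 2); last by ring.
 by rewrite lerXn2r// nnegrE mulr_ge0.
have H := bounded_L2cvg_weighted Lk k4 k0 jg (fun x => sqr_ge0 _).
have E n : nr mu (fun x => b (f_ n x) * g x - b (v x) * g x) =
 Num.sqrt (\int[mu]_x (k n x * g x ^+ 2)).
 rewrite /nr /ip; congr Num.sqrt; apply: eq_Rintegral => x _.
 by rewrite /k; ring.
rewrite /L2cvg; under eq_fun do rewrite E.
have H' : (fun n => Num.sqrt (\int[mu]_x (k n x * g x ^+ 2))) @ \oo --> Num.sqrt (0 : R).
 by apply: (cvg_comp _ _ H); exact: sqrt_continuous.
by rewrite sqrtr0 in H'.
Qed.

End L2_composition.

(** * Weak gradients and the fundamental lemma *)

Section weak_gradient.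
Context {R : realType} {d : nat}.
Notation V := 'rV[R]_d.
Notation mu := (@lebesgue_rV R d).
Notation e_ i := (delta_mx ord0 i : V).
Implicit Types (f g v : V -> R) (U : set V) (G : 'I_d -> V -> R) (phi : V -> R).

Definition wgrad U f G := forall phi, testf U phi -> forall i,
 \int[mu]_x (f x * 'D_(e_ i) phi x) = - \int[mu]_x (G i x * phi x).

(** Convolve with the indicator of a large ball: for small [x] the result is the constant
    [\int phi], and its derivative at 0 is minus the integral of the derivative of [phi]. *)
Lemma Rint_derive_test phi i : testf setT phi ->
 \int[mu]_x 'D_(e_ i) phi x = 0.
Proof.
move=> tphi; have [_ [K [cK _ K0]]] := tphi.
have [M [_ /(_ (M + 1))]] := compact_bounded cK.
rewrite ltrDl ltr01 => /(_ isT) KM.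
(* The support lies within [M + 1]; translating it by less than 1 keeps it in the ball, with one
   unit to spare. *)
pose B := ball (0 : V) (M + 3).
have mB : measurable B := measurable_ballrV _ _.
have jB : intg mu (\1_B : V -> R).
 by apply: intg_indicU => //; exact: lebesgue_rV_ball_fin.
have inB x y : ball (0 : V) 1 x -> K (y - x) -> B y.
 move=> bx /KM /= yx; move: bx; rewrite /B -!ball_normE /ball_/= !sub0r !normrN => x1.
 rewrite -(subrK x y) (le_lt_trans (ler_normD _ _))//.
 have -> : M + 3 = (M + 1) + 1 + 1 by ring.
 by rewrite -addrA; apply: ler_ltD => //; rewrite (lt_trans x1)// ltrDl.
have tD := test_derive i tphi.
have cvE (psi : V -> R) x : testf setT psi -> (forall x, ~ K x -> psi x = 0) ->
 ball (0 : V) 1 x -> convol (\1_B) psi x = \int[mu]_y psi y.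
 move=> tpsi psi0 bx; rewrite -(Rint_translation (- x)); last exact: test_meas tpsi.
 apply: eq_Rintegral => y _; have [Ky|nKy] := pselect (K (y - x)).
 by rewrite indicE mem_set ?mul1r//; exact: inB Ky.
 by rewrite psi0// mulr0.
have := is_derive_convol i 0 jB tphi; move=> [_ H].
have DK0 x : ~ K x -> 'D_(e_ i) phi x = 0.
 by apply: derive_off_closed => //; exact: compact_closed_rV.
have b0 : ball (0 : V) 1 0 by apply: ballxx.
rewrite -(cvE ('D_(e_ i) phi) 0)//.
rewrite -[LHS]opprK -H.
rewrite (@near_eq_derive _ _ _ _ (fun=> \int[mu]_y phi y)); first by rewrite derive_cst oppr0.
apply/nbhs_ballP; exists 1 => //= x bx; exact: cvE.
Qed.

Lemma test_wgrad U phi : testf U phi -> wgrad U phi (fun i => 'D_(e_ i) phi).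
Proof.
move=> tphi psi tpsi i; apply/eqP; rewrite -addr_eq0; apply/eqP.
have tphi' : testf setT phi by exact: test_subset tphi.
have tpsi' : testf setT psi by exact: test_subset tpsi.
have tM := testM (test_Cinf tphi) tpsi'.
have i1 : intg mu (fun x => phi x * 'D_(e_ i) psi x).
 by apply: (@test_intg _ _ setT); apply: testM (test_Cinf tphi) _; exact: test_derive.
have i2 : intg mu (fun x => 'D_(e_ i) phi x * psi x).
 by apply: (@test_intg _ _ setT); apply: testM tpsi'; exact: test_Cinf (test_derive i tphi).
rewrite -RintegralD// -[RHS](Rint_derive_test i tM).
apply: eq_Rintegral => x _.
have H := is_deriveM (test_is_derive i x tphi) (test_is_derive i x tpsi).
by have [_ ->] := H; rewrite /GRing.scale/=; congr (_ + _); rewrite mulrC.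
Qed.

Lemma Ck_shift k (phi : V -> R) x : Ck k phi -> Ck k (fun y => phi (y - x)).
Proof.
elim: k phi => [phi [cp _]|k IH phi /Ck_elim[cp dp pk]].
 split => // y; apply: (@cvg_comp _ _ _ (fun y : V => y - x) phi (nbhs y) (nbhs (y - x))); last exact: cp.
 by apply: cvgB => //; exact: cvg_cst.
apply: Ck_intro.
 move=> y; apply: (@cvg_comp _ _ _ (fun y : V => y - x) phi (nbhs y) (nbhs (y - x))); last exact: cp.
 by apply: cvgB => //; exact: cvg_cst.
move=> i; exists (fun y => 'D_(e_ i) phi (y - x)); last exact: (IH _ (pk i)).
move=> y; have [d1 d2] := dp i (y - x).
have E : (fun h : R => h^-1 *: (((fun y => phi (y - x)) \o shift y) (h *: e_ i) - phi (y - x)))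
  = (fun h => h^-1 *: ((phi \o shift (y - x)) (h *: e_ i) - phi (y - x))).
 by apply/funext => h /=; rewrite addrA.
by split; [rewrite /derivable E|rewrite /derive E].
Qed.

Lemma derive_shift_rV (phi : V -> R) x i y : 'D_(e_ i) (fun y => phi (y - x)) y = 'D_(e_ i) phi (y - x).
Proof.
rewrite /derive.
have -> : (fun h : R => h^-1 *: (((fun y => phi (y - x)) \o shift y) (h *: e_ i) - phi (y - x)))
  = (fun h => h^-1 *: ((phi \o shift (y - x)) (h *: e_ i) - phi (y - x))).
 by apply/funext => h /=; rewrite addrA.
by [].
Qed.

(** The factor 2 puts the closed cube of half side [1/(k+1)] around [x], which carries the shifted
    mollifier, inside [U]. *)
Definition inner_at (U : set V) (k : nat) : set V := [set x | ball x (2 * k.+1%:R^-1) `<=` U].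

Lemma test_moll_shift U k x : inner_at U k x -> testf U (fun y => moll k (y - x)).
Proof.
move=> Ux; split; first by move=> n; apply: Ck_shift; exact: test_Cinf (test_moll k) n.
exists [set y : V | forall i, `[x ord0 i - k.+1%:R^-1, x ord0 i + k.+1%:R^-1]%classic (y ord0 i)].
have k0 : 0 < k.+1%:R^-1 :> R by rewrite invr_gt0.
split.
- have H := @rV_compact R d (fun i => `[x ord0 i - k.+1%:R^-1, x ord0 i + k.+1%:R^-1]%classic)
 (fun _ => @segment_compact _ _ _).
 exact: H.
- move=> y H; apply: Ux; split; first by rewrite mulr_gt0.
 move=> i j; rewrite (ord1 i); have := H j; rewrite /= in_itv/= => /andP[h1 h2].
 rewrite /ball/= ltr_norml; move: h1 h2; set r := k.+1%:R^-1 in k0 *.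
 by move=> h1 h2; apply/andP; split; lra.
- move=> y H; apply: moll_off => -[_ h]; apply: H => i.
 have := h ord0 i; rewrite !mxE /ball/= sub0r normrN ltr_norml => /andP[h1 h2].
 move: h1 h2; set t := k.+1%:R^-1 => h1 h2.
 by rewrite in_itv/=; apply/andP; split; lra.
Qed.

Lemma derive_conv U f G k i x : intg mu f -> intg mu (G i) -> wgrad U f G ->
 inner_at U k x -> is_derive x (e_ i) (conv k f) (conv k (G i) x).
Proof.
move=> jf jG wG Ux.
have H := is_derive_convol i x jf (test_moll k).
apply: is_derive_conv H _.
have E : convol f ('D_(e_ i) (moll k)) x =
 \int[mu]_y (f y * 'D_(e_ i) (fun y => moll k (y - x)) y).
 by apply: eq_Rintegral => y _; rewrite derive_shift_rV.
by rewrite E (wG _ (test_moll_shift Ux)) opprK.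
Qed.

Lemma near_inner_at U x : open U -> U x -> \forall k \near \oo, inner_at U k x.
Proof.
move=> oU Ux.
have /nbhs_ballP[r /= r0 rU] : nbhs x U by exact: open_nbhs_nbhs.
have r2 : 0 < r / 2 by rewrite divr_gt0.
near=> k; apply: subset_trans rU; apply: le_ball.
rewrite mulrC -ler_pdivlMr//; apply: ltW.
by near: k; exact: (near_infty_natSinv_lt (PosNum r2)).
Unshelve. all: end_near. Qed.

Lemma near_inner_at_compact U (K : set V) : open U -> compact K -> K `<=` U ->
 \forall k \near \oo, K `<=` inner_at U k.
Proof.
move=> oU /compact_near_coveringP cK KU; apply: cK => x /KU Ux.
have /nbhs_ballP[r /= r0 rU] : nbhs x U by exact: open_nbhs_nbhs.
have r2 : 0 < r / 2 by rewrite divr_gt0.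
have r4 : 0 < r / 2 / 2 by rewrite divr_gt0.
near=> y k => z bz; apply: rU.
have by2 : ball x (r / 2) y by near: y; exact: nbhsx_ballx.
have bz2 : ball y (r / 2) z.
 apply: le_ball bz; rewrite mulrC -ler_pdivlMr//; apply: ltW => /=.
 by near: k; exact: (near_infty_natSinv_lt (PosNum r4)).
rewrite [r]splitr; exact: ball_triangle by2 bz2.
Unshelve. all: end_near. Qed.

(** Mollifications of [g] vanish at inner points, so [min(|conv g - g|, |g| \1_U)] tends pointwise
    to [|g| \1_U], which also dominates it. Its integral tends to 0 by L^1 convergence; the minimum
    makes it unnecessary to extract an a.e. convergent subsequence. *)
Lemma weak_zero_ae U g : open U -> intg mu g ->
 (forall phi, testf U phi -> \int[mu]_x (g x * phi x) = 0) ->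
 {ae mu, forall x, U x -> g x = 0}.
Proof.
move=> oU jg H; have mU := open_meas oU; have mg := intg_meas jg.
pose g1 x := `|g x| * \1_U x.
have m1 : mfun g1.
 by apply: mfunM; [exact: mcomp|exact: mindic].
have j1 : intg mu g1.
 apply: (@intg_le _ _ _ _ _ (fun x => `|g x|)) => //; last exact: intg_abs.
 move=> x; rewrite normrM normr_id ler_piMr// indicE.
 by case: (_ \in _); rewrite ?normr1 ?normr0.
have c0 k x : inner_at U k x -> conv k g x = 0.
 by move=> /test_moll_shift /H.
pose h k x := Num.min `|conv k g x - g x| (g1 x).
have mh k : mfun (h k).
 apply: measurable_minr => //; apply: mcomp => //.
 by apply: mfunB => //; exact: conv_meas.
have h0 k x : 0 <= h k x by rewrite le_min normr_ge0 mulr_ge0.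
have hcvg : (fun k => \int[mu]_x h k x) @ \oo --> \int[mu]_x g1 x.
 apply: (@Rdct _ _ _ _ _ _ g1) => //; last first.
 by move=> k x; rewrite ger0_norm// ge_min lexx orbT.
 move=> x; have [Ux|nUx] := pselect (U x).
 apply: cvg_near_cst; near=> k; rewrite /h c0; last first.
  by near: k; exact: near_inner_at.
 by rewrite sub0r normrN /g1 indicE mem_set// mulr1 minxx.
 apply: cvg_near_cst; near=> k.
 by rewrite /h /g1 indicE memNset// mulr0; apply/min_idPr.
have hcvg0 : (fun k => \int[mu]_x h k x) @ \oo --> (0 : R).
 have [_ +] := ccvg_intg jg; apply: cvg0_le => k.
 rewrite ger0_norm; last exact: Rint_ge0.
 apply: Rint_lem => //; first exact/intg_abs/intg_convB.
 by move=> x; rewrite h0/= ge_min lexx.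
have g10 : \int[mu]_x g1 x = 0 by exact: (cvg_unique _ hcvg hcvg0).
have := Rint_eq0_ae j1 (fun x => mulr_ge0 (normr_ge0 _) (ler0n _ _)) g10.
apply: filterS => x g1x Ux; move: g1x; rewrite /g1 indicE mem_set// mulr1.
by move=> /eqP; rewrite normr_eq0 => /eqP.
Unshelve. all: end_near. Qed.

End weak_gradient.

(** * Pairs of a function in H^1_0 and its gradient *)

Section pairs.
Context {R : realType} {d : nat}.
Notation V := 'rV[R]_d.
Notation mu := (@lebesgue_rV R d).
Notation e_ i := (delta_mx ord0 i : V).
Variable U : set V.
Hypothesis oU : open U.
Implicit Types (f g v w : V -> R) (G F : 'I_d -> V -> R) (phi : V -> R).

Definition approx_by (p : nat -> V -> R) v G :=
 [/\ forall n, testf U (p n), L2cvg mu p v &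
  forall i, L2cvg mu (fun n => 'D_(e_ i) (p n)) (G i)].

(* [v] lies in the closure of the test functions for the H^1 norm, with gradient [G]. *)
Definition h10p v G :=
 [/\ L2 mu v, forall i, L2 mu (G i) & exists p, approx_by p v G].

Lemma test_derive_L2 phi i : testf U phi -> L2 mu ('D_(e_ i) phi).
Proof. by move=> /(test_derive i) /test_L2. Qed.

Lemma L2cvg_cst v : L2cvg mu (fun=> v) v.
Proof.
rewrite /L2cvg (_ : (fun=> _) = fun=> 0); first exact: cvg_cst.
by apply/funext => n; rewrite -[RHS](@nr0 _ V R mu); apply: eq_nr => x; rewrite subrr.
Qed.

Lemma L2cvg_ext (f_ g_ : nat -> V -> R) f g : (forall n x, f_ n x = g_ n x) -> f =1 g ->
 L2cvg mu f_ f -> L2cvg mu g_ g.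
Proof.
move=> fg /funext <-; rewrite (_ : g_ = f_)//.
by apply/funext => n; apply/funext => x; rewrite fg.
Qed.

Lemma L2cvg_shift N (f_ : nat -> V -> R) f : L2cvg mu f_ f -> L2cvg mu (fun n => f_ (n + N)%N) f.
Proof. by move=> H; apply: (cvg_comp _ _ (@cvg_addnr N) H). Qed.

Lemma h10p_test phi : testf U phi -> h10p phi (fun i => 'D_(e_ i) phi).
Proof.
move=> tphi; split; first exact: test_L2 tphi.
 by move=> i; exact: test_derive_L2.
by exists (fun=> phi); split => // [|i]; exact: L2cvg_cst.
Qed.

Lemma h10pD v w G F : h10p v G -> h10p w F ->
 h10p (fun x => v x + w x) (fun i x => G i x + F i x).
Proof.
move=> [Lv LG [p [tp pv pG]]] [Lw LF [q [tq qw qF]]]; split.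
- exact: L2D.
- by move=> i; exact: L2D.
exists (fun n x => p n x + q n x); split.
- by move=> n; exact: testD.
- by apply: L2cvgD => // n; exact: test_L2.
move=> i; rewrite (_ : (fun n => _) = (fun n x => 'D_(e_ i) (p n) x + 'D_(e_ i) (q n) x)).
 by apply: L2cvgD => // n; exact: test_derive_L2.
apply/funext => n; apply/funext => x.
have := is_deriveD (test_is_derive i x (tp n)) (test_is_derive i x (tq n)).
by case.
Qed.

Lemma h10pZ a v G : h10p v G -> h10p (fun x => a * v x) (fun i x => a * G i x).
Proof.
move=> [Lv LG [p [tp pv pG]]]; split.
- exact: L2Z.
- by move=> i; exact: L2Z.
exists (fun n x => a * p n x); split.
- by move=> n; exact: testZ.
- by apply: L2cvgZ => // n; exact: test_L2.
move=> i; rewrite (_ : (fun n => _) = (fun n x => a * 'D_(e_ i) (p n) x)).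
 by apply: L2cvgZ => // n; exact: test_derive_L2.
apply/funext => n; apply/funext => x.
by have := is_deriveZ a (test_is_derive i x (tp n)); case.
Qed.

Lemma h10pB v w G F : h10p v G -> h10p w F ->
 h10p (fun x => v x - w x) (fun i x => G i x - F i x).
Proof.
move=> pv /(h10pZ (-1)) /(h10pD pv).
by congr h10p; [apply/funext => x|apply/funext => i; apply/funext => x]; rewrite mulN1r.
Qed.

Lemma h10p0 : h10p (fun=> 0) (fun=> fun=> 0).
Proof.
have := h10pZ 0 (h10p_test (test0 U)).
by congr h10p; [apply/funext => x|apply/funext => i; apply/funext => x]; rewrite mul0r.
Qed.

Lemma L2_sum_dist_lim (p : nat -> V -> R) v G :
 (forall k : nat, nr mu (fun x => p k x - v x) <= k.+1%:R^-1 /\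
 forall i, nr mu (fun x => 'D_(e_ i) (p k) x - G i x) <= k.+1%:R^-1) ->
 L2cvg mu p v /\ forall i, L2cvg mu (fun k => 'D_(e_ i) (p k)) (G i).
Proof.
have c0 : (fun k : nat => k.+1%:R^-1) @ \oo --> (0 : R) by exact: cvg_harmonic.
move=> H; split => [|i]; apply: cvg0_le c0 => k; rewrite ger0_norm ?nr_ge0//.
 by have [] := H k.
by have [_] := H k.
Qed.

Lemma h10p_near v G : h10p v G -> forall e : R, 0 < e ->
 exists2 phi, testf U phi &
 nr mu (fun x => phi x - v x) <= e /\
 forall i, nr mu (fun x => 'D_(e_ i) phi x - G i x) <= e.
Proof.
move=> [Lv LG [p [tp pv pG]]] e e0.
have H1 : \forall n \near \oo, nr mu (fun x => p n x - v x) <= e.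
 move/cvgr0Pnorm_le : pv => /(_ _ e0); apply: filterS => n; exact/le_trans/ler_norm.
have H2 : \forall n \near \oo, forall i, nr mu (fun x => 'D_(e_ i) (p n) x - G i x) <= e.
 apply: filter_forall => i.
 by move/cvgr0Pnorm_le : (pG i) => /(_ _ e0); apply: filterS => n; exact/le_trans/ler_norm.
have [n _ /(_ n (leqnn n)) [h1 h2]] := filterI H1 H2.
by exists (p n).
Qed.

(** A diagonal choice: within [1/(2(k+1))] of a late enough pair, itself that close to the limit,
    there is a test function. *)
Lemma h10p_lim (v_ : nat -> V -> R) (G_ : nat -> 'I_d -> V -> R) v G :
 (forall n, h10p (v_ n) (G_ n)) -> L2 mu v -> (forall i, L2 mu (G i)) ->
 L2cvg mu v_ v -> (forall i, L2cvg mu (fun n => G_ n i) (G i)) -> h10p v G.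
Proof.
move=> Pn Lv LG vv GG; split => //.
have k0 (k : nat) : 0 < k.+1%:R^-1 / 2 :> R by rewrite divr_gt0 ?invr_gt0.
have /choice[p Hp] : forall k : nat, exists phi, testf U phi /\
 (nr mu (fun x => phi x - v x) <= k.+1%:R^-1 /\
 forall i, nr mu (fun x => 'D_(e_ i) phi x - G i x) <= k.+1%:R^-1).
 move=> k.
 have H1 : \forall n \near \oo, nr mu (fun x => v_ n x - v x) <= k.+1%:R^-1 / 2.
 move/cvgr0Pnorm_le : vv => /(_ _ (k0 k)); apply: filterS => n; exact/le_trans/ler_norm.
 have H2 : \forall n \near \oo, forall i, nr mu (fun x => G_ n i x - G i x) <= k.+1%:R^-1 / 2.
 apply: filter_forall => i.
 by move/cvgr0Pnorm_le : (GG i) => /(_ _ (k0 k)); apply: filterS => n; exact/le_trans/ler_norm.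
 have [n _ /(_ n (leqnn n)) [h1 h2]] := filterI H1 H2.
 have [Lvn LGn _] := Pn n.
 have [phi tphi [h3 h4]] := h10p_near (Pn n) (k0 k).
 exists phi; split => //; split => [|i].
 apply: le_trans (nr_triB (test_L2 tphi) Lvn Lv) _.
 by rewrite [leRHS]splitr lerD.
 apply: le_trans (nr_triB (test_derive_L2 i tphi) (LGn i) (LG i)) _.
 by rewrite [leRHS]splitr lerD.
have [c1 c2] := L2_sum_dist_lim (fun k => (Hp k).2).
by exists p; split => // n; exact: (Hp n).1.
Qed.

Lemma h10p_wgrad v G : h10p v G -> wgrad U v G.
Proof.
move=> [Lv LG [p [tp pv pG]]] phi tphi i.
have Lphi := test_L2 tphi; have LD := test_derive_L2 i tphi.
have c1 : (fun n => ip mu (p n) ('D_(e_ i) phi)) @ \oo --> ip mu v ('D_(e_ i) phi).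
 by apply: L2cvg_ip => // n; exact: test_L2.
have c2 : (fun n => - ip mu ('D_(e_ i) (p n)) phi) @ \oo --> - ip mu (G i) phi.
 by apply: cvgN; apply: L2cvg_ip => // n; exact: test_derive_L2.
have E n : ip mu (p n) ('D_(e_ i) phi) = - ip mu ('D_(e_ i) (p n)) phi.
 exact: (test_wgrad (tp n)).
have E' : (fun n => ip mu (p n) ('D_(e_ i) phi)) =
   (fun n => - ip mu ('D_(e_ i) (p n)) phi) by exact/funext.
by rewrite E' in c1; exact: (cvg_unique _ c1 c2).
Qed.

Lemma h10p_off v G : measurable U -> h10p v G ->
 {ae mu, forall x, ~ U x -> v x = 0}.
Proof.
move=> mU [Lv LG [p [tp pv pG]]].
have mI : mfun (\1_(~` U) : V -> R).
 by apply: mindic; exact: measurableC.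
have I1 x : `|\1_(~` U) x : R| <= 1 by rewrite indicE; case: (_ \in _); rewrite ?normr1 ?normr0.
have := L2cvg_bmul mI I1 (fun n => test_L2 (tp n)) Lv pv.
have -> : (fun n x => \1_(~` U) x * p n x) = (fun=> fun=> 0).
 apply/funext => n; apply/funext => x; rewrite indicE.
 have [Ux|nUx] := pselect (U x); first by rewrite memNset ?mul0r//; exact.
 by rewrite (test_off (tp n))// mulr0.
have Lw : L2 mu (fun x => \1_(~` U) x * v x) by exact: L2_bmul I1 Lv.
move=> c0.
have c1 : (fun=> nr mu (fun x => 0 - \1_(~` U) x * v x)) @ \oo -->
 nr mu (fun x => 0 - \1_(~` U) x * v x) by exact: cvg_cst.
have : nr mu (fun x => 0 - \1_(~` U) x * v x) = 0 by exact: (cvg_unique _ c1 c0).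
rewrite nrBC (@eq_nr _ _ _ _ _ (fun x => \1_(~` U) x * v x)); last by move=> x; rewrite subr0.
move=> /(nr_eq0_ae Lw); apply: filterS => x + nUx.
by rewrite indicE mem_set// mul1r.
Qed.

Lemma h10p_ae v w G F : mfun w -> (forall i, mfun (F i)) ->
 {ae mu, forall x, v x = w x} -> (forall i, {ae mu, forall x, G i x = F i x}) ->
 h10p v G -> h10p w F.
Proof.
move=> mw mF vw GF [Lv LG [p [tp pv pG]]].
have Lw := ae_eq_L2 mw vw Lv; have LF i := ae_eq_L2 (mF i) (GF i) (LG i).
split => //; exists p; split => //.
- rewrite /L2cvg (_ : (fun n => _) = (fun n => nr mu (fun x => p n x - v x)))//.
 apply/funext => n; apply: ae_eq_nr.
 + by apply: mfunB; [exact: test_meas (tp n)|].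
 + by apply: mfunB; [exact: test_meas (tp n)|exact: L2_meas Lv].
 + by apply: filterS vw => x ->.
- move=> i; rewrite /L2cvg (_ : (fun n => _) =
 (fun n => nr mu (fun x => 'D_(e_ i) (p n) x - G i x))); last first.
 apply/funext => n; have tD := test_derive i (tp n); apply: ae_eq_nr.
 + by apply: mfunB; [exact: test_meas tD|].
 + by apply: mfunB; [exact: test_meas tD|exact: L2_meas (LG i)].
 + by apply: filterS (GF i) => x ->.
 exact: pG.
Qed.

Lemma derive_comp_test (b b' : R -> R) phi i x :
 (forall y : R, is_derive y 1 b (b' y)) -> testf U phi ->
 'D_(e_ i) (b \o phi) x = b' (phi x) * 'D_(e_ i) phi x.
Proof.
by move=> db tphi; have [] := is_derive_comp1 (db (phi x)) (test_is_derive i x tphi).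
Qed.

Section composition.
Variables (b b' : R -> R) (C L : R).
Hypotheses (sb : smooth b)
 (b0 : b 0 = 0)
 (db : forall y : R, is_derive y 1 b (b' y))
 (b'C : forall y, `|b' y| <= C)
 (L0 : 0 <= L)
 (b'L : forall x y, `|b' x - b' y| <= L * `|x - y|).

Let bC := derive_lipschitz db b'C.

Lemma approx_comp p v G : L2 mu v -> (forall i, L2 mu (G i)) -> approx_by p v G ->
 approx_by (fun n => b \o p n) (b \o v) (fun i x => b' (v x) * G i x).
Proof.
move=> Lv LG [tp pv pG].
have C0 : 0 <= C by rewrite (le_trans _ (b'C 0)).
have mb' := lipschitz_meas b'L.
split.
- by move=> n; exact: test_comp.
- apply: L2cvg_comp bC _ Lv pv => // n; exact: test_L2.
move=> i.
(* Two different reasons for convergence: in the first term [b'] is bounded and the gradients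
   converge, in the second [G] is fixed and [L2cvg_comp_mul] applies. *)
rewrite (_ : (fun n => _) = (fun n x => b' (p n x) * ('D_(e_ i) (p n) x - G i x) + b' (p n x) * G i x)); last first.
 apply/funext => n; apply/funext => x; rewrite (derive_comp_test _ _ db)//.
 by rewrite -mulrDr subrK.
have mp n : mfun (fun x => b' (p n x)).
 by apply: (mcomp mb'); exact: test_meas (tp n).
have mb'v : mfun (fun x => b' (v x)).
 by apply: (mcomp mb'); exact: L2_meas Lv.
have LpG n : L2 mu (fun x => 'D_(e_ i) (p n) x - G i x).
 by apply: L2B => //; exact: test_derive_L2.
rewrite (_ : (fun x => b' (v x) * G i x) = (fun x => 0 + b' (v x) * G i x)); last first.
 by apply/funext => x; rewrite add0r.
apply: L2cvgD => //.
- by move=> n; exact: L2_bmul (LpG n).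
- exact: L2_0.
- by move=> n; exact: L2_bmul (LG i).
- exact: L2_bmul (LG i).
- have : (fun n => C * nr mu (fun x => 'D_(e_ i) (p n) x - G i x)) @ \oo --> (0 : R).
 by rewrite -(mulr0 C); apply: cvgMr; exact: pG.
 apply: cvg0_le => n; rewrite ger0_norm ?nr_ge0//.
 rewrite -[X in X * _](ger0_norm C0) -nrZ//.
 apply: nr_le; last 2 first.
 + exact: L2Z.
 + by move=> x; rewrite subr0 !normrM (ger0_norm C0) ler_wpM2r.
 by apply: mfunB => //; apply: mfunM => //; exact: L2_meas (LpG n).
- by apply: (L2cvg_comp_mul L0 b'C b'L) => // n; exact: test_L2.
Qed.

Lemma h10p_comp v G : h10p v G ->
 h10p (b \o v) (fun i x => b' (v x) * G i x).
Proof.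
move=> [Lv LG [p ap]]; split; first exact: L2_comp bC Lv.
 move=> i; apply: (L2_bmul _ (fun x => b'C _) (LG i)).
 by apply: (mcomp (lipschitz_meas b'L)); exact: L2_meas Lv.
by exists (fun n => b \o p n); exact: approx_comp.
Qed.

Section multiplier.
Variables (rho : V -> R) (Grho : 'I_d -> V -> R) (Mr : R).
Hypotheses (Lrho : L2 mu rho)
 (jrho : intg mu rho)
 (rhoM : forall x, `|rho x| <= Mr)
 (LGrho : forall i, L2 mu (Grho i))
 (jGrho : forall i, intg mu (Grho i))
 (wrho : wgrad U rho Grho).

(** [rho] need not vanish at the boundary and has a weak gradient in [U] only. Once mollified it is
    smooth, with the mollified gradient as its derivative at inner points, and the compact support
    of [phi] consists of inner points as soon as the mollifier is narrow enough. *)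
Lemma h10p_mul_test phi : testf U phi ->
 h10p (fun x => rho x * phi x)
   (fun i x => rho x * 'D_(e_ i) phi x + phi x * Grho i x).
Proof.
move=> tphi; have [_ [K [cK KU K0]]] := tphi.
have [Cp phiC] := test_bounded tphi.
have mphi := test_meas tphi.
have mD i := test_meas (test_derive i tphi).
have DC i := test_bounded (test_derive i tphi).
have LrD i : L2 mu (fun x => rho x * 'D_(e_ i) phi x).
 have [Ci DCi] := DC i.
 by under eq_fun do rewrite mulrC; exact: L2_bmul (DCi) Lrho.
have LpG i : L2 mu (fun x => phi x * Grho i x) by exact: L2_bmul phiC (LGrho i).
split.
- by under eq_fun do rewrite mulrC; exact: L2_bmul phiC Lrho.
- by move=> i; exact: L2D.
(* From the index [N] on, the support of [phi] consists of inner points; the approximating sequence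
   is shifted to start there. *)
have [N _ HN] := near_inner_at_compact oU cK KU.
exists (fun n x => conv (n + N) rho x * phi x).
have cD n i x : 'D_(e_ i) (fun x => conv (n + N) rho x * phi x) x =
 'D_(e_ i) phi x * conv (n + N) rho x + phi x * conv (n + N) (Grho i) x.
 have [Kx|nKx] := pselect (K x); last first.
 have cKl := compact_closed_rV cK.
 have E1 : 'D_(e_ i) phi x = 0 by apply: derive_off_closed cKl _ _.
 have E2 : 'D_(e_ i) (fun x => conv (n + N) rho x * phi x) x = 0.
  by apply: derive_off_closed cKl _ _ => // y /K0 ->; rewrite mulr0.
 by rewrite E2 E1 K0// !mul0r addr0.
 have Ux : inner_at U (n + N) x by apply: (HN (n + N)%N) => //=; exact: leq_addl.
 have H := is_deriveM (derive_conv jrho (jGrho i) wrho Ux) (test_is_derive i x tphi).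
 have [_ E] := H; apply: (etrans E).
 by rewrite [in RHS]mulrC.
have shiftcvg (f : V -> R) : intg mu f -> L2 mu f -> L2cvg mu (fun n => conv (n + N) f) f.
 by move=> jf Lf; exact: (L2cvg_shift N (conv_L2cvg jf Lf)).
have Lc (f : V -> R) n : intg mu f -> L2 mu f -> L2 mu (conv (n + N) f).
 by move=> jf Lf; have [] := L2_conv (n + N) jf Lf.
split.
- by move=> n; apply: testM => //; exact: conv_Cinf.
- apply: (@L2cvg_ext (fun n x => phi x * conv (n + N) rho x) _ (fun x => phi x * rho x)).
 + by move=> n x; rewrite mulrC.
 + by move=> x; rewrite mulrC.
 by apply: L2cvg_bmul phiC _ Lrho _ => //; [move=> n; exact: Lc|exact: shiftcvg].
move=> i; rewrite (_ : (fun n => _) = (fun n x =>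
 'D_(e_ i) phi x * conv (n + N) rho x + phi x * conv (n + N) (Grho i) x)); last first.
 by apply/funext => n; apply/funext => x; exact: cD.
have [Ci DCi] := DC i.
apply: L2cvgD => //.
- by move=> n; apply: L2_bmul DCi _ => //; exact: Lc.
- by move=> n; apply: L2_bmul phiC _ => //; exact: Lc.
- apply: (@L2cvg_ext (fun n x => 'D_(e_ i) phi x * conv (n + N) rho x) _ (fun x => 'D_(e_ i) phi x * rho x)) => //.
 + by move=> x; rewrite mulrC.
 by apply: L2cvg_bmul DCi _ Lrho _ => //; [move=> n; exact: Lc|exact: shiftcvg].
- by apply: L2cvg_bmul phiC _ (LGrho i) _ => //; [move=> n; exact: Lc|exact: shiftcvg].
Qed.

(** First for the test functions [b \o p n], then in the limit. The bound on [b] keeps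
    [b (v x) * Grho i x] square integrable, [Grho] being only in L^2. *)
Lemma h10p_mul_comp (B : R) v G : (forall y, `|b y| <= B) -> h10p v G ->
 h10p (fun x => rho x * b (v x))
   (fun i x => rho x * (b' (v x) * G i x) + b (v x) * Grho i x).
Proof.
move=> bB Pv.
have C0 : 0 <= C by rewrite (le_trans _ (b'C 0)).
have mb := lipschitz_meas bC.
have [Lv LG [p ap]] := Pv.
have [Lbv LbG _] := h10p_comp Pv.
have mrho := L2_meas Lrho.
have [tb cbp cbD] := approx_comp Lv LG ap.
have [tp pv pG] := ap.
have mbf f : mfun f -> mfun (fun x => b (f x)).
 by move=> mf; apply: (mcomp mb).
have mv := L2_meas Lv.
apply: (h10p_lim (fun n => h10p_mul_test (tb n))).
- exact: L2_bmul rhoM Lbv.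
- move=> i; apply: L2D; first exact: L2_bmul rhoM (LbG i).
 by apply: (L2_bmul _ (fun x => bB _) (LGrho i)); exact: mbf.
- by apply: L2cvg_bmul rhoM _ Lbv cbp => // n; exact: test_L2 (tb n).
move=> i; apply: L2cvgD.
- by move=> n; apply: L2_bmul rhoM _ => //; exact: test_derive_L2 (tb n).
- exact: L2_bmul rhoM (LbG i).
- move=> n; apply: (L2_bmul _ (fun x => bB _) (LGrho i)).
 by apply: mbf; exact: test_meas (tp n).
- by apply: (L2_bmul _ (fun x => bB _) (LGrho i)); exact: mbf.
- by apply: L2cvg_bmul rhoM _ (LbG i) (cbD i) => // n; exact: test_derive_L2 (tb n).
- by apply: (L2cvg_comp_mul C0 bB bC) => // n; exact: test_L2.
Qed.

End multiplier.

End composition.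

End pairs.

(** * Hoelder's inequality for several factors *)

Section generalized_hoelder.
Context {R : realType}.
Open Scope ereal_scope.

Lemma prod_powR (I : Type) (s : seq I) (y : I -> R) e : (forall i, (0 <= y i)%R) ->
 ((\prod_(i <- s) y i) `^ e = \prod_(i <- s) (y i) `^ e)%R.
Proof.
move=> y0; elim: s => [|i s IH]; first by rewrite !big_nil powR1.
by rewrite !big_cons powRM ?IH// prodr_ge0.
Qed.

Lemma powR_AGM n (y : 'I_n.+1 -> R) : (forall i, (0 <= y i)%R) ->
 (\prod_i (y i) `^ (n.+1%:R^-1) <= n.+1%:R^-1 * \sum_i y i)%R.
Proof.
move=> y0.
have [+ _] := @leif_AGM R _ (mem 'I_n.+1) y (fun i _ => y0 i).
rewrite card_ord => H.
rewrite -prod_powR// mulrC.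
have m0 : (0 <= (\sum_i y i) / n.+1%:R)%R.
 by apply: divr_ge0 => //; apply: sumr_ge0 => i _; exact: y0.
have -> : ((\sum_i y i) / n.+1%:R = (((\sum_i y i) / n.+1%:R) ^+ n.+1) `^ (n.+1%:R^-1))%R.
 by rewrite -powR_mulrn// -powRrM mulfV// powRr1.
apply: ge0_ler_powR => //; rewrite ?invr_ge0// nnegrE ?exprn_ge0//.
by apply: prodr_ge0 => i _; exact: y0.
Qed.

Lemma sume_pinfty (I : finType) (y : I -> \bar R) i : (forall i, 0 <= y i) -> y i = +oo ->
 \sum_i y i = +oo.
Proof.
move=> y0 yi; rewrite (bigD1 i)//= yi addye// gt_eqF//.
by rewrite (lt_le_trans (ltNyr 0))// sume_ge0.
Qed.

Lemma poweR_AGM n (y : 'I_n.+1 -> \bar R) : (forall i, 0 <= y i) ->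
 \prod_i (y i) `^ (n.+1%:R^-1) <= (n.+1%:R^-1)%:E * \sum_i y i.
Proof.
move=> y0.
have e0 : (0 < n.+1%:R^-1 :> R)%R by rewrite invr_gt0.
have [[i yi]|H] := pselect (exists i, y i = +oo).
 by rewrite (sume_pinfty y0 yi) gt0_muley ?lte_fin// leey.
have yE i : y i = (fine (y i))%:E.
 rewrite fineK// ge0_fin_numE// ltey; apply/eqP => yi; apply: H; by exists i.
under eq_bigr do rewrite yE poweR_EFin.
under [in leRHS]eq_bigr do rewrite yE.
by rewrite prodEFin sumEFin -EFinM lee_fin powR_AGM// => i; exact: fine_ge0.
Qed.

Lemma prode_gt0 (I : finType) (P : pred I) (y : I -> \bar R) : (forall i, 0 < y i) -> 0 < \prod_(i | P i) y i.
Proof.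
move=> y0; apply: (big_ind (fun z => 0 < z)) => //.
by move=> a b; exact: mule_gt0.
Qed.

Lemma prode_ge0' (I : finType) (P : pred I) (y : I -> \bar R) : (forall i, 0 <= y i) -> 0 <= \prod_(i | P i) y i.
Proof.
move=> y0; apply: (big_ind (fun z => 0 <= z)) => //.
by move=> a b; exact: mule_ge0.
Qed.

Lemma prode_le (I : finType) (y z : I -> \bar R) : (forall i, 0 <= y i) -> (forall i, y i <= z i) ->
 \prod_i y i <= \prod_i z i.
Proof.
move=> y0 yz; have H : (0 <= \prod_i y i) /\ \prod_i y i <= \prod_i z i.
 apply: (big_ind2 (fun a b => 0 <= a /\ a <= b)) => //.
 by move=> a b c d [a0 ab] [c0 cd]; split; [exact: mule_ge0|exact: lee_pmul].
by have [] := H.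
Qed.

Lemma poweR_prode (I : finType) (y : I -> \bar R) e : (forall i, 0 <= y i) ->
 (\prod_i y i) `^ e = \prod_i (y i) `^ e.
Proof.
move=> y0; have H : (0 <= \prod_i y i) /\ (\prod_i y i) `^ e = \prod_i (y i) `^ e.
 apply: (big_ind2 (fun a b => 0 <= a /\ a `^ e = b)).
 - by split => //; rewrite ?lee_fin ?ler01 ?poweR1r.
 - by move=> a b c d [a0 ab] [c0 cd]; split; [exact: mule_ge0|rewrite poweRM ?ab ?cd].
 - by move=> i _; split.
by have [] := H.
Qed.

Lemma prod_poweR_inv n (x : \bar R) : 0 <= x -> \prod_(k < n.+1) x `^ (n.+1%:R^-1) = x.
Proof.
move=> x0.
have H m (r : R) : (0 < r)%R -> \prod_(k < m) x `^ r = x `^ (m%:R * r).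
 move=> r0; elim: m => [|m IH]; first by rewrite big_ord0 mul0r poweRe0.
 rewrite big_ord_recr/= IH -natr1 mulrDl mul1r poweRD//.
 by rewrite add_neq0_poweRD_def// gt_eqF// ltr_wpDl// mulr_ge0// ltW.
by rewrite H ?invr_gt0// mulfV// poweRe1.
Qed.

Lemma emeasurable_prod disp (T : measurableType disp) (I : finType) (f : I -> T -> \bar R) :
 (forall i, mfun (f i)) -> mfun (fun x => \prod_i f i x).
Proof.
move=> mf; pose g (s : seq I) x := \prod_(i <- s) f i x.
suff H : forall s, mfun (g s) by exact: H.
elim => [|i s IH]; rewrite /g.
 by under eq_fun do rewrite big_nil; exact: mcst.
by under eq_fun do rewrite big_cons; exact: emeasurable_funM.
Qed.

Lemma emeasurable_poweR disp (T : measurableType disp) (f : T -> \bar R) e :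
 mfun f -> mfun (fun x => f x `^ e).
Proof. by move=> mf; apply: (mcomp (measurable_poweR e)). Qed.

(** Divide each factor by its integral and apply the inequality of arithmetic and geometric means
    pointwise. A vanishing integral makes the product vanish a.e.; an infinite one, all of them
    being positive, makes the right-hand side infinite. *)
Lemma ge0_hoelder_prod disp (T : measurableType disp) (mu : {measure set T -> \bar R}) n
 (F : 'I_n.+1 -> T -> \bar R) :
 (forall i, mfun (F i)) -> (forall i x, 0 <= F i x) ->
 \int[mu]_x \prod_i (F i x) `^ (n.+1%:R^-1) <= \prod_i (\int[mu]_x F i x) `^ (n.+1%:R^-1).
Proof.
move=> mF F0; set e : R := (n.+1%:R^-1)%R.
have e0 : (0 < e)%R by rewrite invr_gt0.
have I0 i : 0 <= \int[mu]_x F i x by exact: integral_ge0.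
have mP : mfun (fun x => \prod_i (F i x) `^ e).
 by apply: emeasurable_prod => i; exact: emeasurable_poweR.
have P0 x : 0 <= \prod_i (F i x) `^ e by apply: prode_ge0' => i; exact: poweR_ge0.
have [[i Fi]|nz] := pselect (exists i, \int[mu]_x F i x = 0).
 have E : \int[mu]_x \prod_i (F i x) `^ e = 0.
 apply/eqP; rewrite -[X in X == _]gee0_abs ?integral_ge0// eq_le abse_ge0 andbT gee0_abs ?integral_ge0//.
 rewrite (ae_eq_integral (cst 0))//.
  by rewrite integral0.
 have : ae_eq mu setT (F i) (cst 0).
  apply/(ae_eq_integral_abs mu measurableT (mF i)).
  by rewrite -Fi; apply: eq_integral => x _; rewrite gee0_abs.
 apply: filterS => x /(_ I)/= Fx _; rewrite (bigD1 i)//= Fx.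
 by rewrite poweR0r ?gt_eqF// mul0e.
 by rewrite E; apply: prode_ge0' => j; exact: poweR_ge0.
have Ip i : 0 < \int[mu]_x F i x.
 by rewrite lt0e I0 andbT; apply/eqP => Fi; apply: nz; exists i.
have [[i Fi]|fi] := pselect (exists i, \int[mu]_x F i x = +oo).
 rewrite [leRHS](bigD1 i)//= Fi poweRyr ?gt_eqF// gt0_mulye ?leey//.
 by apply: prode_gt0 => j; exact: poweR_gt0.
pose a i := fine (\int[mu]_x F i x).
have aE i : \int[mu]_x F i x = (a i)%:E.
 by rewrite fineK// ge0_fin_numE// ltey; apply/eqP => Fi; apply: fi; exists i.
have a0 i : (0 < a i)%R by rewrite -lte_fin -aE.
have pE : \prod_i (\int[mu]_x F i x) `^ e = (\prod_i (a i) `^ e)%:E.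
 by rewrite -prodEFin; apply: eq_bigr => i _; rewrite aE poweR_EFin.
pose P := (\prod_i (a i) `^ e)%R.
have PP : (0 <= P)%R by apply: prodr_ge0 => i _; exact: powR_ge0.
have H x : \prod_i (F i x) `^ e <= P%:E * (e%:E * \sum_i ((a i)^-1%:E * F i x)).
 have aF i : 0 <= (a i)^-1%:E * F i x by rewrite mule_ge0// lee_fin invr_ge0 ltW.
 apply: le_trans (lee_wpmul2l _ (poweR_AGM aF)); last by rewrite lee_fin.
 rewrite /P -prodEFin -big_split/= le_eqVlt; apply/orP; left; apply/eqP/eq_bigr => i _.
 rewrite -poweR_EFin -poweRM//; last by rewrite lee_fin ltW.
 by rewrite muleA -EFinM mulfV ?mul1e// gt_eqF.
apply: (@le_trans _ _ (\int[mu]_x (P%:E * (e%:E * \sum_i ((a i)^-1%:E * F i x))))).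
 apply: ge0_le_integral => //.
 - apply: emeasurable_funM; first exact: mcst.
 apply: emeasurable_funM; first exact: mcst.
 by apply: emeasurable_sum => i; apply: emeasurable_funM; first exact: mcst.
have aF i x : 0 <= (a i)^-1%:E * F i x by rewrite mule_ge0// lee_fin invr_ge0 ltW.
have maF i : mfun (fun x => (a i)^-1%:E * F i x).
 by apply: emeasurable_funM; first exact: mcst.
have maS : mfun (fun x => \sum_i (a i)^-1%:E * F i x) by exact: emeasurable_sum.
rewrite ge0_integralZl//; last 2 first.
- by apply: emeasurable_funM; first exact: mcst.
- by move=> x _; rewrite mule_ge0 ?lee_fin ?(ltW e0)// sume_ge0.
rewrite ge0_integralZl//; last 2 first.
- by move=> x _; rewrite sume_ge0.
- by rewrite lee_fin ltW.
rewrite ge0_integral_sum//.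
rewrite (eq_bigr (fun=> 1%:E)); last first.
 move=> i _; rewrite ge0_integralZl// ?aE ?lee_fin ?invr_ge0 ?(ltW (a0 i))//.
 by rewrite -EFinM mulVf// gt_eqF.
rewrite sumEFin -!EFinM pE lee_fin sumr_const card_ord.
by rewrite /e -mulr_natr mul1r mulVf// mulr1.
Qed.

End generalized_hoelder.

(** * A weighted Loomis-Whitney inequality *)

Section loomis_whitney.
Context {R : realType}.
Notation leb := (@lebesgue_measure R).
Notation mu n := (@lebesgue_rV R n).
Open Scope ereal_scope.

Definition rV_upd n (x : 'rV[R]_n) (i : 'I_n) (s : measurableTypeR R) : 'rV[R]_n :=
 \row_j (if j == i then s else x ord0 j).

Definition line_int n i (f : 'rV[R]_n -> \bar R) x := \int[leb]_s f (rV_upd x i s).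

Lemma rV_upd0 n a (y : 'rV[R]_n) s : rV_upd (rV_cons (a, y)) ord0 s = rV_cons (s, y).
Proof.
apply/rowP => j; rewrite mxE; case: (unliftP ord0 j) => [k|] ->.
 by rewrite /= !rV_consS.
by rewrite eqxx rV_cons0.
Qed.

Lemma rV_updS n a (y : 'rV[R]_n) i s :
 rV_upd (rV_cons (a, y)) (lift ord0 i) s = rV_cons (a, rV_upd y i s).
Proof.
apply/rowP => j; rewrite mxE; case: (unliftP ord0 j) => [k|] ->.
 by rewrite !rV_consS (inj_eq lift_inj) mxE.
by rewrite (negbTE (neq_lift _ _)) !rV_cons0.
Qed.

Lemma measurable_upd n (i : 'I_n) :
 mfun (fun p : 'rV[R]_n * measurableTypeR R => rV_upd p.1 i p.2).
Proof.
apply: measurable_fun_rVP => j.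
have [->|ji] := eqVneq j i.
 rewrite (_ : _ \o _ = snd); first exact: measurable_snd.
 by apply/funext => p; rewrite /rV_coord /= mxE eqxx.
rewrite (_ : _ \o _ = rV_coord j \o fst).
 by apply: mcomp; [exact: measurable_rV_coord|exact: measurable_fst].
by apply/funext => p; rewrite /rV_coord /= mxE (negbTE ji).
Qed.

Lemma measurable_line_int n i (f : 'rV[R]_n -> \bar R) : mfun f ->
 (forall x, 0 <= f x) -> mfun (line_int i f).
Proof.
move=> mf f0.
apply: (@measurable_fun_fubini_tonelli_F _ _ _ _ R leb
 (fun p : 'rV[R]_n * measurableTypeR R => f (rV_upd p.1 i p.2))); last by move=> x; exact: f0.
by apply: mcomp => //; exact: measurable_upd.
Qed.

Lemma line_int_ge0 n i (f : 'rV[R]_n -> \bar R) x : (forall x, 0 <= f x) -> 0 <= line_int i f x.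
Proof. by move=> f0; apply: integral_ge0. Qed.

(** Spreads one factor over [n + 1] equal ones, so that Hoelder's inequality with [n + 2] factors
    can be applied to one function and [n + 1] copies of another. *)
Lemma prod_poweR_distr n (x : \bar R) m (y : 'I_m -> \bar R) (e : R) : 0 <= x -> (forall j, 0 <= y j) ->
 \prod_(k < n.+1) (x `^ (n.+1%:R^-1)%R * \prod_j (y j) `^ (n.+1%:R^-1)%R) `^ e =
 x `^ e * \prod_j (y j) `^ e.
Proof.
move=> x0 y0; set r : R := (n.+1%:R^-1)%R.
have h0 : 0 <= \prod_j (y j) `^ e by apply: prode_ge0' => j; exact: poweR_ge0.
rewrite -[RHS](@prod_poweR_inv _ n); last by rewrite mule_ge0// poweR_ge0.
have p0 : 0 <= \prod_j (y j) `^ r by apply: prode_ge0' => j; exact: poweR_ge0.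
apply: eq_bigr => k _; rewrite !poweRM ?poweR_ge0//.
rewrite !poweR_prode//; try by move=> j; exact: poweR_ge0.
rewrite -!poweRrM mulrC; congr (_ * _); apply: eq_bigr => j _.
by rewrite -!poweRrM mulrC.
Qed.

(* A form of the Loomis-Whitney inequality: the extra factor [F] makes the induction on the
 dimension close up, the integral over the first coordinate of its own function taking the
 role of [F] one dimension below. *)
Lemma loomis_whitney n (F : 'rV[R]_n.+1 -> \bar R) (f : 'I_n.+1 -> 'rV[R]_n.+1 -> \bar R) :
 mfun F -> (forall x, 0 <= F x) ->
 (forall i, mfun (f i)) -> (forall i x, 0 <= f i x) ->
 \int[mu n.+1]_x ((F x) `^ (n.+1%:R^-1)%R * \prod_i (line_int i (f i) x) `^ (n.+1%:R^-1)%R)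
 <= (\int[mu n.+1]_x F x) `^ (n.+1%:R^-1)%R * \prod_i (\int[mu n.+1]_x f i x) `^ (n.+1%:R^-1)%R.
Proof.
elim: n F f => [|n IH] F f mF F0 mf f0.
 rewrite big_ord1 invr1 !poweRe1; last by exact: integral_ge0.
 2: exact: integral_ge0.
 have E x : line_int ord0 (f ord0) x = \int[mu 1]_x f ord0 x.
 rewrite ge0_integral_rVS//; apply: eq_integral => a _.
 rewrite integral_dirac//; last exact: measurable_rV_cons_snd.
 rewrite diracT mul1e; congr f.
 by rewrite -[x in LHS]rV_consE rV_upd0; congr (rV_cons (_, _)); apply/rowP => -[].
 under eq_integral => x _ do rewrite big_ord1 E !poweRe1 ?integral_ge0//.
 rewrite ge0_integralZr//; exact: integral_ge0.
set e : R := (n.+2%:R^-1)%R; pose r : R := (n.+1%:R^-1)%R.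
have mprod : mfun (fun x => F x `^ e * \prod_(i < n.+2) line_int i (f i) x `^ e).
 apply: emeasurable_funM; first exact: emeasurable_poweR.
 by apply: emeasurable_prod => i; apply: emeasurable_poweR; exact: measurable_line_int.
have prod0 x : 0 <= F x `^ e * \prod_(i < n.+2) line_int i (f i) x `^ e.
 by rewrite mule_ge0 ?poweR_ge0//; apply: prode_ge0' => i; exact: poweR_ge0.
rewrite ge0_integral_rVS//.
pose Phi y := \int[leb]_s f ord0 (rV_cons (s, y)).
have mPhi : mfun Phi.
 apply: (@measurable_fun_fubini_tonelli_G _ _ _ _ R leb (f ord0 \o @rV_cons R n.+1)); last first.
 by move=> x; exact: f0.
 by apply: mcomp => //; exact: measurable_rV_cons.
have Phi0 y : 0 <= Phi y by exact: integral_ge0.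
have iPhi : \int[mu n.+1]_y Phi y = \int[mu n.+2]_x f ord0 x.
 rewrite [RHS]ge0_integral_rVS//; apply/esym.
 have mc : mfun (f ord0 \o @rV_cons R n.+1).
 by apply: mcomp => //; exact: measurable_rV_cons.
 have mc0 p : 0 <= (f ord0 \o @rV_cons R n.+1) p by exact: f0.
 have := @fubini_tonelli _ _ _ _ R leb (mu n.+1) _ mc mc0.
 exact.
pose fa (a : measurableTypeR R) (j : 'I_n.+1) y := f (lift ord0 j) (rV_cons (a, y)).
have mfa a j : mfun (fa a j) by exact: measurable_rV_cons_snd.
have fa0 a j y : 0 <= fa a j y by exact: f0.
pose Ia a j := \int[mu n.+1]_y fa a j y.
have Ia0 a j : 0 <= Ia a j by exact: integral_ge0.
pose G a y := Phi y `^ r * \prod_j line_int j (fa a j) y `^ r.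
have mG a : mfun (G a).
 apply: emeasurable_funM; first exact: emeasurable_poweR.
 by apply: emeasurable_prod => j; apply: emeasurable_poweR; exact: measurable_line_int.
have G0 a y : 0 <= G a y.
 by rewrite mule_ge0 ?poweR_ge0//; apply: prode_ge0' => i; exact: poweR_ge0.
have mFa a : mfun (fun y => F (rV_cons (a, y))) by exact: measurable_rV_cons_snd.
(* With the first coordinate frozen: Hoelder's inequality for [F] and [n + 1] copies of [G], after
   which the integral of [G] is bounded by the induction hypothesis. *)
have step a : \int[mu n.+1]_y (F (rV_cons (a, y)) `^ e *
  \prod_(i < n.+2) line_int i (f i) (rV_cons (a, y)) `^ e)
 <= (\int[mu n.+1]_y Phi y) `^ e *
  ((\int[mu n.+1]_y F (rV_cons (a, y))) `^ e * \prod_j (Ia a j) `^ e).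
 pose Fam (k : 'I_n.+2) y := if unlift ord0 k is Some _ then G a y else F (rV_cons (a, y)).
 have mFam k : mfun (Fam k) by rewrite /Fam; case: unlift.
 have Fam0 k y : 0 <= Fam k y by rewrite /Fam; case: unlift.
 have E y : F (rV_cons (a, y)) `^ e * \prod_(i < n.+2) line_int i (f i) (rV_cons (a, y)) `^ e
  = \prod_k (Fam k y) `^ e.
 rewrite [RHS]big_ord_recl/= {1}/Fam unlift_none; congr (_ * _).
 rewrite [RHS](eq_bigr (fun=> G a y `^ e)); last by move=> k _; rewrite /Fam liftK.
 rewrite prod_poweR_distr//; last by move=> j; exact: line_int_ge0.
 rewrite big_ord_recl; congr (_ `^ _ * _).
  by apply: eq_integral => s _; rewrite rV_upd0.
 by apply: eq_bigr => j _; congr (_ `^ _); apply: eq_integral => s _; rewrite rV_updS.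
 under eq_integral do rewrite E.
 apply: le_trans (ge0_hoelder_prod (mu n.+1) mFam Fam0) _.
 rewrite big_ord_recl /Fam unlift_none muleCA; apply: lee_wpmul2l; first exact: poweR_ge0.
 rewrite (eq_bigr (fun=> (\int[mu n.+1]_y G a y) `^ e)); last first.
 by move=> k _; rewrite liftK.
 rewrite -(@prod_poweR_distr n)//; last by exact: integral_ge0.
 apply: prode_le => k; rewrite ?poweR_ge0//.
 apply: gt0_ler_poweR; rewrite ?invr_ge0//; last exact: (IH Phi (fa a)).
 by rewrite in_itv/= integral_ge0//= leey.
 rewrite in_itv/= leey andbT mule_ge0 ?poweR_ge0//.
 by apply: prode_ge0' => j; exact: poweR_ge0.
pose Fam (k : 'I_n.+2) a := if unlift ord0 k is Some j then Ia a j else \int[mu n.+1]_y F (rV_cons (a, y)).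
have mFam k : mfun (Fam k).
 rewrite /Fam; case: unlift => [j|]; last exact: measurable_rV_cons_fst.
 exact: (measurable_rV_cons_fst (mf _) (f0 _)).
have Fam0 k y : 0 <= Fam k y by rewrite /Fam; case: unlift => [j|]; exact: integral_ge0.
have E a : (\int[mu n.+1]_y F (rV_cons (a, y))) `^ e * \prod_j (Ia a j) `^ e = \prod_k (Fam k a) `^ e.
 rewrite [RHS]big_ord_recl/= {1}/Fam unlift_none; congr (_ * _).
 by apply: eq_bigr => j _; rewrite /Fam liftK.
(* The remaining integral over the first coordinate is again one of a product of [n + 2] functions
   to the power [1/(n+2)]: a second use of Hoelder's inequality. *)
apply: (@le_trans _ _ (\int[leb]_a ((\int[mu n.+1]_y Phi y) `^ e * \prod_k (Fam k a) `^ e))).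
 apply: ge0_le_integral => //.
 - by move=> a _; exact: integral_ge0.
 - exact: (measurable_rV_cons_fst mprod prod0).
 - apply: emeasurable_funM; first exact: mcst.
 by apply: emeasurable_prod => k; exact: emeasurable_poweR.
 - by move=> a _; rewrite -E; exact: step.
rewrite ge0_integralZl//; last 3 first.
- by apply: emeasurable_prod => k; exact: emeasurable_poweR.
- by move=> a _; apply: prode_ge0' => k; exact: poweR_ge0.
- exact: poweR_ge0.
rewrite iPhi [leRHS](_ : _ = (\int[mu n.+2]_x f ord0 x) `^ e * \prod_k (\int[leb]_a Fam k a) `^ e).
 by apply: lee_wpmul2l; [exact: poweR_ge0|exact: ge0_hoelder_prod].
rewrite [in LHS]big_ord_recl muleCA [in RHS]big_ord_recl; congr (_ * (_ `^ _ * _)).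
 by rewrite /Fam unlift_none ge0_integral_rVS.
by apply: eq_bigr => j _; rewrite /Fam liftK ge0_integral_rVS.
Qed.

End loomis_whitney.

Lemma nr_abs disp (T : measurableType disp) (R : realType) (mu : {measure set T -> \bar R}) f :
 nr mu (fun x => `|f x|) = nr mu f.
Proof.
by congr Num.sqrt; apply: eq_Rintegral => x _; rewrite -normrM ger0_norm// -expr2 sqr_ge0.
Qed.

Lemma nr_sq_int disp (T : measurableType disp) (R : realType) (mu : {measure set T -> \bar R}) f :
 L2 mu f -> (\int[mu]_x (f x ^+ 2)%:E)%E = (nr mu f ^+ 2)%:E.
Proof.
move=> [mf jf]; rewrite nr_sq -[LHS]fineK; last exact: integrable_fin_num.
by congr EFin; apply: eq_Rintegral => x _; rewrite expr2.
Qed.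

(** * Sobolev inequalities for test functions *)

Section gagliardo_nirenberg.
Context {R : realType} {n : nat}.
Notation V := 'rV[R]_n.+1.
Notation mu := (@lebesgue_rV R n.+1).
Notation leb := (@lebesgue_measure R).
Notation e_ i := (delta_mx ord0 i : V).
Implicit Types (U : set V) (phi : V -> R).

Lemma rV_updE (x : V) i : rV_upd x i (x ord0 i) = x.
Proof. by apply/rowP => j; rewrite mxE; case: eqP => // ->. Qed.

Lemma is_derive_upd U phi (x : V) i (s : R) : testf U phi ->
 is_derive s 1 (fun s => phi (rV_upd x i s)) ('D_(e_ i) phi (rV_upd x i s)).
Proof.
move=> tphi; have [d1 d2] := test_is_derive i (rV_upd x i s) tphi.
have E : (fun h : R => h^-1 *: (((fun s => phi (rV_upd x i s)) \o shift s) (h *: 1) - phi (rV_upd x i s)))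
  = (fun h => h^-1 *: ((phi \o shift (rV_upd x i s)) (h *: e_ i) - phi (rV_upd x i s))).
 apply/funext => h /=; congr (_ *: (phi _ - _)); apply/rowP => j; rewrite !mxE eqxx/=.
 by rewrite /GRing.scale/=; case: (j == i); rewrite ?mulr1// mulr0 add0r.
by split; [rewrite /derivable E|rewrite /derive E].
Qed.

Lemma ler_coord_norm (x : V) i : `|x ord0 i| <= `|x|.
Proof.
rewrite [leRHS]/Num.norm/= mx_normrE.
exact: (le_bigmax _ (fun ij => `|x ij.1 ij.2|) (ord0, i)).
Qed.

Lemma test_bounded_support U phi : testf U phi ->
 exists2 B : R, 0 < B & forall (x : V) i, B <= `|x ord0 i| -> phi x = 0.
Proof.
move=> [_ [K [cK _ K0]]].
have [M [_ /(_ (`|M| + 1))]] := compact_bounded cK.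
rewrite (le_lt_trans (ler_norm M)) ?ltrDl// => /(_ isT) KM.
exists (`|M| + 2); first by rewrite ltr_wpDl.
move=> x i xi; apply: K0 => /KM/= /(le_trans (ler_coord_norm x i)).
by move=> /(le_trans xi); rewrite lerD2l => /le_trans/(_ (lexx _)); rewrite lt_geF// ltr1n.
Qed.

(** The value at [x] is the integral of the derivative from the left and minus its integral from the
    right; averaging the two bounds gives the factor 1/2. *)
Lemma half_line_int U phi (x : V) i : testf U phi ->
 (`|phi x|%:E <= 2^-1%:E * line_int i (fun y => `|'D_(e_ i) phi y|%:E) x)%E.
Proof.
move=> tphi; have [B0 B00 HB0] := test_bounded_support tphi.
(* Large enough for [phi] to vanish at both ends of the line segment and for the coordinate of [x]
   to lie strictly inside. *)
pose B := B0 + `|x ord0 i|.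
have xB : `|x ord0 i| < B by rewrite ltrDr.
have [xB1 xB2] : - B < x ord0 i /\ x ord0 i < B by move: xB; rewrite ltr_norml => /andP.
pose h (s : R) := phi (rV_upd x i s); pose h' (s : R) := 'D_(e_ i) phi (rV_upd x i s).
have dh (s : R) : is_derive s 1 h (h' s) by exact: is_derive_upd tphi.
have dh' (s : R) : is_derive s 1 h' ('D_(e_ i) ('D_(e_ i) phi) (rV_upd x i s)).
 by apply: is_derive_upd; exact: test_derive tphi.
have ch : continuous h by move=> s; apply/differentiable_continuous/derivable1_diffP; case: (dh s).
have ch' : continuous h' by move=> s; apply/differentiable_continuous/derivable1_diffP; case: (dh' s).
have mh' : mfun (h' : measurableTypeR R -> R) by exact: continuous_measurable_fun.
have FTC (a b : R) : a < b -> (\int[leb]_(s in `[a, b]) (h' s)%:E = (h b)%:E - (h a)%:E)%E.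
 move=> ab; apply: continuous_FTC2 => //.
 - exact: continuous_subspaceT.
 - split.
 + by move=> s _; have [] := dh s.
 + exact/cvg_at_right_filter/ch.
 + exact/cvg_at_left_filter/ch.
 - by move=> s _; rewrite derive1E; have [] := dh s.
have hB : h B = 0.
 apply: (HB0 _ i); rewrite mxE eqxx ger0_norm; first by rewrite lerDl.
 by rewrite addr_ge0// ltW.
have hNB : h (- B) = 0.
 apply: (HB0 _ i); rewrite mxE eqxx normrN ger0_norm; first by rewrite lerDl.
 by rewrite addr_ge0// ltW.
have hx : h (x ord0 i) = phi x by rewrite /h rV_updE.
have bd (a b : R) : a < b -> `|h b - h a|%:E = `|\int[leb]_(s in `[a, b]) (h' s)%:E|%E.
 by move=> ab; rewrite FTC.
have mn : mfun ((fun s => `|h' s|%:E) : measurableTypeR R -> \bar R).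
 by apply/mEFinP; apply: (mcomp mnormr).
have H1 (a b : R) : a < b -> (`|h b - h a|%:E <= \int[leb]_(s in `[a, b]) `|h' s|%:E)%E.
 move=> ab; rewrite bd//; apply: le_trans (le_abse_integral _ _ _) _ => //.
 by apply/mEFinP; exact: measurable_funTS.
have h1 : (`|phi x|%:E <= \int[leb]_(s in `[(- B)%R, x ord0 i[) `|h' s|%:E)%E.
 rewrite integral_itv_bndo_bndc; last exact: measurable_funTS.
 by have := H1 _ _ xB1; rewrite hx hNB subr0.
have h2 : (`|phi x|%:E <= \int[leb]_(s in `[x ord0 i, B]) `|h' s|%:E)%E.
 by have := H1 _ _ xB2; rewrite hx hB sub0r normrN.
have -> : `|phi x|%:E = (2^-1%:E * (`|phi x|%:E + `|phi x|%:E))%E.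
 by rewrite -EFinD -EFinM; congr EFin; field.
apply: lee_wpmul2l; first by rewrite lee_fin invr_ge0.
apply: le_trans (leeD h1 h2) _.
rewrite -ge0_integral_setU//=; last 2 first.
- exact: measurable_funTS.
- by apply/disj_setPS => s [] /=; rewrite !in_itv/= => /andP[_ s1] /andP[s2 _]; move: (lt_le_trans s1 s2); rewrite ltxx.
apply: ge0_subset_integral => //.
by apply: measurableU.
Qed.

Lemma measurable_upd1 (x : V) i : mfun (fun s : measurableTypeR R => rV_upd x i s).
Proof. exact: (measurable_fun_pair2 x (@measurable_upd R n.+1 i)). Qed.

(** Each half line integral bounds [|phi|^(k+2)], hence so does the product of their [(n+1)]-th
    roots, and the weighted Loomis-Whitney inequality applies; Cauchy-Schwarz bounds the integral of
    the derivative of [phi^(k+2)]. The free weight [F] is the point: [\1_U] gives the Poincare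
    inequality, a power of [c] the bound on the potential, a power of [phi] the planar
    inequality. *)
Lemma sobolev_test U phi k (F : V -> R) g : testf U phi ->
 intg mu F -> (forall x, 0 <= F x) -> (forall i, nr mu ('D_(e_ i) phi) <= g) ->
 (\int[mu]_x ((F x) `^ (n.+1%:R^-1) * `|phi x| ^+ k.+2)%:E <=
 ((\int[mu]_x F x) `^ (n.+1%:R^-1) * (k.+2%:R / 2 * (nr mu (fun x => phi x ^+ k.+1) * g)))%:E)%E.
Proof.
move=> tphi jF F0 Dg; set e := n.+1%:R^-1.
pose W x := phi x ^+ k.+2.
have sX m : smooth (fun y : R => y ^+ m.+1) by move=> j; apply: C1kX; exact: C1k_id.
have tX m : testf U (fun x => phi x ^+ m.+1).
 by apply: (test_comp (sX m)) tphi; rewrite expr0n.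
have tW : testf U W by exact: tX.
have DW i x : 'D_(e_ i) W x = k.+2%:R * phi x ^+ k.+1 * 'D_(e_ i) phi x.
 have dX (y : R) : is_derive y 1 (fun y : R => y ^+ k.+2) (k.+2%:R * y ^+ k.+1).
 rewrite (_ : (fun z : R => z ^+ k.+2) = (id : R -> R) ^+ k.+2); last first.
  by apply/funext => z; rewrite exprfctE.
 by apply: (is_derive_conv (is_deriveX k.+2 (is_derive_id y (1 : R)))); rewrite /GRing.scale/= mulr1.
 exact: (derive_comp_test i x dX tphi).
have LX : L2 mu (fun x => phi x ^+ k.+1) := test_L2 (tX k).
have LD i := test_derive_L2 i tphi.
have tDW i := test_derive i tW.
have mDW i : mfun (fun x => `|'D_(e_ i) W x|%:E).
 apply/mEFinP; apply: (mcomp mnormr).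
 exact: test_meas (tDW i).
have D0 i x : (0 <= `|'D_(e_ i) W x|%:E)%E by rewrite lee_fin.
have mF : mfun (EFin \o F) by apply/mEFinP; exact: intg_meas jF.
have F0e x : (0 <= (EFin \o F) x)%E by rewrite lee_fin.
pose f (i : 'I_n.+1) (x : V) : \bar R := (2^-1%:E * `|'D_(e_ i) W x|%:E)%E.
have mf i : mfun (f i).
 by apply: emeasurable_funM; first exact: mcst.
have f0 i x : (0 <= f i x)%E by rewrite mule_ge0// lee_fin invr_ge0.
have If i : (\int[mu]_x f i x <= (k.+2%:R / 2 * (nr mu (fun x => phi x ^+ k.+1) * g))%:E)%E.
 have j2 : intg mu (fun x => `|phi x ^+ k.+1| * `|'D_(e_ i) phi x|) by apply: L2_mul; exact: L2_abs.
 have j1 := intgZ (k.+2%:R / 2) j2.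
 rewrite (eq_integral (fun x => (k.+2%:R / 2 * (`|phi x ^+ k.+1| * `|'D_(e_ i) phi x|))%:E)); last first.
 by move=> x _; rewrite /f DW !normrM (ger0_norm (ler0n _ _)) -EFinM; congr EFin; ring.
 rewrite -[leLHS]fineK; last exact: integrable_fin_num.
 rewrite lee_fin -/(Rintegral mu setT _) (RintZl j2).
 apply: ler_wpM2l => //; apply: le_trans (ler_norm _) _.
 apply: le_trans (ip_le (L2_abs LX) (L2_abs (LD i))) _.
 by rewrite !nr_abs; apply: ler_wpM2l; rewrite ?nr_ge0.
have LF i x : (`|W x|%:E <= line_int i (f i) x)%E.
 apply: le_trans (half_line_int x i tW) _; rewrite /line_int.
 rewrite [leRHS]ge0_integralZl//.
 by apply: mcomp (mDW i) _; exact: measurable_upd1.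
apply: le_trans.
 apply: (@ge0_le_integral _ _ _ mu setT measurableT _ (fun x => ((EFin \o F) x `^ e * \prod_i (line_int i (f i) x) `^ e)%E)).
 - by move=> x _; rewrite lee_fin mulr_ge0// ?powR_ge0// exprn_ge0.
 - apply/mEFinP; apply: mfunM.
  by apply: (mcomp (measurable_powR e)); exact: intg_meas jF.
 under eq_fun do rewrite -normrX.
 by apply: (mcomp mnormr); exact: test_meas tW.
 - apply: emeasurable_funM; first exact: emeasurable_poweR.
 by apply: emeasurable_prod => i; apply: emeasurable_poweR; exact: measurable_line_int.
 move=> x _; rewrite EFinM -poweR_EFin; apply: lee_wpmul2l; first exact: poweR_ge0.
 rewrite -[X in (X <= _)%E](@prod_poweR_inv _ n); last by rewrite lee_fin exprn_ge0.
 apply: prode_le => i; first exact: poweR_ge0.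
 apply: gt0_ler_poweR; rewrite ?invr_ge0//.
 - by rewrite in_itv/= leey lee_fin exprn_ge0.
 - by rewrite in_itv/= leey line_int_ge0.
 - by apply: le_trans (LF i x); rewrite normrX.
apply: le_trans (loomis_whitney mF F0e mf f0) _.
rewrite EFinM; apply: lee_pmul; first exact: poweR_ge0.
- by apply: prode_ge0' => i; exact: poweR_ge0.
- by rewrite -poweR_EFin /Rintegral fineK//; exact: integrable_fin_num.
have N0 : 0 <= k.+2%:R / 2 * (nr mu (fun x => phi x ^+ k.+1) * g).
 by rewrite !mulr_ge0 ?nr_ge0// (le_trans _ (Dg ord0)) ?nr_ge0.
rewrite -[leRHS](@prod_poweR_inv _ n); last by rewrite lee_fin.
apply: prode_le => i; first exact: poweR_ge0.
apply: gt0_ler_poweR; rewrite ?invr_ge0//.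
- by rewrite in_itv/= leey integral_ge0.
- by rewrite in_itv/= leey lee_fin N0.
Qed.

Lemma powR_le1 (x s : R) : 0 <= x <= 1 -> 0 <= s -> x `^ s <= 1.
Proof.
move=> /andP[x0 x1] s0; apply: (@le_trans _ _ (1 `^ s)); last by rewrite powR1.
by apply: ge0_ler_powR; rewrite ?nnegrE.
Qed.

Lemma ler_sqr_mul (x y : R) : 0 <= x -> 0 <= y -> x ^+ 2 <= x * y -> x <= y.
Proof.
rewrite le_eqVlt => /predU1P[<-//|x0] y0.
by rewrite expr2 ler_pM2l.
Qed.

(** [sobolev_test] with weight [\1_U] and [k = 0]: the factor [(k+2)/2] is 1, and one norm of [phi]
    cancels. The constant must not be larger for the rate in (ii). *)
Lemma poincare_test U phi g : measurable U -> (mu U < +oo)%E -> testf U phi ->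
 (forall i, nr mu ('D_(e_ i) phi) <= g) ->
 nr mu phi <= fine (mu U) `^ (n.+1%:R^-1) * g.
Proof.
move=> mU fU tphi Dg.
have g0 : 0 <= g by rewrite (le_trans _ (Dg ord0)) ?nr_ge0.
have Lphi := test_L2 tphi.
have jU := intg_indicU mU fU.
have U0 x : 0 <= \1_U x :> R by rewrite indicE.
have := sobolev_test 0 tphi jU U0 Dg.
rewrite (eq_integral (fun x => (phi x ^+ 2)%:E)); last first.
 move=> x _; congr EFin; rewrite indicE real_normK ?num_real//.
 have [Ux|nUx] := boolP (x \in U); first by rewrite powR1 mul1r.
 by rewrite powR0 ?gt_eqF ?invr_gt0// mul0r (test_off tphi) ?expr0n//; rewrite notin_setE in nUx.
rewrite nr_sq_int// lee_fin divff// mul1r.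
have -> : \int[mu]_x \1_U x = fine (mu U).
 by rewrite /Rintegral integral_indic// setIT.
rewrite mulrCA => /ler_sqr_mul; apply; rewrite ?nr_ge0//.
by rewrite mulr_ge0// powR_ge0.
Qed.

Section pot.
Variables (U : set V) (c : V -> R) (s : R).
Hypotheses (mU : measurable U)
 (fU : (mu U < +oo)%E)
 (mc : mfun c)
 (c0 : forall x, 0 <= c x)
 (cU : forall x, ~ U x -> c x = 0)
 (jc : intg mu (fun x => c x `^ s)).

Let m := fine (mu U) `^ (n.+1%:R^-1).

(** With [s = d/2] the weight [c^s] enters to the power [1/d], that is as [c^(1/2)], which controls
    [c^(1/4) |phi|] in L^2. The complementary factor [c^(3/4)] is in L^2 because [3/2 <= s] and [U]
    has finite measure. *)
Lemma pot_test_ge3 : (2 <= n)%N -> s = n.+1%:R / 2 -> exists2 C : R, 0 <= C &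
 forall phi g, testf U phi -> 0 < g -> (forall i, nr mu ('D_(e_ i) phi) <= g) ->
 intg mu (fun x => c x * `|phi x|) /\ \int[mu]_x (c x * `|phi x|) <= C * g.
Proof.
move=> n2 sE.
have j32 : intg mu (fun x => c x `^ (3 / 2)).
 apply: (@intg_le _ _ _ _ _ (fun x => \1_U x + c x `^ s)).
 - by apply: (mcomp (measurable_powR _)).
 - move=> x; rewrite ger0_norm ?powR_ge0// indicE.
 have [Ux|nUx] := boolP (x \in U); last first.
  rewrite cU; last by rewrite notin_setE in nUx.
  by rewrite powR0 ?add0r ?powR_ge0// gt_eqF// divr_gt0.
 have [c1|c1] := leP 1 (c x).
  rewrite (@le_trans _ _ (c x `^ s)) ?lerDr//; apply: ler_powR => //.
  by rewrite sE ler_pM2r ?invr_gt0// ler_nat.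
 apply: (@le_trans _ _ 1); last by rewrite lerDl powR_ge0.
 by apply: powR_le1; rewrite ?divr_ge0// c0 ltW.
 - by apply: intgD => //; exact: intg_indicU.
pose M := (\int[mu]_x c x `^ s) `^ (n.+1%:R^-1).
have M0 : 0 <= M by exact: powR_ge0.
have L34 : L2 mu (fun x => c x `^ (3 / 4)).
 split; first by apply: (mcomp (measurable_powR _)).
 rewrite (_ : (fun x => _) = (fun x => c x `^ (3 / 2)))//.
 apply/funext => x; rewrite -powR_mulrn ?powR_ge0// -powRrM; congr (_ `^ _).
 by field.
exists (nr mu (fun x => c x `^ (3 / 4)) * Num.sqrt (M * m)).
 by rewrite mulr_ge0 ?nr_ge0// sqrtr_ge0.
move=> phi g tphi g0 Dg.
have Lphi := test_L2 tphi.
have P := poincare_test mU fU tphi Dg.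
have := sobolev_test 0 tphi jc (fun x => powR_ge0 _ _) Dg.
rewrite divff// mul1r -/M => H.
pose w x := c x `^ 4^-1 * `|phi x|.
have mw : mfun w.
 apply: mfunM; first by apply: (mcomp (measurable_powR _)).
 by apply: (mcomp mnormr); exact: test_meas tphi.
have wE x : (c x `^ s) `^ n.+1%:R^-1 * `|phi x| ^+ 2 = w x ^+ 2.
 have E1 : (c x `^ s) `^ n.+1%:R^-1 = (c x `^ 4^-1) ^+ 2.
 rewrite -powRrM -[RHS]powR_mulrn ?powR_ge0// -powRrM; congr (c x `^ _).
 by rewrite sE; field; rewrite nat1r pnatr_eq0.
 by rewrite E1 /w exprMn.
have Hw : (\int[mu]_x (w x ^+ 2)%:E <= (M * (nr mu phi * g))%:E)%E.
 by rewrite (eq_integral (fun x => ((c x `^ s) `^ n.+1%:R^-1 * `|phi x| ^+ 2)%:E))// => x _; rewrite wE.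
have Lw : L2 mu w.
 split => //; apply/integrableP; split.
 by apply/mEFinP; exact: measurable_funX.
 rewrite (eq_integral (fun x => (w x ^+ 2)%:E)) ?(le_lt_trans Hw) ?ltry//.
 by move=> x _ /=; rewrite ger0_norm ?sqr_ge0.
have cE x : c x * `|phi x| = c x `^ (3 / 4) * w x.
 rewrite /w mulrA -powRD; last by rewrite gt_eqF// addr_gt0 ?divr_gt0 ?invr_gt0.
 rewrite (_ : 3 / 4 + 4^-1 = 1) ?powRr1//; by field.
split.
 by under eq_fun do rewrite cE; exact: L2_mul.
under eq_Rintegral do rewrite cE.
apply: le_trans (ler_norm _) _; apply: le_trans (ip_le L34 Lw) _.
rewrite -mulrA; apply: ler_wpM2l; rewrite ?nr_ge0//.
rewrite -(ler_pXn2r (_ : 0 < 2)%N)// ?nnegrE ?nr_ge0 ?mulr_ge0 ?sqrtr_ge0 ?(ltW g0)//.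
have Mm0 : 0 <= M * m by rewrite mulr_ge0// powR_ge0.
rewrite exprMn (sqr_sqrtr Mm0).
rewrite -lee_fin -nr_sq_int//; apply: le_trans Hw _.
rewrite lee_fin -mulrA; apply: ler_wpM2l => //.
by rewrite expr2 mulrA ler_wpM2r// ltW.
Qed.

(** In the plane the weight enters as a square root, so the choice [F = (phi^(k+2))^2] bounds the
    norm of [phi^(k+2)] by that of [phi^(k+1)]; the factorial collects the factors [k+2]. *)
Lemma ladyzhenskaya_test phi g k : n = 1%N -> testf U phi ->
 0 <= g -> (forall i, nr mu ('D_(e_ i) phi) <= g) ->
 nr mu (fun x => phi x ^+ k.+1) <= k.+1`!%:R * m * g ^+ k.+1.
Proof.
move=> n1 tphi g0 Dg.
have e2 : n.+1%:R^-1 = 2^-1 :> R by rewrite n1.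
have m0 : 0 <= m by exact: powR_ge0.
elim: k => [|k IH].
 by rewrite fact_prod big_nat1 mul1r expr1; exact: poincare_test.
have LX j : L2 mu (fun x => phi x ^+ j.+1).
 apply: (@test_L2 _ _ U); apply: (@test_comp _ _ _ (fun y => y ^+ j.+1)) tphi; last by rewrite expr0n.
 by move=> i; apply: C1kX; exact: C1k_id.
have [_ jF] := LX k.+1.
have := sobolev_test k tphi jF (fun x => sqr_ge0 _) Dg.
rewrite (eq_integral (fun x => ((phi x ^+ k.+2) ^+ 2)%:E)); last first.
 move=> x _; congr EFin; rewrite e2 powR12_sqrt ?sqr_ge0// sqrtr_sqr -normrX.
 by rewrite -normrM ger0_norm ?expr2// -expr2 sqr_ge0.
rewrite nr_sq_int// lee_fin.
have -> : (\int[mu]_x (phi x ^+ k.+2) ^+ 2) `^ n.+1%:R^-1 = nr mu (fun x => phi x ^+ k.+2).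
 rewrite e2 powR12_sqrt; last by apply: Rint_ge0 => x; exact: sqr_ge0.
 by congr Num.sqrt; apply: eq_Rintegral => x _; rewrite expr2.
move=> /ler_sqr_mul H; apply: le_trans (H _ _) _; rewrite ?nr_ge0//.
 by rewrite !mulr_ge0 ?nr_ge0.
have k2 : k.+2%:R / 2 <= k.+2%:R :> R by rewrite ler_pdivrMr// ler_peMr// ler1n.
apply: (@le_trans _ _ (k.+2%:R * ((k.+1`!%:R * m * g ^+ k.+1) * g))).
 apply: ler_pM k2 _; rewrite ?divr_ge0 ?mulr_ge0 ?nr_ge0//.
 exact: ler_wpM2r.
by rewrite (factS k.+1) natrM (exprSr g k.+1) !mulrA.
Qed.

(** Young's inequality with the exponent conjugate to [s]. In the plane every power of [phi] is
    integrable, so the conjugate power is bounded by 1 plus an even power that [ladyzhenskaya_test]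
    controls. *)
Lemma pot_test_2 : n = 1%N -> 1 < s -> exists2 C : R, 0 <= C &
 forall phi g, testf U phi -> 0 < g -> (forall i, nr mu ('D_(e_ i) phi) <= g) ->
 intg mu (fun x => c x * `|phi x|) /\ \int[mu]_x (c x * `|phi x|) <= C * g.
Proof.
move=> n1 s1.
have s0 : 0 < s by exact: lt_trans s1.
pose s' := s / (s - 1).
have sB : 0 < s - 1 by rewrite subr_gt0.
have s'0 : 0 < s' by rewrite divr_gt0.
have sconj : s^-1 + s'^-1 = 1 by rewrite /s'; field; rewrite !gt_eqF.
have s1inv : s^-1 <= 1 by rewrite invf_le1// ltW.
have s'1inv : s'^-1 <= 1 by rewrite -sconj lerDr invr_ge0 ltW.
have [k sk] : exists k : nat, s' <= (2 * k.+1)%:R.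
 exists (Num.truncn s'); apply: le_trans (ltW (truncnS_gt s')) _.
 by rewrite ler_nat mul2n -addnn leq_addr.
have jU := intg_indicU mU fU.
pose C := \int[mu]_x (c x `^ s) + \int[mu]_x \1_U x + (k.+1`!%:R * m) ^+ 2.
have C0 : 0 <= C by rewrite !addr_ge0 ?Rint_ge0 ?sqr_ge0// => x; rewrite ?powR_ge0// indicE.
exists C => // phi0 g tphi0 g0 Dg0.
(* Young's inequality is not homogeneous, so it is applied after normalising the gradient; the
   linear dependence on [g] is restored at the end. *)
pose phi x := g^-1 * phi0 x.
have tphi : testf U phi by exact: testZ.
have gE x : phi0 x = g * phi x by rewrite /phi mulrA mulfV ?mul1r// gt_eqF.
have Dg i : nr mu ('D_(e_ i) phi) <= 1.
 rewrite (@eq_nr _ _ _ _ _ (fun x => g^-1 * 'D_(e_ i) phi0 x)).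
 rewrite nrZ; last exact: test_derive_L2 tphi0.
 by rewrite ger0_norm ?invr_ge0 ?(ltW g0)// mulrC ler_pdivrMr// mul1r.
 by move=> x; have := is_deriveZ g^-1 (test_is_derive i x tphi0); case.
have := ladyzhenskaya_test k n1 tphi ler01 Dg; rewrite expr1n mulr1 => H.
have LX : L2 mu (fun x => phi x ^+ k.+1).
 apply: (@test_L2 _ _ U); apply: (@test_comp _ _ _ (fun y => y ^+ k.+1)) tphi; last by rewrite expr0n.
 by move=> i; apply: C1kX; exact: C1k_id.
have [_ jX] := LX.
pose F x := c x `^ s + \1_U x + (phi x ^+ k.+1) ^+ 2.
have jF : intg mu F by apply: intgD => //; apply: intgD.
have bd x : c x * `|phi x| <= F x.
 have [Ux|nUx] := pselect (U x); last first.
 by rewrite cU// mul0r /F !addr_ge0 ?powR_ge0 ?sqr_ge0// indicE.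
 apply: le_trans (conjugate_powR (c0 x) (normr_ge0 (phi x)) s0 s'0 sconj) _.
 rewrite /F indicE mem_set// -addrA; apply: lerD.
 by rewrite ler_piMr// powR_ge0.
 apply: (@le_trans _ _ (`|phi x| `^ s')); first by rewrite ler_piMr// powR_ge0.
 rewrite -exprM -[phi x ^+ _]ger0_norm ?normrX; last by rewrite mulnC exprM exprn_ge0// sqr_ge0.
 rewrite mulnC -powR_mulrn//.
 have [p1|p1] := leP 1 `|phi x|.
 by rewrite (@le_trans _ _ (`|phi x| `^ (2 * k.+1)%:R)) ?lerDr//; exact: ler_powR.
 apply: (@le_trans _ _ 1); last by rewrite lerDl powR_ge0.
 by apply: powR_le1; rewrite ?(ltW s'0)// normr_ge0 ltW.
have mcp : mfun (fun x => c x * `|phi x|).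
 apply: mfunM => //.
 by apply: (mcomp mnormr); exact: test_meas tphi.
have cp0 x : 0 <= c x * `|phi x| by rewrite mulr_ge0.
have jcp : intg mu (fun x => c x * `|phi x|).
 by apply: intg_le jF => // x; rewrite ger0_norm.
have E x : c x * `|phi0 x| = g * (c x * `|phi x|) by rewrite gE normrM (gtr0_norm g0) mulrCA.
split; first by under eq_fun do rewrite E; exact: intgZ.
under eq_Rintegral do rewrite E.
rewrite (RintegralZl g measurableT jcp) mulrC; apply: ler_wpM2r; first exact: ltW.
apply: le_trans (Rint_le jcp jF bd) _.
rewrite /F RintegralD//; last by apply: intgD.
rewrite RintegralD// lerD2l.
have -> : \int[mu]_x (phi x ^+ k.+1) ^+ 2 = nr mu (fun x => phi x ^+ k.+1) ^+ 2.
 by rewrite nr_sq; apply: eq_Rintegral => x _; rewrite expr2.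
by rewrite ler_pXn2r// nnegrE ?nr_ge0// mulr_ge0// powR_ge0.
Qed.

End pot.

End gagliardo_nirenberg.

(** * Potential and Poincare bounds for pairs *)

Section gradient_norm.
Context {R : realType} {d : nat}.
Notation V := 'rV[R]_d.
Notation mu := (@lebesgue_rV R d).
Notation e_ i := (delta_mx ord0 i : V).
Implicit Types (U : set V) (phi v : V -> R) (G : 'I_d -> V -> R).

Definition gnr G := Num.sqrt (\sum_i nr mu (G i) ^+ 2).

Lemma gnr_ge0 G : 0 <= gnr G. Proof. exact: sqrtr_ge0. Qed.

Lemma gnr_sq G : gnr G ^+ 2 = \sum_i nr mu (G i) ^+ 2.
Proof. by rewrite sqr_sqrtr// sumr_ge0// => i _; exact: sqr_ge0. Qed.

Lemma nr_le_gnr G i : nr mu (G i) <= gnr G.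
Proof.
rewrite -(ler_pXn2r (_ : 0 < 2)%N)// ?nnegrE ?nr_ge0 ?gnr_ge0// gnr_sq (bigD1 i)//=.
by rewrite lerDl sumr_ge0// => j _; exact: sqr_ge0.
Qed.

Lemma cvg_gnr (G_ : nat -> 'I_d -> V -> R) G :
 (forall n i, L2 mu (G_ n i)) -> (forall i, L2 mu (G i)) ->
 (forall i, L2cvg mu (fun n => G_ n i) (G i)) -> gnr (G_ n) @[n --> \oo] --> gnr G.
Proof.
move=> LGn LG GG.
have c1 : (fun n => \sum_i nr mu (G_ n i) ^+ 2) @ \oo --> \sum_i nr mu (G i) ^+ 2.
 apply: cvg_big => [|i _]; first exact: add_continuous.
 rewrite expr2; under eq_fun do rewrite expr2.
 by apply: cvgM; apply: L2cvg_nr => // n; exact: LGn.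
exact: (cvg_comp _ _ c1 (@sqrt_continuous R _)).
Qed.

Section pot_bound.
Variables (U : set V) (c : V -> R) (C : R).
Hypotheses (mU : measurable U)
 (fU : (mu U < +oo)%E)
 (mc : mfun c)
 (c0 : forall x, 0 <= c x)
 (cU : forall x, ~ U x -> c x = 0)
 (C0 : 0 <= C)
 (HC : forall phi g, testf U phi -> 0 < g ->
 (forall i, nr mu ('D_(e_ i) phi) <= g) ->
 intg mu (fun x => c x * `|phi x|) /\ \int[mu]_x (c x * `|phi x|) <= C * g).

(** Convergence in L^2 does not pass to the limit against [c] itself. The truncations [min(c, k)]
    are in L^2, so the bound holds for each of them, and monotone convergence in [k] gives it for
    [c]. *)
Lemma h10p_pot v G : h10p U v G ->
 intg mu (fun x => c x * `|v x|) /\ \int[mu]_x (c x * `|v x|) <= C * gnr G.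
Proof.
move=> [Lv LG [p [tp pv pG]]].
pose ck (k : nat) x := Num.min (c x) k%:R.
have ck0 k x : 0 <= ck k x by rewrite /ck le_min c0 ler0n.
have mck k : mfun (ck k) by apply: measurable_minr => //; exact: mcst.
have jU := intg_indicU mU fU.
have Lck k : L2 mu (ck k).
 split => //; apply: (intg_le _ _ (intgZ (k%:R ^+ 2) jU)); first exact: measurable_funX.
 move=> x; rewrite ger0_norm ?sqr_ge0// indicE.
 have [Ux|nUx] := boolP (x \in U).
 by rewrite mulr1 ler_pXn2r ?nnegrE// /ck ge_min lexx orbT.
 by rewrite mulr0 /ck cU ?min_l ?expr0n//; rewrite notin_setE in nUx.
have Labs n : L2 mu (fun x => `|p n x|) by apply: L2_abs; exact: test_L2 (tp n).
have Lav := L2_abs Lv.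
have ck_bd k : ip mu (ck k) (fun x => `|v x|) <= C * gnr G.
 have c1 : (fun n => ip mu (ck k) (fun x => `|p n x|)) @ \oo --> ip mu (ck k) (fun x => `|v x|).
 under eq_fun do rewrite ipC; rewrite ipC.
 apply: L2cvg_ip => //.
 have nb (x y : R) : `| `|x| - `|y| | <= 1 * `|x - y| by rewrite mul1r ler_dist_dist.
 by apply: (L2cvg_comp ler01 nb _ Lv pv) => // n; exact: test_L2 (tp n).
 (* The vanishing term [1/(n+1)] supplies the strictly positive bound on the gradient that [HC] asks
    for. *)
 have c2 : (fun n => C * (gnr (fun i => 'D_(e_ i) (p n)) + n.+1%:R^-1)) @ \oo --> C * (gnr G + 0).
 apply: cvgMr; apply: cvgD; last exact: cvg_harmonic.
 by apply: cvg_gnr => // n i; exact: test_derive_L2 (tp n).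
 rewrite addr0 in c2; apply: (ler_cvg_to c1 c2).
 near=> n.
 have g0 : 0 < gnr (fun i => 'D_(e_ i) (p n)) + n.+1%:R^-1.
 by rewrite ltr_wpDl ?gnr_ge0// invr_gt0.
 have Dg i : nr mu ('D_(e_ i) (p n)) <= gnr (fun i => 'D_(e_ i) (p n)) + n.+1%:R^-1.
 apply: le_trans (nr_le_gnr (fun i => 'D_(e_ i) (p n)) i) _.
 by rewrite lerDl invr_ge0.
 have [j1 b1] := HC (tp n) g0 Dg.
 apply: le_trans b1; apply: Rint_le => // [|x]; first exact: L2_mul.
 by rewrite ler_wpM2r// /ck ge_min lexx.
have mcv : mfun (fun x => c x * `|v x|).
 by apply: mfunM => //; exact: L2_meas Lav.
have cv0 x : 0 <= c x * `|v x| by rewrite mulr_ge0.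
have E : (\int[mu]_x (c x * `|v x|)%:E <= (C * gnr G)%:E)%E.
 pose g' (k : nat) x := (ck k x * `|v x|)%:E.
 have limE x : limn (g'^~ x) = (c x * `|v x|)%:E.
 apply: cvg_lim => //; apply: cvg_near_cst.
 exists (Num.truncn (c x)).+1 => // k /= ck_k.
 rewrite /g' /ck min_l//; apply: le_trans (ltW (truncnS_gt (c x))) _.
 by rewrite ler_nat.
 under eq_integral do rewrite -limE.
 have mg k : mfun (g' k).
 by apply/mEFinP; apply: mfunM => //; exact: L2_meas Lav.
 have g0 k x : setT x -> (0 <= g' k x)%E by move=> _; rewrite lee_fin mulr_ge0.
 have nd x : setT x -> {homo g'^~ x : n m / (n <= m)%N >-> (n <= m)%E}.
 move=> _ k l kl; rewrite lee_fin ler_wpM2r// /ck le_min ge_min lexx/= ge_min.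
 by rewrite ler_nat kl orbT.
 have c1 := @cvg_monotone_convergence _ _ _ mu _ measurableT _ mg g0 nd.
 rewrite -(cvg_lim _ c1)//; apply: lime_le; first by apply: cvgP c1.
 apply: nearW => k; rewrite -[leLHS]fineK; first by rewrite lee_fin; exact: ck_bd.
 by apply: integrable_fin_num => //; exact: L2_mul.
have jcv : intg mu (fun x => c x * `|v x|).
 apply/integrableP; split; first exact/mEFinP.
 rewrite (eq_integral (fun x => (c x * `|v x|)%:E)) ?(le_lt_trans E) ?ltry//.
 by move=> x _ /=; rewrite ger0_norm.
split => //; rewrite -lee_fin; apply: le_trans E.
by rewrite /Rintegral fineK//; exact: integrable_fin_num.
Unshelve. all: by end_near.
Qed.

End pot_bound.

Lemma h10p_poincare U v G m : (forall phi g, testf U phi ->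
 (forall i, nr mu ('D_(e_ i) phi) <= g) -> nr mu phi <= m * g) ->
 h10p U v G -> nr mu v <= m * gnr G.
Proof.
move=> H [Lv LG [p [tp pv pG]]].
have c1 : (fun n => nr mu (p n)) @ \oo --> nr mu v.
 by apply: L2cvg_nr => // n; exact: test_L2 (tp n).
have c2 : (fun n => m * gnr (fun i => 'D_(e_ i) (p n))) @ \oo --> m * gnr G.
 by apply: cvgMr; apply: cvg_gnr => // n i; exact: test_derive_L2 (tp n).
apply: (ler_cvg_to c1 c2); apply: nearW => n; apply: (H _ _ (tp n)) => i.
exact: (nr_le_gnr (fun i => 'D_(e_ i) (p n))).
Qed.

End gradient_norm.

Import HBSimple HBNNSimple.

(** * Integrals without measurability *)

Section integral_nonmeasurable.
Context disp (T : measurableType disp) (R : realType) (mu : {measure set T -> \bar R}).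
Open Scope ereal_scope.

(* The library integral of a nonnegative function is a supremum over simple functions below it,
 so it is monotone without any measurability assumption. *)
Lemma ge0_le_integral_ae (f g : T -> \bar R) : (forall x, 0 <= f x) -> (forall x, 0 <= g x) ->
 {ae mu, forall x, f x <= g x} -> \int[mu]_x f x <= \int[mu]_x g x.
Proof.
move=> f0 g0 [N [mN N0 subN]].
rewrite [leLHS]ge0_integralTE//; apply: ge_ereal_sup => _ [h /= hf <-].
rewrite [leRHS]ge0_integralTE//.
pose k := [the {nnsfun T >-> R} of mul_nnsfun h (indic_nnsfun R (measurableC mN))].
have kE x : k x = (h x * \1_(~` N) x)%R by [].
apply: ereal_sup_ubound; exists k; [move=> x|].
 rewrite kE indicE; have [Nx|nNx] := boolP (x \in ~` N); last by rewrite mulr0.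
 rewrite mulr1; apply: le_trans (hf x) _; apply: contrapT => h1.
 by move: Nx; rewrite in_setC => /negP; apply; rewrite inE; apply: subN.
rewrite -!integralT_nnsfun; apply: ae_eq_integral => //; try exact/mEFinP.
exists N; split => // x /= H; apply: contrapT => nNx; apply: H => _.
by congr EFin; apply: etrans (kE x) _; rewrite indicE mem_set// mulr1.
Qed.

(** This moves an integral from a function measurable only for the completed sigma-algebra to a
    Borel version of it. *)
Lemma ae_integral (f g : T -> \bar R) : {ae mu, forall x, f x = g x} ->
 \int[mu]_x f x = \int[mu]_x g x.
Proof.
move=> fg; rewrite integralE [RHS]integralE; congr (_ - _); apply/eqP; rewrite eq_le;
 apply/andP; split; apply: ge0_le_integral_ae => //; apply: filterS fg => x H;
 by rewrite ?funeposE ?funenegE H.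
Qed.

Lemma ae_Lnorm r (f g : T -> \bar R) : {ae mu, forall x, f x = g x} -> 'N[mu]_r%:E[f] = 'N[mu]_r%:E[g].
Proof.
by move=> fg; rewrite unlock; congr (_ `^ _); apply: ae_integral; apply: filterS fg => x ->.
Qed.

End integral_nonmeasurable.

(** * Borel representatives of elements of the function spaces over [U] *)

Section representatives.
Context {R : realType} {d : nat}.
Notation V := 'rV[R]_d.
Notation mu := (@lebesgue_rV R d).
Notation e_ i := (delta_mx ord0 i : V).
Variable U : set V.
Hypotheses (oU : open U)
 (fU : (mu U < +oo)%E).
Implicit Types (f g u v : V -> R) (G : V -> V) (H : 'I_d -> V -> R).

Let mU : measurable U := open_meas oU.

(** The link between the functions of the statement and the proof: [g] is Borel on the whole space
    and agrees a.e. with the extension of [f] by zero, so norms and integrals over [U] become those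
    of [g]. *)
Definition repr f g := mfun g /\ {ae mu, forall x, zext U f x = g x}.

Lemma zextE f x : U x -> zext U f x = f x.
Proof. by move=> Ux; rewrite /zext patchE mem_set. Qed.

Lemma zext0 f x : ~ U x -> zext U f x = 0.
Proof. by move=> Ux; rewrite /zext patchE memNset. Qed.

Lemma reprP f g : repr f g <-> [/\ mfun g,
 {ae mu, forall x, U x -> f x = g x} & {ae mu, forall x, ~ U x -> g x = 0}].
Proof.
split=> [[mg fg]|[mg fg g0]]; split => //.
- by apply: filterS fg => x + Ux; rewrite zextE.
- by apply: filterS fg => x <- Ux; rewrite zext0.
apply: filterS2 fg g0 => x h1 h2; have [Ux|nUx] := pselect (U x).
 by rewrite zextE// h1.
by rewrite zext0// h2.
Qed.

Lemma ae_measurable_repr f : ae_measurable U f ->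
 exists2 g, repr f g & forall x, ~ U x -> g x = 0.
Proof.
move=> [g mg fg]; exists (fun x => \1_U x * g x).
 apply/reprP; split; first by apply: mfunM => //; exact: mindic.
 by apply: filterS fg => x + Ux => -> //; rewrite indicE mem_set// mul1r.
 by apply: nearW => x nUx; rewrite indicE memNset// mul0r.
by move=> x nUx; rewrite indicE memNset// mul0r.
Qed.

Lemma repr_ae_measurable f g : repr f g -> ae_measurable U f.
Proof. by move=> /reprP[mg fg _]; exists g. Qed.

Lemma repr_comb (b : R -> R -> R) f1 f2 g1 g2 : b 0 0 = 0 ->
 (mfun g1 -> mfun g2 -> mfun (fun x => b (g1 x) (g2 x))) ->
 repr f1 g1 -> repr f2 g2 -> repr (fun x => b (f1 x) (f2 x)) (fun x => b (g1 x) (g2 x)).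
Proof.
move=> b0 mb [m1 h1] [m2 h2]; split; first exact: mb.
apply: filterS2 h1 h2 => x <- <-; have [Ux|nUx] := pselect (U x).
 by rewrite !zextE.
by rewrite !zext0.
Qed.

Lemma repr_test phi : testf U phi -> repr phi phi.
Proof.
move=> tphi; apply/reprP; split; first exact: test_meas tphi.
 exact: nearW.
by apply: nearW => x; exact: test_off tphi.
Qed.

Lemma repr_ext f f' g : f =1 f' -> repr f g -> repr f' g.
Proof. by move=> /funext <-. Qed.

Lemma reprD f1 f2 g1 g2 : repr f1 g1 -> repr f2 g2 ->
 repr (fun x => f1 x + f2 x) (fun x => g1 x + g2 x).
Proof. by apply: (@repr_comb +%R); [rewrite addr0|exact: measurable_funD]. Qed.

Lemma reprB f1 f2 g1 g2 : repr f1 g1 -> repr f2 g2 ->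
 repr (fun x => f1 x - f2 x) (fun x => g1 x - g2 x).
Proof. by apply: (@repr_comb (fun a b => a - b)); [rewrite subr0|exact: mfunB]. Qed.

Lemma reprM f1 f2 g1 g2 : repr f1 g1 -> repr f2 g2 ->
 repr (fun x => f1 x * f2 x) (fun x => g1 x * g2 x).
Proof. by apply: (@repr_comb *%R); [rewrite mulr0|exact: mfunM]. Qed.

Lemma reprZ a f g : repr f g -> repr (fun x => a * f x) (fun x => a * g x).
Proof.
move=> h; apply: (@repr_comb (fun x _ => a * x) f f g g) => //; first by rewrite mulr0.
by move=> m1 _; apply: mfunM => //; exact: mcst.
Qed.

Lemma repr_sum (I : finType) (f g : I -> V -> R) : (forall i, repr (f i) (g i)) ->
 repr (fun x => \sum_i f i x) (fun x => \sum_i g i x).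
Proof.
move=> h.
suff H (s : seq I) : repr (fun x => \sum_(i <- s) f i x) (fun x => \sum_(i <- s) g i x) by exact: H.
elim: s => [|i s IH].
 under eq_fun do rewrite big_nil; under [X in repr _ X]eq_fun do rewrite big_nil.
 apply/reprP; split; [exact: mcst|exact: nearW|exact: nearW].
under eq_fun do rewrite big_cons; under [X in repr _ X]eq_fun do rewrite big_cons.
exact: reprD.
Qed.

Lemma repr_unique f g1 g2 : repr f g1 -> repr f g2 -> {ae mu, forall x, g1 x = g2 x}.
Proof. by move=> [_ h1] [_ h2]; apply: filterS2 h1 h2 => x <- <-. Qed.

Lemma repr_trans f g1 g2 : mfun g2 -> {ae mu, forall x, g1 x = g2 x} ->
 repr f g1 -> repr f g2.
Proof. by move=> m2 h [m1 h1]; split => //; apply: filterS2 h h1 => x <- <-. Qed.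

Lemma Rint_repr f g : repr f g -> \int[mu]_(x in U) f x = \int[mu]_x g x.
Proof.
move=> [mg fg]; congr fine; rewrite integral_mkcond; apply: ae_integral.
by apply: filterS fg => x <-; rewrite restrict_EFin.
Qed.

Lemma Lpnorm_repr_int f g : repr f g ->
 Lpnorm U 2%:E f = ((\int[mu]_x (g x ^+ 2)%:E) `^ 2^-1)%E.
Proof.
move=> [mg fg]; rewrite /Lpnorm (@ae_Lnorm _ _ _ mu 2 _ (EFin \o g)).
 rewrite unlock /=; congr (_ `^ _)%E; apply: eq_integral => x _.
 by rewrite powR_mulrn ?normr_ge0// real_normK ?num_real.
by apply: filterS fg => x /= ->.
Qed.

Lemma Lpnorm_repr f g : repr f g -> L2 mu g -> Lpnorm U 2%:E f = (nr mu g)%:E.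
Proof.
move=> fg Lg; rewrite (Lpnorm_repr_int fg) nr_sq_int// poweR_EFin powR12_sqrt ?sqr_ge0//.
by rewrite sqrtr_sqr ger0_norm ?nr_ge0.
Qed.

Lemma Lpnorm_repr_L2 f g : repr f g -> (Lpnorm U 2%:E f < +oo)%E -> L2 mu g.
Proof.
move=> fg; have [mg _] := fg; rewrite (Lpnorm_repr_int fg) => h; split => //.
apply/integrableP; split; first by apply/mEFinP; exact: measurable_funX.
rewrite (eq_integral (fun x => (g x ^+ 2)%:E)); last first.
 by move=> x _ /=; rewrite ger0_norm ?sqr_ge0.
rewrite ltey; apply/eqP => E; move: h; rewrite E poweRyr ?ltxx//.
Qed.

Lemma in_Lp2P f : in_Lp U 2%:E f ->
 exists2 g, repr f g & L2 mu g /\ forall x, ~ U x -> g x = 0.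
Proof.
move=> [/ae_measurable_repr[g fg g0] h]; exists g => //; split => //.
exact: Lpnorm_repr_L2 h.
Qed.

Lemma repr_in_Lp2 f g : repr f g -> L2 mu g -> in_Lp U 2%:E f.
Proof.
move=> fg Lg; split; first exact: repr_ae_measurable fg.
by rewrite (Lpnorm_repr fg Lg) ltry.
Qed.

Definition vrepr G H := forall i, repr (fun x => G x ord0 i) (H i).

Let sqH H := fun x => Num.sqrt (\sum_i H i x ^+ 2).

Lemma vrepr_enorm G H : vrepr G H -> repr (enorm \o G) (sqH H).
Proof.
move=> h.
have hs : repr (fun x => \sum_i G x ord0 i * G x ord0 i) (fun x => \sum_i H i x * H i x).
 by apply: repr_sum => i; exact: reprM.
have ms : mfun (@Num.sqrt R).
 by apply: continuous_measurable_fun; exact: sqrt_continuous.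
have := @repr_comb (fun x _ => Num.sqrt x) _ _ _ _ (sqrtr0 _) _ hs hs.
have -> : sqH H = (fun x => Num.sqrt (\sum_i H i x * H i x)).
 by apply/funext => x; congr Num.sqrt; apply: eq_bigr => i _; rewrite expr2.
by apply => m1 _; apply: (mcomp ms).
Qed.

Lemma sqH_sq H x : sqH H x ^+ 2 = \sum_i H i x ^+ 2.
Proof. by rewrite sqr_sqrtr// sumr_ge0// => i _; exact: sqr_ge0. Qed.

Lemma measurable_sqH H : (forall i, mfun (H i)) -> mfun (sqH H).
Proof.
move=> mH; apply: (mcomp (f := @Num.sqrt R)).
 by apply: continuous_measurable_fun; exact: sqrt_continuous.
by apply: measurable_sum => i; exact: measurable_funX.
Qed.

Lemma L2_sqH H : (forall i, L2 mu (H i)) -> L2 mu (sqH H) /\ nr mu (sqH H) = gnr H.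
Proof.
move=> LH; have L : L2 mu (sqH H).
 split; first by apply: measurable_sqH => i; exact: L2_meas (LH i).
 under eq_fun do rewrite sqH_sq.
 by apply: intg_sum => i; have [] := LH i.
split => //; congr Num.sqrt.
rewrite /ip; under eq_Rintegral do rewrite -expr2 sqH_sq.
rewrite Rint_sum; last by move=> i; have [] := LH i.
by apply: eq_bigr => i _; rewrite nr_sq; apply: eq_Rintegral => x _; rewrite expr2.
Qed.

Lemma Lpnorm_vrepr G H : vrepr G H -> (forall i, L2 mu (H i)) ->
 Lpnorm U 2%:E (enorm \o G) = (gnr H)%:E.
Proof.
move=> h LH; have [L <-] := L2_sqH LH.
exact: Lpnorm_repr (vrepr_enorm h) L.
Qed.

Lemma in_Lp_vec2P G : in_Lp_vec U 2%:E G ->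
 exists2 H, vrepr G H & (forall i, L2 mu (H i)) /\ forall i x, ~ U x -> H i x = 0.
Proof.
move=> [/(fun h i => ae_measurable_repr (h i)) h hG].
have /choice[H hH] : forall i, exists g, repr (fun x => G x ord0 i) g /\ forall x, ~ U x -> g x = 0.
 by move=> i; have [g] := h i; exists g.
exists H; first by move=> i; have [] := hH i.
split=> i; last by have [] := hH i.
have mH j : mfun (H j) by have [[]] := hH j.
have := Lpnorm_repr_L2 (vrepr_enorm (fun i => (hH i).1)) hG.
apply: L2_le => // x.
rewrite (ger0_norm (sqrtr_ge0 _)) -sqrtr_sqr ler_wsqrtr// (bigD1 i)//=.
by rewrite lerDl sumr_ge0// => j _; exact: sqr_ge0.
Qed.

Lemma vrepr_in_Lp G H : vrepr G H -> (forall i, L2 mu (H i)) -> in_Lp_vec U 2%:E G.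
Proof.
move=> h LH; split; first by move=> i; exact: repr_ae_measurable (h i).
by rewrite (Lpnorm_vrepr h LH) ltry.
Qed.

Lemma L2_intg g : L2 mu g -> (forall x, ~ U x -> g x = 0) -> intg mu g.
Proof.
move=> Lg g0; apply: (intg_le (L2_meas Lg) _ (intgD (intg_indicU mU fU) (L2_sq Lg))).
move=> x; rewrite indicE; have [Ux|nUx] := boolP (x \in U); last first.
 by rewrite g0 ?normr0 ?expr0n ?addr0//; rewrite notin_setE in nUx.
rewrite -[X in _ + X]real_normK ?num_real//.
rewrite mulr1n.
by set y := `|g x|; have := sqr_ge0 (y - 1); have : 0 <= y := normr_ge0 _; nra.
Qed.

Lemma wgrad_repr u v G H : repr u v -> vrepr G H -> is_weak_grad U u G <-> wgrad U v H.
Proof.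
move=> uv GH; split => h phi tphi i.
 rewrite -(Rint_repr (reprM uv (repr_test (test_derive i tphi)))) h//.
 by rewrite (Rint_repr (reprM (GH i) (repr_test tphi))).
rewrite (Rint_repr (reprM uv (repr_test (test_derive i tphi)))) h//.
by rewrite (Rint_repr (reprM (GH i) (repr_test tphi))).
Qed.

Lemma wgrad_unique v H1 H2 : (forall i, L2 mu (H1 i)) -> (forall i, L2 mu (H2 i)) ->
 wgrad U v H1 -> wgrad U v H2 -> forall i, {ae mu, forall x, U x -> H1 i x = H2 i x}.
Proof.
move=> L1 L2_ w1 w2 i.
have LB := L2B (L1 i) (L2_ i).
pose g x := \1_U x * (H1 i x - H2 i x).
have Lg : L2 mu g.
 apply: (L2_bmul (C := 1)) LB; first exact: mindic.
 by move=> x; rewrite indicE; case: (_ \in _); rewrite ?normr1 ?normr0.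
have jg : intg mu g.
 by apply: L2_intg => // x nUx; rewrite /g indicE memNset// mul0r.
have := weak_zero_ae oU jg.
suff h : forall phi, testf U phi -> \int[mu]_x (g x * phi x) = 0.
 move=> /(_ h); apply: filterS => x gx Ux; apply/eqP; rewrite -subr_eq0; apply/eqP.
 by have := gx Ux; rewrite /g indicE mem_set// mul1r.
move=> phi tphi; have Lphi := test_L2 tphi.
have := w1 phi tphi i; rewrite w2// => /oppr_inj E.
rewrite (@eq_Rintegral _ _ _ _ _ (fun x => H1 i x * phi x - H2 i x * phi x)).
 by rewrite RintegralB ?E ?subrr//; exact: L2_mul.
move=> x _; rewrite /g indicE; have [Ux|nUx] := boolP (x \in U).
 by rewrite mul1r mulrBl.
by rewrite (test_off tphi) ?mulr0 ?subrr//; rewrite notin_setE in nUx.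
Qed.

Lemma h10p_offG v H i : h10p U v H -> {ae mu, forall x, ~ U x -> H i x = 0}.
Proof.
move=> [Lv LG [p [tp pv pG]]].
have mI : mfun (\1_(~` U) : V -> R).
 by apply: mindic; exact: measurableC.
have I1 x : `|\1_(~` U) x : R| <= 1 by rewrite indicE; case: (_ \in _); rewrite ?normr1 ?normr0.
have := L2cvg_bmul mI I1 (fun n => test_derive_L2 i (tp n)) (LG i) (pG i).
have -> : (fun n x => \1_(~` U) x * 'D_(e_ i) (p n) x) = (fun=> fun=> 0).
 apply/funext => n; apply/funext => x; rewrite indicE.
 have [Ux|nUx] := pselect (U x); first by rewrite memNset ?mul0r//; exact.
 by rewrite (test_off (test_derive i (tp n)))// mulr0.
have Lw : L2 mu (fun x => \1_(~` U) x * H i x) by exact: L2_bmul I1 (LG i).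
move=> c0.
have c1 : (fun=> nr mu (fun x => 0 - \1_(~` U) x * H i x)) @ \oo -->
 nr mu (fun x => 0 - \1_(~` U) x * H i x) by exact: cvg_cst.
have : nr mu (fun x => 0 - \1_(~` U) x * H i x) = 0 by exact: (cvg_unique _ c1 c0).
rewrite nrBC (@eq_nr _ _ _ _ _ (fun x => \1_(~` U) x * H i x)); last by move=> x; rewrite subr0.
move=> /(nr_eq0_ae Lw); apply: filterS => x + nUx.
by rewrite indicE mem_set// mul1r.
Qed.

(* The chosen gradient [grad U u] is any square integrable weak gradient, up to null sets. *)
Lemma vrepr_grad u v H : repr u v -> wgrad U v H -> (forall i, L2 mu (H i)) ->
 (forall i, {ae mu, forall x, ~ U x -> H i x = 0}) -> vrepr (grad U u) H.
Proof.
move=> uv wH LH H0.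
have GH : vrepr (fun x => \row_i H i x) H.
 move=> i; apply/reprP; split; [exact: L2_meas (LH i)| |exact: H0].
 by apply: nearW => x _; rewrite mxE.
have : exists G, in_Lp_vec U 2%:E G /\ is_weak_grad U u G.
 exists (fun x => \row_i H i x); split; first exact: vrepr_in_Lp GH LH.
 exact/(wgrad_repr uv GH).
move=> /(@xgetPex _ (fun=> 0) [set G | in_Lp_vec U 2%:E G /\ is_weak_grad U u G]).
rewrite -/(grad U u) => -[/in_Lp_vec2P[H' gH' [LH' _]] /(wgrad_repr uv gH') wH'] i.
have := wgrad_unique LH' LH wH' wH i => E.
have /reprP[mH' h1 h2] := gH' i; apply/reprP; split; [exact: L2_meas (LH i)| |exact: H0].
by apply: filterS2 h1 E => x a b Ux; rewrite a// b.
Qed.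

Lemma cvg_sum_sqr0 m (f : 'I_m -> nat -> R) : (forall i, f i n @[n --> \oo] --> 0) ->
 (\sum_i f i n ^+ 2) @[n --> \oo] --> 0.
Proof.
move=> f0; pose l : R := \sum_(i < m) (0 * 0).
have c1 : (\sum_i f i n ^+ 2) @[n --> \oo] --> l.
 apply: cvg_big => [|i _]; first exact: add_continuous.
 by under eq_fun do rewrite expr2; apply: cvgM; exact: f0.
by rewrite /l big1 in c1 => // i _; rewrite mulr0.
Qed.

(** Together with [H10_pair] this is the dictionary between pairs and [H10]; it also identifies the
    chosen gradient and the norm. *)
Lemma pair_H10 u v H : repr u v -> h10p U v H ->
 [/\ H10 U u, vrepr (grad U u) H & H10norm U u = (gnr H)%:E].
Proof.
move=> uv pv; have [Lv LH [p [tp cp cD]]] := pv.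
have H0 i := h10p_offG i pv.
have GH : vrepr (grad U u) H by apply: vrepr_grad uv (h10p_wgrad pv) LH H0.
split => //; last exact: Lpnorm_vrepr GH LH.
split.
 split; first exact: repr_in_Lp2 uv Lv.
 exists (grad U u); first exact: vrepr_in_Lp GH LH.
 exact/(wgrad_repr uv GH)/(h10p_wgrad pv).
exists p => //.
have E n : H12norm U (u \- p n) = (Num.sqrt (nr mu (fun x => p n x - v x) ^+ 2 +
 gnr (fun i x => 'D_(e_ i) (p n) x - H i x) ^+ 2))%:E.
 have uvn : repr (u \- p n) (fun x => v x - p n x) by apply: reprB uv (repr_test (tp n)).
 have pB := h10pB pv (h10p_test (tp n)).
 have [LB LBH _] := pB.
 have GB := vrepr_grad uvn (h10p_wgrad pB) LBH (fun i => h10p_offG i pB).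
 rewrite /H12norm (Lpnorm_repr uvn LB) (Lpnorm_vrepr GB LBH) -!EFin_expe.
 rewrite -EFinD poweR_EFin powR12_sqrt; last by rewrite addr_ge0 ?sqr_ge0.
 rewrite nrBC !gnr_sq.
 by under eq_bigr do rewrite nrBC.
under eq_fun do rewrite E; apply: cvg_EFin; first exact: nearW.
have -> : fine \o (fun n => (Num.sqrt (nr mu (fun x => p n x - v x) ^+ 2 +
 gnr (fun i x => 'D_(e_ i) (p n) x - H i x) ^+ 2))%:E) = Num.sqrt \o (fun n => (nr mu (fun x => p n x - v x) ^+ 2 +
 gnr (fun i x => 'D_(e_ i) (p n) x - H i x) ^+ 2)) by [].
have c1 : (fun n => (nr mu (fun x => p n x - v x) ^+ 2 +
 gnr (fun i x => 'D_(e_ i) (p n) x - H i x) ^+ 2)) @ \oo --> (0 : R).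
 rewrite -[0]addr0; apply: cvgD.
 by rewrite -[0](mulr0 0); under eq_fun do rewrite expr2; exact: cvgM.
 by under eq_fun do rewrite gnr_sq; apply: cvg_sum_sqr0 => i; exact: cD.
by have := cvg_comp _ _ c1 (@sqrt_continuous R 0); rewrite sqrtr0.
Qed.

Lemma H10_pair u : H10 U u -> exists v H,
 [/\ repr u v, vrepr (grad U u) H, h10p U v H & forall x, ~ U x -> v x = 0].
Proof.
move=> [[/in_Lp2P[v uv [Lv v0]] [G LG wG]] [p tp cp]].
have [H GH [LH H0]] := in_Lp_vec2P LG.
have wH := (wgrad_repr uv GH).1 wG.
have gH : vrepr (grad U u) H.
 by apply: vrepr_grad uv wH LH _ => i; apply: nearW => x; exact: H0.
exists v, H; split => //; split => //; exists p.
have E n : H12norm U (u \- p n) = (Num.sqrt (nr mu (fun x => p n x - v x) ^+ 2 +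
 \sum_i nr mu (fun x => 'D_(e_ i) (p n) x - H i x) ^+ 2))%:E.
 have uvn : repr (u \- p n) (fun x => v x - p n x) by apply: reprB uv (repr_test (tp n)).
 have LB : L2 mu (fun x => v x - p n x) by apply: L2B => //; exact: test_L2 (tp n).
 have LBH i : L2 mu (fun x => H i x - 'D_(e_ i) (p n) x) by apply: L2B => //; exact: test_derive_L2 (tp n).
 have wB : wgrad U (fun x => v x - p n x) (fun i x => H i x - 'D_(e_ i) (p n) x).
 move=> phi tphi i; have Lphi := test_L2 tphi; have LD := test_derive_L2 i tphi.
 have Lpn := test_L2 (tp n); have LDn := test_derive_L2 i (tp n).
 under eq_Rintegral do rewrite mulrBl.
 under [in RHS]eq_Rintegral do rewrite mulrBl.
 rewrite !RintegralB//; try exact: L2_mul.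
 by rewrite wH// (test_wgrad (tp n))// opprB opprK addrC.
 have GB := vrepr_grad uvn wB LBH.
 rewrite /H12norm (Lpnorm_repr uvn LB) (Lpnorm_vrepr (GB _) LBH); last first.
 by move=> i; apply: nearW => x nUx; rewrite H0// (test_off (test_derive i (tp n)))// subrr.
 rewrite -!EFin_expe -EFinD poweR_EFin powR12_sqrt; last by rewrite addr_ge0 ?sqr_ge0.
 rewrite nrBC gnr_sq.
 by under eq_bigr do rewrite nrBC.
have S0 n : 0 <= \sum_i nr mu (fun x => 'D_(e_ i) (p n) x - H i x) ^+ 2.
 by apply: sumr_ge0 => i _; exact: sqr_ge0.
have c1 : (fun n => Num.sqrt (nr mu (fun x => p n x - v x) ^+ 2 +
 \sum_i nr mu (fun x => 'D_(e_ i) (p n) x - H i x) ^+ 2)) @ \oo --> (0 : R).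
 have E' : (fun n => H12norm U (u \- p n)) = EFin \o (fun n => Num.sqrt (nr mu (fun x => p n x - v x) ^+ 2 +
  \sum_i nr mu (fun x => 'D_(e_ i) (p n) x - H i x) ^+ 2)) by apply/funext => n; exact: E.
 by rewrite E' in cp; move/fine_cvgP : cp => [].
split => //.
 apply: cvg0_le c1 => n; rewrite ger0_norm ?nr_ge0//.
 by rewrite -[leLHS]ger0_norm ?nr_ge0// -sqrtr_sqr ler_wsqrtr// lerDl.
move=> i; apply: cvg0_le c1 => n; rewrite ger0_norm ?nr_ge0//.
rewrite -[leLHS]ger0_norm ?nr_ge0// -sqrtr_sqr ler_wsqrtr// (bigD1 i)//= addrCA lerDl.
by rewrite addr_ge0 ?sqr_ge0// sumr_ge0// => j _; exact: sqr_ge0.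
Qed.

End representatives.

(** * Weak derivatives in time and the fundamental theorem of calculus *)

Section weak_time_derivative.
Context {R : realType}.
Notation leb := (@lebesgue_measure R).
Implicit Types (f q k : R -> R) (s t l e x : R).

Lemma nd_derive1_ge0 f (x : R) l : {homo f : x y / x <= y} -> is_derive x 1 f l -> 0 <= l.
Proof.
move=> nd [df fl]; rewrite -fl; apply: (ler_cvg_to (cvg_cst 0) df).
apply: nearW => h /=; rewrite /GRing.scale/= mulr1.
have [h1|h1] := leP 0 h.
 by rewrite mulr_ge0 ?invr_ge0// subr_ge0 nd// lerDr.
by rewrite mulr_le0 ?invr_le0 ?(ltW h1)// subr_le0 nd// gerDr ltW.
Qed.

Lemma derive1_locally_cst f (U : set R) (c x : R) : open U -> U x -> (forall y, U y -> f y = c) ->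
 derive1 f x = 0.
Proof.
move=> oU Ux fU; rewrite derive1E (@near_eq_derive _ _ _ f (fun=> c)); first by rewrite derive_cst.
by have : nbhs x U by [exact: open_nbhs_nbhs]; apply: filterS => y /fU.
Qed.

Lemma intg_itv_continuous k (a b : R) : continuous k -> (forall x, x \notin `[a, b] -> k x = 0) ->
 intg leb k.
Proof.
move=> ck k0.
have : leb.-integrable `[a, b] (EFin \o k).
 by apply: continuous_compact_integrable; [exact: segment_compact|exact: continuous_subspaceT].
move=> h; have := (@integrable_mkcond _ (measurableTypeR R) R leb `[a, b]%classic (EFin \o k) (mitv _)).1 h.
congr integrable; apply/funext => x; rewrite patchE mem_setE.
by case: ifPn => // /k0 /= ->.
Qed.

(* The derivative of [S (n (t - s))] is an approximate identity at [s]. *)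
Definition rstep (n : nat) (s t : R) := step (n.+1%:R * (t - s)).

Lemma rstepE n s t : rstep n s t = step (n.+1%:R * t + - (n.+1%:R * s)).
Proof. by rewrite /rstep mulrBr. Qed.

Lemma smooth_rstep n s : smooth (rstep n s).
Proof.
move=> k; apply: C1k_ext (smooth_affine n.+1%:R (- (n.+1%:R * s)) (@smooth_step R) k) => t.
by rewrite rstepE.
Qed.

Lemma rstep_nd n s : {homo rstep n s : x y / x <= y}.
Proof. by move=> x y xy; apply: step_nd; rewrite ler_pM2l// lerB. Qed.

Lemma rstep_le n s t : t <= s -> rstep n s t = 0.
Proof. by move=> ts; apply: step_le0; rewrite pmulr_rle0// subr_le0. Qed.

Lemma rstep_ge n s t : s + n.+1%:R^-1 <= t -> rstep n s t = 1.
Proof.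
move=> ts; apply: step_ge1; rewrite -ler_pdivrMl// mulr1 lerBrDl.
exact: ts.
Qed.

Lemma drstep_ge0 n s t : 0 <= derive1 (rstep n s) t.
Proof.
have [_ /(_ t) d] := smooth_derive (smooth_rstep n s).
exact: nd_derive1_ge0 (@rstep_nd n s) d.
Qed.

Lemma drstep_off n s t : t \notin `[s, s + n.+1%:R^-1] -> derive1 (rstep n s) t = 0.
Proof.
rewrite in_itv/= negb_and -!ltNge => /orP[ts|ts].
 apply: (@derive1_locally_cst _ `]-oo, s[%classic 0); [exact: interval_open|by rewrite /= in_itv|].
 move=> y; rewrite /= in_itv/= => ys; apply: rstep_le; exact: ltW.
apply: (@derive1_locally_cst _ `]s + n.+1%:R^-1, +oo[%classic 1); [exact: interval_open|by rewrite /= in_itv/= andbT|].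
move=> y; rewrite /= in_itv/= andbT => ys; apply: rstep_ge; exact: ltW.
Qed.

Lemma continuous_drstep n s : continuous (derive1 (rstep n s)).
Proof. by have [sd _] := smooth_derive (smooth_rstep n s); exact: smooth_continuous. Qed.

Lemma intg_drstep n s : intg leb (derive1 (rstep n s)).
Proof.
apply: (@intg_itv_continuous _ s (s + n.+1%:R^-1)); first exact: continuous_drstep.
exact: drstep_off.
Qed.

Lemma Rint_drstep n s : \int[leb]_t derive1 (rstep n s) t = 1.
Proof.
have n0 : 0 < n.+1%:R^-1 :> R by rewrite invr_gt0.
have -> : 1 = rstep n s (s + n.+1%:R^-1) - rstep n s s :> R.
 by rewrite rstep_ge// rstep_le// subr0.
have [_ ds] := smooth_derive (smooth_rstep n s).
have cs : continuous (rstep n s) := smooth_continuous (smooth_rstep n s).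
have := @continuous_FTC2 R (derive1 (rstep n s)) (rstep n s) s (s + n.+1%:R^-1).
rewrite ltrDl n0 => /(_ isT) H.
rewrite -[RHS]/(fine (_%:E - _%:E)%E) -H; last 3 first.
- by apply: continuous_subspaceT; exact: continuous_drstep.
- split; first by move=> t _; have [] := ds t.
 + exact/cvg_at_right_filter/cs.
 + exact/cvg_at_left_filter/cs.
- by [].
rewrite /Rintegral [in RHS]integral_mkcond; congr fine; apply: eq_integral => t _.
by rewrite patchE mem_setE; case: ifPn => // /drstep_off ->.
Qed.

Lemma drstep_avg n s f l e : mfun f ->
 (forall t, t \in `[s, s + n.+1%:R^-1] -> `|f t - l| <= e) ->
 intg leb (fun t => derive1 (rstep n s) t * f t) /\
 `|\int[leb]_t (derive1 (rstep n s) t * f t) - l| <= e.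
Proof.
move=> mf fl; have jk := intg_drstep n s; set k : R -> R := derive1 _ in jk *.
have k0 t : 0 <= k t by exact: drstep_ge0.
have bd t : `|k t * (f t - l)| <= e * k t.
 have [ti|/drstep_off] := boolP (t \in `[s, s + n.+1%:R^-1]); last first.
 by rewrite -/k => ->; rewrite mul0r mulr0 normr0.
 by rewrite normrM (ger0_norm (k0 t)) mulrC ler_wpM2r// fl.
have mk := intg_meas jk.
have j1 : intg leb (fun t => k t * (f t - l)).
 apply: (@intg_le _ (measurableTypeR R) R leb _ (fun t => e * k t)) => //; last exact: intgZ.
 apply: mfunM => //.
 by apply: mfunB => //; exact: mcst.
have E : (fun t => k t * f t) = (fun t => k t * (f t - l) + l * k t).
 by apply/funext => t; ring.
have jl := intgZ l jk.
split; first by rewrite E; exact: intgD.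
rewrite E RintegralD// (RintegralZl l measurableT jk) Rint_drstep mulr1 addrK.
apply: le_trans (le_normr_Rintegral measurableT j1) _.
apply: (@le_trans _ _ (\int[leb]_t (e * k t))).
 by apply: Rint_le => //; [exact: intg_abs|exact: intgZ].
by rewrite (RintegralZl e measurableT jk) Rint_drstep mulr1.
Qed.

Lemma rstep_cvg s t : rstep n s t @[n --> \oo] --> ((s < t)%R%:R : R).
Proof.
have [ts|st] := leP t s.
 by apply: cvg_near_cst; apply: nearW => n; rewrite rstep_le.
apply: cvg_near_cst; have ts0 : 0 < t - s by rewrite subr_gt0.
have := near_infty_natSinv_lt (PosNum ts0); apply: filterS => n /= h.
by rewrite rstep_ge// -lerBrDl ltW.
Qed.

(** Test with a smoothed indicator of []t1, t2]]: its derivative is a difference of approximate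
    identities, which converges by continuity of [f]. In the hypothesis [q] is minus the weak
    derivative of [f], whence the sign in the conclusion. *)
Lemma weak_derivative_ftc (T : R) f q :
 {in `]0, T[, continuous f} -> intg leb (fun t => \1_`]0, T[ t * q t) ->
 (forall zeta, time_test_function T zeta -> smooth zeta ->
 \int[leb]_t (\1_`]0, T[ t * (zeta t * q t)) =
 \int[leb]_t (\1_`]0, T[ t * (derive1 zeta t * f t))) ->
 forall t1 t2, 0 < t1 -> t1 <= t2 -> t2 < T ->
 f t2 - f t1 = - \int[leb]_t (\1_`]t1, t2] t * q t).
Proof.
move=> cf jq H t1 t2 t10; rewrite le_eqVlt => /predU1P[<- _|t12 t2T].
 rewrite subrr /Rintegral integral0_eq ?oppr0// => t _.
 by rewrite indicE set_itvoc0// in_set0 mul0r.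
pose D : set R := `]0, T[%classic.
pose F t := \1_D t * f t.
have mF : mfun F.
 have : measurable_fun D f.
 by apply: open_continuous_measurable_fun => [|t]; [exact: interval_open|rewrite inE; exact: cf].
 move=> /(measurable_restrictT f (mitv _)).
 by congr measurable_fun; apply/funext => t; rewrite patchE /F indicE; case: ifPn => tD; rewrite ?mul1r ?mul0r.
have t1D : t1 \in `]0, T[ by rewrite in_itv/= t10 (lt_trans t12).
have t2D : t2 \in `]0, T[ by rewrite in_itv/= t2T (lt_trans t10).
have key s : s \in `]0, T[ -> (\int[leb]_t (derive1 (rstep n s) t * F t)) @[n --> \oo] --> f s.
 move=> sD; apply/cvgrPdist_le => e e0.
 have := cf s sD; move/cvgrPdist_le/(_ e e0) => fe.
 have := near_in_itvoo sD.
 move=> /(filterI fe) [d /= d0 Hd].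
 have := near_infty_natSinv_lt (PosNum d0); apply: filterS => n /= nd.
 rewrite distrC; apply: (drstep_avg mF _).2 => t; rewrite in_itv/= => /andP[st ts].
 have [|h1 h2] := Hd t.
 by rewrite /ball/= distrC ger0_norm ?subr_ge0// (le_lt_trans _ nd)// lerBlDl.
 by rewrite distrC /F indicE mem_set// mul1r.
have jkey s : s \in `]0, T[ -> \forall n \near \oo, intg leb (fun t => derive1 (rstep n s) t * F t).
 move=> sD; have := cf s sD; move/cvgrPdist_le/(_ 1 ltr01) => fe.
 have := near_in_itvoo sD.
 move=> /(filterI fe) [d /= d0 Hd].
 have := near_infty_natSinv_lt (PosNum d0); apply: filterS => n /= nd.
 apply: (@drstep_avg _ _ _ (f s) 1 mF _).1 => t; rewrite in_itv/= => /andP[st ts].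
 have [|h1 h2] := Hd t.
 by rewrite /ball/= distrC ger0_norm ?subr_ge0// (le_lt_trans _ nd)// lerBlDl.
 by rewrite distrC /F indicE mem_set// mul1r.
(* Each step needs a length [1/(n+1)] after its base point, so [z n] has its support in []0, T[]
   only once [t2 + 1/(n+1) < T]. *)
pose z n t := rstep n t1 t - rstep n t2 t.
have z1 n t : `|z n t| <= 1.
 rewrite ler_norml; have := step_ge0 (n.+1%:R * (t - t1)); have := step_le1 (n.+1%:R * (t - t1)).
 have := step_ge0 (n.+1%:R * (t - t2)); have := step_le1 (n.+1%:R * (t - t2)).
 by rewrite -/(rstep n t1 t) -/(rstep n t2 t) /z => *; apply/andP; split; lra.
have sz n : smooth (z n) by move=> k; apply: C1kB; exact: smooth_rstep.
have dz n t : derive1 (z n) t = derive1 (rstep n t1) t - derive1 (rstep n t2) t.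
 have [_ /(_ t) d1] := smooth_derive (smooth_rstep n t1).
 have [_ /(_ t) d2] := smooth_derive (smooth_rstep n t2).
 by rewrite derive1E; have [_ ->] := is_deriveB d1 d2.
have c1 : (\int[leb]_t (derive1 (rstep n t1) t * F t) - \int[leb]_t (derive1 (rstep n t2) t * F t))
 @[n --> \oo] --> f t1 - f t2 by apply: cvgB; exact: key.
have c2 : (\int[leb]_t (z n t * (\1_D t * q t))) @[n --> \oo] -->
 \int[leb]_t (\1_`]t1, t2] t * (\1_D t * q t)).
 apply: (@Rdct _ (measurableTypeR R) R leb _ _ (fun t => `|\1_D t * q t|)).
 - move=> n; apply: mfunM; last exact: intg_meas jq.
 by apply: continuous_measurable_fun; exact: smooth_continuous.
 - exact: intg_abs.
 - move=> t; apply: cvgMl.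
 have -> : \1_`]t1, t2] t = (t1 < t)%R%:R - (t2 < t)%R%:R :> R.
  rewrite indicE mem_setE in_itv/=; have [h|h] := ltP t2 t.
  by rewrite (lt_trans t12 h) andbF subrr.
  by rewrite subr0 andbT.
 by apply: cvgB; exact: rstep_cvg.
 - by move=> n t; rewrite normrM ler_piMl.
have E : \forall n \near \oo, \int[leb]_t (z n t * (\1_D t * q t)) =
 \int[leb]_t (derive1 (rstep n t1) t * F t) - \int[leb]_t (derive1 (rstep n t2) t * F t).
 have Tt : 0 < T - t2 by rewrite subr_gt0.
 apply: filterS3 (near_infty_natSinv_lt (PosNum Tt)) (jkey _ t1D) (jkey _ t2D) => n /= nT0 j1 j2.
 have nT : t2 + n.+1%:R^-1 < T by rewrite -ltrBrDl.
 have tz : time_test_function T (z n).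
 split; first by move=> k t; exact: smooth_derive1n.
 exists `[t1, t2 + n.+1%:R^-1]%classic; split; first exact: segment_compact.
  move=> t /=; rewrite !in_itv/= => /andP[a b].
  by rewrite (lt_le_trans t10 a) (le_lt_trans b nT).
 move=> t /= /negP; rewrite in_itv/= negb_and -!ltNge => /orP[h|h].
  by rewrite /z !rstep_le ?subrr// ltW// (lt_trans h t12).
 rewrite /z !rstep_ge ?subrr//; first exact: ltW.
 by rewrite (le_trans _ (ltW h))// lerD2r ltW.
 transitivity (\int[leb]_t (\1_D t * (z n t * q t))).
 by apply: eq_Rintegral => t _; rewrite mulrCA.
 rewrite H// -(RintB j1 j2); apply: eq_Rintegral => t _.
 by rewrite dz -mulrBl /F mulrCA.
have c3 : (\int[leb]_t (z n t * (\1_D t * q t))) @[n --> \oo] --> f t1 - f t2.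
 by apply: cvg_trans c1; apply: near_eq_cvg; apply: filterS E.
rewrite -opprB; congr (- _); rewrite (cvg_unique _ c3 c2)//.
apply: eq_Rintegral => t _; rewrite mulrA; congr (_ * _).
rewrite !indicE !mem_setE; have [|//] := boolP (t \in `]t1, t2]); last by rewrite mul0r.
rewrite in_itv/= => /andP[a b].
by rewrite in_itv/= (lt_trans t10 a) (le_lt_trans b t2T) mul1r.
Qed.

End weak_time_derivative.

(** * Measurable versions of a.e. limits *)

Section measurable_limits.
Context disp (T : measurableType disp) (R : realType) (mu : {measure set T -> \bar R}).

Lemma ae_mono (P Q : T -> Prop) : {ae mu, forall t, P t} -> (forall t, P t -> Q t) ->
 {ae mu, forall t, Q t}.
Proof. by move=> h PQ; apply: filterS h. Qed.

Lemma ae_mono2 (P Q S : T -> Prop) : {ae mu, forall t, P t} -> {ae mu, forall t, Q t} ->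
 (forall t, P t -> Q t -> S t) -> {ae mu, forall t, S t}.
Proof. by move=> hP hQ PQ; apply: filterS2 hP hQ. Qed.

Lemma ae_mono3 (P Q S W : T -> Prop) : {ae mu, forall t, P t} -> {ae mu, forall t, Q t} ->
 {ae mu, forall t, S t} -> (forall t, P t -> Q t -> S t -> W t) -> {ae mu, forall t, W t}.
Proof. by move=> hP hQ hS PQ; apply: filterS3 hP hQ hS. Qed.

Lemma ae_all (P : T -> Prop) : (forall t, P t) -> {ae mu, forall t, P t}.
Proof. by move=> h; apply: nearW. Qed.

Lemma cvg_fineP (f : nat -> R) l : (fun n => (f n)%:E) @ \oo --> l%:E <-> f @ \oo --> l.
Proof.
split => [/fine_cvgP[_]|h]; first by [].
by apply/fine_cvgP; split => //; exact: nearW.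
Qed.

Lemma cvg_ext (S : Type) (Y : topologicalType) (F : set_system S) (f g : S -> Y) (l : Y) :
 (forall n, f n = g n) -> f @ F --> l -> g @ F --> l.
Proof. by move=> /funext ->. Qed.

Lemma intg_indic_fin (B : set T) : measurable B -> (mu B < +oo)%E -> intg mu (\1_B : T -> R).
Proof.
move=> mB fB; apply/integrableP; split; first by apply/mEFinP; exact: mindic.
rewrite (eq_integral (fun t => (\1_B t)%:E)); first by rewrite integral_indic// setIT.
by move=> t _ /=; rewrite ger0_norm// indicE.
Qed.

(** The upper limit is defined and measurable everywhere and equals the limit wherever there is
    one. *)
Lemma ae_lim_measurable (D : set T) (f_ : nat -> T -> R) (w : T -> R) :
 (forall n, mfun (f_ n)) ->
 {ae mu, forall t, D t -> f_ n t @[n --> \oo] --> w t} ->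
 exists2 q : T -> R, mfun q & {ae mu, forall t, D t -> w t = q t}.
Proof.
move=> mf fw; exists (fun t => fine (limn_esup (fun n => (f_ n t)%:E))).
 apply: (mcomp (f := fine)) => //.
 by apply: measurable_fun_limn_esup => n; apply/mEFinP.
apply: filterS fw => t + Dt => /(_ Dt) ft.
have c : (fun n => (f_ n t)%:E) @ \oo --> (w t)%:E by exact/cvg_fineP.
by rewrite is_cvg_limn_esupE ?(cvg_lim _ c)//; apply/cvg_ex; exists (w t)%:E.
Qed.

End measurable_limits.

(** * From Bochner integrals in H^{-1} to scalar integrals *)

Section pairing.
Context {R : realType} {d : nat}.
Notation V := 'rV[R]_d.
Notation leb := (@lebesgue_measure R).
Notation mT := (measurableTypeR R).
Variable U : set V.
Variable T : R.
Hypothesis T0 : 0 < T.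
Notation D := (`]0, T[%classic : set mT).
Implicit Types (v : V -> R) (t : R).

Let mD : measurable D. Proof. exact: mitv. Qed.

Lemma itv_fin (A : set mT) : measurable A -> (leb (A `&` D) < +oo)%E.
Proof.
move=> mA; apply: (@le_lt_trans _ _ (leb D)).
 by apply: le_measure; rewrite ?inE//; exact: measurableI.
by rewrite /= lebesgue_measure_itv/= lte_fin T0 -EFinD ltry.
Qed.

Lemma intg_indic_itv (A : set mT) : measurable A -> intg leb (fun t => \1_D t * \1_A t : R).
Proof.
move=> mA; rewrite (_ : (fun t => _) = \1_(A `&` D)).
 by apply: intg_indic_fin; [exact: measurableI|exact: itv_fin].
by apply/funext => t; rewrite indicI mulrC.
Qed.

Lemma Rint_indic_itv (A : set mT) : measurable A ->
 \int[leb]_t (\1_D t * \1_A t) = fine (leb (A `&` D)).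
Proof.
move=> mA; have mAD := measurableI _ _ mA mD.
rewrite /Rintegral -[A `&` D]setIT -(integral_indic leb measurableT mAD).
by congr fine; apply: eq_integral => t _; rewrite indicI mulrC.
Qed.

Lemma Hm1norm_ge F v : H10 U v -> (H10norm U v <= 1)%E -> (`|F v|%:E <= Hm1norm U F)%E.
Proof. by move=> Hv nv; apply: ereal_sup_ubound; exists v. Qed.

Lemma Hm1norm_ge0 F v : H10 U v -> (H10norm U v <= 1)%E -> (0 <= Hm1norm U F)%E.
Proof. by move=> Hv nv; apply: le_trans (Hm1norm_ge F Hv nv); rewrite lee_fin. Qed.

Lemma measurable_sf_eval (s : simple_fun R (V -> R)) v :
 (forall i, measurable (sf_set s i)) -> mfun (fun t : mT => sf_eval s t v).
Proof.
move=> ms; apply: measurable_sum => i; apply: mfunM; last exact: mcst.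
exact: mindic.
Qed.

Lemma sf_eval_integral (s : simple_fun R (V -> R)) v : (forall i, measurable (sf_set s i)) ->
 intg leb (fun t => \1_D t * sf_eval s t v) /\ \int[leb]_t (\1_D t * sf_eval s t v) = sf_integral D s v.
Proof.
move=> ms.
have E : (fun t : mT => \1_D t * sf_eval s t v) =
 (fun t => \sum_(i < sf_size s) sf_val s i v * (\1_D t * \1_(sf_set s i) t)).
 apply/funext => t; rewrite mulr_sumr; apply: eq_bigr => i _.
 by rewrite mulrA mulrC.
have j i : intg leb (fun t => sf_val s i v * (\1_D t * \1_(sf_set s i) t)).
 by apply: intgZ; exact: intg_indic_itv.
rewrite E; split; first by apply: intg_sum => i _; exact: j.
rewrite Rint_sum//; apply: eq_bigr => i _.
by rewrite (RintZl (intg_indic_itv (ms i))) Rint_indic_itv// mulrC.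
Qed.

Lemma approx_eval s (w : R -> (V -> R) -> R) v : H10 U v -> (H10norm U v <= 1)%E ->
 sf_approx (Hm1 U) (Hm1norm U) D s w ->
 exists2 q : mT -> R, mfun q & {ae leb, forall t, D t -> w t v = q t}.
Proof.
move=> Hv nv [vs sw]; apply: (@ae_lim_measurable _ _ _ leb D (fun n t => sf_eval (s n) t v)).
 by move=> n; apply: measurable_sf_eval => i; have [] := vs n i.
apply: (ae_mono sw) => t + Dt => /(_ Dt) c0.
have c1 : (fun n => `|sf_eval (s n) t v - w t v|%:E) @ \oo --> 0%E.
 apply: (squeeze_cvge _ (cvg_cst 0%E) c0); apply: nearW => n.
 by rewrite lee_fin normr_ge0/=; exact: (Hm1norm_ge _ Hv nv).
apply/subr_cvg0/norm_cvg0P.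
exact/cvg_fineP.
Qed.

(** Evaluation at [v] is dominated by the dual norm, a supremum over the unit ball, so the simple
    functions that define the Bochner integral converge in L^1 after evaluation. *)
Lemma bochner_eval (w : R -> (V -> R) -> R) I v : H10 U v -> (H10norm U v <= 1)%E ->
 is_bochner_integral (Hm1 U) (Hm1norm U) D w I ->
 exists q : mT -> R, [/\ mfun q, {ae leb, forall t, D t -> w t v = q t},
 intg leb (fun t => \1_D t * q t) & I v = \int[leb]_t (\1_D t * q t)].
Proof.
move=> Hv nv [XI [s [sw cw cI]]].
have [q mq wq] := approx_eval Hv nv sw; have [vs _] := sw.
have ms n i : measurable (sf_set (s n) i) by have [] := vs n i.
have mI1 : mfun (\1_D : mT -> R) by exact: mindic.
have js n := (sf_eval_integral v (ms n)).1.
have mdiff n : mfun (fun t : mT => \1_D t * sf_eval (s n) t v - \1_D t * q t).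
 by apply: mfunB; [exact: intg_meas (js n)|exact: mfunM].
have bd n : (\int[leb]_t `|\1_D t * sf_eval (s n) t v - \1_D t * q t|%:E <=
 \int[leb]_(t in D) Hm1norm U (sf_eval (s n) t \- w t)%R)%E.
 (* The dual norm, a supremum over an uncountable family, is not known to be measurable in time;
    monotonicity of the integral is used without it. *)
 rewrite [leRHS]integral_mkcond; apply: ge0_le_integral_ae => [t|t|].
 - by rewrite lee_fin.
 - by rewrite patchE; case: ifPn => // _; exact: Hm1norm_ge0 Hv nv.
 apply: (ae_mono wq) => t {}wq; rewrite patchE indicE; case: ifPn => tD.
 rewrite (_ : true%:R = 1)// !mul1r -wq; last exact: set_mem.
 exact: (Hm1norm_ge _ Hv nv).
 by rewrite (_ : false%:R = 0)// !mul0r subrr normr0.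
have c1 : (\int[leb]_t `|\1_D t * sf_eval (s n) t v - \1_D t * q t|%:E)%E @[n --> \oo] --> 0%E.
 apply: (squeeze_cvge _ (cvg_cst 0%E) cw); apply: nearW => n.
 by rewrite bd andbT; apply: integral_ge0 => t _; rewrite lee_fin.
have [N jN] : exists n, intg leb (fun t => \1_D t * sf_eval (s n) t v - \1_D t * q t).
 have /fine_cvgP[[N _ /(_ N (leqnn N)) fN] _] := c1.
 exists N; apply/integrableP; split; first exact/mEFinP.
 by rewrite ltey_eq fN.
have jq : intg leb (fun t => \1_D t * q t).
 have := intgB (js N) jN; congr intg; apply/funext => t.
 by rewrite opprB addrCA subrr addr0.
exists q; split => //.
have c2 : sf_integral D (s n) v @[n --> \oo] --> \int[leb]_t (\1_D t * q t).
 apply/subr_cvg0; apply: (@cvg0_le _ _ (fun n => \int[leb]_t `|\1_D t * sf_eval (s n) t v - \1_D t * q t|)).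
 move=> n; rewrite -(sf_eval_integral v (ms n)).2 -(RintB (js n) jq).
 by apply: le_normr_Rintegral => //; exact: intgB (js n) jq.
 apply/cvg_fineP; apply: cvg_ext c1 => n.
 rewrite /Rintegral fineK//; apply: integrable_fin_num => //.
 by apply: intg_abs; exact: intgB (js n) jq.
have c3 : sf_integral D (s n) v @[n --> \oo] --> I v.
 have c4 : (fun n => `|sf_integral D (s n) v - I v|%:E) @ \oo --> 0%E.
 apply: (squeeze_cvge _ (cvg_cst 0%E) cI); apply: nearW => n.
 by rewrite lee_fin normr_ge0/=; exact: (Hm1norm_ge _ Hv nv).
 by apply/subr_cvg0/norm_cvg0P; exact/cvg_fineP.
exact: (cvg_unique _ c3 c2).
Qed.

Lemma time_test_facts (eta : R -> R) : time_test_function T eta ->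
 [/\ mfun (eta : mT -> R), mfun (derive1 eta : mT -> R),
  exists C : R, forall t, `|eta t| <= C & exists C : R, forall t, `|derive1 eta t| <= C].
Proof.
move=> [sm [K [cK KD K0]]].
have dc (f : R -> R) : (forall t, derivable f t 1) -> continuous f.
 by move=> df t; apply/differentiable_continuous/derivable1_diffP.
have c0 : continuous eta by apply: dc; exact: (sm 0).
have c1 : continuous (derive1 eta) by apply: dc; exact: (sm 1).
have bdd (f : R -> R) : continuous f -> (forall t, ~ K t -> f t = 0) -> exists C : R, forall t, `|f t| <= C.
 move=> cf f0; have := continuous_compact (continuous_subspaceT cf) cK.
 move=> /compact_bounded[M [_ /(_ (`|M| + 1))]].
 rewrite (le_lt_trans (ler_norm M)) ?ltrDl// => /(_ isT) h.
 exists (`|M| + 1) => t; have [Kt|nKt] := pselect (K t); last by rewrite f0// normr0 addr_ge0.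
 by apply: h; exists t.
split; [exact: continuous_measurable_fun|exact: continuous_measurable_fun|exact: bdd|].
apply: bdd => // t nKt.
have cKl : closed K by apply: compact_closed => //; exact: Rhausdorff.
apply: (@derive1_locally_cst _ _ (~` K) 0) => //; exact: closed_openC.
Qed.

Lemma bochner_L2_eval (w : R -> (V -> R) -> R) v : H10 U v -> (H10norm U v <= 1)%E ->
 bochner_L2 (Hm1 U) (Hm1norm U) D w ->
 exists q : mT -> R, [/\ mfun q, {ae leb, forall t, D t -> w t v = q t} &
 L2 leb (fun t => \1_D t * q t)].
Proof.
move=> Hv nv [[_ [s sw]] wL2].
have [q mq wq] := approx_eval Hv nv sw.
have mq1 : mfun (fun t => \1_D t * q t).
 by apply: mfunM => //; exact: mindic.
exists q; split => //; split => //; apply/integrableP; split.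
 by apply/mEFinP; exact: measurable_funX.
move: wL2; rewrite /bochner_L2norm unlock /= => h.
apply: (@le_lt_trans _ _ (\int[leb]_t (`|(patch (fun=> 0) D (fun t => Hm1norm U (w t))) t| `^ 2)))%E.
 apply: ge0_le_integral_ae => [t|t|]; [by rewrite lee_fin|exact: poweR_ge0|].
 apply: (ae_mono wq) => t {}wq; rewrite patchE indicE; case: ifPn => tD; last first.
 by rewrite (_ : false%:R = 0)// mul0r expr0n normr0 poweR_ge0.
 rewrite (_ : true%:R = 1)// mul1r -wq; last exact: set_mem.
 have H0 := Hm1norm_ge0 (w t) Hv nv.
 rewrite gee0_abs// ger0_norm ?sqr_ge0// -[_ ^+ 2]real_normK ?num_real//.
 rewrite -powR_mulrn// -poweR_EFin; apply: gt0_ler_poweR => //.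
 - by rewrite in_itv/= lee_fin normr_ge0 leey.
 - by rewrite in_itv/= H0 leey.
 - exact: (Hm1norm_ge _ Hv nv).
rewrite ltey; apply/eqP => E; move: h; rewrite E poweRyr ?ltxx//.
Qed.

Lemma intg_itv (q : mT -> R) : L2 leb (fun t => \1_D t * q t) -> intg leb (fun t => \1_D t * q t).
Proof.
move=> Lq; have LI : L2 leb (\1_D : mT -> R).
 split; first exact: mindic.
 rewrite (_ : (fun t => _) = (fun t : mT => \1_D t * \1_D t)); first exact: intg_indic_itv.
 by apply/funext => t; rewrite expr2.
have := L2_mul LI Lq; congr intg; apply/funext => t.
by rewrite mulrA indicE; case: (_ \in _); rewrite ?mul1r ?mul0r.
Qed.

(** The only form in which the time derivative is used later: [u' t v] has a Borel version that is,
    up to sign and for each fixed [v], the scalar weak derivative of the pairing of [u t] with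
    [v]. *)
Lemma time_derivative_pairing u u' v : H10 U v -> (H10norm U v <= 1)%E ->
 L2_Hm1 U T u' -> is_time_derivative U T u u' ->
 mfun (fun t : mT => \1_D t * L2_to_Hm1 U (u t) v) ->
 exists q : mT -> R, [/\ mfun q, {ae leb, forall t, D t -> u' t v = q t},
 intg leb (fun t => \1_D t * q t) &
 forall eta, time_test_function T eta ->
  \int[leb]_t (\1_D t * (eta t * q t)) = - \int[leb]_t (\1_D t * (derive1 eta t * L2_to_Hm1 U (u t) v))].
Proof.
move=> Hv nv Lu' du' mf.
have [q [mq wq Lq]] := bochner_L2_eval Hv nv Lu'.
have mI : mfun (\1_D : mT -> R) by exact: mindic.
exists q; split => //; first exact: intg_itv.
move=> eta teta; have [I [J [bI bJ IJ]]] := du' eta teta.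
have [mE mE' _ _] := time_test_facts teta.
have [qI [mqI wI _ EI]] := bochner_eval Hv nv bI.
have [qJ [mqJ wJ _ EJ]] := bochner_eval Hv nv bJ.
have -> : \int[leb]_t (\1_D t * (eta t * q t)) = I v.
 rewrite EI; apply: ae_eq_Rint.
 - by apply: mfunM => //; exact: mfunM.
 - exact: mfunM.
 apply: (ae_mono2 wI wq) => t h1 h2; rewrite indicE.
 have [tD|tD] := boolP (t \in D); last by rewrite !mul0r.
 by rewrite -h1 ?h2//; exact: set_mem.
rewrite IJ//; congr (- _); rewrite EJ; apply: ae_eq_Rint.
- exact: mfunM.
- rewrite (_ : (fun t => _) = (fun t : mT => derive1 eta t * (\1_D t * L2_to_Hm1 U (u t) v))).
 exact: mfunM.
 by apply/funext => t; rewrite mulrCA.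
apply: (ae_mono wJ) => t h1; rewrite indicE.
have [tD|tD] := boolP (t \in D); last by rewrite !mul0r.
by rewrite -h1//; exact: set_mem.
Qed.

End pairing.

Lemma cvg0Ml (R : realType) (c : R) (f : nat -> R) : f @ \oo --> 0 -> c * f n @[n --> \oo] --> 0.
Proof. by move=> h; rewrite -[0](mulr0 c); exact: cvgMr. Qed.

Lemma cvg0_sq (R : realType) (f : nat -> R) : f @ \oo --> 0 -> f n ^+ 2 @[n --> \oo] --> 0.
Proof. by move=> h; rewrite -[0](mulr0 0); under eq_fun do rewrite expr2; exact: cvgM. Qed.

(** * Curves in H^1_0: measurability and approximation by continuous curves *)

Section curves.
Context {R : realType} {d : nat}.
Notation V := 'rV[R]_d.
Notation mu := (@lebesgue_rV R d).
Notation leb := (@lebesgue_measure R).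
Notation mT := (measurableTypeR R).
Variable U : set V.
Variable cP : R.
Hypothesis poincare : forall v G, h10p U v G -> nr mu v <= cP * gnr G.
Variable T : R.
Hypothesis T0 : 0 < T.
Notation D := (`]0, T[%classic : set mT).

Definition cv m (p : 'I_m -> V -> R) (a : 'I_m -> R) : V -> R := fun x => \sum_i a i * p i x.
Definition cG m (P : 'I_m -> 'I_d -> V -> R) (a : 'I_m -> R) : 'I_d -> V -> R :=
 fun j x => \sum_i a i * P i j x.

Lemma h10p_combo m (p : 'I_m -> V -> R) P a : (forall i, h10p U (p i) (P i)) ->
 h10p U (cv p a) (cG P a).
Proof.
move=> pP; rewrite /cv /cG.
suff H (s : seq 'I_m) : h10p U (fun x => \sum_(i <- s) a i * p i x)
 (fun j x => \sum_(i <- s) a i * P i j x) by exact: H.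
elim: s => [|i s IH].
 have := @h10p0 R d U; congr h10p; first by apply/funext => x; rewrite big_nil.
 by apply/funext => j; apply/funext => x; rewrite big_nil.
have := h10pD (h10pZ (a i) (pP i)) IH; congr h10p; first by apply/funext => x; rewrite big_cons.
by apply/funext => j; apply/funext => x; rewrite big_cons.
Qed.

Lemma nr_combo m (q : 'I_m -> V -> R) (a : 'I_m -> R) : (forall i, L2 mu (q i)) ->
 L2 mu (cv q a) /\ nr mu (cv q a) <= \sum_i `|a i| * nr mu (q i).
Proof.
move=> Lq; have La i : L2 mu (fun x => a i * q i x) by exact: L2Z.
split; first exact: L2_sum.
apply: le_trans (nr_sum _ _) _ => //.
by apply: ler_sum => i _; rewrite nrZ.
Qed.

Lemma cvg_sum0 m (f : 'I_m -> nat -> R) : (forall i, f i n @[n --> \oo] --> 0) ->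
 (\sum_i f i n) @[n --> \oo] --> 0.
Proof.
move=> f0; have c1 : (\sum_i f i n) @[n --> \oo] --> \sum_(i < m) (0 : R).
 by apply: cvg_big => [|i _]; [exact: add_continuous|exact: f0].
by rewrite big1 in c1.
Qed.

Lemma L2cvg_combo m (q : 'I_m -> V -> R) (a_ : nat -> 'I_m -> R) a : (forall i, L2 mu (q i)) ->
 (forall i, a_ n i @[n --> \oo] --> a i) -> L2cvg mu (fun n => cv q (a_ n)) (cv q a).
Proof.
move=> Lq aa.
have c0 : (\sum_i `|a_ n i - a i| * nr mu (q i)) @[n --> \oo] --> 0.
 apply: cvg_sum0 => i; rewrite -[0](mul0r (nr mu (q i))); apply: cvgMl.
 by apply/norm_cvg0P; apply/subr_cvg0; exact: aa.
apply: cvg0_le c0 => n; rewrite ger0_norm ?nr_ge0//.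
apply: le_trans (nr_combo (fun i => a_ n i - a i) Lq).2.
rewrite le_eqVlt; apply/orP; left; apply/eqP; apply: eq_nr => x.
by rewrite -sumrB; apply: eq_bigr => i _; rewrite mulrBl.
Qed.

(* Functionals of a pair that are sequentially continuous for the H^1 norm. *)
Definition seq_cont (Q : (V -> R) -> ('I_d -> V -> R) -> R) :=
 forall (v_ : nat -> V -> R) (G_ : nat -> 'I_d -> V -> R) v G,
 (forall n, h10p U (v_ n) (G_ n)) -> h10p U v G ->
 L2cvg mu v_ v -> (forall i, L2cvg mu (fun n => G_ n i) (G i)) ->
 Q (v_ n) (G_ n) @[n --> \oo] --> Q v G.

(** [Q] is continuous as a function of the finite vector of coefficients, and that vector is a
    measurable function of time. *)
Lemma measurable_combo Q m (p : 'I_m -> V -> R) P (a : 'I_m -> mT -> R) : seq_cont Q ->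
 (forall i, h10p U (p i) (P i)) -> (forall i, mfun (a i)) ->
 mfun (fun t => Q (cv p (a ^~ t)) (cG P (a ^~ t))).
Proof.
move=> cQ pP ma; pose F (y : 'rV[R]_m) := Q (cv p (y ord0)) (cG P (y ord0)).
have cF : continuous F.
 move=> y; apply: seq_cvg_rV => y_ yy; apply: cQ.
 - by move=> n; exact: h10p_combo.
 - exact: h10p_combo.
 - apply: L2cvg_combo => i; first by have [] := pP i.
 exact: (cvg_comp _ _ yy (@continuous_coord R m i y)).
 - move=> j; apply: L2cvg_combo => i; first by have [_ h _] := pP i; exact: h.
 exact: (cvg_comp _ _ yy (@continuous_coord R m i y)).
have mY : mfun (fun t : mT => \row_i a i t : 'rV[R]_m).
 apply: measurable_fun_rVP => i; rewrite (_ : _ \o _ = a i)//.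
 exact: ma.
 by apply/funext => t; rewrite /rV_coord/= mxE.
have := mcomp (continuous_measurable_rV cF) mY.
congr measurable_fun; apply/funext => t; rewrite /F/=.
have E : (\row_i a i t) ord0 = a ^~ t by apply/funext => i; rewrite mxE.
by rewrite E.
Qed.

Lemma seq_cont_gnr : seq_cont (fun _ G => gnr G).
Proof.
move=> v_ G_ v G Pn [_ LG _] _ GG; apply: cvg_gnr => // n i.
by have [_ h _] := Pn n; exact: h.
Qed.

(** Equivalent to [gnr]; a plain sum of norms lets triangle inequalities be taken component by
    component. *)
Definition n1 (G : 'I_d -> V -> R) : R := \sum_i nr mu (G i).

Lemma n1_ge0 G : 0 <= n1 G. Proof. by apply: sumr_ge0 => i _; exact: nr_ge0. Qed.

Lemma nr_le_n1 G i : nr mu (G i) <= n1 G.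
Proof. by rewrite /n1 (bigD1 i)//= lerDl sumr_ge0// => j _; exact: nr_ge0. Qed.

Lemma n1_le_gnr G : n1 G <= d%:R * gnr G.
Proof.
apply: (@le_trans _ _ (\sum_(i < d) gnr G)); first by apply: ler_sum => i _; exact: nr_le_gnr.
by rewrite sumr_const card_ord mulr_natl.
Qed.

Lemma gnr_le_n1 G : gnr G <= n1 G.
Proof.
rewrite -(ler_pXn2r (_ : 0 < 2)%N)// ?nnegrE ?n1_ge0 ?gnr_ge0// gnr_sq.
rewrite [in leRHS]expr2 {1}/n1 mulr_suml; apply: ler_sum => i _.
by rewrite expr2; apply: ler_wpM2l; rewrite ?nr_ge0// nr_le_n1.
Qed.

Lemma eq_n1 (G F : 'I_d -> V -> R) : (forall i x, G i x = F i x) -> n1 G = n1 F.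
Proof. by move=> GF; apply: eq_bigr => i _; apply: eq_nr => x. Qed.

Lemma n1Z a G : (forall i, L2 mu (G i)) -> n1 (fun i x => a * G i x) = `|a| * n1 G.
Proof. by move=> LG; rewrite /n1 mulr_sumr; apply: eq_bigr => i _; rewrite nrZ. Qed.

Lemma n1_sym (G F : 'I_d -> V -> R) : n1 (fun i x => G i x - F i x) = n1 (fun i x => F i x - G i x).
Proof. by apply: eq_bigr => i _; rewrite nrBC. Qed.

Lemma n1_triB G F K : (forall i, L2 mu (G i)) -> (forall i, L2 mu (F i)) -> (forall i, L2 mu (K i)) ->
 n1 (fun i x => G i x - K i x) <= n1 (fun i x => G i x - F i x) + n1 (fun i x => F i x - K i x).
Proof.
move=> LG LF LK; rewrite /n1 -big_split/=; apply: ler_sum => i _.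
exact: nr_triB.
Qed.

Lemma n1_leB G F : (forall i, L2 mu (G i)) -> (forall i, L2 mu (F i)) ->
 n1 (fun i x => G i x - F i x) <= n1 G + n1 F.
Proof.
move=> LG LF; rewrite /n1 -big_split/=; apply: ler_sum => i _.
exact: nrB.
Qed.

Lemma seq_cont_n1 : seq_cont (fun _ G => n1 G).
Proof.
move=> v_ G_ v G Pn [_ LG _] _ GG; apply: cvg_big => [|i _]; first exact: add_continuous.
by apply: L2cvg_nr => // n; have [_ h _] := Pn n; exact: h.
Qed.

Lemma n1_combo m (P : 'I_m -> 'I_d -> V -> R) a : (forall i j, L2 mu (P i j)) ->
 n1 (cG P a) <= \sum_i `|a i| * n1 (P i).
Proof.
move=> LP; rewrite /n1; under [leRHS]eq_bigr do rewrite mulr_sumr.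
rewrite exchange_big/=; apply: ler_sum => j _.
exact: (nr_combo (q := fun i => P i j) a (fun i => LP i j)).2.
Qed.

Variables (w : R -> V -> R) (Gw : R -> 'I_d -> V -> R).
Hypothesis pair_w : {ae leb, forall t, D t -> h10p U (w t) (Gw t)}.

(* Strong measurability, with combinations whose coefficients are bounded measurable functions
 of time. *)
Definition approx_curve := exists (m : nat -> nat) (a : forall n, 'I_(m n) -> mT -> R)
 (p : forall n, 'I_(m n) -> V -> R) (P : forall n, 'I_(m n) -> 'I_d -> V -> R),
 [/\ forall n i, mfun (a n i), forall n i, exists C : R, forall t, `|a n i t| <= C,
 forall n i, h10p U (p n i) (P n i) &
 {ae leb, forall t, D t -> n1 (fun j x => cG (P n) (a n ^~ t) j x - Gw t j x) @[n --> \oo] --> 0}].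

Hypothesis approx_w : approx_curve.

(** An a.e. limit of the values along the approximating combinations. The approximation is given for
    gradients only; the Poincare inequality adds the convergence of the functions. *)
Lemma measurable_curve Q : seq_cont Q ->
 exists2 q : mT -> R, mfun q & {ae leb, forall t, D t -> Q (w t) (Gw t) = q t}.
Proof.
move=> cQ; have [m [a [p [P [ma _ pP aw]]]]] := approx_w.
apply: (@ae_lim_measurable _ mT R leb D (fun n t => Q (cv (p n) (a n ^~ t)) (cG (P n) (a n ^~ t)))
 (fun t => Q (w t) (Gw t))).
 by move=> n; exact: measurable_combo.
apply: (ae_mono2 aw pair_w) => t h1 h2 Dt; have {}h1 := h1 Dt; have {}h2 := h2 Dt.
have pn n := h10p_combo (a n ^~ t) (pP n).
have GG i : L2cvg mu (fun n => cG (P n) (a n ^~ t) i) (Gw t i).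
 apply: cvg0_le h1 => n; rewrite ger0_norm ?nr_ge0//.
 exact: (nr_le_n1 (fun j x => cG (P n) (a n ^~ t) j x - Gw t j x)).
apply: cQ => //.
have c0 : (fun n => `|cP| * n1 (fun j x => cG (P n) (a n ^~ t) j x - Gw t j x)) @ \oo --> 0.
 exact: cvg0Ml.
apply: cvg0_le c0 => n; rewrite ger0_norm ?nr_ge0//.
apply: le_trans (poincare (h10pB (pn n) h2)) _.
apply: (@le_trans _ _ (`|cP| * gnr (fun j x => cG (P n) (a n ^~ t) j x - Gw t j x))).
 by rewrite ler_wpM2r ?gnr_ge0// ler_norm.
by rewrite ler_wpM2l// gnr_le_n1.
Qed.

Variable N : mT -> R.
Hypotheses (mN : mfun N)
 (NE : {ae leb, forall t, D t -> n1 (Gw t) = N t})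
 (LN : L2 leb (fun t => \1_D t * N t)).

(** Approximate in L^1 by a continuous function and clip it to [[-C, C]], which does not increase
    the distance to [b]; the square of the difference is then at most [2 C] times the L^1
    integrand. *)
Lemma continuous_approx_L2 (b : mT -> R) (C : R) (e : R) : mfun b ->
 (forall t, `|b t| <= C) -> 0 < e ->
 exists2 chi : R -> R, continuous chi &
 intg leb (fun t => \1_D t * (b t - chi t) ^+ 2) /\
 \int[leb]_t (\1_D t * (b t - chi t) ^+ 2) <= e.
Proof.
move=> mb bC e0.
have C0 : 0 <= C by rewrite (le_trans _ (bC 0)).
have mD : measurable D by exact: mitv.
have fD : (leb D < +oo)%E by rewrite /= lebesgue_measure_itv/= lte_fin T0 -EFinD ltry.
have jb : leb.-integrable D (EFin \o b).
 apply: (@measurable_bounded_integrable _ mT R leb) => //; first exact: measurable_funTS.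
 exists C; split; first by rewrite num_real.
 by move=> x Cx t _ /=; rewrite (le_trans (bC t))// ltW.
have [g_ [cg jg gb]] := approximation_continuous_integrable mD fD jb.
pose k (n : nat) t := Num.max (- C) (Num.min (g_ n t) C).
have kC n t : `|k n t| <= C.
 rewrite /k ler_norml le_max lexx/= ge_max ge_min lexx orbT andbT.
 by rewrite (le_trans _ C0)// oppr_le0.
have ck n : continuous (k n).
 move=> t; apply: (@continuous_max _ R (fun=> - C) (fun t => Num.min (g_ n t) C)); first exact: cvg_cst.
 by apply: (@continuous_min _ R (g_ n) (fun=> C)); [exact: cg|exact: cvg_cst].
have mk n : mfun (k n : mT -> R) by exact: continuous_measurable_fun.
have kb n t : `|b t - k n t| <= `|b t - g_ n t|.
 have := bC t; rewrite ler_norml /k => /andP[b1 b2].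
 have [h1|h1] := leP (g_ n t) C.
 have [h2|h2] := leP (- C) (g_ n t) => //.
 rewrite opprK !ger0_norm; first by rewrite lerD2l lerNr ltW.
  by rewrite subr_ge0 (le_trans (ltW h2)).
 by rewrite -[C]opprK subr_ge0.
 rewrite max_r; last by rewrite (le_trans _ C0)// oppr_le0.
 rewrite !ler0_norm ?subr_le0//; first by rewrite lerN2 lerD2l lerN2 ltW.
 by rewrite (le_trans b2)// ltW.
have bd n t : \1_D t * (b t - k n t) ^+ 2 <= (2 * C) * (\1_D t * `|b t - g_ n t|).
 rewrite [leRHS]mulrCA; apply: ler_wpM2l; first by rewrite indicE.
 rewrite -real_normK ?num_real// expr2; apply: ler_pM => //.
 by apply: le_trans (ler_normB _ _) _; rewrite mulr_natl mulr2n lerD.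
have jd n : intg leb (fun t => \1_D t * `|b t - g_ n t|).
 have : leb.-integrable D (EFin \o (fun t => `|b t - g_ n t|)).
 have := integrable_abse (integrableB mD jb (jg n)).
 by apply: eq_integrable => // t _.
 move=> /(integrable_mkcond _ mD).1; congr integrable; apply/funext => t.
 by rewrite patchE/= indicE; case: ifPn => _ /=; rewrite ?mul1r ?mul0r.
have mdk n : mfun (fun t : mT => \1_D t * (b t - k n t) ^+ 2).
 apply: mfunM; first exact: mindic.
 by apply: measurable_funX; exact: mfunB.
have jk n : intg leb (fun t => \1_D t * (b t - k n t) ^+ 2).
 apply: (@intg_le _ mT R leb _ (fun t => (2 * C) * (\1_D t * `|b t - g_ n t|))) => //.
 by move=> t; rewrite ger0_norm ?bd// mulr_ge0 ?sqr_ge0// indicE.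
 exact: intgZ.
have ik n : \int[leb]_t (\1_D t * (b t - k n t) ^+ 2) <= 2 * C * \int[leb]_t (\1_D t * `|b t - g_ n t|).
 rewrite -(RintZl (jd n)); apply: Rint_le => //; exact: intgZ.
have c0 : (2 * C * \int[leb]_t (\1_D t * `|b t - g_ n t|)) @[n --> \oo] --> 0.
 apply: cvg0Ml; apply/cvg_fineP.
 apply: cvg_ext gb => n; rewrite integral_mkcond /Rintegral fineK; last exact: (integrable_fin_num measurableT (jd n)).
 by apply: eq_integral => t _; rewrite patchE/= indicE; case: ifPn => _ /=; rewrite ?mul1r ?mul0r.
move/cvgr0Pnorm_le : c0 => /(_ e e0) [n _ /(_ n (leqnn n)) h].
exists (k n) => //; split => //.
by apply: le_trans (ik n) _; apply: le_trans (ler_norm _) h.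
Qed.

Lemma cvg_n1 (G_ : nat -> 'I_d -> V -> R) G : (forall n i, L2 mu (G_ n i)) -> (forall i, L2 mu (G i)) ->
 (forall i, L2cvg mu (fun n => G_ n i) (G i)) -> n1 (G_ n) @[n --> \oo] --> n1 G.
Proof.
move=> Ln L GG; apply: cvg_big => [|i _]; first exact: add_continuous.
exact: L2cvg_nr.
Qed.

(** The difference of two combinations is one combination over the concatenated index set. *)
Lemma measurable_combo_diff m1 m2 (p1 : 'I_m1 -> V -> R) P1 (p2 : 'I_m2 -> V -> R) P2
 (a1 : 'I_m1 -> mT -> R) (a2 : 'I_m2 -> mT -> R) :
 (forall i, h10p U (p1 i) (P1 i)) -> (forall i, h10p U (p2 i) (P2 i)) ->
 (forall i, mfun (a1 i)) -> (forall i, mfun (a2 i)) ->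
 mfun (fun t => n1 (fun j x => cG P1 (a1 ^~ t) j x - cG P2 (a2 ^~ t) j x)).
Proof.
move=> h1 h2 ma1 ma2.
pose p (i : 'I_(m1 + m2)) := match fintype.split i with inl k => p1 k | inr k => p2 k end.
pose P (i : 'I_(m1 + m2)) := match fintype.split i with inl k => P1 k | inr k => P2 k end.
pose a (i : 'I_(m1 + m2)) (t : mT) := match fintype.split i with inl k => a1 k t | inr k => - a2 k t end.
have hp i : h10p U (p i) (P i) by rewrite /p /P; case: fintype.split.
have ma i : mfun (a i).
 by rewrite /a; case: fintype.split => k //; exact: measurable_funN.
have := measurable_combo seq_cont_n1 hp ma.
congr measurable_fun; apply/funext => t; apply: eq_n1 => j x.
rewrite /cG big_split_ord/=; congr (_ + _).
 by apply: eq_bigr => i _; rewrite /a /P (unsplitK (inl i)).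
by rewrite -sumrN; apply: eq_bigr => i _; rewrite /a /P (unsplitK (inr i)) mulNr.
Qed.

Lemma nr_indic_le (f : mT -> R) e : L2 leb (fun t => \1_D t * f t) -> 0 <= e ->
 \int[leb]_t (\1_D t * f t ^+ 2) <= e ^+ 2 -> nr leb (fun t => \1_D t * f t) <= e.
Proof.
move=> Lf e0 h; rewrite -(ler_pXn2r (_ : 0 < 2)%N)// ?nnegrE ?nr_ge0//.
rewrite nr_sq (le_trans _ h)// le_eqVlt; apply/orP; left; apply/eqP; apply: eq_Rintegral => t _.
by rewrite indicE; case: (_ \in _); rewrite ?mul1r ?mul0r// expr2.
Qed.

(** Strong measurability gives only a.e. convergence. Truncating the combinations relative to the
    size [N] of the curve provides a majorant, hence convergence in L^2 in time; the bounded
    coefficients are then replaced by continuous ones. *)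
Lemma curve_continuous_approx eps : 0 < eps ->
 exists m (chi : 'I_m -> R -> R) (p : 'I_m -> V -> R) P (e : mT -> R),
 [/\ forall i, continuous (chi i), forall i, h10p U (p i) (P i), forall t, 0 <= e t,
  {ae leb, forall t, D t -> n1 (fun j x => Gw t j x - cG P (chi ^~ t) j x) <= e t} &
  L2 leb (fun t => \1_D t * e t) /\ nr leb (fun t => \1_D t * e t) <= eps].
Proof.
move=> eps0; have [m [a [p [P [ma aC pP aw]]]]] := approx_w.
have LP n i j : L2 mu (P n i j) by have [_ h _] := pP n i; exact: h.
pose g n (t : mT) := n1 (cG (P n) (a n ^~ t)).
have mg n : mfun (g n).
 exact: (measurable_combo seq_cont_n1 (pP n) (ma n)).
(* Where the combination is more than twice as large as the curve, its coefficients are set to zero;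
   the error is then at most [3 N], a square integrable majorant. *)
pose B n : set mT := [set t | g n t <= 2 * N t].
have mB n : measurable (B n).
 rewrite -[B n]setTI; apply: measurable_fun_ler => //.
 by apply: mfunM => //; exact: mcst.
pose b n i (t : mT) := \1_(B n) t * a n i t.
have mb n i : mfun (b n i).
 by apply: mfunM => //; exact: mindic.
have bC n i : exists C : R, forall t, `|b n i t| <= C.
 have [C aCi] := aC n i; exists C => t; rewrite normrM (le_trans _ (aCi t))// ler_piMl//.
 by rewrite indicE; case: (_ \in _); rewrite ?normr1 ?normr0.
have mD : measurable D by exact: mitv.
have mI : mfun (\1_D : mT -> R) by exact: mindic.
pose e0 n t := n1 (fun j x => cG (P n) (b n ^~ t) j x - Gw t j x).
have LcG n (c : 'I_(m n) -> R) j : L2 mu (cG (P n) c j).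
 by have [_ h _] := h10p_combo c (pP n); exact: h.
have e0n n : exists2 E : mT -> R, mfun E & {ae leb, forall t, D t -> e0 n t = E t}.
 apply: (@ae_lim_measurable _ mT R leb D (fun k t => n1 (fun j x => cG (P n) (b n ^~ t) j x - cG (P k) (a k ^~ t) j x)) (e0 n)).
 by move=> k; exact: measurable_combo_diff.
 apply: (ae_mono2 aw pair_w) => t h1 h2 Dt; have {}h1 := h1 Dt; have [_ LG _] := h2 Dt.
 apply: cvg_n1 => [k i|i|i]; [exact: L2B|exact: L2B|].
 apply: cvg0_le h1 => k; rewrite ger0_norm ?nr_ge0//.
 apply: le_trans (nr_le_n1 (fun j x => cG (P k) (a k ^~ t) j x - Gw t j x) i).
 rewrite [leRHS]nrBC le_eqVlt; apply/orP; left; apply/eqP/eq_nr => x.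
 by ring.
have /choice[E hE] : forall n, exists E : mT -> R, mfun E /\ {ae leb, forall t, D t -> e0 n t = E t}.
 by move=> n; have [E ? ?] := e0n n; exists E.
have e0B n : {ae leb, forall t, D t -> (B n t -> e0 n t = n1 (fun j x => cG (P n) (a n ^~ t) j x - Gw t j x)) /\ (~ B n t -> e0 n t = N t)}.
 apply: (ae_mono2 pair_w NE) => t h2 h3 Dt; have [_ LG _] := h2 Dt.
 split => Bt; first by apply: eq_n1 => j x; congr (_ - _); apply: eq_bigr => i _; rewrite /b indicE mem_set// mul1r.
 rewrite -h3// /e0 n1_sym; apply: eq_n1 => j x.
 by rewrite /cG big1 ?subr0// => i _; rewrite /b indicE memNset// !mul0r.
have N0 : {ae leb, forall t, D t -> 0 <= N t}.
 by apply: (ae_mono NE) => t h Dt; rewrite -h// n1_ge0.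
have bd n : {ae leb, forall t, D t -> `|E n t| <= 3 * N t}.
 apply: (ae_mono3 (e0B n) (ae_mono2 (hE n).2 N0 (fun t h1 h2 Dt => conj (h1 Dt) (h2 Dt)))
 (ae_mono2 pair_w NE (fun t h1 h2 Dt => conj (h1 Dt) (h2 Dt)))) => t h1 h2 h3 Dt.
 have [hB hnB] := h1 Dt; have [h4 h5] := h2 Dt; have [[_ LG _] h6] := h3 Dt.
 rewrite -h4 ger0_norm ?n1_ge0//; have [Bt|nBt] := pselect (B n t).
 rewrite hB//; apply: le_trans (n1_leB (LcG n _) LG) _.
 rewrite h6; apply: (@le_trans _ _ (2 * N t + N t)); first by rewrite lerD2r.
 by rewrite -[X in _ + X]mul1r -mulrDl (_ : 2 + 1 = 3)//; ring.
 by rewrite hnB// ler_peMl// ler1n.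
have LE n : L2 leb (fun t => \1_D t * E n t).
 split; first by apply: mfunM => //; exact: (hE n).1.
 apply: (@intg_le_ae _ mT R leb _ (fun t => 9 * (\1_D t * N t) ^+ 2)).
 - by apply: measurable_funX; apply: mfunM => //; exact: (hE n).1.
 - apply: (ae_mono (bd n)) => t h; rewrite indicE; have [tD|tD] := boolP (t \in D); last first.
  by rewrite !mul0r expr0n mulr0 normr0.
 rewrite !mul1r normrX (_ : 9 = 3 ^+ 2); last by ring.
 rewrite -exprMn ler_pXn2r ?nnegrE//; first exact/h/set_mem.
 by apply: le_trans (h _); rewrite ?normr_ge0//; exact: set_mem.
 - by have [_ j] := LN; exact: intgZ.
have cE : nr leb (fun t => \1_D t * E n t) @[n --> \oo] --> 0.
 have c1 : (\int[leb]_t (\1_D t * E n t) ^+ 2) @[n --> \oo] --> \int[leb]_t (0 : R).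
 apply: (@Rdct_ae _ mT R leb _ _ (fun t => 9 * (\1_D t * N t) ^+ 2)).
 - by move=> n; apply: measurable_funX; have [] := LE n.
 - exact: mcst.
 - by have [_ j] := LN; exact: intgZ.
 - have hall : {ae leb, forall t, forall n, D t -> e0 n t = E n t /\ ((B n t -> e0 n t = n1 (fun j x => cG (P n) (a n ^~ t) j x - Gw t j x)) /\ (~ B n t -> e0 n t = N t))}.
  apply: ae_foralln => n; exact: (ae_mono2 (hE n).2 (e0B n) (fun t h1 h2 Dt => conj (h1 Dt) (h2 Dt))).
  apply: (ae_mono3 hall aw (ae_mono2 pair_w NE (fun t h1 h2 Dt => conj (h1 Dt) (h2 Dt)))) => t h1 h2 h3.
  have [Dt|nDt] := pselect (D t); last first.
  apply: cvg_ext (cvg_cst 0) => n; by rewrite indicE memNset// mul0r expr0n.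
  have {}h2 := h2 Dt; have [[_ LG _] h6] := h3 Dt.
  have N0t : 0 <= N t by rewrite -h6 n1_ge0.
  have c2 : E n t @[n --> \oo] --> 0.
  have gN : g n t @[n --> \oo] --> N t.
   rewrite -h6; apply: cvg_n1 => // i; apply: cvg0_le h2 => n; rewrite ger0_norm ?nr_ge0//.
   exact: (nr_le_n1 (fun j x => cG (P n) (a n ^~ t) j x - Gw t j x)).
  have ev : \forall n \near \oo, `|E n t| <= n1 (fun j x => cG (P n) (a n ^~ t) j x - Gw t j x).
   have EE n : E n t = e0 n t by have [-> _] := h1 n Dt.
   (* If [N t > 0], the threshold [2 N t] is eventually respected because the norms of the
      combinations tend to [N t]; if [N t = 0], the zero combination makes no error. *)
   have [N00|Npos] : N t = 0 \/ 0 < N t.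
   by move: N0t; rewrite le_eqVlt => /predU1P[<-|]; [left|right].
   apply: nearW => n; rewrite EE ger0_norm ?n1_ge0//.
   have [_ [hB hnB]] := h1 n Dt; have [/hB -> //|/hnB ->] := pselect (B n t).
   by rewrite N00 n1_ge0.
   have : \forall n \near \oo, g n t < 2 * N t.
   by apply: (cvgr_lt (N t)) => //; rewrite ltr_pMl// ltr1n.
   apply: filterS => n gn; rewrite EE ger0_norm ?n1_ge0//.
   by have [_ [hB _]] := h1 n Dt; rewrite hB//= /B/= ltW.
  apply/norm_cvg0P; apply: (squeeze_cvgr _ (cvg_cst 0) h2).
  by apply: filterS ev => n ->; rewrite normr_ge0.
  by apply: cvg0_sq; exact: cvg0Ml.
 - move=> n; apply: (ae_mono (bd n)) => t h; rewrite indicE; have [tD|tD] := boolP (t \in D); last first.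
  by rewrite !mul0r expr0n mulr0 normr0.
  rewrite !mul1r normrX (_ : 9 = 3 ^+ 2); last by ring.
  rewrite -exprMn ler_pXn2r ?nnegrE//; first exact/h/set_mem.
  by apply: le_trans (h _); rewrite ?normr_ge0//; exact: set_mem.
 rewrite Rintegral_cst// mul0r in c1.
 have := cvg_comp _ _ c1 (@sqrt_continuous R 0); rewrite sqrtr0.
 by apply: cvg_ext => n; congr Num.sqrt; apply: eq_Rintegral => t _; rewrite expr2.
have eps2 : 0 < eps / 2 by rewrite divr_gt0.
move/cvgr0Pnorm_le : cE => /(_ _ eps2) [n _ /(_ n (leqnn n)) hn].
pose S := \sum_(i < m n) n1 (P n i).
have S0 : 0 <= S by apply: sumr_ge0 => i _; exact: n1_ge0.
(* Weighted by the norms [n1 (P n i)] and summed, the errors on the coefficients contribute at most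
   [eps / 2]; the [+ 1] covers [S = 0]. *)
pose del := eps / (2 * (S + 1)).
have del0 : 0 < del by rewrite divr_gt0// mulr_gt0// ltr_wpDl.
have /choice[chi hchi] : forall i, exists chi : R -> R, continuous chi /\
 (intg leb (fun t => \1_D t * (b n i t - chi t) ^+ 2) /\
 \int[leb]_t (\1_D t * (b n i t - chi t) ^+ 2) <= del ^+ 2).
 move=> i; have [C bCi] := bC n i.
 have [|chi cchi [h1 h2]] := continuous_approx_L2 (e := del ^+ 2) (mb n i) bCi.
 by rewrite exprn_gt0.
 by exists chi.
have mchi i : mfun (chi i : mT -> R) by apply: continuous_measurable_fun; exact: (hchi i).1.
have Ld i : L2 leb (fun t => \1_D t * `|b n i t - chi i t|).
 split.
 apply: mfunM => //; apply: (mcomp mnormr).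
 exact: mfunB.
 have [_ [j _]] := hchi i; move: j; congr intg; apply/funext => t.
 rewrite exprMn real_normK ?num_real// indicE; case: (_ \in _); rewrite ?expr1n//.
 by rewrite expr0n/= !mul0r.
have nd i : nr leb (fun t => \1_D t * `|b n i t - chi i t|) <= del.
 apply: nr_indic_le => //; first exact: ltW.
 have [_ [_]] := hchi i; apply: le_trans; rewrite le_eqVlt; apply/orP; left; apply/eqP.
 by apply: eq_Rintegral => t _; rewrite real_normK ?num_real.
pose e t := `|E n t| + \sum_i n1 (P n i) * `|b n i t - chi i t|.
have eE t : \1_D t * e t = `|\1_D t * E n t| + \sum_i n1 (P n i) * (\1_D t * `|b n i t - chi i t|).
 rewrite mulrDr normrM ger0_norm; last by rewrite indicE.
 by congr (_ + _); rewrite mulr_sumr; apply: eq_bigr => i _; rewrite mulrCA.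
have LS : L2 leb (fun t => \sum_i n1 (P n i) * (\1_D t * `|b n i t - chi i t|)).
 by apply: L2_sum => i _; exact: L2Z.
exists (m n), chi, (p n), (P n), e; split.
- by move=> i; exact: (hchi i).1.
- exact: pP.
- move=> t; rewrite addr_ge0// sumr_ge0// => i _.
 by rewrite mulr_ge0// n1_ge0.
- apply: (ae_mono2 pair_w (hE n).2) => t h1 h2 Dt; have [_ LG _] := h1 Dt.
 apply: le_trans (n1_triB LG (LcG n (b n ^~ t)) (LcG n (chi ^~ t))) _.
 apply: lerD; first by rewrite n1_sym -/(e0 n t) h2// ler_norm.
 rewrite (@eq_n1 _ (cG (P n) (fun i => b n i t - chi i t))).
 apply: le_trans (n1_combo _ (LP n)) _.
 by apply: ler_sum => i _; rewrite mulrC.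
 by move=> j x; rewrite /cG -sumrB; apply: eq_bigr => i _; rewrite mulrBl.
have LA := L2_abs (LE n).
have eF : (fun t : mT => \1_D t * e t) = (fun t => `|\1_D t * E n t| +
  \sum_i n1 (P n i) * (\1_D t * `|b n i t - chi i t|)) by apply/funext => t; exact: eE.
rewrite eF; split; first exact: L2D.
 apply: le_trans (nrD LA LS) _.
rewrite nr_abs [leRHS]splitr; apply: lerD; first by apply: le_trans (ler_norm _) hn.
apply: le_trans (nr_sum _ _) _ => [i _|]; first exact: L2Z.
apply: (@le_trans _ _ (\sum_i n1 (P n i) * del)).
 apply: ler_sum => i _; rewrite nrZ// ger0_norm ?n1_ge0//.
 by apply: ler_wpM2l; rewrite ?n1_ge0.
have S1 : 0 < S + 1 by rewrite ltr_wpDl.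
rewrite -mulr_suml -/S (_ : S * del = eps / 2 * (S / (S + 1))); last first.
 by rewrite /del invfM; ring.
by rewrite ler_piMr ?(ltW eps2)// ler_pdivrMr// mul1r lerDl.
Qed.

End curves.

Section Rint_ae.
Context disp (T : measurableType disp) (R : realType) (mu : {measure set T -> \bar R}).
Implicit Types f g : T -> R.

Lemma Rint_le_ae f g : intg mu f -> intg mu g -> {ae mu, forall x, f x <= g x} ->
 \int[mu]_x f x <= \int[mu]_x g x.
Proof.
move=> jf jg fg; rewrite -subr_ge0 -(RintB jg jf).
have mB := intg_meas (intgB jg jf).
rewrite (@ae_eq_Rint _ _ _ _ _ (fun x => `|g x - f x|))//; first exact: Rint_ge0.
 by apply: (mcomp mnormr).
by apply: (ae_mono fg) => x h; rewrite ger0_norm// subr_ge0.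
Qed.

End Rint_ae.

(** * Increments and averages over short time intervals *)

Section averages.
Context {R : realType}.
Notation leb := (@lebesgue_measure R).
Notation mT := (measurableTypeR R).
Implicit Types (f : mT -> R) (a b h s t : R).

Lemma measurable_translation1 f h : mfun f -> mfun (fun t : mT => f (t + h)).
Proof.
move=> mf; apply: (mcomp mf (f := f) (g := (fun t : mT => t + h : mT))).
by apply: measurable_funD => //; exact: mcst.
Qed.

Lemma Rint_translation1 f h : mfun f -> \int[leb]_t f (t + h) = \int[leb]_t f t.
Proof.
move=> mf; have mE : mfun (EFin \o f) by exact/mEFinP.
rewrite /Rintegral integralE [in RHS]integralE; congr (fine (_ - _)%E).
 rewrite -(@ge0_integral_translation1 _ (fun t => ((EFin \o f)^\+ t)%E) h)//; last first.
 exact: measurable_funepos.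
 by apply: eq_integral => t _; rewrite !funeposE.
rewrite -(@ge0_integral_translation1 _ (fun t => ((EFin \o f)^\- t)%E) h)//; last first.
 exact: measurable_funeneg.
by apply: eq_integral => t _; rewrite !funenegE.
Qed.

Lemma intg_translation1 f h : intg leb f -> intg leb (fun t => f (t + h)).
Proof.
move=> jf; have mf := intg_meas jf; apply/integrableP; split.
 by apply/mEFinP; exact: measurable_translation1.
rewrite (@ge0_integral_translation1 _ (fun t => `|(f t)%:E|%E) h)//.
 by have /integrableP[] := jf.
by apply: mcomp => //; exact/mEFinP.
Qed.

Lemma Rint_indic_oc a b : a <= b -> intg leb (\1_`]a, b] : mT -> R) /\ \int[leb]_t \1_`]a, b] t = b - a.
Proof.
move=> ab; have mI : measurable (`]a, b]%classic : set mT) by exact: mitv.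
have E : leb `]a, b]%classic = (b - a)%:E.
 rewrite /= lebesgue_measure_itv/= lte_fin; move: ab; rewrite le_eqVlt => /predU1P[->|->].
 by rewrite ltxx subrr.
 by rewrite EFinB.
have fE : (leb `]a, b]%classic < +oo)%E by rewrite E ltry.
split; first exact: (@intg_indic_fin _ mT R leb _ mI fE).
rewrite /Rintegral (@integral_indic _ mT R leb _ measurableT _ mI) setIT.
by transitivity (fine (b - a)%:E) => //; congr fine; exact: E.
Qed.

Lemma intg_indicM (A : set mT) f : measurable A -> intg leb f -> intg leb (fun t => \1_A t * f t).
Proof.
move=> mA jf; apply: (@intg_bmul _ mT R leb (\1_A) f 1 _ _ jf); first exact: mindic.
by move=> t; rewrite indicE; case: (_ \in _); rewrite ?normr1 ?normr0.
Qed.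

Lemma indic_oc (a b t : R) : \1_`]a, b] t = ((a < t) && (t <= b))%:R :> R.
Proof. by rewrite indicE mem_setE in_itv. Qed.

(* Integrating the increments of [f] over [a, b] leaves only the averages at the two ends. *)
Lemma Rint_increment f a b h : intg leb f -> 0 < h -> h <= b - a ->
 \int[leb]_t (\1_`]a, b] t * (f t - f (t - h))) =
 \int[leb]_t (\1_`](b - h), b] t * f t) - \int[leb]_t (\1_`](a - h), a] t * f t).
Proof.
move=> jf h0 hab.
have mI (x y : R) : measurable (`]x, y]%classic : set mT) by exact: mitv.
have jI x y := intg_indicM (mI x y) jf.
have E1 : \int[leb]_t (\1_`]a, b] t * f (t - h)) = \int[leb]_t (\1_`](a - h), (b - h)] t * f t).
 rewrite -(@Rint_translation1 (fun t => \1_`](a - h), (b - h)] t * f t) (- h)); last exact: intg_meas (jI _ _).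
 by apply: eq_Rintegral => t _; congr (_ * _); rewrite !indic_oc ltrD2r lerD2r.
have j2 : intg leb (fun t => \1_`]a, b] t * f (t - h)).
 by apply: intg_indicM => //; exact: intg_translation1.
transitivity (\int[leb]_t (\1_`]a, b] t * f t - \1_`]a, b] t * f (t - h))).
 by apply: eq_Rintegral => t _; rewrite mulrBr.
rewrite (RintB (jI a b) j2) E1 -(RintB (jI a b) (jI _ _)).
rewrite -(RintB (jI (b - h) b) (jI (a - h) a)).
apply: eq_Rintegral => t _; rewrite -!mulrBl; congr (_ * _); rewrite !indic_oc.
have hb : b - h <= b by rewrite gerBl ltW.
have ha : a - h <= a by rewrite gerBl ltW.
have hab2 : a <= b - h by rewrite lerBrDl -lerBrDr.
have [h1|h1] := leP t (a - h).
 by rewrite !ltNge (le_trans h1)// (le_trans h1 (le_trans ha hab2))// (le_trans h1 ha)//= h1 subrr.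
have [h2|h2] := leP t a.
 by rewrite (le_trans h2 hab2)/= ltNge (le_trans h2 hab2).
have [h3|h3] := leP t (b - h) => //.
by rewrite (le_trans h3 hb)/= !subrr.
Qed.

Lemma avg_ge f s h l e : intg leb f -> 0 < h -> (forall t, s - h < t <= s -> l - e <= f t) ->
 h * (l - e) <= \int[leb]_t (\1_`](s - h), s] t * f t).
Proof.
move=> jf h0 fl; have hs : s - h <= s by rewrite gerBl ltW.
have [jI EI] := Rint_indic_oc hs.
have -> : h * (l - e) = \int[leb]_t ((l - e) * \1_`](s - h), s] t).
 by rewrite (RintZl jI) EI opprB addrCA subrr addr0 mulrC.
apply: Rint_le; [exact: intgZ|by apply: intg_indicM => //; exact: mitv|].
move=> t; rewrite indic_oc mulrC; have [H|_] := boolP (_ && _); last by rewrite !mul0r.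
by rewrite !mul1r fl.
Qed.

Lemma avg_le f s h l e : intg leb f -> 0 < h -> (forall t, s - h < t <= s -> f t <= l + e) ->
 \int[leb]_t (\1_`](s - h), s] t * f t) <= h * (l + e).
Proof.
move=> jf h0 fl; have hs : s - h <= s by rewrite gerBl ltW.
have [jI EI] := Rint_indic_oc hs.
have -> : h * (l + e) = \int[leb]_t ((l + e) * \1_`](s - h), s] t).
 by rewrite (RintZl jI) EI opprB addrCA subrr addr0 mulrC.
apply: Rint_le; [by apply: intg_indicM => //; exact: mitv|exact: intgZ|].
move=> t; rewrite indic_oc mulrC; have [H|_] := boolP (_ && _); last by rewrite !mulr0 ?mul0r.
by rewrite !mulr1 ?mul1r fl.
Qed.

(** Bounds on short increments replace a differential inequality. Integrated over []a, b]] the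
    increments leave [h] times averages of the function near the two ends, which continuity of [f]
    evaluates once divided by [h]. *)
Lemma increment_bound (T a b K : R) (f g e2 : mT -> R) : 0 < a -> a < b -> b < T -> 0 <= K ->
 {in `]0, T[, continuous (f : R -> R)} -> intg leb (fun t => \1_`]a, b] t * g t) ->
 (forall t, 0 <= e2 t) -> intg leb (fun t => \1_`]0, T[ t * e2 t) ->
 (forall om : R, 0 < om -> exists2 h0 : R, 0 < h0 & forall h, 0 < h < h0 ->
 {ae leb, forall t : R, a < t <= b ->
  f t - f (t - h) <= h * (g t + K * om) + K * \int[leb]_tau (\1_`](t - h), t] tau * e2 tau)}) ->
 f b - f a <= \int[leb]_t (\1_`]a, b] t * g t) + K * \int[leb]_t (\1_`]0, T[ t * e2 t).
Proof.
move=> a0 ab bT K0 cf jg e0 je hf.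
pose J (t : mT) := \int[leb]_tau (\1_`]0, t] tau * (\1_`]0, T[ tau * e2 tau)).
have mI (x y : R) : measurable (`]x, y]%classic : set mT) by exact: mitv.
have jJ (x y : R) : intg leb (fun tau => \1_`]x, y] tau * (\1_`]0, T[ tau * e2 tau)).
 by apply: intg_indicM.
have pe t : 0 <= \1_`]0, T[ t * e2 t by rewrite mulr_ge0// indicE.
have ndJ : {homo J : s t / s <= t}.
 move=> s t st; apply: Rint_le => // tau; apply: ler_wpM2r => //.
 rewrite !indic_oc ler_nat; case: (0 < tau) => //=.
 by case: (leP tau s) => // ts; rewrite (le_trans ts st).
have JE t : J t <= \int[leb]_t (\1_`]0, T[ t * e2 t).
 apply: Rint_le => // tau; rewrite ler_piMl// indicE; by case: (_ \in _).
have J0 t : 0 <= J t by apply: Rint_ge0 => tau; rewrite mulr_ge0// indicE.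
have mJ : mfun J by apply: nondecreasing_measurable => //; exact: measurableT.
set S := \int[leb]_t (\1_`]0, T[ t * e2 t) in JE *; set G := \int[leb]_t (\1_`]a, b] t * g t).
have S0 : 0 <= S by exact: le_trans (J0 0) (JE 0).
suff key (om : R) : 0 < om -> f b - f a <= G + K * S + (K * (b - a) + 2) * om.
 have k0 : 0 < K * (b - a) + 2 by rewrite ltr_wpDl// mulr_ge0// subr_ge0 ltW.
 apply/ler_addgt0Pr => eps eps0.
 apply: le_trans (key (eps / (K * (b - a) + 2)) _) _; first by rewrite divr_gt0.
 by rewrite mulrCA divff ?mulr1// gt_eqF.
move=> om0; have [h0 h00 hh] := hf om om0.
have bD : b \in `]0, T[ by rewrite in_itv/= (lt_trans a0 ab).
have aD : a \in `]0, T[ by rewrite in_itv/= a0 (lt_trans ab bT).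
have /cvgrPdist_le /(_ om om0) /nbhs_ballP [/= d1 d10 c1] := cf b bD.
have /cvgrPdist_le /(_ om om0) /nbhs_ballP [/= d2 d20 c2] := cf a aD.
(* Below [h0] for the hypothesis, at most [a / 2] to keep [t - h] away from 0, at most [b - a] to
   separate the two end intervals, below [d1] and [d2] for the continuity of [f] at [b] and at
   [a]. *)
pose h := Num.min (Num.min (h0 / 2) (a / 2)) (Num.min (b - a) (Num.min (d1 / 2) (d2 / 2))).
have hp : 0 < h by rewrite !lt_min !divr_gt0// subr_gt0 ab.
have hle : [/\ h < h0, h <= a / 2, h <= b - a & h < d1 /\ h < d2].
 have l2 (x : R) : 0 < x -> x / 2 < x by move=> x0; rewrite ltr_pdivrMr// ltr_pMr// ltr1n.
 have : h <= h by []; rewrite {2}/h !le_min => /andP[/andP[A1 A2] /andP[A3 /andP[A4 A5]]].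
 by split => //; [exact: le_lt_trans A1 (l2 _ h00)|split; [exact: le_lt_trans A4 (l2 _ d10)|exact: le_lt_trans A5 (l2 _ d20)]].
have {hle}[hh0 ha hab [hd1 hd2]] := hle.
have a2 : 0 < a / 2 by rewrite divr_gt0.
have aa : a / 2 + a / 2 = a by rewrite -splitr.
have aha : a / 2 <= a - h by rewrite -{2}aa lerBrDl addrC lerD2l.
pose C := `[a / 2, b]%classic : set mT.
have mC : measurable C by exact: mitv.
have CE (t : R) : \1_C t = ((a / 2 <= t) && (t <= b))%:R :> R by rewrite indicE mem_setE in_itv.
have fC : (leb C < +oo)%E.
 by rewrite /= lebesgue_measure_itv/=; case: ifP => _; rewrite ?ltry// -EFinB ltry.
have jC : intg leb (\1_C : mT -> R) by exact: (@intg_indic_fin _ mT R leb _ mC fC).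
have jf : intg leb (fun t => \1_C t * f t).
 have : leb.-integrable C (EFin \o f).
 apply: continuous_compact_integrable; first exact: segment_compact.
 apply: continuous_in_subspaceT => t /set_mem; rewrite /C/= in_itv/= => /andP[t1 t2].
 by apply: cf; rewrite in_itv/= (lt_le_trans a2 t1) (le_lt_trans t2 bT).
 move=> /(@integrable_mkcond _ mT R leb _ _ mC).1; congr integrable; apply/funext => t.
 by rewrite patchE/= indicE; case: ifPn => _ /=; rewrite ?mul1r ?mul0r.
have jCJ : intg leb (fun t => J t * \1_C t).
 apply: (@intg_bmul _ mT R leb J _ S) => // t.
 by rewrite ger0_norm.
(* Subtracting [K] times the primitive [J] of [e2] absorbs the last term of the hypothesis. At [b]
   this costs at most [K * S], and at [a] the sign of [J] is favourable. *)
pose f2 (t : mT) := \1_C t * f t - K * (J t * \1_C t).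
have jf2 : intg leb f2 by apply: intgB => //; exact: intgZ.
have f2E (t : mT) : a / 2 <= t -> t <= b -> f2 t = f t - K * J t.
 by move=> t1 t2; rewrite /f2 CE t1 t2 mul1r mulr1.
have JB (s t : R) : 0 <= s -> s <= t -> t < T -> J t - J s = \int[leb]_tau (\1_`]s, t] tau * e2 tau).
 move=> s0 st tT; rewrite /J -(RintB (jJ 0 t) (jJ 0 s)).
 apply: eq_Rintegral => tau _; rewrite !indic_oc [\1_`]0, T[ _]indicE mem_setE in_itv/= -mulrBl.
 have [q1|q1] := leP tau s.
 by rewrite (le_trans q1 st) andbT subrr !mul0r.
 rewrite (le_lt_trans s0 q1)/=; have [q2|q2] := leP tau t; last by rewrite subrr !mul0r.
 by rewrite (le_lt_trans q2 tT) subr0 !mul1r.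
have I1 := @Rint_increment f2 a b h jf2 hp hab.
have j2 : intg leb (fun t => \1_`]a, b] t * (f2 t - f2 (t - h))).
 by apply: intg_indicM => //; apply: intgB => //; exact: intg_translation1.
have [jab Eab] := Rint_indic_oc (ltW ab).
have I2 : \int[leb]_t (\1_`]a, b] t * (f2 t - f2 (t - h))) <= h * (G + K * om * (b - a)).
 have -> : h * (G + K * om * (b - a)) = \int[leb]_t (h * (\1_`]a, b] t * g t + K * om * \1_`]a, b] t)).
 have j3 := intgZ (K * om) jab.
 rewrite (RintZl (intgD jg j3)) (RintD jg j3).
 by rewrite (RintZl jab) Eab.
 apply: (@Rint_le_ae _ mT R leb) => //; first by apply: intgZ; apply: intgD => //; exact: intgZ.
 have hE : 0 < h < h0 by rewrite hp hh0.
 apply: (ae_mono (hh h hE)) => t ht; rewrite indic_oc.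
 have [tab|_] := boolP (a < t <= b); last by rewrite !mul0r mulr0 addr0 mulr0.
 have /andP[t1 t2] := tab; have th : t - h <= t by rewrite gerBl ltW.
 have ath : a / 2 <= t - h by apply: le_trans aha _; rewrite lerD2r ltW.
 have ta := le_trans ath th; have thb := le_trans th t2.
 rewrite !mul1r mulr1 !f2E//.
 have := ht tab; rewrite -JB//; last 2 first.
 - exact: le_trans (ltW a2) ath.
 - exact: le_lt_trans t2 bT.
 by move=> q; rewrite -subr_ge0; move: q; rewrite -subr_ge0; congr (0 <= _); ring.
have I3 : h * ((f b - K * S) - om) <= \int[leb]_t (\1_`](b - h), b] t * f2 t).
 apply: avg_ge => // t /andP[t1 t2].
 have ta : a / 2 <= t by apply: le_trans (ltW t1); apply: le_trans aha _; rewrite lerD2r ltW.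
 rewrite f2E//; have := c1 t; rewrite /ball/= ger0_norm ?subr_ge0//.
 have -> : b - t < d1 by apply: le_lt_trans hd1; rewrite lerBlDr -lerBlDl ltW.
 move=> /(_ isT); rewrite ler_norml => /andP[_ q].
 have : K * J t <= K * S by exact: ler_wpM2l.
 by move: q => /[swap]; clear; lra.
have I4 : \int[leb]_t (\1_`](a - h), a] t * f2 t) <= h * (f a + om).
 apply: avg_le => // t /andP[t1 t2].
 rewrite f2E//; last 2 first.
 - exact: le_trans aha (ltW t1).
 - exact: le_trans t2 (ltW ab).
 have := c2 t; rewrite /ball/= ger0_norm ?subr_ge0//.
 have -> : a - t < d2 by apply: le_lt_trans hd2; rewrite lerBlDr -lerBlDl ltW.
 move=> /(_ isT); rewrite ler_norml => /andP[q _].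
 have : 0 <= K * J t by exact: mulr_ge0.
 by move: q => /[swap]; clear; lra.
have : h * ((f b - K * S) - om - (f a + om)) <= h * (G + K * om * (b - a)).
 by rewrite mulrBr; apply: le_trans I2; rewrite I1; apply: lerB.
rewrite ler_pM2l// -subr_ge0 => q; rewrite -subr_ge0; move: q; congr (0 <= _); ring.
Qed.

End averages.

(** Only [t] is confined to the segment: the nearby time [s] may fall to the left of [a]. *)
Lemma segment_unif_continuous (R : realType) (f : R -> R) (a b e : R) : continuous f -> 0 < e ->
 exists2 h0 : R, 0 < h0 & forall s t, a <= t <= b -> `|s - t| <= h0 -> `|f s - f t| <= e.
Proof.
move=> cf e0; pose P (h t : R) := forall s, `|s - t| <= h -> `|f s - f t| <= e.
have := (compact_near_coveringP `[a, b]%classic).1 (@segment_compact R a b).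
move=> /(_ R (0^'+) P _) H.
have {}H : \forall h \near 0^'+, `[a, b]%classic `<=` P h.
 apply: H => x _; have e2 : 0 < e / 2 by rewrite divr_gt0.
 have /cvgrPdist_le /(_ _ e2) /nbhs_ballP [/= r r0 br] := cf x.
 exists (ball x (r / 2), [set h : R | h < r / 2]) => /=; first split => /=.
 - by apply: nbhsx_ballx; rewrite divr_gt0.
 - by apply: nbhs_right_lt; rewrite divr_gt0.
 move=> [t h] [/= xt hr] s st; rewrite (splitr e).
 have xr : ball x r t.
 by apply: le_ball xt; rewrite ler_pdivrMr// ler_pMr// ler1n.
 have xs : ball x r s.
 rewrite (splitr r); apply: ball_triangle xt _; rewrite /ball/= distrC.
 exact: le_lt_trans st hr.
 rewrite (_ : f s - f t = (f x - f t) - (f x - f s)); last by ring.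
 by apply: le_trans (ler_normB _ _) _; apply: lerD; [exact: br|exact: br].
have [h [h0 hP]] := filter_ex (filterI (nbhs_right_gt (0 : R)) H).
by exists h => // s t tab st; apply: (hP t) => //=; rewrite in_itv.
Qed.

(** * The energy inequality for a convex profile *)

Section energy.
Context {R : realType} {d : nat}.
Notation V := 'rV[R]_d.
Notation mu := (@lebesgue_rV R d).
Notation leb := (@lebesgue_measure R).
Notation mT := (measurableTypeR R).
Notation e_ i := (delta_mx ord0 i : V).
Variable U : set V.
Hypothesis oU : open U.
Variables (Ar : 'I_d -> 'I_d -> V -> R) (Hr : 'I_d -> V -> R) (cr rho : V -> R) (Grho : 'I_d -> V -> R).
Variables (M lam Mr Cc : R).
Hypotheses (mA : forall i j, mfun (Ar i j))
 (Mge0 : 0 <= M)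
 (AM : forall i j x, `|Ar i j x| <= M)
 (coercive : {ae mu, forall x, forall xi : 'I_d -> R,
 lam * \sum_i xi i ^+ 2 <= \sum_i \sum_j Ar i j x * xi j * xi i})
 (LH : forall j, L2 mu (Hr j))
 (mc : mfun cr)
 (c0 : forall x, 0 <= cr x)
 (Cc0 : 0 <= Cc)
 (pot : forall v G, h10p U v G ->
 intg mu (fun x => cr x * `|v x|) /\ \int[mu]_x (cr x * `|v x|) <= Cc * gnr G)
 (Lrho : L2 mu rho)
 (jrho : intg mu rho)
 (rho0 : forall x, 0 <= rho x <= Mr)
 (LGrho : forall i, L2 mu (Grho i))
 (jGrho : forall i, intg mu (Grho i))
 (wrho : wgrad U rho Grho).

Definition flux j (x : V) : R := \sum_i Ar i j x * Grho i x + rho x * Hr j x.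

Hypothesis adjoint : forall phi, testf U phi ->
 \sum_j \int[mu]_x (flux j x * 'D_(e_ j) phi x) = 0.

Let M0 : 0 <= Mr. Proof. by have /andP[a b] := rho0 0; exact: le_trans a b. Qed.

Lemma nr_bounded_mul (b f : V -> R) (C : R) : mfun b -> 0 <= C ->
 (forall x, `|b x| <= C) -> L2 mu f -> nr mu (fun x => b x * f x) <= C * nr mu f.
Proof.
move=> mb C0 bC Lf; rewrite -{1}(ger0_norm C0) -nrZ//; apply: nr_le.
- by apply: mfunM => //; exact: L2_meas Lf.
- exact: L2Z.
- by move=> x; rewrite !normrM (ger0_norm C0) ler_wpM2r.
Qed.

Lemma L2_flux j : L2 mu (flux j).
Proof.
apply: L2D; first by apply: L2_sum => i _; exact: L2_bmul.
apply: (@L2_bmul _ _ _ _ _ _ Mr) => //; first exact: L2_meas Lrho.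
by move=> x; have /andP[a b] := rho0 x; rewrite ger0_norm.
Qed.

(** The flux is in L^2, so the adjoint equation extends by density from test functions to H^1_0,
    where [Phi \o w] lies. *)
Lemma adjoint_pair v G : h10p U v G -> \sum_j \int[mu]_x (flux j x * G j x) = 0.
Proof.
move=> [Lv LG [p [tp pv pG]]].
have LD n i : L2 mu ('D_(e_ i) (p n)) by have [_ h _] := h10p_test (tp n); exact: h.
have c1 : (\sum_j \int[mu]_x (flux j x * 'D_(e_ j) (p n) x)) @[n --> \oo] -->
 \sum_j \int[mu]_x (flux j x * G j x).
 apply: cvg_big => [|j _]; first exact: add_continuous.
 have := L2cvg_ip (fun n => LD n j) (LG j) (L2_flux j) (pG j).
 have -> : ip mu (G j) (flux j) = \int[mu]_x (flux j x * G j x) by rewrite ipC.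
 by apply: cvg_ext => n; rewrite ipC.
have c2 : (\sum_j \int[mu]_x (flux j x * 'D_(e_ j) (p n) x)) @[n --> \oo] --> (0 : R).
 by apply: cvg_ext (cvg_cst 0) => n; rewrite adjoint.
exact: (cvg_unique _ c1 c2).
Qed.

(** There is no term in [theta]: the factor [exp (theta t)] of the rescaled curve takes it away. *)
Definition form (z : V -> R) (Gz : 'I_d -> V -> R) (v : V -> R) (Gv : 'I_d -> V -> R) : R :=
 \sum_i \sum_j \int[mu]_x (Ar i j x * Gz j x * Gv i x) +
 \sum_j \int[mu]_x (Hr j x * Gz j x * v x) + \int[mu]_x (cr x * z x * v x).

Lemma intg_form_principal i j f g : L2 mu f -> L2 mu g -> intg mu (fun x => Ar i j x * f x * g x).
Proof. by move=> Lf Lg; apply: L2_mul => //; exact: L2_bmul. Qed.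

Lemma intg_form_drift j f (v : V -> R) (B : R) : L2 mu f -> mfun v -> (forall x, `|v x| <= B) ->
 intg mu (fun x => Hr j x * f x * v x).
Proof.
move=> Lf mv vB; have := intg_bmul mv vB (L2_mul (LH j) Lf).
by congr intg; apply/funext => x; rewrite mulrC.
Qed.

Lemma intg_pot z Gz : h10p U z Gz -> intg mu (fun x => cr x * z x).
Proof.
move=> pz; have [j _] := pot pz; have [Lz _ _] := pz.
apply: intg_le j; first by apply: mfunM => //; exact: L2_meas Lz.
by move=> x; rewrite normrM ger0_norm.
Qed.

Lemma intg_form_pot z Gz (v : V -> R) (B : R) : h10p U z Gz -> mfun v ->
 (forall x, `|v x| <= B) -> intg mu (fun x => cr x * z x * v x).
Proof.
move=> pz mv vB; have := intg_bmul mv vB (intg_pot pz).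
by congr intg; apply/funext => x; rewrite mulrC.
Qed.

Lemma formB z Gz y Gy v Gv (B : R) : h10p U z Gz -> h10p U y Gy -> h10p U v Gv ->
 (forall x, `|v x| <= B) ->
 form (fun x => z x - y x) (fun i x => Gz i x - Gy i x) v Gv = form z Gz v Gv - form y Gy v Gv.
Proof.
move=> pz py [Lv LGv _] vB; have [Lz LGz _] := pz; have [Ly LGy _] := py; have mv := L2_meas Lv.
rewrite /form.
have -> : \int[mu]_x (cr x * (z x - y x) * v x) = \int[mu]_x (cr x * z x * v x) - \int[mu]_x (cr x * y x * v x).
 rewrite -(RintB (intg_form_pot pz mv vB) (intg_form_pot py mv vB)).
 by apply: eq_Rintegral => x _; ring.
have -> : \sum_j \int[mu]_x (Hr j x * (Gz j x - Gy j x) * v x) =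
 \sum_j \int[mu]_x (Hr j x * Gz j x * v x) - \sum_j \int[mu]_x (Hr j x * Gy j x * v x).
 rewrite -sumrB; apply: eq_bigr => j _.
 rewrite -(RintB (intg_form_drift j (LGz j) mv vB) (intg_form_drift j (LGy j) mv vB)).
 by apply: eq_Rintegral => x _; ring.
have -> : \sum_i \sum_j \int[mu]_x (Ar i j x * (Gz j x - Gy j x) * Gv i x) =
 \sum_i \sum_j \int[mu]_x (Ar i j x * Gz j x * Gv i x) - \sum_i \sum_j \int[mu]_x (Ar i j x * Gy j x * Gv i x).
 rewrite -sumrB; apply: eq_bigr => i _; rewrite -sumrB; apply: eq_bigr => j _.
 rewrite -(RintB (intg_form_principal i j (LGz j) (LGv i)) (intg_form_principal i j (LGy j) (LGv i))).
 by apply: eq_Rintegral => x _; ring.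
ring.
Qed.

(** Linear in the gradient of [z] alone, the potential term being estimated by [pot]. The test
    function enters the lower order terms through its sup norm, so the drift only has to be in
    L^2. *)
Lemma form_bound z Gz v Gv (B : R) : h10p U z Gz -> h10p U v Gv -> (forall x, `|v x| <= B) ->
 `|form z Gz v Gv| <= (M * n1 Gv + B * (n1 Hr + Cc)) * n1 Gz.
Proof.
move=> pz [Lv LGv _] vB; have [Lz LGz _] := pz; have mv := L2_meas Lv.
have B0 : 0 <= B by apply: le_trans (vB 0).
have -> : (M * n1 Gv + B * (n1 Hr + Cc)) * n1 Gz = M * n1 Gv * n1 Gz + B * (n1 Hr * n1 Gz) + B * (Cc * n1 Gz).
 by ring.
apply: le_trans (ler_normD _ _) _; apply: lerD; first (apply: le_trans (ler_normD _ _) _; apply: lerD).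
- apply: le_trans (ler_norm_sum _ _ _) _; rewrite [n1 Gv]/n1 -mulrA mulr_suml mulr_sumr.
 apply: ler_sum => i _; apply: le_trans (ler_norm_sum _ _ _) _; rewrite mulrA mulr_sumr.
 apply: ler_sum => j _.
 have LA : L2 mu (fun x => Ar i j x * Gz j x) by exact: L2_bmul.
 apply: le_trans (ip_le LA (LGv i)) _; rewrite mulrAC; apply: ler_wpM2r; first exact: nr_ge0.
 exact: nr_bounded_mul.
- apply: le_trans (ler_norm_sum _ _ _) _; rewrite [n1 Hr]/n1 mulr_suml mulr_sumr.
 apply: ler_sum => j _.
 have LA : L2 mu (fun x => v x * Hr j x) by exact: L2_bmul.
 have -> : \int[mu]_x (Hr j x * Gz j x * v x) = ip mu (fun x => v x * Hr j x) (Gz j).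
 by apply: eq_Rintegral => x _; ring.
 apply: le_trans (ip_le LA (LGz j)) _; rewrite mulrA; apply: ler_pM; rewrite ?nr_ge0//.
 exact: nr_bounded_mul.
 exact: nr_le_n1.
- have [j1 j2] := pot pz.
 apply: (@le_trans _ _ (\int[mu]_x (B * (cr x * `|z x|)))).
 apply: le_trans (le_normr_Rintegral measurableT (intg_form_pot pz mv vB)) _.
 apply: Rint_le; [exact/intg_abs/(intg_form_pot pz mv vB)|exact: intgZ|].
 by move=> x; rewrite !normrM (ger0_norm (c0 x)) mulrC ler_wpM2r// mulr_ge0.
 rewrite (RintZl j1); apply: ler_wpM2l => //; apply: le_trans j2 _.
 by apply: ler_wpM2l => //; exact: gnr_le_n1.
Qed.

Section convex_energy.
Variables (Phi b b2 : R -> R) (B L L2' : R).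
Hypotheses (sPhi : smooth Phi)
 (sb : smooth b)
 (dPhi : forall y : R, is_derive y 1 Phi (b y))
 (db : forall y : R, is_derive y 1 b (b2 y))
 (Phi0 : Phi 0 = 0)
 (b0 : b 0 = 0)
 (bB : forall y, `|b y| <= B)
 (b2L : forall y, 0 <= b2 y <= L)
 (b2Lip : forall x y, `|b2 x - b2 y| <= L2' * `|x - y|)
 (convex : forall x y, Phi x - Phi y <= b x * (x - y)).

Let b2L' y : `|b2 y| <= L. Proof. by have /andP[p q] := b2L y; rewrite ger0_norm. Qed.
Let B0 : 0 <= B. Proof. exact: le_trans (normr_ge0 _) (bB 0). Qed.
Let L0 : 0 <= L. Proof. exact: le_trans (normr_ge0 _) (b2L' 0). Qed.
Let L20 : 0 <= L2'. Proof. by have := b2Lip 1 0; rewrite subr0 normr1 mulr1; exact: le_trans. Qed.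

Lemma energy_test_pair w Gw : h10p U w Gw ->
 h10p U (fun x => rho x * b (w x))
 (fun i x => rho x * (b2 (w x) * Gw i x) + b (w x) * Grho i x).
Proof.
move=> pw; apply: (@h10p_mul_comp _ _ _ oU b b2 L L2' sb b0 db b2L' L20 b2Lip rho Grho Mr Lrho jrho _ LGrho jGrho wrho B _ _ bB pw).
by move=> x; have /andP[p q] := rho0 x; rewrite ger0_norm.
Qed.

Lemma energy_test_bound (w : V -> R) x : `|rho x * b (w x)| <= Mr * B.
Proof. by have /andP[p q] := rho0 x; rewrite normrM (ger0_norm p); exact: ler_pM. Qed.

Lemma energy_pair w Gw : h10p U w Gw -> h10p U (Phi \o w) (fun i x => b (w x) * Gw i x).
Proof.
move=> pw; apply: (h10p_comp sPhi Phi0 dPhi bB L0 _ pw).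
exact: derive_lipschitz db b2L'.
Qed.

Definition dissip (w : V -> R) (Gw : 'I_d -> V -> R) : R :=
 \int[mu]_x (rho x * b2 (w x) * \sum_i Gw i x ^+ 2).

Let mb2 : mfun (b2 : mT -> R).
Proof.
apply: continuous_measurable_fun => x; apply/cvgrPdist_le => e e0; apply/nbhs_ballP.
exists (e / (L2' + 1)) => /=; first by rewrite divr_gt0// ltr_wpDl.
move=> y; rewrite /ball/= => xy; apply: le_trans (b2Lip _ _) _.
have k0 : 0 < L2' + 1 by rewrite ltr_wpDl.
apply: (@le_trans _ _ ((L2' + 1) * `|x - y|)); first by apply: ler_wpM2r; rewrite ?lerDl.
by rewrite mulrC -ler_pdivlMr// ltW.
Qed.

Lemma dissip_weight (w : V -> R) : mfun w -> mfun (fun x => rho x * b2 (w x)) /\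
 forall x, 0 <= rho x * b2 (w x) <= Mr * L.
Proof.
move=> mw; split.
 apply: mfunM; first exact: L2_meas Lrho.
 exact: (mcomp mb2 mw).
move=> x; have /andP[p q] := rho0 x; have /andP[r s] := b2L (w x).
by rewrite mulr_ge0//=; apply: ler_pM.
Qed.

Lemma intg_dissip (w : V -> R) (Gw : 'I_d -> V -> R) : mfun w -> (forall i, L2 mu (Gw i)) ->
 intg mu (fun x => rho x * b2 (w x) * \sum_i Gw i x ^+ 2).
Proof.
move=> mw LG; have [m1 m2] := dissip_weight mw.
apply: (intg_bmul m1 (C := Mr * L)) => [x|]; first by have /andP[p q] := m2 x; rewrite ger0_norm.
by apply: intg_sum => i _; have [] := LG i.
Qed.

Lemma dissip_ge0 w Gw : 0 <= dissip w Gw.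
Proof.
apply: Rint_ge0 => x; have /andP[p q] := rho0 x; have /andP[r s] := b2L (w x).
by rewrite mulr_ge0// ?mulr_ge0// sumr_ge0// => i _; exact: sqr_ge0.
Qed.

Lemma dissip_le w Gw : h10p U w Gw -> dissip w Gw <= Mr * L * n1 Gw ^+ 2.
Proof.
move=> [Lw LG _]; have mw := L2_meas Lw; have [m1 m2] := dissip_weight mw.
have jS : intg mu (fun x => \sum_i Gw i x ^+ 2) by apply: intg_sum => i _; have [] := LG i.
apply: (@le_trans _ _ (Mr * L * gnr Gw ^+ 2)); last first.
 apply: ler_wpM2l; first exact: mulr_ge0.
 by rewrite ler_pXn2r ?nnegrE ?gnr_ge0 ?n1_ge0// gnr_le_n1.
have -> : Mr * L * gnr Gw ^+ 2 = \int[mu]_x (Mr * L * \sum_i Gw i x ^+ 2).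
 rewrite (RintZl jS) Rint_sum; last by move=> i _; have [] := LG i.
 by rewrite gnr_sq; congr (_ * _); apply: eq_bigr => i _; rewrite nr_sqE.
apply: Rint_le; [exact: intg_dissip|exact: intgZ|].
move=> x; apply: ler_wpM2r; first by apply: sumr_ge0 => i _; exact: sqr_ge0.
by have /andP[] := m2 x.
Qed.

(* The drift term is compensated by the equation satisfied by [rho], tested with [Phi \o w]. *)
Lemma form_coercive w Gw : h10p U w Gw ->
 lam * dissip w Gw <= form w Gw (fun x => rho x * b (w x))
 (fun i x => rho x * (b2 (w x) * Gw i x) + b (w x) * Grho i x).
Proof.
move=> pw; have [Lw LG _] := pw; have mw := L2_meas Lw.
have [m1 m2] := dissip_weight mw; have pv := energy_test_pair pw.
have [Lv LGv _] := pv; have pP := energy_pair pw; have [LP LGP _] := pP.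
have LA i : L2 mu (fun x => rho x * b2 (w x) * Gw i x).
 apply: (@L2_bmul _ _ _ _ _ _ (Mr * L)) => // x.
 by have /andP[p q] := m2 x; rewrite ger0_norm.
have mbw : mfun (fun x => b (w x)).
 apply: (mcomp (f := (b : mT -> R)) _ mw).
 by apply: continuous_measurable_fun; exact: smooth_continuous.
have LbG i : L2 mu (fun x => b (w x) * Grho i x) by exact: L2_bmul.
have E1 : \sum_i \sum_j \int[mu]_x (Ar i j x * Gw j x * (rho x * (b2 (w x) * Gw i x) + b (w x) * Grho i x)) =
 \sum_i \sum_j \int[mu]_x (Ar i j x * Gw j x * (rho x * b2 (w x) * Gw i x)) +
 \sum_i \sum_j \int[mu]_x (Ar i j x * Gw j x * (b (w x) * Grho i x)).
 rewrite -big_split; apply: eq_bigr => i _; rewrite -big_split; apply: eq_bigr => j _ /=.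
 rewrite -(RintD (intg_form_principal i j (LG j) (LA i)) (intg_form_principal i j (LG j) (LbG i))).
 by apply: eq_Rintegral => x _; ring.
have E2 : \sum_i \sum_j \int[mu]_x (Ar i j x * Gw j x * (b (w x) * Grho i x)) +
 \sum_j \int[mu]_x (Hr j x * Gw j x * (rho x * b (w x))) = 0.
 rewrite exchange_big/= -big_split/= -[RHS](adjoint_pair pP); apply: eq_bigr => j _.
 have jj i := intg_form_principal i j (LG j) (LbG i).
 rewrite -(Rint_sum _ (fun i _ => jj i)).
 rewrite -(RintD); first last.
 - exact: (intg_form_drift j (LG j) (L2_meas Lv) (energy_test_bound w)).
 - by apply: intg_sum => i _; exact: jj.
 apply: eq_Rintegral => x _; rewrite /flux mulrDl mulr_suml; congr (_ + _); last by ring.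
 by apply: eq_bigr => i _; ring.
have E3 : 0 <= \int[mu]_x (cr x * w x * (rho x * b (w x))).
 apply: Rint_ge0 => x; have /andP[p q] := rho0 x.
 rewrite (_ : _ * _ = cr x * (rho x * (b (w x) * w x))); last by ring.
 rewrite mulr_ge0// mulr_ge0//.
 (* The tangent inequalities at [w x] and at 0 give [0 <= Phi (w x) <= b (w x) * w x]. *)
 have h1 := convex (w x) 0; have h2 := convex 0 (w x).
 move: h1 h2; rewrite Phi0 b0 subr0 mul0r sub0r oppr_le0 subr0 => h1 h2.
 exact: le_trans h2 h1.
rewrite /form E1 -[X in X + _]addrA E2 addr0 -[leLHS]addr0; apply: lerD => //.
have jj i j := intg_form_principal i j (LG j) (LA i).
have -> : \sum_i \sum_j \int[mu]_x (Ar i j x * Gw j x * (rho x * b2 (w x) * Gw i x)) =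
 \int[mu]_x (\sum_i \sum_j Ar i j x * Gw j x * (rho x * b2 (w x) * Gw i x)).
 rewrite Rint_sum; last by move=> i _; apply: intg_sum => j _; exact: jj.
 by apply: eq_bigr => i _; rewrite Rint_sum// => j _; exact: jj.
have jd := intg_dissip mw LG.
rewrite /dissip -(RintZl jd); apply: Rint_le_ae.
- exact: intgZ.
- by apply: intg_sum => i _; apply: intg_sum => j _; exact: jj.
apply: (ae_mono coercive) => x /(_ (fun i => Gw i x)) h.
have /andP[p q] := m2 x.
rewrite mulrCA; apply: le_trans (ler_wpM2l p h) _.
rewrite le_eqVlt; apply/orP; left; apply/eqP; rewrite mulr_sumr; apply: eq_bigr => i _.
by rewrite mulr_sumr; apply: eq_bigr => j _; ring.
Qed.

(** Change the weight first, with the gradient fixed: bounded factors that vanish in L^2, integrated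
    against an integrable weight. Then change the gradient, with [G_ n^2 - G^2] factored as a
    product and the weight bounded. *)
Lemma seq_cont_dissip : seq_cont U dissip.
Proof.
move=> v_ G_ v G Pn [Lv LG _] vv GG.
have Lvn n : L2 mu (v_ n) by have [h _ _] := Pn n.
have LGn n i : L2 mu (G_ n i) by have [_ h _] := Pn n; exact: h.
pose S n x := \sum_i G_ n i x ^+ 2; pose S0 x := \sum_i G i x ^+ 2.
have jS0 : intg mu S0 by apply: intg_sum => i _; have [] := LG i.
pose k n x := `|b2 (v_ n x) - b2 (v x)|.
have mk n : mfun (k n).
 apply: mcomp => //; apply: mfunB.
 by apply: (mcomp mb2); exact: L2_meas (Lvn n).
 by apply: (mcomp mb2); exact: L2_meas Lv.
have Lk n : L2 mu (k n).
 apply: (@L2_le _ _ _ _ _ (fun x => L2' * (v_ n x - v x))) => //.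
 by move=> x; rewrite /k normr_id normrM (ger0_norm L20).
 by apply: L2Z; exact: L2B.
have ck : L2cvg mu k (fun=> 0).
 apply: cvg0_le (cvg0Ml L2' vv) => n; rewrite ger0_norm ?nr_ge0//.
 rewrite -[X in X * _](ger0_norm L20) -nrZ; last exact: L2B.
 apply: nr_le.
 - by apply: mfunB => //; exact: mcst.
 - by apply: L2Z; exact: L2B.
 - by move=> x; rewrite subr0 /k normr_id normrM (ger0_norm L20).
have c1 : \int[mu]_x (k n x * (Mr * S0 x)) @[n --> \oo] --> (0 : R).
 apply: (@bounded_L2cvg_weighted _ _ _ mu k (L + L)) => //.
 - move=> n x; rewrite normr_ge0/=; apply: le_trans (ler_normB _ _) _.
 by apply: lerD; exact: b2L'.
 - exact: intgZ.
 - by move=> x; rewrite mulr_ge0// sumr_ge0// => i _; exact: sqr_ge0.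
have c2 : (\sum_i (Mr * L) * (nr mu (fun x => G_ n i x - G i x) * (nr mu (fun x => G_ n i x - G i x) + 2 * nr mu (G i)))) @[n --> \oo] --> (0 : R).
 apply: cvg_sum0 => i; apply: cvg0Ml.
 rewrite -[0](mul0r (0 + 2 * nr mu (G i))); apply: cvgM; first exact: GG.
 by apply: cvgD; [exact: GG|exact: cvg_cst].
have c3 : (\int[mu]_x (k n x * (Mr * S0 x)) + \sum_i (Mr * L) *
 (nr mu (fun x => G_ n i x - G i x) * (nr mu (fun x => G_ n i x - G i x) + 2 * nr mu (G i)))) @[n --> \oo] --> (0 : R).
 by rewrite -[X in _ --> X](addr0 (0 : R)); apply: cvgD.
suff c4 : dissip (v_ n) (G_ n) - dissip v G @[n --> \oo] --> 0 by exact/subr_cvg0.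
apply: cvg0_le c3 => n.
have [m1 m2] := dissip_weight (L2_meas (Lvn n)).
have [m3 m4] := dissip_weight (L2_meas Lv).
have jDn := intg_dissip (L2_meas (Lvn n)) (LGn n).
have jD := intg_dissip (L2_meas Lv) LG.
have jx : intg mu (fun x => rho x * b2 (v_ n x) * S0 x).
 apply: (intg_bmul m1 (C := Mr * L)) => // x; have /andP[p q] := m2 x; by rewrite ger0_norm.
have -> : dissip (v_ n) (G_ n) - dissip v G =
 (\int[mu]_x (rho x * b2 (v_ n x) * S0 x) - dissip v G) +
 (dissip (v_ n) (G_ n) - \int[mu]_x (rho x * b2 (v_ n x) * S0 x)) by ring.
apply: le_trans (ler_normD _ _) _; apply: lerD.
 rewrite /dissip -(RintB jx jD).
 have jB := intgB jx jD.
 apply: le_trans (le_normr_Rintegral measurableT jB) _.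
 apply: Rint_le.
 - exact: intg_abs.
 - apply: (intg_bmul (mk n) (C := L + L)); last exact: intgZ.
 move=> x; rewrite normr_id; apply: le_trans (ler_normB _ _) _.
 by apply: lerD; exact: b2L'.
 - move=> x; rewrite -mulrBl -mulrBr normrM (ger0_norm (_ : 0 <= S0 x)); last first.
  by apply: sumr_ge0 => i _; exact: sqr_ge0.
 rewrite normrM mulrA; apply: ler_wpM2r; first by apply: sumr_ge0 => i _; exact: sqr_ge0.
 have /andP[p q] := rho0 x; rewrite (ger0_norm p) mulrC; exact: ler_wpM2l.
rewrite /dissip -(RintB jDn jx).
have LD i : L2 mu (fun x => G_ n i x - G i x) by exact: L2B.
have LS i : L2 mu (fun x => G_ n i x + G i x) by exact: L2D.
have LW i : L2 mu (fun x => rho x * b2 (v_ n x) * (G_ n i x - G i x)).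
 apply: (L2_bmul m1 (C := Mr * L)) => // x; have /andP[p q] := m2 x; by rewrite ger0_norm.
have -> : \int[mu]_x (rho x * b2 (v_ n x) * (\sum_i G_ n i x ^+ 2) - rho x * b2 (v_ n x) * S0 x) =
 \sum_i ip mu (fun x => rho x * b2 (v_ n x) * (G_ n i x - G i x)) (fun x => G_ n i x + G i x).
 rewrite -Rint_sum; last by move=> i _; exact: L2_mul.
 apply: eq_Rintegral => x _; rewrite -mulrBr -sumrB mulr_sumr.
 by apply: eq_bigr => i _; ring.
apply: le_trans (ler_norm_sum _ _ _) _; apply: ler_sum => i _.
apply: le_trans (ip_le (LW i) (LS i)) _; rewrite mulrA; apply: ler_pM; rewrite ?nr_ge0//.
 apply: nr_bounded_mul => //; first exact: mulr_ge0.
 by move=> x; have /andP[p q] := m2 x; rewrite ger0_norm.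
have -> : nr mu (fun x => G_ n i x + G i x) = nr mu (fun x => (G_ n i x - G i x) + 2 * G i x).
 by apply: eq_nr => x; ring.
have LG2 : L2 mu (fun x => 2 * G i x) by exact: L2Z.
apply: le_trans (nrD (LD i) LG2) _; rewrite nrZ// ger0_norm//.
Qed.

Section evolution.
Variable T : R.
Hypothesis T0 : 0 < T.
Notation D := (`]0, T[%classic : set mT).
Variables (w : R -> V -> R) (Gw : R -> 'I_d -> V -> R).
Hypotheses (pair_w : {ae leb, forall t : R, D t -> h10p U (w t) (Gw t)})
 (approx_w : approx_curve U T Gw).
Variable N : mT -> R.
Hypotheses (mN : mfun N)
 (NE : {ae leb, forall t : R, D t -> n1 (Gw t) = N t})
 (LN : L2 leb (fun t => \1_D t * N t))
 (L2_w : forall t, 0 < t < T -> L2 mu (w t))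
 (cont_w : forall t : R, 0 < t < T -> nr mu (fun x => w s x - w t x) @[s --> t] --> (0 : R))
 (weak : forall v Gv (C : R), h10p U v Gv -> (forall x, `|v x| <= C) ->
 exists q : mT -> R, [/\ intg leb (fun t => \1_D t * q t),
 {ae leb, forall t : R, D t -> q t = form (w t) (Gw t) v Gv} &
 forall t1 t2, 0 < t1 -> t1 <= t2 -> t2 < T ->
  ip mu (fun x => w t2 x - w t1 x) v = - \int[leb]_t (\1_`]t1, t2] t * q t)]).

Definition energy (t : R) : R := \int[mu]_x (rho x * Phi (w t x)).

Let Phi_lip x y : `|Phi x - Phi y| <= B * `|x - y|.
Proof. exact: derive_lipschitz dPhi bB x y. Qed.

Lemma intg_energy z : L2 mu z -> intg mu (fun x => rho x * Phi (z x)).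
Proof.
move=> Lz; have mP : mfun (fun x => Phi (z x)).
 apply: (mcomp (f := (Phi : mT -> R)) _ (L2_meas Lz)).
 by apply: continuous_measurable_fun; exact: smooth_continuous.
apply: L2_mul => //; apply: (@L2_le _ _ _ _ _ (fun x => B * z x)) => //; last exact: L2Z.
by move=> x; have := Phi_lip (z x) 0; rewrite Phi0 !subr0 normrM (ger0_norm B0).
Qed.

Lemma energy_continuous : {in `]0, T[, continuous energy}.
Proof.
move=> t; rewrite in_itv/= => tT; apply/cvgrPdist_le => e e0.
have k0 : 0 < B * nr mu rho + 1 by rewrite ltr_wpDl// mulr_ge0 ?nr_ge0.
have e1 : 0 < e / (B * nr mu rho + 1) by rewrite divr_gt0.
have /cvgrPdist_le /(_ _ e1) h := cont_w tT.
have h2 : \forall s \near t, 0 < s < T.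
 have := @near_in_itvoo R 0 T t; rewrite in_itv => /(_ tT).
 by apply: filterS => s; rewrite in_itv.
apply: filterS2 h h2 => s hs sT; rewrite sub0r normrN ger0_norm ?nr_ge0// in hs.
have Lt := L2_w tT; have Ls := L2_w sT; have jt := intg_energy Lt; have js := intg_energy Ls.
rewrite /energy -(RintB jt js).
have LA := L2_abs (L2B Ls Lt).
apply: (@le_trans _ _ (B * ip mu rho (fun x => `|w s x - w t x|))).
 rewrite -(RintZl (L2_mul Lrho LA)).
 apply: le_trans (le_normr_Rintegral measurableT (intgB jt js)) _.
 apply: Rint_le; [exact/intg_abs/intgB|exact/intgZ/L2_mul|] => x.
 have /andP[p q] := rho0 x; rewrite -mulrBr normrM (ger0_norm p) mulrCA; apply: ler_wpM2l => //.
 by rewrite (distrC (w s x)); exact: Phi_lip.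
apply: (@le_trans _ _ (B * nr mu rho * nr mu (fun x => w s x - w t x))).
 rewrite -mulrA; apply: ler_wpM2l => //; apply: le_trans (ler_norm _) _.
 by apply: le_trans (ip_le Lrho LA) _; rewrite nr_abs.
apply: (@le_trans _ _ ((B * nr mu rho + 1) * (e / (B * nr mu rho + 1)))).
 by apply: ler_pM; rewrite ?nr_ge0// ?mulr_ge0 ?nr_ge0// lerDl.
by rewrite mulrCA divff ?mulr1// gt_eqF.
Qed.

(** The tangent inequality at the later value [z]; the earlier value [y] only has to be in L^2,
    while [z] must be in H^1_0 for [rho * b z] to be admissible. *)
Lemma energy_increment_le y z Gz : L2 mu y -> h10p U z Gz ->
 \int[mu]_x (rho x * Phi (z x)) - \int[mu]_x (rho x * Phi (y x)) <=
 ip mu (fun x => z x - y x) (fun x => rho x * b (z x)).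
Proof.
move=> Ly pz; have [Lz _ _] := pz; have [Lv _ _] := energy_test_pair pz.
have jz := intg_energy Lz; have jy := intg_energy Ly.
rewrite -(RintB jz jy); apply: Rint_le.
- exact: intgB.
- by apply: L2_mul => //; exact: L2B.
- move=> x; have /andP[p q] := rho0 x; rewrite -mulrBr mulrCA; apply: ler_wpM2l => //.
 by rewrite mulrC.
Qed.

(** Collects the bounds of the principal part, of its contribution from the gradient of [rho], and
    of the drift and potential terms, so that one constant multiplies [1 + n1 Gy] in
    [energy_form_bound]. *)
Let K0 : R := M * (Mr * L) + M * (B * n1 Grho) + Mr * B * (n1 Hr + Cc).

Lemma energy_form_bound y Gy z Gz : h10p U y Gy -> h10p U z Gz ->
 `|form z Gz (fun x => rho x * b (y x)) (fun i x => rho x * (b2 (y x) * Gy i x) + b (y x) * Grho i x)|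
 <= K0 * (1 + n1 Gy) * n1 Gz.
Proof.
move=> py pz; have pv := energy_test_pair py.
apply: le_trans (form_bound pz pv (energy_test_bound y)) _.
apply: ler_wpM2r; first exact: n1_ge0.
have [Ly LGy _] := py; have my := L2_meas Ly; have [m1 m2] := dissip_weight my.
have LA i : L2 mu (fun x => rho x * b2 (y x) * Gy i x).
 apply: (@L2_bmul _ _ _ _ _ _ (Mr * L)) => // x.
 by have /andP[p q] := m2 x; rewrite ger0_norm.
have mby : mfun (fun x => b (y x)).
 apply: (mcomp (f := (b : mT -> R)) _ my).
 by apply: continuous_measurable_fun; exact: smooth_continuous.
have LbG i : L2 mu (fun x => b (y x) * Grho i x) by exact: L2_bmul.
have n0 := n1_ge0 Gy; have n2 := n1_ge0 Grho; have n3 := n1_ge0 Hr.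
have h : n1 (fun i x => rho x * (b2 (y x) * Gy i x) + b (y x) * Grho i x) <= Mr * L * n1 Gy + B * n1 Grho.
 rewrite /n1 !mulr_sumr -big_split; apply: ler_sum => i _ /=.
 have -> : nr mu (fun x => rho x * (b2 (y x) * Gy i x) + b (y x) * Grho i x) =
 nr mu (fun x => rho x * b2 (y x) * Gy i x + b (y x) * Grho i x) by apply: eq_nr => x; rewrite mulrA.
 apply: le_trans (nrD (LA i) (LbG i)) _; apply: lerD.
 apply: nr_bounded_mul => //; first exact: mulr_ge0.
 by move=> x; have /andP[p q] := m2 x; rewrite ger0_norm.
 exact: nr_bounded_mul.
apply: (@le_trans _ _ (M * (Mr * L * n1 Gy + B * n1 Grho) + Mr * B * (n1 Hr + Cc))).
 by rewrite lerD2r; exact: ler_wpM2l.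
have p1 : 0 <= M * (Mr * L) by rewrite mulr_ge0// mulr_ge0.
have p2 : 0 <= M * (B * n1 Grho) * n1 Gy by rewrite !mulr_ge0.
have p3 : 0 <= Mr * B * (n1 Hr + Cc) * n1 Gy by rewrite mulr_ge0// mulr_ge0 ?addr_ge0// mulr_ge0.
rewrite -subr_ge0 (_ : _ - _ = M * (Mr * L) + M * (B * n1 Grho) * n1 Gy + Mr * B * (n1 Hr + Cc) * n1 Gy).
 by rewrite !addr_ge0.
by rewrite /K0; ring.
Qed.

(** A crude Young inequality; the difference of the two sides is
    [((del X - Y/2)^2 + 3/4 Y^2) / del]. *)
Let young (del X Y : R) : 0 < del -> X * Y <= del * X ^+ 2 + del^-1 * Y ^+ 2.
Proof.
move=> d0; have h : 0 <= del^-1 * ((del * X - Y / 2) ^+ 2 + 3 / 4 * Y ^+ 2).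
 apply: mulr_ge0; first by rewrite invr_ge0 ltW.
 by apply: addr_ge0; [exact: sqr_ge0|apply: mulr_ge0 => //; exact: sqr_ge0].
rewrite -subr_ge0; move: h; congr (0 <= _).
by field; rewrite gt_eqF.
Qed.

Let K0ge0 : 0 <= K0.
Proof.
have n2 := n1_ge0 Grho; have n3 := n1_ge0 Hr.
by rewrite /K0 !addr_ge0// ?mulr_ge0// addr_ge0.
Qed.

Lemma combo_unif_continuous m (chi : 'I_m -> R -> R) (P : 'I_m -> 'I_d -> V -> R) (a c om : R) :
 (forall i, continuous (chi i)) -> (forall i j, L2 mu (P i j)) -> 0 < om ->
 exists2 h0 : R, 0 < h0 & forall s t, a <= t <= c -> `|s - t| <= h0 ->
 n1 (fun j x => cG P (chi ^~ t) j x - cG P (chi ^~ s) j x) <= om.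
Proof.
move=> cchi LP om0; pose S := \sum_i n1 (P i).
have S0 : 0 <= S by apply: sumr_ge0 => i _; exact: n1_ge0.
have e0 : 0 < om / (S + 1) by rewrite divr_gt0// ltr_wpDl.
have H : \forall h0 \near 0^'+, forall i s t, a <= t <= c -> `|s - t| <= h0 -> `|chi i s - chi i t| <= om / (S + 1).
 apply: filter_forall => i; have [h0 h00 hh] := segment_unif_continuous a c (cchi i) e0.
 apply: filterS (nbhs_right_lt h00) => h hh0 s t tac st; apply: hh => //.
 exact: le_trans st (ltW hh0).
have [h [h0 hP]] := filter_ex (filterI (nbhs_right_gt (0 : R)) H).
exists h => // s t tac st.
have -> : n1 (fun j x => cG P (chi ^~ t) j x - cG P (chi ^~ s) j x) = n1 (cG P (fun i => chi i t - chi i s)).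
 by apply: eq_n1 => j x; rewrite /cG -sumrB; apply: eq_bigr => i _; rewrite mulrBl.
apply: le_trans (n1_combo _ LP) _.
apply: (@le_trans _ _ (\sum_i om / (S + 1) * n1 (P i))).
 apply: ler_sum => i _; apply: ler_wpM2r; first exact: n1_ge0.
 by rewrite distrC; exact: hP.
rewrite -mulr_sumr -/S mulrAC ler_pdivrMr; last by rewrite ltr_wpDl.
by apply: ler_wpM2l; [exact: ltW|rewrite lerDl].
Qed.

(** On [[t - h, t]] the form at [w r] is the form at [w t], bounded below by the dissipation through
    [form_coercive], minus the form at [w t - w r]. The latter is bounded by the H^1 distance, which
    the continuous approximation of the curve controls. *)
Lemma energy_inequality a c (Dq : mT -> R) : 0 < a -> a < c -> c < T -> mfun Dq ->
 {ae leb, forall t : R, D t -> dissip (w t) (Gw t) = Dq t} ->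
 energy c - energy a + lam * \int[leb]_t (\1_`]a, c] t * Dq t) <= 0.
Proof.
move=> a0 ac cT mDq DqE.
have mD : measurable D by exact: mitv.
have mac : measurable (`]a, c]%classic : set mT) by exact: mitv.
have DE (t : R) : \1_D t = ((0 < t) && (t < T))%:R :> R by rewrite indicE mem_setE in_itv.
have acD (t : R) : a < t <= c -> D t.
 by move=> /andP[t1 t2]; rewrite /= in_itv/= (lt_trans a0 t1) (le_lt_trans t2 cT).
have L1N : L2 leb (fun t => \1_D t * (1 + N t)).
 have -> : (fun t : mT => \1_D t * (1 + N t)) = (fun t => \1_D t + \1_D t * N t).
 by apply/funext => t; rewrite mulrDr mulr1.
 apply: L2D => //; split; first exact: mindic.
 have := @intg_indic_itv R T T0 D mD; congr intg; apply/funext => t; rewrite ?expr2.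

have indsq (f : mT -> R) : (fun t => \1_D t * f t ^+ 2) = (fun t => (\1_D t * f t) ^+ 2).
 by apply/funext => t; rewrite indicE; case: (_ \in _); rewrite ?mul1r// !mul0r expr0n.
have j1N : intg leb (fun t => \1_D t * (1 + N t) ^+ 2) by rewrite indsq; have [] := L1N.
have sub_ac (f : mT -> R) : (fun t => \1_`]a, c] t * f t) = (fun t => \1_`]a, c] t * (\1_D t * f t)).
 apply/funext => t; rewrite indic_oc; have [h|_] := boolP (a < t <= c); last by rewrite !mul0r.
 by rewrite !mul1r indicE mem_set ?mul1r//; exact: acD.
set S := \int[leb]_t (\1_`]a, c] t * (1 + N t) ^+ 2).
have jS : intg leb (fun t => \1_`]a, c] t * (1 + N t) ^+ 2) by rewrite sub_ac; exact: intg_indicM.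
have jDq : intg leb (fun t => \1_`]a, c] t * Dq t).
 apply: (@intg_le_ae _ mT R leb _ (fun t => Mr * L * (\1_D t * (1 + N t) ^+ 2))).
 - by apply: mfunM => //; exact: mindic.
 - apply: (ae_mono3 pair_w NE DqE) => t h1 h2 h3.
 rewrite indic_oc; have [h|_] := boolP (a < t <= c); last first.
  rewrite mul0r normr0; apply: mulr_ge0; first exact: mulr_ge0.
  by apply: mulr_ge0; [rewrite indicE|exact: sqr_ge0].
 have Dt := acD _ h; rewrite mul1r -h3//; rewrite indicE mem_set// mul1r.
 rewrite ger0_norm ?dissip_ge0//; apply: le_trans (dissip_le (h1 Dt)) _.
 apply: ler_wpM2l; first exact: mulr_ge0.
 rewrite -h2// ler_pXn2r ?nnegrE ?n1_ge0//; first by rewrite lerDr.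
 by rewrite addr_ge0// n1_ge0.
 - exact: intgZ.
set I := \int[leb]_t (\1_`]a, c] t * Dq t).
have S0 : 0 <= S by apply: Rint_ge0 => t; rewrite mulr_ge0 ?sqr_ge0// indicE.
(* [del] is both the accuracy of the continuous approximation and the parameter of Young's
   inequality. [3 S] counts three uses of that inequality; [2] counts two integrals of [e ^+ 2],
   each at most [del ^+ 2] and multiplied by [del^-1]. *)
suff key del : 0 < del -> energy c - energy a + lam * I <= K0 * (3 * S + 2) * del.
 apply/ler_addgt0Pr => eps eps0; rewrite add0r.
 have k0 : 0 < K0 * (3 * S + 2) + 1 by rewrite ltr_wpDl// mulr_ge0// addr_ge0// mulr_ge0.
 apply: le_trans (key (eps / (K0 * (3 * S + 2) + 1)) _) _; first by rewrite divr_gt0.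
 rewrite mulrCA ger_pMr// ler_pdivrMr// mul1r; lra.
move=> del0.
have [m [chi [p [P [e [cchi pP e0 eE [Le ne]]]]]]] :=
 curve_continuous_approx T0 pair_w approx_w mN NE LN del0.
have LP i j : L2 mu (P i j) by have [_ h _] := pP i; exact: h.
have je : intg leb (fun t => \1_D t * e t ^+ 2) by rewrite indsq; have [] := Le.
have ise : \int[leb]_t (\1_D t * e t ^+ 2) <= del ^+ 2.
 rewrite (_ : (fun t => _) = (fun t => (\1_D t * e t) ^+ 2)); last exact: indsq.
 rewrite -nr_sqE ler_pXn2r ?nnegrE ?nr_ge0//; exact: ltW.
pose g (t : mT) := - lam * Dq t + K0 * (3 * del * (1 + N t) ^+ 2 + del^-1 * e t ^+ 2).
have jse : intg leb (fun t => \1_`]a, c] t * e t ^+ 2) by rewrite sub_ac; exact: intg_indicM.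
have gE : (fun t => \1_`]a, c] t * g t) = (fun t => - lam * (\1_`]a, c] t * Dq t) +
 (K0 * (3 * del) * (\1_`]a, c] t * (1 + N t) ^+ 2) + K0 * del^-1 * (\1_`]a, c] t * e t ^+ 2))).
 by apply/funext => t; rewrite /g; ring.
have jg2 : intg leb (fun t => K0 * (3 * del) * (\1_`]a, c] t * (1 + N t) ^+ 2) + K0 * del^-1 * (\1_`]a, c] t * e t ^+ 2)).
 by apply: intgD; exact: intgZ.
have jg : intg leb (fun t => \1_`]a, c] t * g t) by rewrite gE; apply: intgD => //; exact: intgZ.
have K1 : 0 <= K0 * del^-1 by rewrite mulr_ge0// invr_ge0 ltW.
have main : energy c - energy a <= \int[leb]_t (\1_`]a, c] t * g t) + K0 * del^-1 * \int[leb]_t (\1_D t * e t ^+ 2).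
 apply: (increment_bound a0 ac cT K1 energy_continuous jg) => //; first by move=> t; exact: sqr_ge0.
 (* [increment_bound] expects an error linear in [om], Young's inequality yields a square; since
    [om' <= 1], its square is at most [om]. *)
 move=> om om0; pose om' := Num.min 1 om.
 have om'0 : 0 < om' by rewrite lt_min ltr01.
 have om'2 : om' ^+ 2 <= om.
 apply: (@le_trans _ _ om'); last by rewrite ge_min lexx orbT.
 by rewrite expr2 ger_pMl// ge_min lexx.
 have [h1 h10 hh] := combo_unif_continuous a c cchi LP om'0.
 exists (Num.min h1 (a / 2)); first by rewrite lt_min h10 divr_gt0.
 move=> h /andP[h0]; rewrite lt_min => /andP[hh1 ha2].
 have ha : h < a by apply: lt_trans ha2 _; rewrite ltr_pdivrMr// ltr_pMr// ltr1n.
 apply: (ae_mono3 (ae_mono2 pair_w NE (fun t x1 x2 Dt => conj (x1 Dt) (x2 Dt))) DqE eE) => t q1 q2 q3 tac.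
 have Dt := acD _ tac; have [pt Nt] := q1 Dt; have {q2}Et := q2 Dt; have {q3}et := q3 Dt.
 have /andP[t1 t2] := tac.
 have s0 : 0 < t - h by rewrite subr_gt0 (lt_trans ha t1).
 have st : t - h <= t by rewrite gerBl ltW.
 have tT := le_lt_trans t2 cT.
 have Ls : L2 mu (w (t - h)) by apply: L2_w; rewrite s0 (le_lt_trans st tT).
 have pv := energy_test_pair pt.
 (* The test function is frozen at the right end [t] and so does not depend on the running time [r]
    of the integral it produces. *)
 have [q [jq qE qI]] := weak pv (energy_test_bound (w t)).
 apply: le_trans (energy_increment_le Ls pt) _.
 rewrite qI//.
 have mst : measurable (`]t - h, t]%classic : set mT) by exact: mitv.
 have stD (r : R) : t - h < r <= t -> D r.
 by move=> /andP[r1 r2]; rewrite /= in_itv/= (lt_trans s0 r1) (le_lt_trans r2 tT).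
 have sub_st (f : mT -> R) : (fun r => \1_`](t - h), t] r * f r) = (fun r => \1_`](t - h), t] r * (\1_D r * f r)).
 apply/funext => r; rewrite indic_oc; have [H|_] := boolP (_ < r <= _); last by rewrite !mul0r.
 by rewrite !mul1r indicE mem_set ?mul1r//; exact: stD.
 have jq2 : intg leb (fun r => \1_`](t - h), t] r * q r) by rewrite sub_st; exact: intg_indicM.
 have je2 : intg leb (fun r => \1_`](t - h), t] r * e r ^+ 2) by rewrite sub_st; exact: intg_indicM.
 have [j1 E1] := Rint_indic_oc st.
 set k := g t + K0 / del * om.
 have -> : h * k + K0 / del * \int[leb]_r (\1_`](t - h), t] r * e r ^+ 2) =
  \int[leb]_r (k * \1_`](t - h), t] r + K0 / del * (\1_`](t - h), t] r * e r ^+ 2)).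
 rewrite (RintD (intgZ k j1) (intgZ (K0 / del) je2)) (RintZl j1).
 by rewrite (RintZl je2) E1; congr (_ + _); rewrite mulrC; congr (_ * _); ring.
 have -> : - (\int[leb]_r (\1_`](t - h), t] r * q r)) = \int[leb]_r (-1 * (\1_`](t - h), t] r * q r)) :> R.
 by rewrite (RintZl jq2) mulN1r.
 apply: (@Rint_le_ae _ mT R leb); [exact: intgZ|by apply: intgD; exact: intgZ|].
 apply: (ae_mono3 qE pair_w eE) => r x1 x2 x3; rewrite indic_oc.
 have [H|_] := boolP (_ < r <= _); last by rewrite !mul0r !mulr0 addr0.
 have Dr := stD _ H; have {x1}-> := x1 Dr; have {x2}pr := x2 Dr; have {x3}er := x3 Dr.
 rewrite !mul1r mulr1 mulN1r.
 have F1 := form_coercive pt.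
 have pB : h10p U (fun x => w t x - w r x) (fun i x => Gw t i x - Gw r i x).
 have := h10pD pt (h10pZ (-1) pr); congr h10p; first by apply/funext => x; rewrite mulN1r.
 by apply/funext => i; apply/funext => x; rewrite mulN1r.
 have F2 := energy_form_bound pt pB.
 rewrite (formB pt pr pv (energy_test_bound (w t))) ler_norml in F2.
 have [_ LGt _] := pt; have [_ LGr _] := pr.
 have LC s' j : L2 mu (cG P (chi ^~ s') j) by have [_ x _] := h10p_combo (chi ^~ s') pP; exact: x.
 (* From [w t] to [w r] through the continuous approximations at [t] and at [r], which are within
    [om'] of each other because [r] is within [h] of [t]. *)
 have F3 : n1 (fun i x => Gw t i x - Gw r i x) <= e t + om' + e r.
 apply: le_trans (n1_triB LGt (LC r) LGr) _; apply: lerD; last by rewrite n1_sym.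
 apply: le_trans (n1_triB LGt (LC t) (LC r)) _; apply: lerD => //.
 have /andP[r1 r2] := H.
 apply: hh; first by rewrite (ltW t1).
 rewrite distrC ger0_norm ?subr_ge0//; apply: le_trans (ltW hh1).
 by rewrite lerBlDr -lerBlDl ltW.
 have Np : 0 <= 1 + N t by rewrite -Nt addr_ge0// n1_ge0.
 have F4 : K0 * (1 + n1 (Gw t)) * n1 (fun i x => Gw t i x - Gw r i x) <=
  K0 * (3 * del * (1 + N t) ^+ 2 + del^-1 * (e t ^+ 2 + om + e r ^+ 2)).
 rewrite -mulrA Nt; apply: ler_wpM2l => //.
 apply: le_trans (ler_wpM2l Np F3) _; rewrite !mulrDr.
 have y1 := young (1 + N t) (e t) del0; have y2 := young (1 + N t) om' del0.
 have y3 := young (1 + N t) (e r) del0.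
 have y4 : del^-1 * om' ^+ 2 <= del^-1 * om by apply: ler_wpM2l => //; rewrite invr_ge0 ltW.
 have := lerD (lerD y1 (le_trans y2 (lerD (lexx _) y4))) y3; clear => h.
 apply: le_trans h _; rewrite le_eqVlt; apply/orP; left; apply/eqP; ring.
 have /andP[_ F5] := F2.
 rewrite Et in F1.
 move: (le_trans F5 F4) F1; rewrite /k /g; clear => x1 x2.
 rewrite -subr_ge0; have := addr_ge0 (_ : 0 <= _ - _) (_ : 0 <= _ - _).
 move: x1 x2; rewrite -subr_ge0 => x1; rewrite -subr_ge0 => x2 _.
 have := addr_ge0 x1 x2; congr (0 <= _); ring.
have : energy c - energy a <= - lam * I + K0 * (3 * del) * S + K0 * del^-1 * del ^+ 2 + K0 * del^-1 * del ^+ 2.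
 apply: le_trans main _; apply: lerD; last exact: ler_wpM2l.
 have -> : \int[leb]_t (\1_`]a, c] t * g t) = \int[leb]_t (- lam * (\1_`]a, c] t * Dq t) +
 (K0 * (3 * del) * (\1_`]a, c] t * (1 + N t) ^+ 2) + K0 * del^-1 * (\1_`]a, c] t * e t ^+ 2))).
 by apply: eq_Rintegral => t _; have /(congr1 (fun f => f t)) := gE.
 rewrite (RintD (intgZ (- lam) jDq) jg2).
 rewrite (RintD (intgZ (K0 * (3 * del)) jS) (intgZ (K0 * del^-1) jse)).
 rewrite (RintZl jDq) (RintZl jS) (RintZl jse).
 rewrite addrA; apply: lerD => //; apply: ler_wpM2l => //.
 apply: le_trans ise; rewrite sub_ac; apply: Rint_le => //; first exact: intg_indicM.
 move=> t; have h : 0 <= \1_D t * e t ^+ 2 by apply: mulr_ge0; [rewrite indicE|exact: sqr_ge0].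
 by rewrite -[leRHS]mul1r; apply: ler_wpM2r => //; rewrite indic_oc; case: (_ && _).
have -> : K0 * del^-1 * del ^+ 2 = K0 * del by rewrite expr2 mulrA mulfVK// gt_eqF.
move=> h; rewrite -subr_ge0; move: h; rewrite -subr_ge0 => h; apply: le_trans h _.
by rewrite le_eqVlt; apply/orP; left; apply/eqP; ring.
Qed.

End evolution.

End convex_energy.
End energy.

Lemma Rint0_eq disp (T : measurableType disp) (R : realType) (mu : {measure set T -> \bar R}) (f : T -> R) :
 (forall x, f x = 0) -> \int[mu]_x f x = 0.
Proof. by move=> f0; rewrite (_ : f = cst 0) ?Rintegral_cst ?mul0r//; apply/funext. Qed.

(** * L^q norms of representatives *)

Section Lp_representatives.
Context {R : realType} {d : nat}.
Notation V := 'rV[R]_d.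
Notation mu := (@lebesgue_rV R d).
Variable U : set V.
Hypotheses (oU : open U)
 (fU : (mu U < +oo)%E).
Implicit Types (f g u v : V -> R) (q : R).

Lemma Lpnorm_repr_powR q f g : repr U f g ->
 Lpnorm U q%:E f = ((\int[mu]_x (`|g x| `^ q)%:E) `^ q^-1)%E.
Proof.
move=> [mg fg]; rewrite /Lpnorm (@ae_Lnorm _ _ _ mu q _ (EFin \o g)).
 by rewrite unlock /=; congr (_ `^ _)%E.
by apply: (ae_mono fg) => x /= ->.
Qed.

Lemma measurable_powR_abs q g : mfun g -> mfun (fun x => `|g x| `^ q).
Proof.
move=> mg; apply: (mcomp (measurable_powR _)).
exact: (mcomp mnormr).
Qed.

Lemma Lpnorm_repr_intg q f g : repr U f g -> 0 < q -> (Lpnorm U q%:E f < +oo)%E ->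
 intg mu (fun x => `|g x| `^ q).
Proof.
move=> fg q0; have [mg _] := fg; rewrite (Lpnorm_repr_powR q fg) => h.
apply/integrableP; split; first by apply/mEFinP; exact: measurable_powR_abs.
rewrite (eq_integral (fun x => (`|g x| `^ q)%:E)); last first.
 by move=> x _ /=; rewrite ger0_norm ?powR_ge0.
rewrite ltey; apply/eqP => E; move: h; rewrite E poweRyr ?ltxx//.
by rewrite gt_eqF// invr_gt0.
Qed.

Lemma Lpnorm_reprE q f g : repr U f g -> intg mu (fun x => `|g x| `^ q) ->
 Lpnorm U q%:E f = ((\int[mu]_x (`|g x| `^ q)) `^ q^-1)%:E.
Proof.
move=> fg jg; rewrite (Lpnorm_repr_powR q fg) -poweR_EFin /Rintegral fineK//.
exact: (integrable_fin_num measurableT jg).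
Qed.

Lemma repr_in_Lp q f g : repr U f g -> intg mu (fun x => `|g x| `^ q) -> in_Lp U q%:E f.
Proof.
move=> fg jg; split; first exact: repr_ae_measurable fg.
by rewrite (Lpnorm_reprE fg jg) ltry.
Qed.

(** Square integrability of the drift: on [U], of finite measure, [|H|^2 <= 1 + |H|^p] since
    [p >= 2]. *)
Lemma drift_repr p H : 2 <= p -> in_Lp_vec U p%:E H ->
 exists2 Hr, vrepr U H Hr & (forall j, L2 mu (Hr j)) /\ forall j x, ~ U x -> Hr j x = 0.
Proof.
move=> p2 [/(fun h i => ae_measurable_repr oU (h i)) h hH].
have p0 : 0 < p by apply: lt_le_trans p2.
have /choice[Hr hHr] : forall i, exists g, repr U (fun x => H x ord0 i) g /\ forall x, ~ U x -> g x = 0.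
 by move=> i; have [g] := h i; exists g.
have vH : vrepr U H Hr by move=> i; have [] := hHr i.
have jp := Lpnorm_repr_intg (vrepr_enorm vH) p0 hH.
exists Hr => //; split => j; last by have [] := hHr j.
have mH : mfun (Hr j) by have [[]] := hHr j.
have jU : intg mu (\1_U : V -> R) by exact: intg_indic_fin (open_meas oU) fU.
split => //; apply: intg_le (intgD jU jp) => [|x]; first exact: measurable_funX.
rewrite ger0_norm ?sqr_ge0// indicE; have [Ux|nUx] := boolP (x \in U); last first.
 by rewrite (hHr j).2 ?expr0n ?add0r ?powR_ge0//; rewrite notin_setE in nUx.
set S := Num.sqrt _; have S0 : 0 <= S by exact: sqrtr_ge0.
have HS : `|Hr j x| <= S.
 rewrite -sqrtr_sqr ler_wsqrtr// (bigD1 j)//= lerDl.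
 by apply: sumr_ge0 => i _; exact: sqr_ge0.
rewrite (ger0_norm S0) -real_normK ?num_real//.
have [S1|S1] := leP S 1.
 by rewrite -[leLHS]addr0 lerD ?powR_ge0// expr_le1// (le_trans HS).
apply: (@le_trans _ _ (S ^+ 2)); first by rewrite ler_pXn2r ?nnegrE.
rewrite -[leLHS]add0r lerD// -powR_mulrn//.
by apply: ler_powR => //; exact: ltW.
Qed.

End Lp_representatives.

(** * Borel versions of the coefficients *)

Section coefficients.
Context {R : realType} {d : nat}.
Notation V := 'rV[R]_d.
Notation mu := (@lebesgue_rV R d).

Lemma mxact_dotp (A : 'M[R]_d) (xi eta : V) :
 dotp (mxact A xi) eta = \sum_i \sum_j A i j * xi ord0 j * eta ord0 i.
Proof.
apply: eq_bigr => i _; rewrite /mxact mxE mulr_suml; apply: eq_bigr => j _.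
by rewrite mxE (mulrC (xi _ _)).
Qed.

Lemma enorm_sq (x : V) : enorm x ^+ 2 = \sum_i x ord0 i ^+ 2.
Proof.
rewrite sqr_sqrtr; last by apply: sumr_ge0 => i _; rewrite -expr2 sqr_ge0.
by apply: eq_bigr => i _; rewrite expr2.
Qed.

(** Clipping the entries to [[-M, M]] turns the a.e. bound into one at every point, as the bounded
    multiplication lemmas need; coercivity may stay a.e., being used under an integral only. *)
Lemma diffusion_repr (A : V -> 'M[R]_d) (M lam : R) : 0 <= M ->
 (forall i j, ae_measurable setT (fun x => A x i j)) ->
 {ae mu, forall x, (forall i j, `|A x i j| <= M) /\
 (forall xi, lam * enorm xi ^+ 2 <= dotp (mxact (A x) xi) xi)} ->
 exists Ar : 'I_d -> 'I_d -> V -> R,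
 [/\ forall i j, mfun (Ar i j), forall i j x, `|Ar i j x| <= M,
 {ae mu, forall x, forall i j, A x i j = Ar i j x} &
 {ae mu, forall x, forall xi : 'I_d -> R,
  lam * \sum_i xi i ^+ 2 <= \sum_i \sum_j Ar i j x * xi j * xi i}].
Proof.
move=> M0 mA hA.
have /choice[g0 hg0] : forall ij : 'I_d * 'I_d, exists g : V -> R,
 mfun g /\ {ae mu, forall x, A x ij.1 ij.2 = g x}.
 by move=> [i j]; have [g mg h] := mA i j; exists g; split => //; apply: (ae_mono h) => x; exact.
pose Ar i j (x : V) := Num.max (- M) (Num.min (g0 (i, j) x) M).
have ArM i j x : `|Ar i j x| <= M.
 by rewrite /Ar ler_norml le_max lexx/= ge_max ge_min lexx orbT andbT (le_trans _ M0)// oppr_le0.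
have hall : {ae mu, forall x, forall ij : 'I_d * 'I_d, A x ij.1 ij.2 = g0 ij x}.
 by apply: filter_forall => ij; exact: (hg0 ij).2.
have AE : {ae mu, forall x, forall i j, A x i j = Ar i j x}.
 apply: (ae_mono2 hall hA) => x h1 [h2 _] i j; rewrite /Ar -(h1 (i, j))/=.
 have := h2 i j; rewrite ler_norml => /andP[a b].
 by rewrite min_l// max_r.
exists Ar; split => //.
 move=> i j; apply: measurable_maxr; first exact: mcst.
 by apply: measurable_minr; [exact: (hg0 (i, j)).1|exact: mcst].
apply: (ae_mono2 AE hA) => x h1 [_ h2] xi; have := h2 (\row_i xi i).
rewrite enorm_sq mxact_dotp; congr (_ <= _).
 by congr (_ * _); apply: eq_bigr => i _; rewrite mxE.
by apply: eq_bigr => i _; apply: eq_bigr => j _; rewrite !mxE h1.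
Qed.

End coefficients.

(** Joins the planar case and the case [d >= 3]. Taking the positive part of a Borel version makes
    the potential nonnegative at every point. *)
Lemma pot_repr (R : realType) (d : nat) (U : set 'rV[R]_d) (c : 'rV[R]_d -> R) (s : R) :
 open U -> (lebesgue_rV d U < +oo)%E -> (2 <= d)%N -> (d = 2%N -> 1 < s) ->
 ((3 <= d)%N -> s = d%:R / 2) -> in_Lp U s%:E c ->
 {ae @lebesgue_rV R d, forall x, U x -> 0 <= c x} ->
 exists cr (Cc : R), [/\ repr U c cr, forall x, 0 <= cr x, 0 <= Cc &
 forall v G, h10p U v G -> intg (lebesgue_rV d) (fun x => cr x * `|v x|) /\
  \int[lebesgue_rV d]_x (cr x * `|v x|) <= Cc * gnr G].
Proof.
move=> oU fU; case: d U c oU fU => // n U c oU fU d2 s2 s3 [/(ae_measurable_repr oU)[g cg g0] hc] cp.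
have mU := open_meas oU.
have s0 : 0 < s.
 have [/eqP/s2|n2] := boolP (n.+1 == 2%N); first exact: lt_trans.
 by rewrite s3 ?divr_gt0// ltn_neqAle eq_sym n2.
pose cr x := Num.max 0 (g x).
have [mg gE] := cg.
have crE : repr U c cr.
 apply: repr_trans cg; first by apply: measurable_maxr => //; exact: mcst.
 apply: (ae_mono2 gE cp) => x h1 h2; rewrite /cr; have [Ux|nUx] := pselect (U x).
 by rewrite max_r// -h1 zextE// h2.
 by rewrite g0// maxxx.
have cr0 x : 0 <= cr x by rewrite le_max lexx.
have crU x : ~ U x -> cr x = 0 by move=> nUx; rewrite /cr g0// maxxx.
have jc : intg (lebesgue_rV n.+1) (fun x => cr x `^ s).
 have := Lpnorm_repr_intg crE s0 hc; congr intg; apply/funext => x.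
 by rewrite ger0_norm.
have [Cc Cc0 HC] : exists2 C : R, 0 <= C & forall phi g, testf U phi -> 0 < g ->
 (forall i, nr (lebesgue_rV n.+1) ('D_(delta_mx ord0 i) phi) <= g) ->
 intg (lebesgue_rV n.+1) (fun x => cr x * `|phi x|) /\
 \int[lebesgue_rV n.+1]_x (cr x * `|phi x|) <= C * g.
 have [n2|n2] := leqP 2 n.
 by apply: (pot_test_ge3 mU fU crE.1 cr0 crU jc n2); exact: s3.
 have n1 : n = 1%N by apply/eqP; rewrite eqn_leq -ltnS n2 -ltnS.
 by apply: (pot_test_2 mU fU crE.1 cr0 crU jc n1); apply: s2; rewrite n1.
exists cr, Cc; split => // v G pv.
by apply: (h10p_pot mU fU crE.1 cr0 crU _ pv) => phi g' tphi g'0 h; exact: HC.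
Qed.

Lemma poincare_pair (R : realType) (d : nat) (U : set 'rV[R]_d) v G :
 (0 < d)%N -> open U -> (lebesgue_rV d U < +oo)%E -> h10p U v G ->
 nr (lebesgue_rV d) v <= fine (lebesgue_rV d U) `^ d%:R^-1 * gnr G.
Proof.
case: d U v G => // n U v G _ oU fU; apply: h10p_poincare => phi g tphi h.
exact: poincare_test (open_meas oU) fU tphi h.
Qed.

(** * Topology of Euclidean balls *)

Section euclidean_balls.
Context {R : realType}.

Lemma enorm_continuous (d : nat) (x0 : 'rV[R]_d) : continuous (fun x : 'rV[R]_d => enorm (x - x0)).
Proof.
move=> x; rewrite /enorm.
have c1 : (fun y : 'rV[R]_d => dotp (y - x0) (y - x0)) @ x --> dotp (x - x0) (x - x0).
 pose F i (y : 'rV[R]_d) : R := (y - x0) ord0 i * (y - x0) ord0 i.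
 apply: (@cvg_big R 'I_d +%R 0 xpredT (@add_continuous R) 'rV[R]_d (nbhs x) (index_enum _) F (F ^~ x) (nbhs_filter x)) => i _.
 have c2 : (fun y : 'rV[R]_d => (y - x0) ord0 i) @ x --> (x - x0) ord0 i.
 have -> : (fun y : 'rV[R]_d => (y - x0) ord0 i) = (fun y => y ord0 i - x0 ord0 i).
  by apply/funext => y; rewrite !mxE.
 have -> : (x - x0) ord0 i = x ord0 i - x0 ord0 i by rewrite !mxE.
 exact: cvgB (@continuous_coord R d i x) (cvg_cst _).
 exact: cvgM.
exact: (cvg_comp _ _ c1 (@sqrt_continuous R _)).
Qed.

Lemma open_eball (d : nat) (x0 : 'rV[R]_d) (r : R) : open (eball x0 r).
Proof.
have -> : eball x0 r = (fun x : 'rV[R]_d => enorm (x - x0)) @^-1` [set y | y < r] by [].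
by apply: open_comp => //= x _; exact: enorm_continuous.
Qed.

Lemma closure_eball_sub (d : nat) (x0 : 'rV[R]_d) (r : R) :
 closure (eball x0 r) `<=` [set x | enorm (x - x0) <= r].
Proof.
rewrite closureE => x; apply; split => /=; last by move=> y; exact: ltW.
have -> : [set x | enorm (x - x0) <= r] = (fun x : 'rV[R]_d => enorm (x - x0)) @^-1` [set y | y <= r] by [].
by apply: closed_comp => [y _|]; [exact: enorm_continuous|exact: closed_le].
Qed.

Lemma compact_closure_eball (d : nat) (x0 : 'rV[R]_d.+1) (r : R) : compact (closure (eball x0 r)).
Proof.
apply: bounded_closed_compact; last exact: closed_closure.
exists (`|x0| + `|r|); split; first exact: num_real.
move=> y hy x /closure_eball_sub/= hx; apply: le_trans (ltW hy).
rewrite -[x](subrK x0) addrC; apply: le_trans (ler_normD _ _) _; rewrite lerD2l.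
rewrite [leLHS]/Num.norm/= mx_normrE; apply: bigmax_le => //= [[i j] _] /=.
rewrite (ord1 i); apply: le_trans (ler_norm r); apply: le_trans hx.
rewrite -sqrtr_sqr ler_wsqrtr// /dotp (bigD1 j)//= expr2 lerDl.
by apply: sumr_ge0 => k _; rewrite -expr2 sqr_ge0.
Qed.

End euclidean_balls.

Lemma test_function_sub (R : realType) (d : nat) (U B : set 'rV[R]_d) phi :
 U `<=` B -> testf U phi -> testf B phi.
Proof.
move=> UB [ck [K [cK KU K0]]]; split => //; exists K; split => //.
exact: subset_trans UB.
Qed.

(** * The weight [rho] and its two-sided bounds *)

Section weight.
Context {R : realType} {n : nat}.
Notation d := n.+1.
Notation V := 'rV[R]_d.
Notation mu := (@lebesgue_rV R d).
Variables (U : set V) (x0 : V) (r p lambda M K1 : R) (H : V -> V) (h : V -> R) (A : V -> 'M[R]_d).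
Hypotheses (r0 : 0 < r)
 (hyps : structural_hypotheses lambda M r p U x0 A H h)
 (hK1 : is_K1 d lambda M r p (Lpnorm U p%:E h) K1).
Variables (Ar : 'I_d -> 'I_d -> V -> R) (Hr : 'I_d -> V -> R).
Hypotheses (mA : forall i j, mfun (Ar i j))
 (AM : forall i j x, `|Ar i j x| <= M)
 (AE : {ae mu, forall x, forall i j, A x i j = Ar i j x})
 (HE : vrepr U H Hr)
 (LH : forall j, L2 mu (Hr j)).

(** The solution of the adjoint equation lives on the ball of radius [4 r]. On the compact closure
    of the ball of radius [3 r], which contains [U], it attains its extrema [mr] and [Mr], and the
    Harnack inequality reads [Mr <= K1 * mr]. Test functions of [U] are test functions of the larger
    ball, so the equation restricts. *)
Lemma weight_exists : exists rho Grho (mr Mr : R),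
 [/\ [/\ L2 mu rho, intg mu rho & forall x, 0 <= rho x <= Mr],
  [/\ forall x, U x -> mr <= rho x, 0 < mr & Mr <= K1 * mr],
  [/\ forall i, L2 mu (Grho i), forall i, intg mu (Grho i) & wgrad U rho Grho] &
  forall phi, testf U phi ->
  \sum_j \int[mu]_x (flux Ar Hr rho Grho j x * 'D_(delta_mx ord0 j) phi x) = 0].
Proof.
have [K11 HK] := hK1; have [[oU bU cU] _] := hyps.
have mU := open_meas oU; have fU := lebesgue_rV_bounded_fin mU bU.
have jU : intg mu (\1_U : V -> R) by exact: intg_indic_fin.
have [->|/set0P[x1 Ux1]] := eqVneq U set0.
 (* With [U] empty there is no normalisation point [x1]; the zero weight satisfies every clause, the
    lower bound being asked on [U] only. *)
 exists (fun=> 0), (fun _ _ => 0), 1, 1; split.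
 - by split => [||x]; [exact: L2_0|exact: intg0|rewrite lexx ler01].
 - by split => //; rewrite mulr1.
 - split => [i|i|]; [exact: L2_0|exact: intg0|] => phi tphi i.
 by rewrite !Rint0_eq ?oppr0// => x; rewrite mul0r.
 - move=> phi tphi; rewrite big1// => j _; rewrite Rint0_eq// => x.
 by rewrite /flux big1 ?mul0r ?add0r ?mul0r// => i _; rewrite mulr0.
have [[rho hrho] Hrho] := HK _ _ _ _ _ hyps erefl _ Ux1.
have {Hrho} := Hrho _ hrho; set C := closure _.
have {hrho}[[Lrho [G0 LG0 wG0]] crho rho_gt0 rho1 eqrho] := hrho.
set B := eball x0 (4 * r) in Lrho G0 LG0 wG0 crho rho_gt0 eqrho.
move=> supinf; have oB : open B by exact: open_eball.
have r34 : 3 * r < 4 * r by rewrite ltr_pM2r// ltr_nat.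
have CB : C `<=` B.
 by move=> x /closure_eball_sub/= h1; apply: le_lt_trans r34.
have UC : U `<=` C.
 move=> x Ux; apply: subset_closure; have /= := cU x (subset_closure Ux).
 by move/lt_le_trans; apply; rewrite ler_peMl ?ltW// ltr1n.
have UB := subset_trans UC CB.
have cC : compact C by exact: compact_closure_eball.
have C0 : C !=set0 by exists x1; exact: UC.
have cwC : {within C, continuous rho}.
 by apply: continuous_in_subspaceT => x /set_mem Cx; apply: crho; exact: CB.
have [c1 Cc1 min1] := compact_EVT_min C0 cC cwC.
have [c2 Cc2 max2] := compact_EVT_max C0 cC cwC.
have mr0 : 0 < rho c1 by apply: rho_gt0; apply: CB; exact: set_mem.
pose mr := rho c1; pose Mr := rho c2.
have mM : Mr <= K1 * mr.
 have -> : Mr = sup (rho @` C).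
 apply/eqP; rewrite eq_le; apply/andP; split.
  apply: ub_le_sup; last by exists c2 => //; exact: set_mem.
  by exists Mr => y [x Cx <-]; apply: max2; exact: mem_set.
 apply: ge_sup; first by exists (rho x1), x1 => //; exact: UC.
 by move=> y [x Cx <-]; apply: max2; exact: mem_set.
 apply: le_trans supinf _; apply: ler_wpM2l; first exact: le_trans ler01 K11.
 apply: ge_inf; last by exists c1 => //; exact: set_mem.
 by exists mr => y [x Cx <-]; apply: min1; exact: mem_set.
have mr_le_Mr : mr <= Mr by exact: min1.
have [g rg [Lg g0]] := in_Lp2P oB Lrho; have [mg gE] := rg.
have [LG wG] : in_Lp_vec B 2%:E (grad B rho) /\ is_weak_grad B rho (grad B rho).
 by apply: (@xgetPex _ (fun=> 0) [set G | in_Lp_vec B 2%:E G /\ is_weak_grad B rho G]); exists G0.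
have [GB vG [LGB GB0]] := in_Lp_vec2P oB LG.
have wB := (wgrad_repr rg vG).1 wG.
(* Clipping a Borel version to [[mr, Mr]] alters it on a null part of [U] only and gives bounds at
   every point; outside [U], where no test function of [U] sees it, it is set to zero. *)
pose rr x := \1_U x * Num.max mr (Num.min (g x) Mr).
pose Grho i x := \1_U x * GB i x.
have mI : mfun (\1_U : V -> R) by exact: mindic.
have rrE : {ae mu, forall x, U x -> rr x = rho x /\ g x = rho x}.
 apply: (ae_mono gE) => x gx Ux; rewrite -gx zextE; last exact: UB.
 split => //; rewrite /rr indicE mem_set// mul1r -gx zextE; last exact: UB.
 by rewrite min_l ?max_r//; [apply: min1|apply: max2]; apply/mem_set/UC.
have rrU x : U x -> mr <= rr x.
 by move=> Ux; rewrite /rr indicE mem_set// mul1r le_max lexx.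
have Mr0 : 0 <= Mr by apply: le_trans mr_le_Mr; exact: ltW.
have rr0 x : 0 <= rr x <= Mr * \1_U x.
 rewrite /rr indicE; case: (_ \in _); rewrite ?mul0r ?mulr0 ?lexx//.
 by rewrite mul1r mulr1 le_max (ltW mr0)/= ge_max mr_le_Mr ge_min lexx orbT.
have mrr : mfun rr.
 apply: mfunM => //; apply: measurable_maxr; first exact: mcst.
 by apply: measurable_minr => //; exact: mcst.
have jrr : intg mu rr.
 apply: (intg_le mrr _ (intgZ Mr jU)) => x; have /andP[a b] := rr0 x.
 by rewrite ger0_norm.
have Lrr : L2 mu rr.
 split => //; apply: (intg_le _ _ (intgZ (Mr ^+ 2) jU)); first exact: measurable_funX.
 move=> x; rewrite ger0_norm ?sqr_ge0//; have /andP[a b] := rr0 x.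
 apply: (@le_trans _ _ ((Mr * \1_U x) ^+ 2)).
 by rewrite ler_pXn2r ?nnegrE// mulr_ge0// indicE.
 by rewrite exprMn indicE; case: (_ \in _); rewrite ?expr1n ?expr0n.
have LGr i : L2 mu (Grho i).
 apply: (@L2_bmul _ _ _ _ _ _ 1) => // x.
 by rewrite indicE; case: (_ \in _); rewrite ?normr1 ?normr0.
have Lfl j : L2 mu (flux Ar Hr rr Grho j).
 apply: L2D; first by apply: L2_sum => i _; exact: L2_bmul.
 apply: (@L2_bmul _ _ _ _ _ _ Mr) => // x; have /andP[a b] := rr0 x.
 rewrite ger0_norm//; apply: le_trans b _; rewrite ler_piMr// indicE; by case: (x \in U).
exists rr, Grho, mr, Mr; split.
- split => // x; have /andP[a b] := rr0 x; rewrite a/=; apply: le_trans b _.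
 by rewrite ler_piMr// indicE; case: (_ \in _).
- by split.
- split => // i.
 apply: (L2_intg oU fU) => // x nUx; by rewrite /Grho indicE memNset// mul0r.
 move=> tphi j; have tB := test_function_sub UB tphi.
 have -> : \int[mu]_x (rr x * 'D_(delta_mx ord0 j) i x) = \int[mu]_x (g x * 'D_(delta_mx ord0 j) i x).
 have mD := L2_meas (test_derive_L2 j tphi).
 apply: ae_eq_Rint; [exact: mfunM..|].
 apply: (ae_mono rrE) => x hx; have [Ux|nUx] := pselect (U x); first by have [-> ->] := hx Ux.
 by rewrite (test_off (test_derive j tphi) nUx) !mulr0.
 rewrite wB//; congr (- _); apply: eq_Rintegral => x _; rewrite /Grho indicE.
 have [Ux|nUx] := pselect (U x); first by rewrite mem_set// mul1r.
 by rewrite (test_off tphi nUx) !mulr0.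
move=> phi tphi; have tB := test_function_sub UB tphi.
rewrite -Rint_sum; last by move=> j _; apply: L2_mul => //; exact: test_derive_L2 tphi.
rewrite -[RHS](eqrho _ tB); apply/esym; apply: Rint_repr; split.
 apply: measurable_sum => j; apply: mfunM; first exact: L2_meas (Lfl j).
 exact: L2_meas (test_derive_L2 j tphi).
have vGE : {ae mu, forall x, forall i, zext B (fun x => grad B rho x ord0 i) x = GB i x}.
 by apply: filter_forall => i; have [] := vG i.
have HE' : {ae mu, forall x, forall i, zext U (fun x => H x ord0 i) x = Hr i x}.
 by apply: filter_forall => i; have [] := HE i.
apply: (ae_mono3 (ae_mono2 rrE AE (fun x a b => conj a b)) vGE HE') => x [h1 h2] h3 h4.
have [Ux|nUx] := pselect (U x); last first.
 rewrite big1 => [|j _]; last by rewrite (test_off (test_derive j tphi) nUx) mulr0.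
 have [Bx|nBx] := pselect (B x); last by rewrite zext0.
 rewrite zextE// /dotp big1// => j _.
 by rewrite !mxE (test_off (test_derive j tphi) nUx) mulr0.
have Bx := UB _ Ux; rewrite zextE// /dotp; apply: eq_bigr => j _.
rewrite [cgrad _ _ _ _]mxE; congr (_ * _).
have -> : zext U H x = H x by rewrite /zext /patch mem_set.
rewrite !mxE /flux; have [e1 _] := h1 Ux; rewrite -e1.
have := h4 j; rewrite zextE// => ->; congr (_ + _).
apply: eq_bigr => i _; rewrite !mxE h2 mulrC; congr (_ * _).
by have := h3 i; rewrite zextE// => ->; rewrite /Grho indicE mem_set// mul1r.
Qed.

End weight.

Lemma is_derive_expR_scale (R : realType) (a t : R) :
 is_derive t 1 (fun s : R => expR (a * s)) (a * expR (a * t)).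
Proof.
have d1 : is_derive t 1 (fun s : R => a * s) a.
 by have := is_deriveZ (f := id) a (is_derive_id t 1); rewrite /GRing.scale/= mulr1.
by have := @is_derive1_comp R expR (fun s => a * s) t _ _ (is_derive_expR _) d1; rewrite mulrC.
Qed.

Lemma smooth_expR_scale (R : realType) (a : R) : smooth (fun t : R => expR (a * t)).
Proof.
move=> k; elim: k => // k IH; exists (fun t => a * expR (a * t)).
 by move=> t; exact: is_derive_expR_scale.
by apply: C1kM => //; exact: C1k_cst.
Qed.

(** One choice of representatives for all times. At times where [u t] is not in H^1_0 the gradient
    is the default zero; a solution has a null set of them. *)
Lemma curve_repr (R : realType) (d : nat) (U : set 'rV[R]_d) (u : R -> 'rV[R]_d -> R) :
 open U -> (lebesgue_rV d U < +oo)%E -> (forall t, 0 <= t -> in_Lp U 2%:E (u t)) ->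
 exists ur GR, forall t, 0 <= t ->
 [/\ repr U (u t) (ur t), L2 (lebesgue_rV d) (ur t), forall x, ~ U x -> ur t x = 0 &
 H10 U (u t) -> h10p U (ur t) (GR t) /\ vrepr U (grad U (u t)) (GR t)].
Proof.
move=> oU fU Lu.
have /choice[f hf] : forall t : R, exists f : ('rV[R]_d -> R) * ('I_d -> 'rV[R]_d -> R), 0 <= t ->
 [/\ repr U (u t) f.1, L2 (lebesgue_rV d) f.1, forall x, ~ U x -> f.1 x = 0 &
 H10 U (u t) -> h10p U f.1 f.2 /\ vrepr U (grad U (u t)) f.2].
 move=> t; have [t0|t0] := leP 0 t; last by exists (fun=> 0, fun _ _ => 0).
 have [v uv [Lv v0]] := in_Lp2P oU (Lu t t0).
 have [Hu|nHu] := pselect (H10 U (u t)); last by exists (v, fun _ _ => 0).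
 have [v' [G [uv' vG pG _]]] := H10_pair oU fU Hu.
 exists (v, G) => _; split => // _; split => //.
 have [mv _] := uv; have [_ LG _] := pG.
 apply: h10p_ae pG => //.
 - by move=> i; exact: L2_meas (LG i).
 - exact: repr_unique uv' uv.
 - by move=> i; exact: ae_all.
by exists (fun t => (f t).1), (fun t => (f t).2) => t t0; exact: hf.
Qed.

(** * The rescaled solution as a curve in H^1_0 *)

Section solution_curve.
Context {R : realType} {d : nat}.
Notation V := 'rV[R]_d.
Notation mu := (@lebesgue_rV R d).
Notation leb := (@lebesgue_measure R).
Notation mT := (measurableTypeR R).
Variable U : set V.
Hypotheses (oU : open U)
 (fU : (mu U < +oo)%E).
Variable cP : R.
Hypothesis poincare : forall v G, h10p U v G -> nr mu v <= cP * gnr G.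
Variables (A : V -> 'M[R]_d) (H : V -> V) (c g : V -> R) (theta : R) (u : R -> V -> R).
Hypotheses (theta0 : 0 <= theta)
 (hsol : global_weak_solution U A H c theta g u).
Variables (ur : R -> V -> R) (GR : R -> 'I_d -> V -> R).
Hypothesis hur : forall t, 0 <= t ->
 [/\ repr U (u t) (ur t), L2 mu (ur t), forall x, ~ U x -> ur t x = 0 &
 H10 U (u t) -> h10p U (ur t) (GR t) /\ vrepr U (grad U (u t)) (GR t)].

(** The factor removes the zero order term [theta * u]; all decay in [theta] is recovered when it is
    undone. *)
Definition wcurve (t : R) (x : V) : R := expR (theta * t) * ur t x.
Definition Gcurve (t : R) (i : 'I_d) (x : V) : R := expR (theta * t) * GR t i x.

Lemma curve_L2 t : 0 <= t -> L2 mu (wcurve t).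
Proof. by move=> t0; have [_ L _ _] := hur t0; exact: L2Z. Qed.

Lemma curve_cont0 t : 0 <= t ->
 nr mu (fun x => ur s x - ur t x) @[s --> nbhs_ge0 t] --> (0 : R).
Proof.
move=> t0; have [[_ /(_ t t0) h] _ _] := hsol.
have Lt : L2 mu (ur t) by have [] := hur t0.
apply/cvgrPdist_le => e e0.
have FF : Filter (nbhs_ge0 t) by exact: within_filter.
have /fine_cvgP[_ /cvgrPdist_le /(_ e e0) h2] := h.
have h3 : \forall s \near nbhs_ge0 t, 0 <= s by exact: withinT.
apply: filterS2 h2 h3 => s; rewrite /= => hs s0; move: hs.
have [r1 L1 _ _] := hur s0; have [r2 _ _ _] := hur t0.
by rewrite (Lpnorm_repr (reprB r1 r2) (L2B L1 Lt)).
Qed.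

Lemma curve_cont t : 0 <= t ->
 nr mu (fun x => wcurve s x - wcurve t x) @[s --> nbhs_ge0 t] --> (0 : R).
Proof.
move=> t0; have c0 := curve_cont0 t0; have [_ Lt _ _] := hur t0.
have FF : Filter (nbhs_ge0 t) by exact: within_filter.
have cE : expR (theta * s) @[s --> nbhs_ge0 t] --> expR (theta * t).
 apply: cvg_within_filter.
 apply: (@continuous_comp _ _ _ (fun s : R => theta * s) expR); last exact: continuous_expR.
 exact: mulrl_continuous.
have c1 : (expR (theta * s) * nr mu (fun x => ur s x - ur t x) +
 `|expR (theta * s) - expR (theta * t)| * nr mu (ur t)) @[s --> nbhs_ge0 t] --> (0 : R).
 have e0 : expR (theta * t) * 0 + `|expR (theta * t) - expR (theta * t)| * nr mu (ur t) = 0.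
 by rewrite subrr normr0 mul0r mulr0 addr0.
 rewrite -[X in _ --> X]e0; apply: cvgD; first exact: cvgM.
 by apply: cvgMl; apply: cvg_norm; apply: cvgB => //; exact: cvg_cst.
have h3 : \forall s \near nbhs_ge0 t, 0 <= s by exact: withinT.
apply: (squeeze_cvgr _ (cvg_cst 0) c1); apply: filterS h3 => s s0.
rewrite nr_ge0/=; have [_ Ls _ _] := hur s0; have LB := L2B Ls Lt.
rewrite (@eq_nr _ _ _ _ _ (fun x => expR (theta * s) * (ur s x - ur t x) + (expR (theta * s) - expR (theta * t)) * ur t x)); last first.
 by move=> x; rewrite /wcurve; ring.
apply: le_trans (nrD (L2Z _ LB) (L2Z _ Lt)) _.
by rewrite !nrZ// ger0_norm ?expR_ge0.
Qed.

Variable T : R.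
Hypothesis T0 : 0 < T.
Notation D := (`]0, T[%classic : set mT).

Let D0 (t : R) : D t -> 0 <= t. Proof. by rewrite /= in_itv/= => /andP[/ltW]. Qed.

Lemma curve_cont_interior t : 0 < t < T ->
 nr mu (fun x => wcurve s x - wcurve t x) @[s --> t] --> (0 : R).
Proof.
move=> /andP[t0 _]; have := curve_cont (ltW t0); rewrite within_interior//.
by exists t => //= s; rewrite /ball/=; rewrite ltr_distlC => /andP[]; rewrite subrr => /ltW.
Qed.

Lemma curve_H10 : {ae leb, forall t : R, D t -> H10 U (u t)}.
Proof. by have [_ _ /(_ T T0) [[[]]]] := hsol. Qed.

Lemma curve_pair : {ae leb, forall t : R, D t -> h10p U (ur t) (GR t) /\ h10p U (wcurve t) (Gcurve t)}.
Proof.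
apply: (ae_mono curve_H10) => t h Dt; have [_ _ _ /(_ (h Dt)) [p _]] := hur (D0 Dt).
by split => //; exact: h10pZ.
Qed.

(** The simple functions from the strong measurability of [u], with the exponential moved into the
    coefficients; [\1_D] keeps those bounded. *)
Lemma curve_approx : approx_curve U T Gcurve.
Proof.
have [_ _ /(_ T T0) [[[_ [s [vs cs]]] _] _ _]] := hsol.
have /choice[F hF] : forall f : V -> R, exists pP : (V -> R) * ('I_d -> V -> R), H10 U f ->
 repr U f pP.1 /\ h10p U pP.1 pP.2.
 move=> f; have [Hf|nHf] := pselect (H10 U f); last by exists (f, fun _ => f).
 by have [v [G [? _ ? _]]] := H10_pair oU fU Hf; exists (v, G).
pose pP n i := F (sf_val (s n) i).
have hpP n i : repr U (sf_val (s n) i) (pP n i).1 /\ h10p U (pP n i).1 (pP n i).2.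
 by apply: hF; have [] := vs n i.
exists (fun n => sf_size (s n)), (fun n i t => \1_D t * expR (theta * t) * \1_(sf_set (s n) i) t),
 (fun n i => (pP n i).1), (fun n i => (pP n i).2).
have mD : measurable D by exact: mitv.
have mex : mfun (fun t : mT => expR (theta * t)).
 apply: (mcomp (@measurable_expR R)).
 by apply: mfunM => //; exact: mcst.
have bex t : `|\1_D t * expR (theta * t)| <= expR (theta * T).
 rewrite indicE; have [Dt|_] := boolP (t \in D); last by rewrite mul0r normr0 expR_ge0.
 rewrite mul1r ger0_norm ?expR_ge0// ler_expR; apply: ler_wpM2l => //.
 by move/set_mem : Dt; rewrite /= in_itv/= => /andP[_ /ltW].
split.
- move=> n i; apply: mfunM; last by apply: mindic; have [] := vs n i.
 by apply: mfunM => //; exact: mindic.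
- move=> n i; exists (expR (theta * T)) => t; rewrite normrM (le_trans _ (bex t))// ler_piMr//.
 by rewrite [\1_(sf_set _ _) _]indicE; case: (_ \in _); rewrite ?normr1 ?normr0.
- by move=> n i; have [] := hpP n i.
apply: (ae_mono3 cs curve_H10 curve_pair) => t h1 h2 h3 Dt.
have {}h1 := h1 Dt; have [p1 p2] := h3 Dt; have [r1 _ _ _] := hur (D0 Dt).
pose a n (i : 'I_(sf_size (s n))) : R := \1_(sf_set (s n) i) t.
pose P n i := (pP n i).2.
have pc n := h10p_combo (a n) (fun i => (hpP n i).2).
have rc n : repr U (sf_eval (s n) t) (cv (fun i => (pP n i).1) (a n)).
 apply: (@repr_ext _ _ _ (fun x => \sum_i a n i * sf_val (s n) i x)) => //.
 by apply: repr_sum => i; apply: reprZ; exact: (hpP n i).1.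
have pB n := h10pB (pc n) p1.
have E n : H10norm U (sf_eval (s n) t \- u t) = (gnr (fun j x => cG (P n) (a n) j x - GR t j x))%:E.
 by have [_ _ ->] := pair_H10 oU fU (reprB (rc n) r1) (pB n).
have c1 : gnr (fun j x => cG (P n) (a n) j x - GR t j x) @[n --> \oo] --> 0.
 by apply/cvg_fineP; apply: cvg_ext h1 => n; exact: E.
apply: cvg0_le (cvg0Ml (expR (theta * T) * d%:R) c1) => n; rewrite ger0_norm ?n1_ge0//.
have -> : n1 (fun j x => cG (fun i => (pP n i).2) (fun i => \1_D t * expR (theta * t) * \1_(sf_set (s n) i) t) j x - Gcurve t j x) =
 n1 (fun j x => expR (theta * t) * (cG (P n) (a n) j x - GR t j x)).
 apply: eq_n1 => j x; rewrite mulrBr; congr (_ - _); rewrite /cG mulr_sumr.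
 by apply: eq_bigr => i _; rewrite indicE mem_set// mul1r mulrA.
have [_ LB _] := pB n.
rewrite n1Z// ger0_norm ?expR_ge0// -mulrA; apply: ler_pM; rewrite ?expR_ge0 ?n1_ge0//.
 by have := bex t; rewrite indicE mem_set// mul1r ger0_norm ?expR_ge0.
exact: n1_le_gnr.
Qed.

(** A Borel version of the gradient norm of [u] in time, whose L^2 norm is the Bochner norm of
    estimate (i). It is found for the rescaled curve and scaled back. *)
Lemma curve_gradient_norm : exists qg : mT -> R,
 [/\ mfun qg, {ae leb, forall t : R, D t -> gnr (GR t) = qg t},
  L2 leb (fun t => \1_D t * qg t) &
  L2_H10norm U T u = (nr leb (fun t => \1_D t * qg t))%:E].
Proof.
have cp := (ae_mono curve_pair (fun t h Dt => (h Dt).2)).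
have [q mq qE] := measurable_curve poincare cp curve_approx (@seq_cont_gnr R d U).
pose qg (t : mT) := expR (- (theta * t)) * q t.
have mD : measurable D by exact: mitv.
have mqg : mfun qg.
 apply: mfunM => //; apply: (mcomp (@measurable_expR R)).
 apply: measurable_funN; apply: mfunM => //; exact: mcst.
have qgE : {ae leb, forall t : R, D t -> gnr (GR t) = qg t}.
 apply: (ae_mono2 qE curve_pair) => t h1 h2 Dt; have [[_ LG _] _] := h2 Dt.
 rewrite /qg -h1//.
 have -> : gnr (Gcurve t) = expR (theta * t) * gnr (GR t).
 rewrite /gnr; under eq_bigr do rewrite nrZ// exprMn.
 by rewrite -mulr_sumr sqrtrM ?sqr_ge0// sqrtr_sqr normr_id ger0_norm ?expR_ge0.
 by rewrite mulrA -expRD addNr expR0 mul1r.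
have mI : mfun (fun t : mT => \1_D t * qg t).
 by apply: mfunM => //; exact: mindic.
have nE : L2_H10norm U T u = ((\int[leb]_t ((\1_D t * qg t) ^+ 2)%:E) `^ 2^-1)%E.
 rewrite /L2_H10norm /bochner_L2norm (@ae_Lnorm _ _ _ leb 2 _ (EFin \o (fun t => \1_D t * qg t))).
 rewrite unlock /=; congr (_ `^ _)%E; apply: eq_integral => x _.
 by rewrite powR_mulrn ?normr_ge0// real_normK ?num_real.
 apply: (ae_mono3 qgE curve_H10 curve_pair) => t h1 h2 h3; rewrite /= indicE /patch.
 case: ifPn => [/set_mem Dt|_]; last by rewrite /= mul0r.
 rewrite mul1r -h1//; have [r1 _ _ _] := hur (D0 Dt); have [p1 _] := h3 Dt.
 by have [_ _ ->] := pair_H10 oU fU r1 p1.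
have L : L2 leb (fun t => \1_D t * qg t).
 split => //; apply/integrableP; split; first by apply/mEFinP; exact: measurable_funX.
 rewrite (eq_integral (fun t => ((\1_D t * qg t) ^+ 2)%:E)); last first.
 by move=> x _ /=; rewrite ger0_norm ?sqr_ge0.
 have [_ _ /(_ T T0) [[_]]] := hsol.
 rewrite -/(L2_H10norm U T u) nE => h _ _.
 by rewrite ltey; apply/eqP => E; move: h; rewrite E poweRyr ?ltxx.
exists qg; split => //.
by rewrite nE nr_sq_int// poweR_EFin powR12_sqrt ?sqr_ge0// sqrtr_sqr ger0_norm ?nr_ge0.
Qed.

Section weak_form.
Variables (Ar : 'I_d -> 'I_d -> V -> R) (Hr : 'I_d -> V -> R) (cr : V -> R) (M Cc : R).
Hypotheses (mA : forall i j, mfun (Ar i j))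
 (AM : forall i j x, `|Ar i j x| <= M)
 (AE : {ae mu, forall x, forall i j, A x i j = Ar i j x})
 (HE : vrepr U H Hr)
 (LH : forall j, L2 mu (Hr j))
 (cE : repr U c cr)
 (c0 : forall x, 0 <= cr x)
 (pot : forall v G, h10p U v G ->
 intg mu (fun x => cr x * `|v x|) /\ \int[mu]_x (cr x * `|v x|) <= Cc * gnr G).

Let mc : mfun cr. Proof. by have [] := cE. Qed.

Lemma formZ (a b C : R) z Gz v Gv : h10p U z Gz -> h10p U v Gv -> (forall x, `|v x| <= C) ->
 form Ar Hr cr (fun x => a * z x) (fun i x => a * Gz i x) (fun x => b * v x) (fun i x => b * Gv i x) =
 a * b * form Ar Hr cr z Gz v Gv.
Proof.
move=> pz [Lv LGv _] vC; have [Lz LGz _] := pz; have mv := L2_meas Lv.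
rewrite /form !mulrDr; congr (_ + _ + _).
- rewrite mulr_sumr; apply: eq_bigr => i _; rewrite mulr_sumr; apply: eq_bigr => j _.
 rewrite -(RintZl (intg_form_principal mA AM i j (LGz j) (LGv i))).
 by apply: eq_Rintegral => x _; ring.
- rewrite mulr_sumr; apply: eq_bigr => j _.
 rewrite -(RintZl (intg_form_drift LH j (LGz j) mv vC)).
 by apply: eq_Rintegral => x _; ring.
- rewrite -(RintZl (intg_form_pot mc c0 pot pz mv vC)).
 by apply: eq_Rintegral => x _; ring.
Qed.

Lemma pair_repr v Gv : h10p U v Gv -> repr U v v.
Proof.
move=> pv; have [Lv _ _] := pv; split; first exact: L2_meas Lv.
apply: (ae_mono (h10p_off (open_meas oU) pv)) => x h.
by have [Ux|nUx] := pselect (U x); [rewrite zextE|rewrite zext0// h].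
Qed.

(** Translates the integral of the equation over [U], written with chosen gradients, into the form
    on representatives; the part in [theta] is split off. *)
Lemma form_equation t v Gv (C : R) : 0 <= t -> H10 U (u t) -> h10p U v Gv -> (forall x, `|v x| <= C) ->
 \int[mu]_(x in U) (dotp (mxact (A x) (grad U (u t) x)) (grad U v x) +
  dotp (H x) (grad U (u t) x) * v x + (c x + theta) * u t x * v x) =
 form Ar Hr cr (ur t) (GR t) v Gv + theta * ip mu (ur t) v.
Proof.
move=> t0 Ht pv vC; have [rt Lt ut0 /(_ Ht) [pt vt]] := hur t0.
have rv := pair_repr pv; have [_ vv _] := pair_H10 oU fU rv pv.
have [Lv LGv _] := pv; have [_ LGt _] := pt; have mv := L2_meas Lv.
have mt := L2_meas Lt.
pose gA x := \sum_i \sum_j Ar i j x * GR t j x * Gv i x.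
pose gH x := \sum_j Hr j x * GR t j x * v x.
pose gc x := cr x * ur t x * v x.
pose gt x := theta * (ur t x * v x).
have jA : intg mu gA by apply: intg_sum => i _; apply: intg_sum => j _; exact: (intg_form_principal mA AM).
have jH : intg mu gH by apply: intg_sum => j _; exact: (intg_form_drift LH j (LGt j) mv vC).
have jc : intg mu gc by exact: (intg_form_pot mc c0 pot pt mv vC).
have jt : intg mu gt by apply: intgZ; exact: L2_mul.
have E : \int[mu]_x (gA x + gH x + gc x + gt x) = form Ar Hr cr (ur t) (GR t) v Gv + theta * ip mu (ur t) v.
 have jAH := intgD jA jH; have jAHc := intgD jAH jc.
 rewrite (RintD jAHc jt) (RintD jAH jc) (RintD jA jH).
 rewrite (RintZl (L2_mul Lt Lv)) /form; congr (_ + _ + _ + _).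
 rewrite Rint_sum; last by move=> i _; apply: intg_sum => j _; exact: (intg_form_principal mA AM).
 by apply: eq_bigr => i _; rewrite Rint_sum// => j _; exact: (intg_form_principal mA AM).
 by rewrite Rint_sum// => j _; exact: (intg_form_drift LH j (LGt j) mv vC).
rewrite -E; apply: Rint_repr; split.
 exact: intg_meas (intgD (intgD (intgD jA jH) jc) jt).
have vtE : {ae mu, forall x, forall i, U x -> grad U (u t) x ord0 i = GR t i x}.
 apply: filter_forall => i; have [_ h] := vt i; apply: (ae_mono h) => x hx Ux.
 by rewrite -hx zextE.
have vvE : {ae mu, forall x, forall i, (U x -> grad U v x ord0 i = Gv i x) /\ (~ U x -> Gv i x = 0)}.
 apply: filter_forall => i; have [_ h] := vv i; apply: (ae_mono h) => x hx; split=> Ux.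
 by rewrite -hx zextE.
 by rewrite -hx zext0.
have HvE : {ae mu, forall x, forall i, U x -> H x ord0 i = Hr i x}.
 apply: filter_forall => i; have [_ h] := HE i; apply: (ae_mono h) => x hx Ux.
 by rewrite -hx zextE.
have [_ cEae] := cE; have [_ rtae] := rt; have [_ rvae] := rv.
apply: (ae_mono3 (ae_mono2 vtE vvE (fun x a b => conj a b)) (ae_mono2 HvE AE (fun x a b => conj a b))
 (ae_mono3 cEae rtae rvae (fun x a b c => conj a (conj b c)))) => x [h1 h2] [h3 h4] [h5 [h6 h7]].
have [Ux|nUx] := pselect (U x); last first.
 rewrite zext0// /gA /gH /gc /gt -h7 zext0// !mulr0 !addr0 big1 ?big1 ?addr0//.
 by move=> j _; rewrite mulr0.
 by move=> i _; apply: big1 => j _; have [_ ->] := h2 i; rewrite ?mulr0.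
rewrite zextE// in h5; rewrite zextE// in h6; rewrite zextE//.
rewrite mxact_dotp /gA /gH /gc /gt -[RHS]addrA; congr (_ + _ + _).
- apply: eq_bigr => i _; apply: eq_bigr => j _; have [h2a _] := h2 i.
 by rewrite h4 h1// h2a.
- by rewrite /dotp mulr_suml; apply: eq_bigr => j _; rewrite h3// h1.
- by rewrite -h5 -h6; ring.
Qed.

(** The equation integrated in time against a fixed [v]: the scalar weak derivative of the pairing,
    read off from the equation, and [weak_derivative_ftc]. The sign of [q] is that of [form], so
    increments carry a minus. *)
Lemma curve_weak v Gv (C : R) : h10p U v Gv -> (forall x, `|v x| <= C) ->
 exists q : mT -> R, [/\ intg leb (fun t => \1_D t * q t),
 {ae leb, forall t : R, D t -> q t = form Ar Hr cr (wcurve t) (Gcurve t) v Gv} &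
 forall t1 t2, 0 < t1 -> t1 <= t2 -> t2 < T ->
  ip mu (fun x => wcurve t2 x - wcurve t1 x) v = - \int[leb]_t (\1_`]t1, t2] t * q t)].
Proof.
move=> pv vC; have [_ _ /(_ T T0) [_ [u' [Lu' du' eqn]] _]] := hsol.
(* [time_derivative_pairing] asks for a test function of norm at most 1, so [v] is divided by [k]
   and the factor is restored at the end; the [+ 1] makes [k] positive. *)
pose k : R := gnr Gv + 1.
have k0 : 0 < k by rewrite ltr_wpDl// gnr_ge0.
have pv1 := h10pZ k^-1 pv; set v1 := (fun x => k^-1 * v x) in pv1 *.
set G1 := (fun i x => k^-1 * Gv i x) in pv1 *.
have kV0 : 0 <= k^-1 by rewrite invr_ge0 ltW.
have [Lv _ _] := pv; have [Lv1 _ _] := pv1.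
have [_ LGv _] := pv.
have v1C x : `|v1 x| <= k^-1 * C.
 by rewrite normrM (ger0_norm kV0); exact: ler_wpM2l.
have [Hv1 _ nv1] := pair_H10 oU fU (pair_repr pv1) pv1.
have nv1' : (H10norm U v1 <= 1)%E.
 rewrite nv1 lee_fin; have -> : gnr G1 = k^-1 * gnr Gv.
 rewrite /gnr; under eq_bigr do rewrite nrZ// exprMn.
 by rewrite -mulr_sumr sqrtrM ?sqr_ge0// sqrtr_sqr normr_id (ger0_norm kV0).
 by rewrite mulrC ler_pdivrMr// mul1r lerDl.
have mD : measurable D by exact: mitv.
have DE (t : R) : D t = (0 < t < T) by rewrite /= in_itv.
pose f (t : R) := ip mu (ur t) v1.
have fE t : D t -> L2_to_Hm1 U (u t) v1 = f t.
 move=> /D0/hur[rt _ _ _]; rewrite /L2_to_Hm1 (Rint_repr (reprM rt (pair_repr pv1))).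
 by [].
have cf : {in `]0, T[, continuous f}.
 move=> t; rewrite in_itv/= => tT; have /andP[/ltW t0 _] := tT.
 have [_ Lt _ _] := hur t0.
 have nT : \forall s \near t, 0 < s < T.
 have := @near_in_itvoo R 0 T t; rewrite in_itv => /(_ tT).
 by apply: filterS => s; rewrite in_itv.
 have c1 : nr mu (fun x => ur s x - ur t x) @[s --> t] --> (0 : R).
 have := curve_cont0 t0; rewrite within_interior//.
 by exists t => /=; [by have /andP[] := tT|move=> s; rewrite /ball/= ltr_distlC subrr => /andP[/ltW]].
 have c2 : (nr mu (fun x => ur s x - ur t x) * nr mu v1) @[s --> t] --> (0 : R).
 by rewrite -[X in _ --> X](mul0r (nr mu v1)); exact: cvgMl.
 apply/cvgrPdist_le => e e0; have /cvgrPdist_le /(_ e e0) c3 := c2.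
 apply: filterS2 c3 nT => s; rewrite sub0r normrN ger0_norm ?mulr_ge0 ?nr_ge0// => h /andP[/ltW s0 _].
 have [_ Ls _ _] := hur s0; apply: le_trans h; rewrite distrC /f -ipBl//.
 by apply: ip_le => //; exact: L2B.
have mf : mfun (fun t : mT => \1_D t * f t).
 have : measurable_fun D (f : mT -> R).
 apply: open_continuous_measurable_fun; first exact: interval_open.
 by move=> t /set_mem Dt; apply: cf.
 move=> /(measurable_restrictT _ mD).1; congr measurable_fun; apply/funext => t.
 by rewrite /patch indicE; case: ifPn => _; rewrite ?mul1r ?mul0r.
have EL : (fun t : mT => \1_D t * L2_to_Hm1 U (u t) v1) = (fun t => \1_D t * f t).
 apply/funext => t; rewrite indicE; have [/set_mem Dt|_] := boolP (t \in D); last by rewrite !mul0r.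
 by rewrite fE.
have mL : mfun (fun t : mT => \1_D t * L2_to_Hm1 U (u t) v1) by rewrite EL.
have [q1 [mq1 q1E jq1 hq1]] := time_derivative_pairing T0 Hv1 nv1' Lu' du' mL.
pose ex (t : R) := expR (theta * t).
have mex : mfun (ex : mT -> R).
 apply: (mcomp (@measurable_expR R)).
 by apply: mfunM => //; exact: mcst.
have bex t : `|\1_D t * ex t| <= expR (theta * T).
 rewrite indicE; have [Dt|_] := boolP (t \in D); last by rewrite mul0r normr0 expR_ge0.
 rewrite mul1r ger0_norm ?expR_ge0// ler_expR; apply: ler_wpM2l => //.
 by move/set_mem : Dt; rewrite /= in_itv/= => /andP[_ /ltW].
have DD (t : R) : \1_D t * \1_D t = \1_D t :> R by rewrite indicE; case: (_ \in _); rewrite ?mul1r ?mul0r.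
have jf : intg leb (fun t => \1_D t * f t).
 have [qg [mqg qgE Lqg _]] := curve_gradient_norm.
 apply: (@intg_le_ae _ mT R leb _ (fun t => nr mu v1 * `|cP| * `|\1_D t * qg t|)) => //; last first.
 by apply: intgZ; apply: intg_abs; exact: intg_itv.
 apply: (ae_mono2 qgE curve_pair) => t h1 h2; rewrite indicE.
 have [/set_mem Dt|_] := boolP (t \in D); last by rewrite !mul0r normr0 mulr0.
 have [p1 _] := h2 Dt; have [Lt _ _] := p1; rewrite !mul1r -h1// (ger0_norm (gnr_ge0 _)).
 apply: le_trans (ip_le Lt Lv1) _; rewrite mulrC -mulrA; apply: ler_wpM2l; first exact: nr_ge0.
 apply: le_trans (poincare p1) _; apply: ler_wpM2r; first exact: gnr_ge0.
 exact: ler_norm.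
(* Minus the weak derivative of [ex t * f t]. By the equation [q1 t + theta * f t] is minus the form
   at [u t], so [qt] is the form at the rescaled curve. *)
pose qt (t : R) := - (ex t * (q1 t + theta * f t)).
have jqt : intg leb (fun t : R => \1_D t * qt t).
 have -> : (fun t : R => \1_D t * qt t) = (fun t : R => - (\1_D t * ex t) * (\1_D t * q1 t + theta * (\1_D t * f t))).
 by apply/funext => t; rewrite /qt -[in LHS](DD t); ring.
 apply: (@intg_bmul _ mT R leb _ _ (expR (theta * T))).
 - by apply: measurable_funN; apply: mfunM => //; exact: mindic.
 - by move=> t; rewrite normrN.
 - by apply: intgD => //; exact: intgZ.
pose ft (t : R) := ex t * f t.
have cft : {in `]0, T[, continuous ft}.
 move=> t tD; apply: cvgM; last exact: cf.
 apply: (@continuous_comp _ _ _ (fun s : R => theta * s) expR); last exact: continuous_expR.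
 exact: mulrl_continuous.
have hz (zeta : R -> R) : time_test_function T zeta -> smooth zeta ->
 \int[leb]_t (\1_D t * (zeta t * qt t)) = \int[leb]_t (\1_D t * (derive1 zeta t * ft t)).
 (* The exponential is moved into the time test function, and the extra term of the product rule
    cancels the [theta * f t] inside [qt]. *)
 move=> tz sz; pose eta (t : R) := ex t * zeta t.
 have seta : smooth eta by move=> j; apply: C1kM; [exact: smooth_expR_scale|exact: sz].
 have teta : time_test_function T eta.
 split; first by move=> j t; exact: smooth_derive1n.
 have [_ [K [cK KT K0]]] := tz; exists K; split => // t nKt.
 by rewrite /eta K0// mulr0.
 have deta t : derive1 eta t = ex t * (theta * zeta t + derive1 zeta t).
 have d1 := is_derive_expR_scale theta t; have [_ /(_ t) d2] := smooth_derive sz.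
 have d3 := is_deriveM d1 d2; rewrite derive1E.
 by rewrite (@derive_val _ _ _ _ _ _ _ d3) /GRing.scale/= /ex; ring.
 have [meta _ [Ce eC] _] := time_test_facts teta.
 have [mzeta mdz [Cz zC] [Cdz dzC]] := time_test_facts tz.
 have := hq1 eta teta => hq.
 have j1 : intg leb (fun t : R => \1_D t * (eta t * q1 t)).
 have := @intg_bmul _ mT R leb _ _ Ce meta eC jq1.
 by congr intg; apply/funext => t; ring.
 have bound_f (b : R -> R) (Cb : R) : mfun (b : mT -> R) -> (forall t, `|b t| <= Cb) ->
  intg leb (fun t : R => \1_D t * (b t * ft t)).
 move=> mb bC.
 have -> : (fun t : R => \1_D t * (b t * ft t)) = (fun t : R => (b t * (\1_D t * ex t)) * (\1_D t * f t)).
  by apply/funext => t; rewrite /ft -[in LHS](DD t); ring.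
 have Cb0 : 0 <= Cb := le_trans (normr_ge0 _) (bC 0).
 apply: (@intg_bmul _ mT R leb _ _ (Cb * expR (theta * T))) => //.
  by apply: mfunM => //; apply: mfunM => //; exact: mindic.
 by move=> t; rewrite normrM; apply: ler_pM.
 have jz := bound_f zeta Cz mzeta zC; have jdz := bound_f _ Cdz mdz dzC.
 have -> : \int[leb]_t (\1_D t * (zeta t * qt t)) =
  \int[leb]_t (-1 * (\1_D t * (eta t * q1 t)) - theta * (\1_D t * (zeta t * ft t))).
 by apply: eq_Rintegral => t _; rewrite /qt /eta /ft; ring.
 rewrite (RintB (intgZ (-1) j1) (intgZ theta jz)).
 rewrite (RintZl j1) (RintZl jz) hq.
 have -> : \int[leb]_t (\1_D t * (derive1 eta t * L2_to_Hm1 U (u t) v1)) =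
  \int[leb]_t (theta * (\1_D t * (zeta t * ft t)) + \1_D t * (derive1 zeta t * ft t)).
 apply: eq_Rintegral => t _; rewrite indicE; have [/set_mem Dt|_] := boolP (t \in D); last first.
  by rewrite !mul0r mulr0 addr0.
 by rewrite deta fE// /ft; ring.
 rewrite (RintD (intgZ theta jz) jdz) (RintZl jz); ring.
have ftc := weak_derivative_ftc cft jqt hz.
exists (fun t => k * qt t); split.
- by have := intgZ k jqt; congr intg; apply/funext => t; rewrite mulrCA.
- apply: (ae_mono3 (eqn v1 Hv1) q1E (ae_mono2 curve_H10 curve_pair (fun t a b Dt => conj (a Dt) (b Dt)))) => t h1 h2 h3 Dt.
 have [Ht [pt _]] := h3 Dt; have := h1 Dt.
 rewrite h2// (form_equation (D0 Dt) Ht pv1 v1C) => h.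
 have -> : form Ar Hr cr (wcurve t) (Gcurve t) v Gv = ex t * k * form Ar Hr cr (ur t) (GR t) v1 G1.
 transitivity (form Ar Hr cr (wcurve t) (Gcurve t) (fun x => k * v1 x) (fun i x => k * G1 i x)); last first.
  exact: (formZ (ex t) k pt pv1 v1C).
 have kK y : k * (k^-1 * y) = y by rewrite mulrA divff ?mul1r// gt_eqF.
 congr form; first by apply/funext => x; rewrite kK.
 by apply/funext => i; apply/funext => x; rewrite kK.
 have q1t : q1 t = - (form Ar Hr cr (ur t) (GR t) v1 G1 + theta * f t).
 by apply/eqP; rewrite -addr_eq0; apply/eqP.
 by rewrite /qt q1t; ring.
- move=> t1 t2 t10 t12 t2T.
 have [_ L1 _ _] := hur (ltW t10); have [_ L2_ _ _] := hur (ltW (lt_le_trans t10 t12)).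
 have -> : ip mu (fun x => wcurve t2 x - wcurve t1 x) v = k * (ft t2 - ft t1).
 have Lw1 := curve_L2 (ltW t10); have Lw2 := curve_L2 (ltW (lt_le_trans t10 t12)).
 rewrite ipBl// /ft /f /wcurve !ipZl// /v1 !ipZr// mulrBr.
 by congr (_ - _); rewrite mulrCA [k * _]mulrA divff ?mul1r// gt_eqF.
 have sub12 (r : R) : t1 < r <= t2 -> D r.
 by move=> /andP[r1 r2]; rewrite DE (lt_trans t10 r1) (le_lt_trans r2 t2T).
 have j12 : intg leb (fun r => \1_`]t1, t2] r * qt r).
 have -> : (fun r : R => \1_`]t1, t2] r * qt r) = (fun r => \1_`]t1, t2] r * (\1_D r * qt r)).
  apply/funext => r; rewrite indic_oc; have [hr|_] := boolP (_ < r <= _); last by rewrite !mul0r.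
  by rewrite !mul1r indicE mem_set ?mul1r//; exact: sub12.
 by apply: intg_indicM => //; exact: mitv.
 rewrite ftc// mulrN -(RintZl j12); congr (- _).
 by apply: eq_Rintegral => r _; rewrite mulrCA.
Qed.

End weak_form.

End solution_curve.

(** * The energy inequality for the solution *)

Definition convex_profile (R : realType) (Phi b b2 : R -> R) (B L L2' : R) :=
 [/\ [/\ smooth Phi, smooth b, forall y : R, is_derive y 1 Phi (b y) & forall y : R, is_derive y 1 b (b2 y)],
  [/\ Phi 0 = 0, b 0 = 0 & forall y, `|b y| <= B] &
  [/\ forall y, 0 <= b2 y <= L, forall x y, `|b2 x - b2 y| <= L2' * `|x - y| &
   forall x y, Phi x - Phi y <= b x * (x - y)]].

Section solution_energy.
Context {R : realType} {d : nat}.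
Notation V := 'rV[R]_d.
Notation mu := (@lebesgue_rV R d).
Notation leb := (@lebesgue_measure R).
Notation mT := (measurableTypeR R).

Definition solution_repr (U : set V) (u : R -> V -> R) ur GR := forall t, 0 <= t ->
 [/\ repr U (u t) (ur t), L2 mu (ur t), forall x, ~ U x -> ur t x = 0 &
 H10 U (u t) -> h10p U (ur t) (GR t) /\ vrepr U (grad U (u t)) (GR t)].

Definition weight_bounds (U : set V) (rho : V -> R) (mr Mr K1 : R) :=
 [/\ L2 mu rho, intg mu rho, forall x, 0 <= rho x <= Mr & [/\ forall x, U x -> mr <= rho x, 0 < mr & Mr <= K1 * mr]].

(** One weight and one choice of representatives serve every profile; this uniformity is what allows
    limits over profiles later. *)
Lemma solution_energy (U : set V) (x0 : V) (r p M lambda : R) (H : V -> V) (h : V -> R)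
 (A : V -> 'M[R]_d) (theta s : R) (c g : V -> R) (u : R -> V -> R) (K1 : R) :
 (2 <= d)%N -> 0 < r -> d%:R < p -> 0 < M ->
 structural_hypotheses lambda M r p U x0 A H h -> 0 <= theta ->
 (d = 2%N -> 1 < s) -> ((3 <= d)%N -> s = d%:R / 2) -> in_Lp U s%:E c ->
 {ae mu, forall x, U x -> 0 <= c x} -> global_weak_solution U A H c theta g u ->
 is_K1 d lambda M r p (Lpnorm U p%:E h) K1 ->
 exists ur GR rho (mr Mr : R), [/\ solution_repr U u ur GR, weight_bounds U rho mr Mr K1 &
 forall Phi b b2 B L L2', convex_profile Phi b b2 B L L2' -> forall T, 0 < T ->
 exists2 Dq : mT -> R, mfun Dq &
  {ae leb, forall t : R, `]0, T[%classic t -> dissip rho b2 (wcurve theta ur t) (Gcurve theta GR t) = Dq t} /\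
  forall a c, 0 < a -> a < c -> c < T ->
  energy rho Phi (wcurve theta ur) c - energy rho Phi (wcurve theta ur) a +
  lambda * \int[leb]_t (\1_`]a, c] t * Dq t) <= 0].
Proof.
move=> d2 r0 dp M0 hyps theta0 s2 s3 Lc cp hsol hK1.
have [[oU bU cU] [[LHp Lh Hh] [mA hA]]] := hyps.
have mU := open_meas oU; have fU := lebesgue_rV_bounded_fin mU bU.
have d0 : (0 < d)%N by exact: leq_trans d2.
have p2 : 2 <= p by apply: le_trans (ltW dp); rewrite ler_nat.
have [Ar [mAr ArM AE coer]] := diffusion_repr (ltW M0) mA hA.
have [Hr HE [LH H0]] := drift_repr oU fU p2 LHp.
have [cr [Cc [cE cr0 Cc0 pot]]] := pot_repr oU fU d2 s2 s3 Lc cp.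
have poinc v G : h10p U v G -> nr mu v <= fine (mu U) `^ d%:R^-1 * gnr G.
 exact: poincare_pair.
have [rho [Grho [mr [Mr [[Lrho jrho rho0] hm [LGrho jGrho wrho] adj]]]]] :
 exists rho Grho (mr Mr : R),
 [/\ [/\ L2 mu rho, intg mu rho & forall x, 0 <= rho x <= Mr],
  [/\ forall x, U x -> mr <= rho x, 0 < mr & Mr <= K1 * mr],
  [/\ forall i, L2 mu (Grho i), forall i, intg mu (Grho i) & wgrad U rho Grho] &
  forall phi, testf U phi ->
  \sum_j \int[mu]_x (flux Ar Hr rho Grho j x * 'D_(delta_mx ord0 j) phi x) = 0].
 clear -r0 hyps hK1 mAr ArM AE HE LH d0.
 case: d d0 U x0 H h A hyps hK1 Ar Hr mAr ArM AE HE LH => // n _ U x0 H h A hyps hK1 Ar Hr mAr ArM AE HE LH.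
 exact: (weight_exists r0 hyps hK1 mAr ArM AE HE LH).
have [Lu _ _] := hsol; have [ur [GR hur]] := curve_repr oU fU Lu.1.
exists ur, GR, rho, mr, Mr; split => // Phi b b2 B L L2' [[sPhi sb dPhi db] [Phi0 b0 bB] [b2L b2Lip conv]] T T0.
have cp2 := curve_pair hsol hur T0.
have pw : {ae leb, forall t : R, `]0, T[%classic t -> h10p U (wcurve theta ur t) (Gcurve theta GR t)}.
 by apply: (ae_mono cp2) => t x Dt; have [] := x Dt.
have aw := curve_approx oU fU theta0 hsol hur T0.
have sQ := seq_cont_dissip Lrho rho0 b2L b2Lip (U := U).
have [Dq mDq DqE] := measurable_curve poinc pw aw sQ.
have [N mN NE] := measurable_curve poinc pw aw (@seq_cont_n1 R d U).
have [qg [mqg qgE Lqg _]] := curve_gradient_norm oU fU poinc theta0 hsol hur T0.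
have LN : L2 leb (fun t => \1_`]0, T[ t * N t).
 have mD : measurable (`]0, T[%classic : set mT) by exact: mitv.
 have mI : mfun (fun t : mT => \1_`]0, T[ t * N t).
 by apply: mfunM => //; exact: mindic.
 split => //; have [_ jq] := L2Z (d%:R * expR (theta * T)) Lqg.
 apply: (@intg_le_ae _ mT R leb _ _ _ _ jq); first exact: measurable_funX.
 apply: (ae_mono3 NE qgE cp2) => t h1 h2 h3; rewrite ger0_norm ?sqr_ge0// indicE.
 have [/set_mem Dt|_] := boolP (t \in _); last by rewrite !mul0r mulr0.
 have [[_ LG _] _] := h3 Dt; rewrite !mul1r -h1// -h2//.
 rewrite ler_pXn2r ?nnegrE ?n1_ge0//; last by rewrite !mulr_ge0 ?expR_ge0 ?gnr_ge0.
 rewrite [n1 _]n1Z// ger0_norm ?expR_ge0// mulrAC mulrC; apply: ler_pM; rewrite ?expR_ge0 ?n1_ge0//.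
 exact: n1_le_gnr.
 rewrite ler_expR; apply: ler_wpM2l => //.
 by move: Dt; rewrite /= in_itv/= => /andP[_ /ltW].
exists Dq => //; split => // a e a0 ae eT.
apply: (@energy_inequality R d U oU Ar Hr cr rho Grho M lambda Mr Cc mAr (ltW M0) ArM coer LH cE.1 cr0 Cc0 pot
 Lrho jrho rho0 LGrho jGrho wrho adj Phi b b2 B L L2' sPhi sb dPhi db Phi0 b0 bB b2L b2Lip conv T T0
 (wcurve theta ur) (Gcurve theta GR) pw aw N mN NE LN) => //.
- by move=> t /andP[/ltW t0 _]; exact: curve_L2 hur _ t0.
- by move=> t; exact: (curve_cont_interior hsol hur).
- move=> v Gv C pv vC.
 exact: (curve_weak oU fU poinc theta0 hsol hur T0 mAr ArM AE HE LH cE cr0 pot pv vC).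
Qed.

End solution_energy.

(** * The quadratic and the hinge profiles *)

Section profiles.
Context {R : realType}.
Implicit Types (x y k e a s : R).

Lemma smooth_sabs e : 0 < e -> smooth (sabs e).
Proof.
move=> e0; case=> [//|k]; exists (dsabs e); first by move=> x; exact: is_derive_sabs.
exact: smooth_dsabs.
Qed.

(** After clearing the denominator this is Cauchy-Schwarz for the plane vectors [(e, x)] and
    [(e, y)]. *)
Lemma sabs_convex e x y : 0 < e -> sabs e x - sabs e y <= dsabs e x * (x - y).
Proof.
move=> e0; have s0 := sabs_gt0 e0 x; have t0 := sabs_gt0 e0 y.
rewrite /dsabs mulrAC ler_pdivlMr//.
suff h : e ^+ 2 + x * y <= sabs e x * sabs e y.
 have E := sabs_sq e0 x; rewrite -subr_ge0.
 rewrite (_ : _ - _ = sabs e x * sabs e y + x ^+ 2 - x * y - sabs e x ^+ 2); last by ring.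
 by rewrite E; move: h; rewrite -subr_ge0; congr (0 <= _); ring.
have p0 : 0 <= sabs e x * sabs e y by rewrite mulr_ge0// ltW.
apply: le_trans (ler_norm _) _; rewrite -(ler_pXn2r (_ : 0 < 2)%N)// ?nnegrE//.
rewrite real_normK ?num_real// exprMn !sabs_sq//.
rewrite -subr_ge0 (_ : _ - _ = (e * (x - y)) ^+ 2) ?sqr_ge0//.
by ring.
Qed.

(** As [k] grows this profile tends to [s^2 / 2] from below, with slope bounded by [k] and second
    derivative between 0 and 1. *)
Lemma quadratic_profile k : 0 < k ->
 convex_profile (fun s => k * sabs k s - k ^+ 2) (fun s => k * dsabs k s) (fun s => k * ddsabs k s)
 k (k * k^-1) (k * (3 / k ^+ 2)).
Proof.
move=> k0; have kn : 0 <= k by exact: ltW.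
have sk : sabs k 0 = k by rewrite /sabs expr0n/= addr0 sqrtr_sqr ger0_norm.
split; split.
- by move=> j; apply: C1kB; [apply: C1kM; [exact: C1k_cst|exact: smooth_sabs]|exact: C1k_cst].
- by move=> j; apply: C1kM; [exact: C1k_cst|exact: smooth_dsabs].
- move=> y; have d1 := is_deriveB (is_deriveZ k (is_derive_sabs k0 y)) (is_derive_cst (k ^+ 2) y 1).
 by rewrite subr0 in d1.
- by move=> y; exact: (is_deriveZ k (is_derive_dsabs k0 y)).
- by rewrite sk -expr2 subrr.
- by rewrite /dsabs mul0r mulr0.
- move=> y; rewrite normrM (ger0_norm kn) -[leRHS]mulr1; apply: ler_wpM2l => //; exact: dsabs_le1.
- by move=> y; rewrite mulr_ge0 ?ddsabs_ge0//=; apply: ler_wpM2l => //; exact: ddsabs_le.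
- move=> x y; rewrite -mulrBr normrM (ger0_norm kn) -mulrA; apply: ler_wpM2l => //; exact: ddsabs_lipschitz.
- move=> x y; rewrite opprB addrA subrK -mulrBr -mulrA; apply: ler_wpM2l => //; exact: sabs_convex.
Qed.

Lemma smooth_shift (f : R -> R) a : smooth f -> smooth (fun s => f (s + a)).
Proof.
by move=> sf k; apply: (@C1k_comp _ _ f (fun s => s + a)) => //; apply: C1kD; [exact: C1k_id|exact: C1k_cst].
Qed.

Lemma is_derive_shift (f : R -> R) (f' : R) a s : is_derive (s + a) 1 f f' -> is_derive s 1 (fun s => f (s + a)) f'.
Proof.
move=> d1; have d2 : is_derive s 1 (fun s : R => s + a) 1.
 by have := is_deriveD (is_derive_id s 1) (is_derive_cst a s 1); rewrite addr0.
by have := @is_derive1_comp R f (fun s => s + a) s _ _ d1 d2; rewrite mulr1.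
Qed.

(** As [e] tends to 0, and for [a >= 0], this tends to [(|s - a| + |s + a|) / 2 - a], which is
    [(|s| - a)^+]. Symmetrising gives slope zero at 0, and the constant gives value zero there. *)
Lemma hinge_profile e a : 0 < e ->
 convex_profile (fun s => 2^-1 * (sabs e (s + - a) + sabs e (s + a)) - sabs e a)
 (fun s => 2^-1 * (dsabs e (s + - a) + dsabs e (s + a)))
 (fun s => 2^-1 * (ddsabs e (s + - a) + ddsabs e (s + a))) 1 e^-1 (3 / e ^+ 2).
Proof.
move=> e0; have eN : sabs e (- a) = sabs e a by rewrite /sabs sqrrN.
have half (u v z : R) : `|u| <= z -> `|v| <= z -> `|2^-1 * (u + v)| <= z.
 move=> h1 h2; rewrite normrM ger0_norm; last by rewrite invr_ge0.
 rewrite mulrC ler_pdivrMr//; apply: le_trans (ler_normD _ _) _.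
 by rewrite mulr_natr mulr2n lerD.
split; split.
- move=> j; apply: C1kB; last exact: C1k_cst.
 apply: C1kM; first exact: C1k_cst.
 by apply: C1kD; apply: smooth_shift; exact: smooth_sabs.
- move=> j; apply: C1kM; first exact: C1k_cst.
 by apply: C1kD; apply: smooth_shift; exact: smooth_dsabs.
- move=> y; have d1 := is_deriveD (is_derive_shift (is_derive_sabs e0 (y + - a))) (is_derive_shift (is_derive_sabs e0 (y + a))).
 by have := is_deriveB (is_deriveZ 2^-1 d1) (is_derive_cst (sabs e a) y 1); rewrite subr0.
- move=> y; have d1 := is_deriveD (is_derive_shift (is_derive_dsabs e0 (y + - a))) (is_derive_shift (is_derive_dsabs e0 (y + a))).
 exact: (is_deriveZ 2^-1 d1).
- by rewrite !add0r eN; field.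
- by rewrite !add0r /dsabs eN mulNr addNr mulr0.
- by move=> y; apply: half; exact: dsabs_le1.
- move=> y; rewrite mulr_ge0 ?invr_ge0 ?addr_ge0 ?ddsabs_ge0//=.
 apply: le_trans (ler_norm _) _; apply: half; rewrite ger0_norm ?ddsabs_ge0// ddsabs_le//.
- move=> x y; rewrite -mulrBr.
 have -> : ddsabs e (x + - a) + ddsabs e (x + a) - (ddsabs e (y + - a) + ddsabs e (y + a)) =
 (ddsabs e (x + - a) - ddsabs e (y + - a)) + (ddsabs e (x + a) - ddsabs e (y + a)) by ring.
 apply: half; apply: le_trans (ddsabs_lipschitz e0 _ _) _; rewrite le_eqVlt; apply/orP; left; apply/eqP.
 by congr (_ * `|_|); ring.
 by congr (_ * `|_|); ring.
- move=> x y; have h1 := sabs_convex (x + - a) (y + - a) e0; have h2 := sabs_convex (x + a) (y + a) e0.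
 have h0 : 0 <= 2^-1 :> R by rewrite invr_ge0.
 have := ler_wpM2l h0 (lerD h1 h2); rewrite -subr_ge0 => h; rewrite -subr_ge0; move: h; congr (0 <= _); ring.
Qed.

End profiles.

(** * Energies decrease in time *)

Section monotone_energies.
Context {R : realType} {d : nat}.
Notation V := 'rV[R]_d.
Notation mu := (@lebesgue_rV R d).
Notation leb := (@lebesgue_measure R).
Notation mT := (measurableTypeR R).
Variables (U : set V) (rho : V -> R) (mr Mr K1 lambda : R) (w : R -> V -> R) (Gw : R -> 'I_d -> V -> R).
Hypotheses (lambda0 : 0 < lambda)
 (hrho : weight_bounds U rho mr Mr K1)
 (Lw : forall t, 0 <= t -> L2 mu (w t))
 (w_off : forall t, 0 <= t -> forall x, ~ U x -> w t x = 0)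
 (cont : forall t, 0 <= t ->
 nr mu (fun x => w s x - w t x) @[s --> nbhs_ge0 t] --> (0 : R))
 (EI : forall Phi b b2 B L L2', convex_profile Phi b b2 B L L2' -> forall T, 0 < T ->
 exists2 Dq : mT -> R, mfun Dq &
  {ae leb, forall t : R, `]0, T[%classic t -> dissip rho b2 (w t) (Gw t) = Dq t} /\
  forall a c, 0 < a -> a < c -> c < T ->
  energy rho Phi w c - energy rho Phi w a + lambda * \int[leb]_t (\1_`]a, c] t * Dq t) <= 0).

Lemma near_zero_time e c : 0 < e -> 0 < c ->
 exists a, [/\ 0 < a, a < c & nr mu (fun x => w a x - w 0 x) <= e].
Proof.
move=> e0 c0; have /cvgrPdist_le /(_ e e0) := cont (lexx 0).
move=> /nbhs_ballP [/= r r0 hr]; pose a := Num.min (r / 2) (c / 2).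
have a0 : 0 < a by rewrite lt_min !divr_gt0.
have l2 (x : R) : 0 < x -> x / 2 < x by move=> x0; rewrite ltr_pdivrMr// ltr_pMr// ltr1n.
exists a; split => //.
 by apply: le_lt_trans (l2 _ c0); rewrite ge_min lexx orbT.
have := hr a; rewrite /ball/= sub0r normrN (ger0_norm (ltW a0)).
have -> : a < r by apply: le_lt_trans (l2 _ r0); rewrite ge_min lexx.
by move=> /(_ isT (ltW a0)); rewrite sub0r normrN ger0_norm ?nr_ge0.
Qed.

Lemma Rint_ae_ge0 disp (X : measurableType disp) (nu : {measure set X -> \bar R}) (f : X -> R) :
 mfun f -> {ae nu, forall x, 0 <= f x} -> 0 <= \int[nu]_x f x.
Proof.
move=> mf f0; rewrite (@ae_eq_Rint _ _ _ nu f (fun x => `|f x|))//; first exact: Rint_ge0.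
 by apply: (mcomp mnormr).
by apply: (ae_mono f0) => x h; rewrite ger0_norm.
Qed.

Lemma energy_lipschitz Phi b b2 B L L2' y z : convex_profile Phi b b2 B L L2' -> L2 mu y -> L2 mu z ->
 `|\int[mu]_x (rho x * Phi (y x)) - \int[mu]_x (rho x * Phi (z x))| <= B * nr mu rho * nr mu (fun x => y x - z x).
Proof.
move=> [[sPhi sb dPhi db] [Phi0 b0 bB] _] Ly Lz; have [Lrho _ rho0 _] := hrho.
have jy := intg_energy Lrho sPhi dPhi Phi0 bB Ly; have jz := intg_energy Lrho sPhi dPhi Phi0 bB Lz.
have B0 : 0 <= B := le_trans (normr_ge0 _) (bB 0).
rewrite -(RintB jy jz); have LA := L2_abs (L2B Ly Lz).
apply: (@le_trans _ _ (B * ip mu rho (fun x => `|y x - z x|))).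
 rewrite -(RintZl (L2_mul Lrho LA)).
 apply: le_trans (le_normr_Rintegral measurableT (intgB jy jz)) _.
 apply: Rint_le; [exact/intg_abs/intgB|exact/intgZ/L2_mul|] => x.
 have /andP[p q] := rho0 x; rewrite -mulrBr normrM (ger0_norm p) mulrCA; apply: ler_wpM2l => //.
 exact: derive_lipschitz dPhi bB _ _.
rewrite -mulrA; apply: ler_wpM2l => //; apply: le_trans (ler_norm _) _.
by apply: le_trans (ip_le Lrho LA) _; rewrite nr_abs.
Qed.

(** The energy inequality starts at positive times; time 0 is reached by the L^2 continuity of the
    curve, the energy being Lipschitz for the L^2 norm. *)
Lemma energy_nonincreasing Phi b b2 B L L2' a c : convex_profile Phi b b2 B L L2' -> 0 <= a -> a <= c ->
 energy rho Phi w c <= energy rho Phi w a.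
Proof.
move=> hP a0 ac; have pos (a' c' : R) : 0 < a' -> a' < c' -> energy rho Phi w c' <= energy rho Phi w a'.
 move=> a'0 a'c'; have T0 : 0 < c' + 1 by rewrite ltr_wpDl// ltW// (lt_trans a'0).
 have [Dq mDq [DqE ineq]] := EI hP T0.
 have [_ _ [b2L _ _]] := hP; have [_ _ rho0 _] := hrho.
 have c'1 : c' < c' + 1 by rewrite ltrDl.
 have I0 : 0 <= \int[leb]_t (\1_`]a', c'] t * Dq t).
 apply: (@Rint_ae_ge0 _ mT leb); first by apply: mfunM => //; apply: mindic; exact: mitv.
 apply: (ae_mono DqE) => t h; rewrite indic_oc; have [/andP[t1 t2]|_] := boolP (_ < t <= _); last by rewrite mul0r.
 rewrite mul1r -h; first exact: dissip_ge0.
 by rewrite /= in_itv/= (lt_trans a'0 t1) (le_lt_trans t2 c'1).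
 have := ineq a' c' a'0 a'c' c'1; rewrite -subr_ge0 => h; rewrite -subr_ge0.
 have h2 := mulr_ge0 (ltW lambda0) I0; have := addr_ge0 h h2; congr (0 <= _); ring.
move: ac; rewrite le_eqVlt => /predU1P[->//|ac].
move: a0; rewrite le_eqVlt => /predU1P[a0|a0]; last exact: pos.
rewrite -{}a0 in ac *; apply/ler_addgt0Pr => e e0.
have [_ [_ _ bB] _] := hP; have B0 : 0 <= B := le_trans (normr_ge0 _) (bB 0).
have k0 : 0 < B * nr mu rho + 1 by rewrite ltr_wpDl// mulr_ge0 ?nr_ge0.
have e1 : 0 < e / (B * nr mu rho + 1) by rewrite divr_gt0.
have [a' [a'0 a'c na]] := near_zero_time e1 ac.
apply: le_trans (pos a' c a'0 a'c) _; rewrite addrC -lerBlDr; apply: le_trans (ler_norm _) _.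
apply: le_trans (energy_lipschitz hP (Lw (ltW a'0)) (Lw (lexx 0))) _.
apply: (@le_trans _ _ ((B * nr mu rho + 1) * (e / (B * nr mu rho + 1)))).
 by apply: ler_pM; rewrite ?nr_ge0// ?mulr_ge0 ?nr_ge0// lerDl.
by rewrite mulrCA divff ?mulr1// gt_eqF.
Qed.

Definition hinge (a s : R) : R := Num.max 0 (`|s| - a).

Lemma hinge_cvg a s : 0 <= a ->
 (2^-1 * (sabs n.+1%:R^-1 (s + - a) + sabs n.+1%:R^-1 (s + a)) - sabs n.+1%:R^-1 a) @[n --> \oo] --> hinge a s.
Proof.
move=> a0; have sc (x : R) : sabs n.+1%:R^-1 x @[n --> \oo] --> `|x|.
 apply/subr_cvg0; apply: cvg0_le (@cvg_harmonic R) => n.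
 have n0 : 0 < n.+1%:R^-1 :> R by rewrite invr_gt0.
 rewrite ger0_norm ?subr_ge0 ?sabs_ge// lerBlDl; exact: sabs_le.
have -> : hinge a s = 2^-1 * (`|s + - a| + `|s + a|) - `|a|.
 rewrite /hinge (ger0_norm a0).
 have [s0|s0] := leP 0 s.
 rewrite (ger0_norm s0) (ger0_norm (addr_ge0 s0 a0)).
 have [h|h] := leP 0 (s - a); [rewrite ger0_norm//; by field|rewrite ltr0_norm//; by field].
 have sa : s - a < 0 by rewrite subr_lt0 (lt_le_trans s0).
 rewrite (ltr0_norm s0) (ltr0_norm sa).
 have [h|h] := leP 0 (- s - a).
 have h2 : s + a <= 0 by rewrite -oppr_ge0 opprD.
 by rewrite ler0_norm//; field.
 have h2 : 0 <= s + a by rewrite -oppr_le0 opprD ltW.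
 by rewrite ger0_norm//; field.
by apply: cvgB => //; apply: cvgMr; exact: cvgD.
Qed.

(** Limit of [hinge_profile] along [e = 1/(n+1)]. The slopes are bounded by 1 uniformly in [n], so
    [rho * |w|] is a common majorant. *)
Lemma hinge_nonincreasing a t : 0 <= a -> 0 <= t ->
 \int[mu]_x (rho x * hinge a (w t x)) <= \int[mu]_x (rho x * hinge a (w 0 x)).
Proof.
move=> a0 t0; have [Lrho _ rho0 _] := hrho.
pose Phi n (s : R) := 2^-1 * (sabs n.+1%:R^-1 (s + - a) + sabs n.+1%:R^-1 (s + a)) - sabs n.+1%:R^-1 a.
have n0 n : 0 < n.+1%:R^-1 :> R by rewrite invr_gt0.
have hP n := hinge_profile a (n0 n).
have c1 (r : R) : 0 <= r -> \int[mu]_x (rho x * Phi n (w r x)) @[n --> \oo] --> \int[mu]_x (rho x * hinge a (w r x)).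
 move=> r0; have Lr := Lw r0.
 apply: (@Rdct _ _ _ mu _ _ (fun x => rho x * `|w r x|)).
 - move=> n; have [[s1 _ s3 _] [s4 _ s5] _] := hP n.
 exact: intg_meas (intg_energy Lrho s1 s3 s4 s5 Lr).
 - by apply: L2_mul => //; exact: L2_abs.
 - by move=> x; apply: cvgMr; exact: hinge_cvg.
 - move=> n x; have /andP[p q] := rho0 x; rewrite normrM (ger0_norm p); apply: ler_wpM2l => //.
 have [[_ _ s3 _] [s4 _ s5] _] := hP n.
 by have := derive_lipschitz s3 s5 (w r x) 0; rewrite s4 !subr0 mul1r.
apply: (ler_cvg_to (c1 t t0) (c1 0 (lexx 0))); apply: nearW => n.
exact: energy_nonincreasing (hP n) (lexx 0) t0.
Qed.

End monotone_energies.

Lemma cvg_sub_cst0 (R : realType) (a : R) (f : nat -> R) :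
 a - f n @[n --> \oo] --> (0 : R) -> f @ \oo --> a.
Proof.
move=> h; suff c : f n - a @[n --> \oo] --> (0 : R) by exact/subr_cvg0.
have h2 : `|a - f n| @[n --> \oo] --> (0 : R) by rewrite -[X in _ --> X](normr0 R); exact: cvg_norm.
by apply: cvg0_le h2 => n; rewrite distrC.
Qed.

(** * The quadratic energy: gradient estimate and exponential decay *)

Section quadratic_energy.
Context {R : realType} {d : nat}.
Notation V := 'rV[R]_d.
Notation mu := (@lebesgue_rV R d).
Notation leb := (@lebesgue_measure R).
Notation mT := (measurableTypeR R).
Variables (U : set V) (rho : V -> R) (mr Mr K1 lambda : R) (w : R -> V -> R) (Gw : R -> 'I_d -> V -> R).
Hypotheses (oU : open U)
 (fU : (mu U < +oo)%E)
 (lambda0 : 0 < lambda)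
 (hrho : weight_bounds U rho mr Mr K1)
 (Lw : forall t, 0 <= t -> L2 mu (w t))
 (w_off : forall t, 0 <= t -> forall x, ~ U x -> w t x = 0)
 (cont : forall t, 0 <= t ->
 nr mu (fun x => w s x - w t x) @[s --> nbhs_ge0 t] --> (0 : R))
 (EI : forall Phi b b2 B L L2', convex_profile Phi b b2 B L L2' -> forall T, 0 < T ->
 exists2 Dq : mT -> R, mfun Dq &
  {ae leb, forall t : R, `]0, T[%classic t -> dissip rho b2 (w t) (Gw t) = Dq t} /\
  forall a c, 0 < a -> a < c -> c < T ->
  energy rho Phi w c - energy rho Phi w a + lambda * \int[leb]_t (\1_`]a, c] t * Dq t) <= 0).
Variable cP : R.
Hypotheses (poincare : forall v G, h10p U v G -> nr mu v <= cP * gnr G)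
 (pair_w : forall T, 0 < T -> {ae leb, forall t : R, `]0, T[%classic t -> h10p U (w t) (Gw t)})
 (approx_w : forall T, 0 < T -> approx_curve U T Gw)
 (gradient_w : forall T, 0 < T -> exists2 q : mT -> R,
 {ae leb, forall t : R, `]0, T[%classic t -> gnr (Gw t) = q t} & L2 leb (fun t => \1_`]0, T[ t * q t)).

Let rho0 x : 0 <= rho x <= Mr. Proof. by have [_ _ h _] := hrho. Qed.
Let Lrho : L2 mu rho. Proof. by have [h _ _ _] := hrho. Qed.
Let Mr0 : 0 <= Mr. Proof. by have /andP[a b] := rho0 0; exact: le_trans a b. Qed.

Lemma intg_weight f : intg mu f -> intg mu (fun x => rho x * f x).
Proof.
move=> jf; apply: (intg_bmul (L2_meas Lrho) (C := Mr)) => // x.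
by have /andP[a b] := rho0 x; rewrite ger0_norm.
Qed.

(** Everything follows from two facts on [x = sabs k s]: the gap to [s^2 / 2] is [(x - k)^2 / 2],
    and [x - k <= s^2 / k]. *)
Lemma quadratic_limit (k s : R) : 0 < k ->
 [/\ 0 <= s ^+ 2 / 2 - (k * sabs k s - k ^+ 2), s ^+ 2 / 2 - (k * sabs k s - k ^+ 2) <= s ^+ 4 / 2 * k^-1 ^+ 2,
  0 <= k * sabs k s - k ^+ 2, 0 <= 1 - k / sabs k s <= s ^+ 2 * k^-1 ^+ 2 & k * ddsabs k s = (k / sabs k s) ^+ 3].
Proof.
move=> k0; have x0 := sabs_gt0 k0 s; have xk := sabs_gee k0 s; have x2 := sabs_sq k0 s.
set x := sabs k s in x0 xk x2 *.
have kn : 0 <= k by exact: ltW.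
have xk0 : 0 <= x - k by rewrite subr_ge0.
have xkE : (x - k) * (x + k) = s ^+ 2 by rewrite -subr_sqr x2; ring.
have xks : x - k <= s ^+ 2 * k^-1.
 rewrite ler_pdivlMr// -xkE; apply: ler_wpM2l => //.
 by rewrite lerDr ltW.
have E : s ^+ 2 / 2 - (k * x - k ^+ 2) = (x - k) ^+ 2 / 2 by rewrite -xkE; field.
split.
- by rewrite E divr_ge0// sqr_ge0.
- rewrite E (_ : s ^+ 4 / 2 * k^-1 ^+ 2 = (s ^+ 2 * k^-1) ^+ 2 / 2); last by field; rewrite gt_eqF.
 rewrite ler_pM2r ?invr_gt0// ler_pXn2r ?nnegrE//.
 exact: le_trans xk0 xks.
- by rewrite expr2 -mulrBr mulr_ge0.
- have -> : 1 - k / x = (x - k) / x by rewrite mulrBl divff// gt_eqF.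
 apply/andP; split; first by apply: divr_ge0 => //; exact: ltW.
 apply: (@le_trans _ _ ((x - k) / k)).
 by apply: ler_wpM2l => //; rewrite lef_pV2 ?posrE.
 by rewrite expr2 mulrA; apply: ler_wpM2r; rewrite ?invr_ge0.
- by rewrite /ddsabs -/x !exprMn exprVn; ring.
Qed.

(** The weight is bounded below on [U] only; this suffices because the gradient of a pair vanishes
    a.e. outside [U]. *)
Lemma dissip_lower v G : h10p U v G -> mr * gnr G ^+ 2 <= dissip rho (fun=> 1) v G.
Proof.
move=> pv; have [_ LG _] := pv; have [_ _ _ [rhomr mr0 _]] := hrho.
have jS : intg mu (fun x => \sum_i G i x ^+ 2) by apply: intg_sum => i _; have [] := LG i.
have -> : gnr G ^+ 2 = \int[mu]_x (\sum_i G i x ^+ 2).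
 rewrite Rint_sum; last by move=> i _; have [] := LG i.
 by rewrite gnr_sq; apply: eq_bigr => i _; rewrite nr_sqE.
rewrite -(RintZl jS) /dissip.
have -> : \int[mu]_x (rho x * 1 * \sum_i G i x ^+ 2) = \int[mu]_x (rho x * \sum_i G i x ^+ 2).
 by apply: eq_Rintegral => x _; rewrite mulr1.
apply: Rint_le_ae; [exact: intgZ|exact: intg_weight|].
have G0 : {ae mu, forall x, forall i, ~ U x -> G i x = 0} by apply: filter_forall => i; exact: (h10p_offG oU i pv).
apply: (ae_mono G0) => x h; have [Ux|nUx] := pselect (U x).
 by apply: ler_wpM2r; [apply: sumr_ge0 => i _; exact: sqr_ge0|exact: rhomr].
by rewrite big1 ?mulr0// => i _; rewrite h// expr0n.
Qed.

Definition wsq (v : V -> R) : R := \int[mu]_x (rho x * v x ^+ 2).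

Lemma wsq_le v : L2 mu v -> 0 <= wsq v <= Mr * nr mu v ^+ 2.
Proof.
move=> Lv; have [_ jv] := Lv; apply/andP; split.
 by apply: Rint_ge0 => x; have /andP[a b] := rho0 x; rewrite mulr_ge0// sqr_ge0.
rewrite nr_sqE -(RintZl jv); apply: Rint_le; [exact: intg_weight|exact: intgZ|].
by move=> x; apply: ler_wpM2r; [exact: sqr_ge0|have /andP[] := rho0 x].
Qed.

Lemma wsq_ge v : L2 mu v -> (forall x, ~ U x -> v x = 0) -> mr * nr mu v ^+ 2 <= wsq v.
Proof.
move=> Lv v0; have [_ jv] := Lv; have [_ _ _ [rhomr _ _]] := hrho.
rewrite nr_sqE -(RintZl jv); apply: Rint_le; [exact: intgZ|exact: intg_weight|].
move=> x; have [Ux|nUx] := pselect (U x); last by rewrite v0// expr0n !mulr0.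
by apply: ler_wpM2r; [exact: sqr_ge0|exact: rhomr].
Qed.

Lemma wsq_diff y z : L2 mu y -> L2 mu z ->
 wsq y <= wsq z + Mr * (nr mu (fun x => y x - z x) * (nr mu (fun x => y x - z x) + 2 * nr mu z)).
Proof.
move=> Ly Lz; have [_ jy] := Ly; have [_ jz] := Lz.
have LB := L2B Ly Lz; have LD := L2D Ly Lz.
rewrite addrC -lerBlDr /wsq -(RintB (intg_weight jy) (intg_weight jz)).
have LA := L2_abs LB; have LAD := L2_abs LD.
apply: (@le_trans _ _ (Mr * ip mu (fun x => `|y x - z x|) (fun x => `|y x + z x|))).
 rewrite -(RintZl (L2_mul LA LAD)); apply: Rint_le.
 - by apply: intgB; exact: intg_weight.
 - exact/intgZ/L2_mul.
 - move=> x; rewrite -mulrBr subr_sqr; have /andP[a b] := rho0 x.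
 apply: le_trans (ler_norm _) _; rewrite !normrM (ger0_norm a).
 by apply: ler_wpM2r => //; rewrite mulr_ge0.
apply: ler_wpM2l => //; apply: le_trans (ler_norm _) _; apply: le_trans (ip_le LA LAD) _.
rewrite !nr_abs; apply: ler_wpM2l; first exact: nr_ge0.
have -> : nr mu (fun x => y x + z x) = nr mu (fun x => (y x - z x) + 2 * z x).
 by apply: eq_nr => x; ring.
apply: le_trans (nrD LB (L2Z 2 Lz)) _.
by rewrite nrZ// ger0_norm.
Qed.

(** Limit of the inequalities for [quadratic_profile]. The limit profile is [s^2 / 2], so
    multiplying by 2 puts the factor [2 * lambda] on the dissipation; its second derivative is 1,
    whence the constant function in [dissip]. *)
Lemma quadratic_energy T : 0 < T -> exists S : mT -> R,
 [/\ mfun S, {ae leb, forall t : R, `]0, T[%classic t -> dissip rho (fun=> 1) (w t) (Gw t) = S t},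
  intg leb (fun t => \1_`]0, T[ t * S t) &
  forall a c, 0 <= a -> a < c -> c < T ->
  wsq (w c) + 2 * lambda * \int[leb]_t (\1_`]a, c] t * S t) <= wsq (w a)].
Proof.
move=> T0; have b21 (y : R) : 0 <= (1 : R) <= 1 by rewrite ler01 lexx.
have Lip0 (x y : R) : `|(1 : R) - 1| <= 0 * `|x - y| by rewrite subrr normr0 mul0r.
have sQ := @seq_cont_dissip R d U rho Mr Lrho rho0 (fun=> 1) 1 0 b21 Lip0.
have [S mS SE] := measurable_curve poincare (pair_w T0) (approx_w T0) sQ.
have [q qE Lq] := gradient_w T0.
have mD : measurable (`]0, T[%classic : set mT) by exact: mitv.
have S_le : {ae leb, forall t : R, `]0, T[%classic t -> 0 <= S t <= Mr * q t ^+ 2}.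
 apply: (ae_mono3 SE qE (pair_w T0)) => t h1 h2 h3 Dt; rewrite -h1// -h2//.
 have [Lt LG _] := h3 Dt; rewrite (dissip_ge0 rho0 b21)//=.
 have jS : intg mu (fun x => \sum_i Gw t i x ^+ 2) by apply: intg_sum => i _; have [] := LG i.
 have -> : gnr (Gw t) ^+ 2 = \int[mu]_x (\sum_i Gw t i x ^+ 2).
 rewrite Rint_sum; last by move=> i _; have [] := LG i.
 by rewrite gnr_sq; apply: eq_bigr => i _; rewrite nr_sqE.
 rewrite -(RintZl jS); apply: Rint_le; [|exact: intgZ|].
 by have := intg_weight jS; congr intg; apply/funext => x; rewrite mulr1.
 move=> x; rewrite mulr1; apply: ler_wpM2r; first by apply: sumr_ge0 => i _; exact: sqr_ge0.
 by have /andP[] := rho0 x.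
have jS : intg leb (fun t => \1_`]0, T[ t * S t).
 have [_ jq] := Lq; apply: (@intg_le_ae _ mT R leb _ _ _ _ (intgZ Mr jq)).
 by apply: mfunM => //; exact: mindic.
 apply: (ae_mono S_le) => t h; rewrite indicE; have [/set_mem Dt|_] := boolP (t \in _); last first.
 by rewrite !mul0r normr0 expr0n mulr0.
 by rewrite !mul1r; have /andP[h1 h2] := h Dt; rewrite ger0_norm.
have sub_D (a c : R) (f : mT -> R) : 0 <= a -> c < T ->
 (fun t : mT => \1_`]a, c] t * f t) = (fun t => \1_`]a, c] t * (\1_`]0, T[ t * f t)).
 move=> a0 cT; apply/funext => t; rewrite indic_oc; have [/andP[h1 h2]|_] := boolP (_ < t <= _); last by rewrite !mul0r.
 by rewrite !mul1r indicE mem_set ?mul1r//= in_itv/= (le_lt_trans a0 h1) (le_lt_trans h2 cT).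
have jac (a c : R) : 0 <= a -> c < T -> intg leb (fun t => \1_`]a, c] t * S t).
 by move=> a0 cT; rewrite sub_D//; apply: intg_indicM => //; exact: mitv.
have pos (a c : R) : 0 < a -> a < c -> c < T ->
 wsq (w c) + 2 * lambda * \int[leb]_t (\1_`]a, c] t * S t) <= wsq (w a).
 move=> a0 ac cT; pose k (n : nat) : R := n.+1%:R.
 have k0 n : 0 < k n by rewrite ltr0n.
 have kV : (k n)^-1 @[n --> \oo] --> (0 : R) by exact: cvg_harmonic.
 pose Phi n (s : R) := k n * sabs (k n) s - k n ^+ 2.
 have hP n := quadratic_profile (k0 n).
 have /choice[Dq hDq] : forall n, exists Dq : mT -> R, mfun Dq /\
  ({ae leb, forall t : R, `]0, T[%classic t -> dissip rho (fun s => k n * ddsabs (k n) s) (w t) (Gw t) = Dq t} /\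
  energy rho (Phi n) w c - energy rho (Phi n) w a + lambda * \int[leb]_t (\1_`]a, c] t * Dq t) <= 0).
 move=> n; have [Dq m1 [m2 m3]] := EI (hP n) T0; exists Dq; split => //; split => //.
 exact: m3.
 have c1 (t : R) : 0 <= t -> energy rho (Phi n) w t @[n --> \oo] --> \int[mu]_x (rho x * (w t x ^+ 2 / 2)).
 move=> t0; have Lt := Lw t0; have [mt jt] := Lt.
 have j2 : intg mu (fun x => w t x ^+ 2 / 2).
  by have := intgZ 2^-1 jt; congr intg; apply/funext => x; rewrite mulrC.
 apply: (@Rdct _ _ _ mu _ _ (fun x => rho x * (w t x ^+ 2 / 2))).
 - move=> n; have [[s1 _ s3 _] [s4 _ s5] _] := hP n.
  exact: intg_meas (intg_energy Lrho s1 s3 s4 s5 Lt).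
 - exact: intg_weight.
 - move=> x; apply: cvgMr.
  apply: cvg_sub_cst0.
  have c2 := cvg0Ml (w t x ^+ 4 / 2) (cvg0_sq kV).
  apply: cvg0_le c2 => n; have [h1 h2 _ _ _] := quadratic_limit (w t x) (k0 n).
  by rewrite ger0_norm.
 - move=> n x; have /andP[p1 p2] := rho0 x; rewrite normrM (ger0_norm p1); apply: ler_wpM2l => //.
  have [h1 _ h3 _ _] := quadratic_limit (w t x) (k0 n).
  by rewrite /Phi (ger0_norm h3) -subr_ge0.
 (* Two dominated limits: in [x] at fixed [t], where the second derivatives lie in [[0, 1]] and tend
    to 1, then in [t], where [S] is the majorant. *)
 have c2 : \int[leb]_t (\1_`]a, c] t * Dq n t) @[n --> \oo] --> \int[leb]_t (\1_`]a, c] t * S t).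
 have mac : mfun (\1_`]a, c] : mT -> R) by apply: mindic; exact: mitv.
 have hall : {ae leb, forall t : R, forall n, `]0, T[%classic t -> dissip rho (fun s => k n * ddsabs (k n) s) (w t) (Gw t) = Dq n t}.
  by apply: ae_foralln => n; exact: (hDq n).2.1.
 have acD (t : R) : a < t <= c -> `]0, T[%classic t.
  by move=> /andP[t1 t2]; rewrite /= in_itv/= (lt_trans a0 t1) (le_lt_trans t2 cT).
 have bnd : {ae leb, forall t : R, (forall n, `|\1_`]a, c] t * Dq n t| <= \1_`]a, c] t * S t) /\
  (\1_`]a, c] t * Dq n t @[n --> \oo] --> \1_`]a, c] t * S t)}.
  apply: (ae_mono3 hall SE (pair_w T0)) => t h1 h2 h3; rewrite indic_oc.
  have [tac|_] := boolP (a < t <= c); last first.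
  split; first by move=> n; rewrite !mul0r normr0.
  by apply: cvg_ext (cvg_cst _) => n; rewrite !mul0r.
  have Dt := acD _ tac; have [Lt LG _] := h3 Dt; rewrite mul1r -h2//.
  have jG : intg mu (fun x => \sum_i Gw t i x ^+ 2) by apply: intg_sum => i _; have [] := LG i.
  have jG1 : intg mu (fun x => rho x * 1 * \sum_i Gw t i x ^+ 2).
  by have := intg_weight jG; congr intg; apply/funext => x; rewrite mulr1.
  have G0 x : 0 <= \sum_i Gw t i x ^+ 2 by apply: sumr_ge0 => i _; exact: sqr_ge0.
  have dd1 n (s : R) : 0 <= k n * ddsabs (k n) s <= 1.
  have [_ _ _ /andP[h4 _] ->] := quadratic_limit s (k0 n).
  have kx : 0 <= k n / sabs (k n) s by rewrite divr_ge0 ?ltW// sabs_gt0.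
  by rewrite exprn_ge0//= exprn_ile1// -subr_ge0.
  have jn n := intg_dissip Lrho rho0 (b2 := fun s => k n * ddsabs (k n) s) (L := k n * (k n)^-1) (L2' := k n * (3 / k n ^+ 2)).
  have jd n : intg mu (fun x => rho x * (k n * ddsabs (k n) (w t x)) * \sum_i Gw t i x ^+ 2).
  have [_ _ [e1 e2 _]] := hP n; exact: jn e1 e2 _ _ (L2_meas Lt) LG.
  split.
  move=> n; rewrite !mul1r -h1// ger0_norm; last first.
   apply: Rint_ge0 => x; have /andP[p1 p2] := rho0 x; have /andP[p3 p4] := dd1 n (w t x).
   by rewrite mulr_ge0// mulr_ge0.
  apply: Rint_le => // x; apply: ler_wpM2r => //; have /andP[p1 p2] := rho0 x.
  by apply: ler_wpM2l => //; have /andP[] := dd1 n (w t x).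
  have -> : (fun n => true%:R * Dq n t) = (fun n => \int[mu]_x (rho x * (k n * ddsabs (k n) (w t x)) * \sum_i Gw t i x ^+ 2)).
  by apply/funext => n; rewrite mul1r -h1.
  apply: (@Rdct _ _ _ mu _ _ (fun x => rho x * 1 * \sum_i Gw t i x ^+ 2)) => //.
  - by move=> n; exact: intg_meas (jd n).
  - move=> x; apply: cvgMl; apply: cvgMr.
  have cx : k n / sabs (k n) (w t x) @[n --> \oo] --> (1 : R).
   apply: cvg_sub_cst0.
   apply: cvg0_le (cvg0Ml (w t x ^+ 2) (cvg0_sq kV)) => n.
   by have [_ _ _ /andP[p1 p2] _] := quadratic_limit (w t x) (k0 n); rewrite ger0_norm.
  have c3 : (k n / sabs (k n) (w t x)) ^+ 3 @[n --> \oo] --> (1 : R).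
   rewrite -[X in _ --> X](expr1n _ 3).
   exact: (cvg_comp _ _ cx (@exprn_continuous R 3 1)).
  by apply: cvg_ext c3 => n; have [_ _ _ _ ->] := quadratic_limit (w t x) (k0 n).
  - move=> n x; have /andP[p1 p2] := rho0 x; have /andP[p3 p4] := dd1 n (w t x).
  rewrite normrM (ger0_norm (G0 x)) normrM (ger0_norm p1) (ger0_norm p3).
  by apply: ler_wpM2r => //; exact: ler_wpM2l.
 apply: (@Rdct_ae _ mT R leb _ _ (fun t => \1_`]a, c] t * S t)).
 - by move=> n; apply: mfunM => //; exact: (hDq n).1.
 - exact: mfunM.
 - by apply: jac => //; exact: ltW.
 - by apply: (ae_mono bnd) => t [].
 - by move=> n; apply: (ae_mono bnd) => t [h _].
 have cc := c1 c (ltW (lt_trans a0 ac)); have ca := c1 a (ltW a0).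
 have c3 : (energy rho (Phi n) w c - energy rho (Phi n) w a + lambda * \int[leb]_t (\1_`]a, c] t * Dq n t)) @[n --> \oo] -->
 \int[mu]_x (rho x * (w c x ^+ 2 / 2)) - \int[mu]_x (rho x * (w a x ^+ 2 / 2)) + lambda * \int[leb]_t (\1_`]a, c] t * S t).
 by apply: cvgD; [exact: cvgB|exact: cvgMr].
 have := ler_cvg_to c3 (cvg_cst (0 : R)) (nearW _ (fun n => (hDq n).2.2)).
 have half (t : R) : 0 <= t -> \int[mu]_x (rho x * (w t x ^+ 2 / 2)) = 2^-1 * wsq (w t).
 move=> t0; have [_ jt] := Lw t0; rewrite -(RintZl (intg_weight jt)).
 by apply: eq_Rintegral => x _; ring.
 rewrite (half c (ltW (lt_trans a0 ac))) (half a (ltW a0)) => h.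
 rewrite -subr_ge0; have h2 : 0 <= 2 * - (2^-1 * wsq (w c) - 2^-1 * wsq (w a) + lambda * \int[leb]_t (\1_`]a, c] t * S t)).
 by apply: mulr_ge0 => //; rewrite oppr_ge0; exact: h.
 by move: h2; congr (0 <= _); field.
exists S; split => // a c; rewrite le_eqVlt => /predU1P[<-|a0] ac cT; last exact: pos.
have n0 n : 0 < n.+1%:R^-1 :> R by rewrite invr_gt0.
(* Positive times tending to 0 along which the curve converges in L^2 to its initial value; the
   inequality from [an n] to [c] then passes to the limit. *)
have /choice[an han] : forall n : nat, exists a : R, [/\ 0 < a, a < Num.min c n.+1%:R^-1 & nr mu (fun x => w a x - w 0 x) <= n.+1%:R^-1].
 by move=> n; apply: (near_zero_time cont); rewrite ?lt_min ?ac ?n0.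
have anc n : an n < c by have [_ + _] := han n; rewrite lt_min => /andP[].
have an0 n : 0 < an n by have [] := han n.
have hN : (nr mu (fun x => w (an n) x - w 0 x)) @[n --> \oo] --> (0 : R).
 by apply: cvg0_le (@cvg_harmonic R) => n; have [_ _ h] := han n; rewrite ger0_norm ?nr_ge0.
have cR : (wsq (w 0) + Mr * (nr mu (fun x => w (an n) x - w 0 x) * (nr mu (fun x => w (an n) x - w 0 x) + 2 * nr mu (w 0)))) @[n --> \oo]
 --> wsq (w 0) + Mr * (0 * (0 + 2 * nr mu (w 0))).
 apply: cvgD; first exact: cvg_cst.
 apply: cvgMr; apply: cvgM => //; apply: cvgD => //; exact: cvg_cst.
rewrite mul0r mulr0 addr0 in cR.
have cI : \int[leb]_t (\1_`](an n), c] t * S t) @[n --> \oo] --> \int[leb]_t (\1_`]0, c] t * S t).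
 apply: (@Rdct _ mT R leb _ _ (fun t => `|\1_`]0, T[ t * S t|)).
 - by move=> n; apply: mfunM => //; apply: mindic; exact: mitv.
 - exact: intg_abs.
 - move=> t; have [t0|t0] := leP t 0.
  apply: cvg_ext (cvg_cst _) => n; rewrite !indic_oc !ltNge t0/=.
  by rewrite (le_trans t0 (ltW (an0 n))).
 have /cvgr0Pnorm_lt /(_ t t0) hN2 := @cvg_harmonic R.
 suff h : \forall n \near \oo, \1_`]0, c] t * S t = \1_`](an n), c] t * S t.
  exact: (cvg_trans (near_eq_cvg h) (cvg_cst _)).
 apply: filterS hN2 => n; rewrite /harmonic/= (ger0_norm (ltW (n0 n))) => h.
 have ant : an n < t by have [_ + _] := han n; rewrite lt_min => /andP[_ /lt_trans]; apply.
 by rewrite !indic_oc t0 ant.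
 - move=> n t; rewrite normrM [leRHS]normrM; apply: ler_wpM2r => //.
 rewrite indic_oc indicE mem_setE in_itv/= !ger0_norm// ler_nat.
 have [/andP[h1 h2]|//] := boolP (_ < t <= _).
 by rewrite (lt_trans (an0 n) h1) (le_lt_trans h2 cT).
have c4 : (wsq (w c) + 2 * lambda * \int[leb]_t (\1_`](an n), c] t * S t)) @[n --> \oo] -->
 wsq (w c) + 2 * lambda * \int[leb]_t (\1_`]0, c] t * S t).
 by apply: cvgD; [exact: cvg_cst|exact: cvgMr].
apply: (ler_cvg_to c4 cR); apply: nearW => n.
apply: le_trans (pos _ _ (an0 n) (anc n) cT) _.
by apply: wsq_diff; apply: Lw => //; exact: ltW.
Qed.

Lemma quadratic_nonincreasing a c : 0 <= a -> a <= c -> wsq (w c) <= wsq (w a).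
Proof.
move=> a0; rewrite le_eqVlt => /predU1P[->//|ac].
have T0 : 0 < c + 1 by rewrite ltr_wpDl// ltW// (le_lt_trans a0).
have [S [mS SE jS h]] := quadratic_energy T0.
have c1 : c < c + 1 by rewrite ltrDl.
apply: le_trans (h a c a0 ac c1); rewrite lerDl; apply: mulr_ge0; first by rewrite mulr_ge0// ltW.
apply: (@Rint_ae_ge0 _ _ mT leb); first by apply: mfunM => //; apply: mindic; exact: mitv.
apply: (ae_mono SE) => t ht; rewrite indic_oc; have [/andP[t1 t2]|_] := boolP (_ < t <= _); last by rewrite mul0r.
rewrite mul1r -ht.
 by apply: (dissip_ge0 rho0 (L := 1)) => _; rewrite ler01 lexx.
by rewrite /= in_itv/= (le_lt_trans a0 t1) (le_lt_trans t2 c1).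
Qed.

(** Stated for a function below the gradient norm of the rescaled curve, since it is applied to the
    gradient norm of the solution itself. *)
Lemma gradient_estimate T (q : mT -> R) : 0 < T ->
 {ae leb, forall t : R, `]0, T[%classic t -> 0 <= q t <= gnr (Gw t)} -> L2 leb (fun t => \1_`]0, T[ t * q t) ->
 2 * lambda * mr * nr leb (fun t => \1_`]0, T[ t * q t) ^+ 2 <= Mr * nr mu (w 0) ^+ 2.
Proof.
(* [quadratic_energy] needs the final time strictly inside its interval, so it is used on []0, T +
   1[]. *)
move=> T0 qG Lq; have T10 : 0 < T + 1 by rewrite ltr_wpDl// ltW.
have T1 : T < T + 1 by rewrite ltrDl.
have [S [mS SE jS h]] := quadratic_energy T10; have [_ _ _ [_ mr0 _]] := hrho.
have /andP[w0 w1] := wsq_le (Lw (lexx 0)); have /andP[w2 _] := wsq_le (Lw (ltW T0)).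
apply: le_trans w1; apply: le_trans (h 0 T (lexx 0) T0 T1).
rewrite -mulrA; apply: le_trans (_ : 2 * lambda * \int[leb]_t (\1_`]0, T] t * S t) <= _); last by rewrite lerDr.
apply: ler_wpM2l; first by rewrite mulr_ge0// ltW.
have [_ jq] := Lq; rewrite nr_sqE -(RintZl jq).
have sT (t : R) : 0 < t <= T -> `]0, (T + 1)[%classic t.
 by move=> /andP[t1 t2]; rewrite /= in_itv/= t1 (le_lt_trans t2 T1).
apply: (@Rint_le_ae _ mT R leb); first exact: intgZ.
 have -> : (fun t : mT => \1_`]0, T] t * S t) = (fun t => \1_`]0, T] t * (\1_`]0, (T + 1)[ t * S t)).
 apply/funext => t; rewrite indic_oc; have [ht|_] := boolP (0 < t <= T); last by rewrite !mul0r.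
 by rewrite !mul1r indicE mem_set ?mul1r//; exact: sT.
 by apply: intg_indicM => //; exact: mitv.
apply: (ae_mono3 SE qG (pair_w T10)) => t h1 h2 h3; rewrite indic_oc indicE mem_setE in_itv/=.
have [/andP[t1 t2]|nt] := boolP (0 < t < T); last first.
 rewrite mul0r expr0n mulr0; have [ht|_] := boolP (0 < t <= T); last by rewrite mul0r.
 by rewrite mul1r -h1; [apply: (dissip_ge0 rho0 (L := 1)) => _; rewrite ler01 lexx|exact: sT].
have ht : 0 < t <= T by rewrite t1 ltW.
rewrite ht !mul1r -h1; last exact: sT.
apply: le_trans (dissip_lower (h3 (sT _ ht))).
apply: ler_wpM2l; first exact: ltW.
have /andP[q0 q1] : 0 <= q t <= gnr (Gw t) by apply: h2; rewrite /= in_itv/= t1.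
by rewrite ler_pXn2r ?nnegrE ?gnr_ge0.
Qed.

(** By the Poincare inequality the dissipation at [t] is at least [wsq (w t) / (K1 * cP ^+ 2)], and
    by monotonicity at least the same with [w c]: one step of an implicit scheme, which needs no
    derivative of [wsq]. *)
Lemma decay_step a c : 0 < cP -> 0 < K1 -> 0 <= a -> a < c ->
 wsq (w c) * (1 + 2 * (lambda / (K1 * cP ^+ 2)) * (c - a)) <= wsq (w a).
Proof.
move=> cP0 K10 a0 ac; have T0 : 0 < c + 1 by rewrite ltr_wpDl// ltW// (le_lt_trans a0).
have c1 : c < c + 1 by rewrite ltrDl.
have [S [mS SE jS h]] := quadratic_energy T0; have [_ _ _ [_ mr0 MrK]] := hrho.
apply: le_trans (h a c a0 ac c1); rewrite mulrDr mulr1 lerD2l.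
pose k := (K1 * cP ^+ 2)^-1.
have k0 : 0 < k by rewrite invr_gt0 mulr_gt0// exprn_gt0.
have [j1 E1] := Rint_indic_oc (ltW ac).
have sT (t : R) : a < t <= c -> `]0, (c + 1)[%classic t.
 by move=> /andP[t1 t2]; rewrite /= in_itv/= (le_lt_trans a0 t1) (le_lt_trans t2 c1).
rewrite (_ : wsq (w c) * _ = 2 * lambda * (k * wsq (w c) * (c - a))); last by rewrite /k; ring.
apply: ler_wpM2l; first by rewrite mulr_ge0// ltW.
rewrite -E1 -(RintZl j1); apply: (@Rint_le_ae _ mT R leb); first exact: intgZ.
 have -> : (fun t : mT => \1_`]a, c] t * S t) = (fun t => \1_`]a, c] t * (\1_`]0, (c + 1)[ t * S t)).
 apply/funext => t; rewrite indic_oc; have [ht|_] := boolP (a < t <= c); last by rewrite !mul0r.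
 by rewrite !mul1r indicE mem_set ?mul1r//; exact: sT.
 by apply: intg_indicM => //; exact: mitv.
apply: (ae_mono2 SE (pair_w T0)) => t h1 h2; rewrite indic_oc.
have [ht|_] := boolP (a < t <= c); last by rewrite mulr0 mul0r.
have Dt := sT _ ht; rewrite mulr1 mul1r -h1//; apply: le_trans (dissip_lower (h2 Dt)).
have /andP[t1 t2] := ht; have t0 := ltW (le_lt_trans a0 t1).
apply: (@le_trans _ _ (k * wsq (w t))).
 by apply: ler_wpM2l; [exact: ltW|exact: quadratic_nonincreasing].
have /andP[_ w1] := wsq_le (Lw t0).
apply: (@le_trans _ _ (k * (K1 * mr * (cP * gnr (Gw t)) ^+ 2))).
 apply: ler_wpM2l; first exact: ltW.
 apply: le_trans w1 _; apply: ler_pM => //; first exact: sqr_ge0.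
 by rewrite ler_pXn2r ?nnegrE ?nr_ge0 ?mulr_ge0 ?gnr_ge0 ?(ltW cP0)//; exact: poincare (h2 Dt).
rewrite le_eqVlt; apply/orP; left; apply/eqP; rewrite /k.
by field; rewrite !gt_eqF.
Qed.

(** With [h = x / (n+1)], the bound [1 - h <= exp (- h)] gives [(1 - h^2) exp h <= 1 + h]; raise to
    the power [n + 1] and use Bernoulli's inequality. *)
Lemma exponential_lower (x : R) (n : nat) : 0 <= x -> x <= n.+1%:R ->
 expR x * (1 - x ^+ 2 / n.+1%:R) <= (1 + x / n.+1%:R) ^+ n.+1.
Proof.
move=> x0 xn; pose h := x / n.+1%:R.
have n0 : 0 < n.+1%:R :> R by [].
have h0 : 0 <= h by rewrite divr_ge0.
have h1 : h <= 1 by rewrite ler_pdivrMr// mul1r.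
have bern (m : nat) : 1 - m%:R * h ^+ 2 <= (1 - h ^+ 2) ^+ m.
 elim: m => [|m IH]; first by rewrite mul0r subr0 expr0.
 have y0 : 0 <= 1 - h ^+ 2 by rewrite subr_ge0 expr_le1.
 rewrite [X in _ <= X]exprS; apply: (le_trans _ (ler_wpM2l y0 IH)).
 rewrite -subr_ge0 (_ : _ - _ = m%:R * (h ^+ 2) ^+ 2); last by rewrite -natr1; ring.
 by rewrite mulr_ge0// sqr_ge0.
have e1 : (1 - h ^+ 2) * expR h <= 1 + h.
 have -> : 1 - h ^+ 2 = (1 + h) * (1 - h) by ring.
 rewrite -mulrA ler_piMr ?addr_ge0//.
 have := expR_ge1Dx (- h); rewrite expRN => h2.
 by rewrite -ler_pdivlMr ?expR_gt0// mul1r.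
have -> : expR x = expR h ^+ n.+1 by rewrite -expRM_natl /h mulrC divfK// gt_eqF.
have -> : x ^+ 2 / n.+1%:R = n.+1%:R * h ^+ 2 by rewrite /h; field.
apply: (@le_trans _ _ (((1 - h ^+ 2) * expR h) ^+ n.+1)).
 rewrite [leRHS]exprMn [leRHS]mulrC; apply: ler_wpM2l; first by rewrite exprn_ge0// expR_ge0.
 exact: bern.
rewrite ler_pXn2r ?nnegrE ?addr_ge0// mulr_ge0 ?expR_ge0// subr_ge0 expr_le1//.
Qed.

(** [decay_step] iterated over [n + 1] equal steps gives the factor [(1 + x/(n+1))^(n+1)], which
    tends to the exponential. *)
Lemma quadratic_decay t : 0 < cP -> 0 < K1 -> 0 <= t ->
 wsq (w t) <= expR (- (2 * (lambda / (K1 * cP ^+ 2)) * t)) * wsq (w 0).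
Proof.
move=> cP0 K10 t0; set be := lambda / (K1 * cP ^+ 2).
have be0 : 0 < be by rewrite divr_gt0// mulr_gt0// exprn_gt0.
have [->|tn0] := eqVneq t 0; first by rewrite mulr0 oppr0 expR0 mul1r.
have tp : 0 < t by rewrite lt_def tn0.
pose x := 2 * be * t; have x0 : 0 <= x.
 by apply: mulr_ge0 => //; apply: mulr_ge0 => //; exact: ltW.
have /andP[wt0 _] := wsq_le (Lw t0).
have step (n i : nat) : wsq (w (t / n.+1%:R * i%:R)) * (1 + x / n.+1%:R) ^+ i <= wsq (w 0).
 elim: i => [|i IH]; first by rewrite mulr0 expr0 mulr1.
 apply: le_trans IH; rewrite exprS mulrA; apply: ler_wpM2r.
 by rewrite exprn_ge0// addr_ge0// divr_ge0.
 have h0 : 0 < t / n.+1%:R by rewrite divr_gt0.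
 have lt_i : t / n.+1%:R * i%:R < t / n.+1%:R * i.+1%:R by rewrite ltr_pM2l// ltr_nat.
 have i0 : 0 <= t / n.+1%:R * i%:R by rewrite mulr_ge0// ltW.
 have := decay_step cP0 K10 i0 lt_i; rewrite -/be; congr (_ * _ <= _); congr (_ + _).
 by rewrite -mulrBr -natrB// subSnn mulr1 /x; ring.
rewrite expRN -/x mulrC ler_pdivlMr ?expR_gt0//.
have c1 : wsq (w t) * expR x * (1 - x ^+ 2 / n.+1%:R) @[n --> \oo] --> wsq (w t) * expR x.
 rewrite -[X in _ --> X]mulr1; apply: cvgMr; rewrite -[X in _ --> X]subr0.
 by apply: cvgB; [exact: cvg_cst|exact: (cvg0Ml _ (@cvg_harmonic R))].
apply: (ler_cvg_to c1 (cvg_cst (wsq (w 0)))).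
have [m xm] : exists m : nat, x <= m%:R by exists (Num.truncn x).+1; exact: ltW (truncnS_gt x).
exists m => // n /= mn; have xn : x <= n.+1%:R by apply: le_trans xm _; rewrite ler_nat leqW.
rewrite -mulrA; apply: le_trans (ler_wpM2l wt0 (exponential_lower x0 xn)) _.
have := step n n.+1; rewrite divfK//.
Qed.

End quadratic_energy.

(** * Powers as limits of combinations of hinges *)

Section power_hinges.
Context {R : realType}.
Variable q : R.
Hypothesis q1 : 1 <= q.
Implicit Types (a b h y z : R).

Definition dpow a : R := q * a `^ (q - 1).

Let q0 : 0 < q. Proof. exact: lt_le_trans q1. Qed.

Lemma dpow_ge0 a : 0 <= dpow a.
Proof. by rewrite mulr_ge0 ?powR_ge0// ltW. Qed.

Lemma dpow_homo a b : 0 <= a -> a <= b -> dpow a <= dpow b.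
Proof.
move=> a0 ab; apply: ler_wpM2l; first exact: ltW.
by apply: ge0_ler_powR; rewrite ?nnegrE ?subr_ge0//; exact: le_trans ab.
Qed.

(* Young's inequality for [b] and [a `^ (q - 1)]. *)
Lemma powR_tangent a b : 0 <= a -> 0 <= b -> a `^ q + dpow a * (b - a) <= b `^ q.
Proof.
move=> a0 b0; move: q1; rewrite le_eqVlt => /predU1P[qE|q1'].
 by rewrite /dpow -qE subrr powRr0 !powRr1// !mul1r addrC subrK.
have q10 : 0 < q - 1 by rewrite subr_gt0.
have aq : a `^ (q - 1) * a = a `^ q.
 have [->|an0] := eqVneq a 0; first by rewrite mulr0 powR0// gt_eqF.
 by rewrite -{2}(powRr1 a0) -powRD ?subrK// an0 implybT.
have cq0 : 0 < q / (q - 1) by rewrite divr_gt0.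
have := @conjugate_powR R b (a `^ (q - 1)) q (q / (q - 1)) b0 (powR_ge0 _ _) q0 cq0.
have -> : q^-1 + (q / (q - 1))^-1 = 1 by field; rewrite !gt_eqF.
move=> /(_ erefl); rewrite -powRrM.
have -> : (q - 1) * (q / (q - 1)) = q by field; rewrite gt_eqF.
move=> /(ler_wpM2l (ltW q0)).
have -> : q * (b `^ q / q + a `^ q / (q / (q - 1))) = b `^ q + (q - 1) * a `^ q.
 by field; rewrite !gt_eqF.
rewrite /dpow -subr_ge0 => h; rewrite -subr_ge0; move: h; congr (0 <= _).
by rewrite -aq; ring.
Qed.

(* A piecewise linear function with nodes [h, 2 h, .., N h], below [y `^ q] and within
 [h * dpow y] of it up to [(N + 1) h]. *)
Fixpoint hsum h (N : nat) y : R :=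
 if N is N'.+1 then hsum h N' y + (dpow (h * N%:R) - dpow (h * N'%:R)) * Num.max 0 (y - h * N%:R)
 else dpow 0 * y.

Variable h : R.
Hypothesis h0 : 0 < h.

Let z0 (N : nat) : 0 <= h * N%:R. Proof. by rewrite mulr_ge0// ltW. Qed.
Let zS (N : nat) : h * N%:R <= h * N.+1%:R.
Proof. by rewrite ler_pM2l// ler_nat. Qed.
Let dz N : 0 <= dpow (h * N.+1%:R) - dpow (h * N%:R).
Proof. by rewrite subr_ge0 dpow_homo. Qed.

Lemma hsum_ge0 N y : 0 <= y -> 0 <= hsum h N y.
Proof.
move=> y0; elim: N => [|N IH] /=; first by rewrite mulr_ge0// dpow_ge0.
by rewrite addr_ge0// mulr_ge0// le_max lexx.
Qed.

Let hinge_zero N y : y <= h * N.+1%:R -> hsum h N.+1 y = hsum h N y.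
Proof. by move=> yz; rewrite /= max_l ?mulr0 ?addr0// subr_le0. Qed.

(** The weights of the hinges telescope, so beyond the last node the slope is the derivative of the
    power at that node. *)
Lemma hsum_affine N y : h * N%:R <= y ->
 hsum h N y = hsum h N (h * N%:R) + dpow (h * N%:R) * (y - h * N%:R).
Proof.
elim: N y => [|N IH] y yz; first by rewrite /= !mulr0 subr0 add0r.
have yz' := le_trans (zS N) yz.
rewrite [in RHS]hinge_zero// /= max_r ?subr_ge0// IH// (IH (h * N.+1%:R))//.
by ring.
Qed.

(** Beyond the last node the function is affine with the slope of the tangent there and starts below
    the power, hence stays below the tangent. *)
Lemma hsum_le N y : 0 <= y -> hsum h N y <= y `^ q.
Proof.
elim: N y => [|N IH] y y0 /=.
 by have := powR_tangent (lexx 0) y0; rewrite powR0 ?gt_eqF// add0r subr0.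
rewrite -/(hsum h N.+1 y); have [yz|/ltW yz] := leP y (h * N.+1%:R); first by rewrite hinge_zero// IH.
have := hsum_affine yz; rewrite /= => ->.
rewrite -/(hsum h N.+1 (h * N.+1%:R)) hinge_zero//.
apply: le_trans (powR_tangent (z0 N.+1) y0); rewrite lerD2r; exact: IH.
Qed.

(** On each cell the error grows by at most [h] times the increase of the derivative; summed over
    the cells this telescopes to [h * dpow y]. *)
Lemma hsum_near N y : 0 <= y -> y <= h * N.+1%:R -> y `^ q - hsum h N y <= h * dpow y.
Proof.
elim: N y => [|N IH] y y0 yz.
 rewrite mulr1 in yz; have := powR_tangent y0 (lexx 0); rewrite powR0 ?gt_eqF// sub0r => t1.
 apply: (@le_trans _ _ (dpow y * y)).
 have p0 : 0 <= dpow 0 * y by rewrite mulr_ge0// dpow_ge0.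
 rewrite -subr_ge0 (_ : _ - _ = (0 - (y `^ q + dpow y * (- y))) + dpow 0 * y); last by rewrite /=; ring.
 by rewrite addr_ge0// subr_ge0.
 by rewrite mulrC; apply: ler_wpM2r => //; exact: dpow_ge0.
have [yz1|/ltW yz1] := leP y (h * N.+1%:R); first by rewrite hinge_zero// IH.
rewrite hsum_affine// hinge_zero//.
set z := h * N.+1%:R in yz1 *.
have t1 := powR_tangent y0 (z0 N.+1); have t2 := IH z (z0 N.+1) (lexx _).
have yzh : y - z <= h.
 by rewrite lerBlDr; apply: le_trans yz _; rewrite /z -[N.+2%:R]natr1 mulrDr mulr1 addrC.
have t3 : 0 <= (dpow y - dpow z) * (h - (y - z)) by rewrite mulr_ge0// subr_ge0// dpow_homo// z0.
rewrite -/z in t1; rewrite -subr_ge0.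
have -> : h * dpow y - (y `^ q - (hsum h N z + dpow z * (y - z))) =
 (z `^ q - (y `^ q + dpow y * (z - y))) + (h * dpow z - (z `^ q - hsum h N z)) + (dpow y - dpow z) * (h - (y - z)).
 by ring.
by apply: addr_ge0 => //; apply: addr_ge0; rewrite subr_ge0.
Qed.

End power_hinges.

(** With mesh [1/(n+1)] and [(n+1)^2] nodes, the last node is at [n + 1], so every fixed [y] is
    eventually covered. *)
Lemma hsum_cvg (R : realType) (q y : R) : 1 <= q -> 0 <= y ->
 hsum q n.+1%:R^-1 (n.+1 * n.+1)%N y @[n --> \oo] --> y `^ q.
Proof.
move=> q1 y0; apply: cvg_sub_cst0; apply: (squeeze_cvgr _ (cvg_cst 0) (_ : dpow q y * n.+1%:R^-1 @[n --> \oo] --> (0 : R))); last first.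
 exact: (cvg0Ml _ (@cvg_harmonic R)).
have [m ym] : exists m : nat, y <= m%:R by exists (Num.truncn y).+1; exact: ltW (truncnS_gt y).
exists m => // n mn; have n0 : 0 < n.+1%:R^-1 :> R by rewrite invr_gt0.
apply/andP; split; first by rewrite subr_ge0; exact: hsum_le.
rewrite mulrC; apply: hsum_near => //.
apply: le_trans ym _; apply: (@le_trans _ _ n.+1%:R); first by rewrite ler_nat leqW.
rewrite mulrC ler_pdivlMr// -natrM ler_nat; exact: leqnSn.
Qed.

(** * From inequalities between hinges to inequalities between powers *)

Section power_domination.
Context disp (X : measurableType disp) (R : realType) (mu : {measure set X -> \bar R}).
Implicit Types (f g rho : X -> R).

Lemma fatou_Rint (f_ : nat -> X -> R) f (I : R) : (forall n, intg mu (f_ n)) -> (forall n x, 0 <= f_ n x) ->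
 mfun f -> (forall x, f_ n x @[n --> \oo] --> f x) -> (forall n, \int[mu]_x f_ n x <= I) ->
 intg mu f /\ \int[mu]_x f x <= I.
Proof.
move=> jf f0 mf ff fI; have mE n : mfun (EFin \o f_ n) by have /integrableP[] := jf n.
have f_ge0 x : 0 <= f x by apply: (ler_cvg_to (cvg_cst 0) (ff x)); exact: nearW.
have fE x : limn_einf (fun n => (f_ n x)%:E) = (f x)%:E.
 have c : (f_ n x)%:E @[n --> \oo] --> (f x)%:E by apply/cvg_fineP; exact: ff.
 by have [] := cvg_limn_einf_sup c.
have pos n x : setT x -> (0 <= (f_ n x)%:E)%E by move=> _; rewrite lee_fin.
have := @fatou _ _ _ mu setT measurableT (fun n => EFin \o f_ n) mE pos.
rewrite (_ : (fun x => limn_einf _) = EFin \o f); last by apply/funext => x; exact: fE.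
set u := (fun n => (\int[mu]_(x in _) _)%E) => H.
have uI n : (u n <= I%:E)%E.
 have := fI n; rewrite -lee_fin /Rintegral fineK//.
 exact: (integrable_fin_num measurableT (jf n)).
have H2 : (\int[mu]_x (f x)%:E <= I%:E)%E.
 apply: le_trans H _; rewrite limn_einf_lim; apply: lime_le; first exact: is_cvg_einfs.
 apply: nearW => n; apply: le_trans (uI n); apply: ereal_inf_lbound.
 by exists n => /=.
have jF : intg mu f.
 apply/integrableP; split; first exact/mEFinP.
 rewrite (eq_integral (EFin \o f)); first exact: le_lt_trans H2 (ltry _).
 by move=> x _ /=; rewrite ger0_norm.
split => //; rewrite -lee_fin; apply: le_trans H2.
by rewrite /Rintegral fineK//; exact: (integrable_fin_num measurableT jF).
Qed.

Lemma hsum_Rint q h N rho f : 1 <= q -> 0 < h -> (forall x, 0 <= f x) ->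
 (forall a, 0 <= a -> intg mu (fun x => rho x * Num.max 0 (f x - a))) ->
 intg mu (fun x => rho x * hsum q h N (f x)).
Proof.
move=> q1 h0 f0 jf; elim: N => [|N IH] /=.
 have := intgZ (dpow q 0) (jf 0 (lexx 0)); congr intg; apply/funext => x.
 by rewrite subr0 max_r// mulrCA.
have z0 : 0 <= h * N.+1%:R by rewrite mulr_ge0// ltW.
have := intgD IH (intgZ (dpow q (h * N.+1%:R) - dpow q (h * N%:R)) (jf _ z0)).
by congr intg; apply/funext => x; rewrite mulrDr mulrCA.
Qed.

Lemma hsum_Rint_le q h N rho f g : 1 <= q -> 0 < h -> (forall x, 0 <= f x) -> (forall x, 0 <= g x) ->
 (forall a, 0 <= a -> intg mu (fun x => rho x * Num.max 0 (f x - a))) ->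
 (forall a, 0 <= a -> intg mu (fun x => rho x * Num.max 0 (g x - a))) ->
 (forall a, 0 <= a -> \int[mu]_x (rho x * Num.max 0 (f x - a)) <= \int[mu]_x (rho x * Num.max 0 (g x - a))) ->
 \int[mu]_x (rho x * hsum q h N (f x)) <= \int[mu]_x (rho x * hsum q h N (g x)).
Proof.
move=> q1 h0 f0 g0 jf jg fg; elim: N => [|N IH] /=.
 have E (k : X -> R) : (forall x, 0 <= k x) -> (forall a, 0 <= a -> intg mu (fun x => rho x * Num.max 0 (k x - a))) ->
  \int[mu]_x (rho x * (dpow q 0 * k x)) = dpow q 0 * \int[mu]_x (rho x * Num.max 0 (k x - 0)).
 move=> k0 jk; rewrite -(RintZl (jk 0 (lexx 0))).
 by apply: eq_Rintegral => x _; rewrite subr0 max_r// mulrCA.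
 rewrite !E//; apply: ler_wpM2l; first exact: dpow_ge0.
 exact: fg.
have z0 (n : nat) : 0 <= h * n%:R by rewrite mulr_ge0// ltW.
have dz : 0 <= dpow q (h * N.+1%:R) - dpow q (h * N%:R).
 by rewrite subr_ge0 dpow_homo// ler_pM2l// ler_nat.
have E (k : X -> R) : (forall x, 0 <= k x) -> (forall a, 0 <= a -> intg mu (fun x => rho x * Num.max 0 (k x - a))) ->
 \int[mu]_x (rho x * (hsum q h N (k x) + (dpow q (h * N.+1%:R) - dpow q (h * N%:R)) * Num.max 0 (k x - h * N.+1%:R))) =
 \int[mu]_x (rho x * hsum q h N (k x)) +
 (dpow q (h * N.+1%:R) - dpow q (h * N%:R)) * \int[mu]_x (rho x * Num.max 0 (k x - h * N.+1%:R)).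
 move=> k0 jk; have j1 := jk _ (z0 N.+1); have j2 := hsum_Rint N q1 h0 k0 jk.
 rewrite -(RintZl j1) -(RintD j2 (intgZ _ j1)).
 by apply: eq_Rintegral => x _; rewrite mulrDr mulrCA.
rewrite !E//; apply: lerD => //; apply: ler_wpM2l => //; exact: fg.
Qed.

(** The comparison passes from hinges to their combinations [hsum]. Fatou's lemma takes the limit on
    the side of [f], whose power is not yet known to be integrable; on the side of [g] the
    combinations are below the power. *)
Lemma power_domination q rho f g : 1 <= q -> mfun rho -> (forall x, 0 <= rho x) ->
 mfun f -> (forall x, 0 <= f x) -> (forall x, 0 <= g x) ->
 (forall a, 0 <= a -> intg mu (fun x => rho x * Num.max 0 (f x - a))) ->
 (forall a, 0 <= a -> intg mu (fun x => rho x * Num.max 0 (g x - a))) ->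
 (forall a, 0 <= a -> \int[mu]_x (rho x * Num.max 0 (f x - a)) <= \int[mu]_x (rho x * Num.max 0 (g x - a))) ->
 intg mu (fun x => rho x * g x `^ q) ->
 intg mu (fun x => rho x * f x `^ q) /\ \int[mu]_x (rho x * f x `^ q) <= \int[mu]_x (rho x * g x `^ q).
Proof.
move=> q1 mrho rho0 mf f0 g0 jf jg fg jgq.
have n0 n : 0 < n.+1%:R^-1 :> R by rewrite invr_gt0.
apply: (@fatou_Rint (fun n x => rho x * hsum q n.+1%:R^-1 (n.+1 * n.+1) (f x))).
- by move=> n; exact: hsum_Rint.
- by move=> n x; rewrite mulr_ge0// hsum_ge0.
- by apply: mfunM => //; exact: (mcomp (measurable_powR _)).
- by move=> x; apply: cvgMr; exact: hsum_cvg.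
- move=> n; apply: le_trans (hsum_Rint_le _ q1 (n0 n) f0 g0 jf jg fg) _.
 apply: Rint_le => //; first exact: hsum_Rint.
 by move=> x; apply: ler_wpM2l => //; exact: hsum_le.
Qed.

End power_domination.

(** * Elementary inequalities for powers and hinges *)

Section power_inequalities.
Context {R : realType}.
Implicit Types (q x y z a b K : R).

Lemma powR_add3 q x y z : 0 <= q -> 0 <= x -> 0 <= y -> 0 <= z ->
 (x + y + z) `^ q <= 3 `^ q * (x `^ q + y `^ q + z `^ q).
Proof.
move=> q0 x0 y0 z0; pose m := Num.max x (Num.max y z).
have [mx my mz] : [/\ x <= m, y <= m & z <= m] by rewrite !le_max !lexx !orbT.
have m0 : 0 <= m by exact: le_trans mx.
apply: (@le_trans _ _ ((3 * m) `^ q)).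
 apply: ge0_ler_powR => //; rewrite ?nnegrE ?addr_ge0 ?mulr_ge0//.
 by rewrite (_ : 3 * m = m + m + m); [rewrite !lerD|ring].
rewrite powRM//; apply: ler_wpM2l; first exact: powR_ge0.
have xq := powR_ge0 x q; have yq := powR_ge0 y q; have zq := powR_ge0 z q.
rewrite /m; have [h|h] := leP x (Num.max y z); last by rewrite -addrA lerDl addr_ge0.
by have [h'|h'] := leP y z; [rewrite lerDr addr_ge0|rewrite addrAC lerDr addr_ge0].
Qed.

(** The analogue of Chebyshev's inequality, valid for every exponent [q >= 0]: below [m] the power
    is at most [m^q], and above it [(y/m)^2] is at least 1. *)
Lemma min_powR_le q m K y : 0 <= q -> 0 < m -> 0 <= K -> 0 <= y ->
 Num.min y K `^ q <= m `^ q + K `^ q * m^-1 ^+ 2 * y ^+ 2.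
Proof.
move=> q0 m0 K0 y0; have min0 : 0 <= Num.min y K by rewrite le_min y0.
have [ym|my] := leP y m.
 rewrite -[leLHS]addr0; apply: lerD; last first.
 by apply: mulr_ge0; [apply: mulr_ge0; [exact: powR_ge0|exact: sqr_ge0]|exact: sqr_ge0].
 by apply: ge0_ler_powR; rewrite ?nnegrE//; [exact: ltW|rewrite ge_min ym].
rewrite -[leLHS]add0r; apply: lerD; first exact: powR_ge0.
rewrite -mulrA -exprMn -[leLHS]mulr1; apply: ler_pM; rewrite ?powR_ge0//.
 by apply: ge0_ler_powR => //; rewrite ge_min lexx orbT.
by rewrite expr_ge1 ?mulr_ge0 ?invr_ge0 ?(ltW m0)// mulrC ler_pdivlMr// mul1r ltW.
Qed.

Lemma hinge_ge0 a s : 0 <= hinge a s. Proof. by rewrite /hinge le_max lexx. Qed.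

(** A hinge of a hinge is a hinge, so the comparison of hinges of [w] is also one for the tail
    [hinge K w]. *)
Lemma hinge_hinge K a s : 0 <= a -> Num.max 0 (hinge K s - a) = hinge (K + a) s.
Proof.
move=> a0; rewrite /hinge opprD addrA.
have [h|h] := leP 0 (`|s| - K) => //.
rewrite sub0r [LHS]max_l ?oppr_le0// max_l//.
by rewrite -[leRHS]subr0 lerB// ltW.
Qed.

(** Separates a distance into two tails above height [K] and a part bounded by [2 K]. *)
Lemma dist_hinge_le K a b : 0 <= K -> `|a - b| <= hinge K a + hinge K b + Num.min `|a - b| (K *+ 2).
Proof.
move=> K0; have ha := hinge_ge0 K a; have hb := hinge_ge0 K b.
have [h|h] := leP `|a - b| (K *+ 2); first by rewrite lerDr addr_ge0.
apply: le_trans (ler_normB _ _) _.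
have h1 : `|a| - K <= hinge K a by rewrite le_max lexx orbT.
have h2 : `|b| - K <= hinge K b by rewrite le_max lexx orbT.
rewrite -subr_ge0 (_ : _ - _ = (hinge K a - (`|a| - K)) + (hinge K b - (`|b| - K))); last by rewrite mulr2n; ring.
by rewrite addr_ge0// subr_ge0.
Qed.

Lemma hinge_le K a b : `|a| <= `|b| -> hinge K a <= hinge K b.
Proof. by move=> ab; rewrite /hinge ge_max !le_max lexx/= lerD2r ab orbT. Qed.

End power_inequalities.

(** * Bounds and continuity in L^q *)

Section Lq_estimates.
Context {R : realType} {d : nat}.
Notation V := 'rV[R]_d.
Notation mu := (@lebesgue_rV R d).
Variables (U : set V) (rho : V -> R) (mr Mr K1 : R) (w z : R -> V -> R).
Hypotheses (oU : open U)
 (fU : (mu U < +oo)%E)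
 (hrho : weight_bounds U rho mr Mr K1)
 (Lw : forall t, 0 <= t -> L2 mu (w t))
 (w_off : forall t, 0 <= t -> forall x, ~ U x -> w t x = 0)
 (hinge_mono : forall a t, 0 <= a -> 0 <= t ->
 \int[mu]_x (rho x * hinge a (w t x)) <= \int[mu]_x (rho x * hinge a (w 0 x)))
 (Lz : forall t, 0 <= t -> L2 mu (z t))
 (z_le : forall t, 0 <= t -> forall x, `|z t x| <= `|w t x|)
 (z_cont : forall t, 0 <= t ->
 nr mu (fun x => z s x - z t x) @[s --> nbhs_ge0 t] --> (0 : R)).

Let rho0 x : 0 <= rho x <= Mr. Proof. by have [_ _ h _] := hrho. Qed.
Let Lrho : L2 mu rho. Proof. by have [h _ _ _] := hrho. Qed.
Let mr0 : 0 < mr. Proof. by have [_ _ _ []] := hrho. Qed.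
Let Mr0 : 0 <= Mr. Proof. by have /andP[a b] := rho0 0; exact: le_trans a b. Qed.

Lemma measurable_hinge (a : R) (f : V -> R) : mfun f -> mfun (fun x : V => hinge a (f x)).
Proof.
move=> mf; apply: measurable_maxr; first exact: mcst.
by apply: mfunB; [exact: (mcomp mnormr)|exact: mcst].
Qed.

Lemma intg_hinge a t : 0 <= a -> 0 <= t -> intg mu (fun x => rho x * hinge a (w t x)).
Proof.
move=> a0 t0; apply: L2_mul => //; apply: (@L2_le _ _ _ _ _ (w t)); last exact: Lw.
 by apply: measurable_hinge; exact: L2_meas (Lw t0).
move=> x; rewrite ger0_norm ?hinge_ge0// /hinge ge_max normr_ge0/=.
by rewrite gerBl.
Qed.

(** For [K = 0] this is the L^q bound; for large [K] it says that the tails at all times are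
    controlled by the initial one, the uniformity behind continuity in L^q. *)
Lemma tail_estimate q K t : 1 <= q -> 0 <= K -> 0 <= t -> intg mu (fun x => hinge K (w 0 x) `^ q) ->
 intg mu (fun x => hinge K (w t x) `^ q) /\
 mr * \int[mu]_x (hinge K (w t x) `^ q) <= Mr * \int[mu]_x (hinge K (w 0 x) `^ q).
Proof.
move=> q1 K0 t0 j0; have q0 : 0 < q := lt_le_trans ltr01 q1.
have [_ _ _ [rhomr _ _]] := hrho.
have mf s : 0 <= s -> mfun (fun x : V => hinge K (w s x)).
 by move=> s0; apply: measurable_hinge; exact: L2_meas (Lw s0).
have jh s : 0 <= s -> forall a, 0 <= a -> intg mu (fun x => rho x * Num.max 0 (hinge K (w s x) - a)).
 move=> s0 a a0; have := intg_hinge (addr_ge0 K0 a0) s0; congr intg; apply/funext => x.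
 by rewrite hinge_hinge.
have jr0 : intg mu (fun x => rho x * hinge K (w 0 x) `^ q).
 apply: (intg_bmul (L2_meas Lrho) (C := Mr)) => // x.
 by have /andP[a b] := rho0 x; rewrite ger0_norm.
have [jt It] : intg mu (fun x => rho x * hinge K (w t x) `^ q) /\
 \int[mu]_x (rho x * hinge K (w t x) `^ q) <= \int[mu]_x (rho x * hinge K (w 0 x) `^ q).
 apply: power_domination => //.
 - exact: L2_meas Lrho.
 - by move=> x; have /andP[] := rho0 x.
 - exact: mf.
 - by move=> x; exact: hinge_ge0.
 - by move=> x; exact: hinge_ge0.
 - exact: jh.
 - exact: jh.
 - move=> a a0; have := hinge_mono (addr_ge0 K0 a0) t0.
 by congr (_ <= _); apply: eq_Rintegral => x _; rewrite hinge_hinge.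
have lo x : mr * hinge K (w t x) `^ q <= rho x * hinge K (w t x) `^ q.
 have [Ux|nUx] := pselect (U x); first by apply: ler_wpM2r; [exact: powR_ge0|exact: rhomr].
 rewrite w_off// /hinge normr0 max_l ?sub0r ?oppr_le0// powR0 ?gt_eqF//.
 by rewrite !mulr0.
have jm : intg mu (fun x => hinge K (w t x) `^ q).
 apply: (intg_le _ _ (intgZ mr^-1 jt)).
 by apply: (mcomp (measurable_powR _)); exact: mf.
 move=> x; rewrite ger0_norm ?powR_ge0// mulrC ler_pdivlMr// mulrC; exact: lo.
split; first exact: jm.
rewrite -(RintegralZl mr measurableT jm) -(RintegralZl Mr measurableT j0).
apply: le_trans (Rint_le (intgZ mr jm) jt lo) _; apply: le_trans It _.
apply: Rint_le => //; first exact: intgZ.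
by move=> x; apply: ler_wpM2r; [exact: powR_ge0|have /andP[] := rho0 x].
Qed.

Variable q : R.
Hypotheses (q1 : 1 <= q)
 (jw0 : intg mu (fun x => `|w 0 x| `^ q)).

Let q0 : 0 < q. Proof. exact: lt_le_trans ltr01 q1. Qed.

Let hinge0 (s : R) : hinge 0 s = `|s|. Proof. by rewrite /hinge subr0 max_r. Qed.

Lemma intg_tail K : 0 <= K -> intg mu (fun x => hinge K (w 0 x) `^ q).
Proof.
move=> K0; apply: (intg_le _ _ jw0).
 by apply: (mcomp (measurable_powR _)); apply: measurable_hinge; exact: L2_meas (Lw (lexx 0)).
move=> x; rewrite ger0_norm ?powR_ge0//; apply: ge0_ler_powR; rewrite ?nnegrE ?hinge_ge0 ?(ltW q0)//.
by rewrite /hinge ge_max normr_ge0/= gerBl.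
Qed.

Lemma power_estimate t : 0 <= t -> intg mu (fun x => `|w t x| `^ q) /\
 mr * \int[mu]_x (`|w t x| `^ q) <= Mr * \int[mu]_x (`|w 0 x| `^ q).
Proof.
move=> t0; have := tail_estimate q1 (lexx 0) t0 (intg_tail (lexx 0)).
rewrite (_ : (fun x => hinge 0 (w t x) `^ q) = (fun x => `|w t x| `^ q)); last by apply/funext => x; rewrite hinge0.
by rewrite (_ : (fun x => hinge 0 (w 0 x) `^ q) = (fun x => `|w 0 x| `^ q)); last by apply/funext => x; rewrite hinge0.
Qed.

Lemma tail_cvg0 : \int[mu]_x (hinge n%:R (w 0 x) `^ q) @[n --> \oo] --> (0 : R).
Proof.
rewrite -[X in _ --> X](@Rint0_eq _ _ _ mu (fun=> 0) (fun=> erefl)).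
apply: (@Rdct _ _ _ mu _ _ (fun x => `|w 0 x| `^ q)) => //.
- by move=> n; exact: intg_meas (intg_tail (ler0n _ _)).
- move=> x; have [m wm] : exists m : nat, `|w 0 x| <= m%:R by exists (Num.truncn `|w 0 x|).+1; exact: ltW (truncnS_gt _).
 suff h : \forall n \near \oo, 0 = hinge n%:R (w 0 x) `^ q by exact: (cvg_trans (near_eq_cvg h) (cvg_cst _)).
 exists m => // n /= mn; rewrite /hinge max_l; first by rewrite powR0// gt_eqF.
 by rewrite subr_le0; apply: le_trans wm _; rewrite ler_nat.
- move=> n x; rewrite ger0_norm ?powR_ge0//; apply: ge0_ler_powR; rewrite ?nnegrE ?hinge_ge0 ?(ltW q0)//.
 by rewrite /hinge ge_max normr_ge0/= gerBl.
Qed.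

Lemma intg_zq t : 0 <= t -> intg mu (fun x => `|z t x| `^ q).
Proof.
move=> t0; have [jt _] := power_estimate t0; apply: (intg_le _ _ jt).
 by apply: measurable_powR_abs; exact: L2_meas (Lz t0).
by move=> x; rewrite ger0_norm ?powR_ge0//; apply: ge0_ler_powR; rewrite ?nnegrE ?(ltW q0)// z_le.
Qed.

Lemma intg_zBq s t : 0 <= s -> 0 <= t -> intg mu (fun x => `|z s x - z t x| `^ q).
Proof.
move=> s0 t0; have js := intg_zq s0; have jt := intg_zq t0.
apply: (intg_le _ _ (intgZ (3 `^ q) (intgD js jt))).
 by apply: measurable_powR_abs; apply: mfunB; [exact: L2_meas (Lz s0)|exact: L2_meas (Lz t0)].
move=> x; rewrite ger0_norm ?powR_ge0//.
have := powR_add3 (ltW q0) (normr_ge0 (z s x)) (normr_ge0 (z t x)) (lexx 0).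
rewrite powR0 ?gt_eqF// !addr0; apply: le_trans.
by apply: ge0_ler_powR; rewrite ?nnegrE ?addr_ge0 ?(ltW q0)// ler_normB.
Qed.

(** The parts of the curve above a height [K] are small uniformly in time, and on the remaining
    bounded part [min_powR_le] converts L^2 continuity into L^q continuity, whether [q] is below or
    above 2. *)
Lemma power_continuous (t e : R) : 0 <= t -> 0 < e ->
 \forall s \near nbhs_ge0 t, 0 <= s /\ \int[mu]_x (`|z s x - z t x| `^ q) <= e.
Proof.
move=> t0 e0.
have e3 : 0 < e / 3 by rewrite divr_gt0.
have t3 : 0 < 3 `^ q :> R by rewrite powR_gt0.
(* Two tails, at [s] and at [t], each at most [Mr / mr] times the initial one; [3 ^ q] comes from
   [powR_add3]. *)
pose k1 : R := 3 `^ q * (2 * (Mr / mr)).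
have k10 : 0 <= k1 by rewrite !mulr_ge0 ?powR_ge0// invr_ge0 ltW.
have /cvgr0Pnorm_le := cvg0Ml k1 tail_cvg0 => /(_ _ e3) [n _ /(_ n (leqnn n))].
set K : R := n%:R; set tau := \int[mu]_x _ => htau.
have K0 : 0 <= K by exact: ler0n.
have {}htau : k1 * tau <= e / 3 by apply: le_trans (ler_norm _) htau.
have jU := intg_indicU (open_meas oU) fU.
pose mU : R := \int[mu]_x \1_U x.
have mU0 : 0 <= mU by apply: Rint_ge0 => x; rewrite indicE.
(* Chosen so that differences below [m] contribute at most [e / 3] over the whole of [U]; the [+ 1]
   avoids a zero denominator. *)
pose m : R := (e / 3 / (3 `^ q * mU + 1)) `^ q^-1.
have D0 : 0 < 3 `^ q * mU + 1 by rewrite ltr_wpDl// mulr_ge0// powR_ge0.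
have m0 : 0 < m by apply: powR_gt0; exact: divr_gt0.
have mq : 3 `^ q * (m `^ q * mU) <= e / 3.
 rewrite /m -powRrM mulVf ?gt_eqF// powRr1; last by rewrite !divr_ge0 ?ltW.
 rewrite mulrCA mulrAC ler_pdivrMr// ler_pM2l// lerDl//.
pose k2 : R := 3 `^ q * ((K *+ 2) `^ q * m^-1 ^+ 2).
have c1 : (k2 * (nr mu (fun x => z s x - z t x) * nr mu (fun x => z s x - z t x))) @[s --> nbhs_ge0 t] --> (0 : R).
 have e00 : k2 * (0 * 0) = 0 by rewrite mulr0 mulr0.
 by rewrite -[X in _ --> X]e00; apply: cvgMr; apply: cvgM; exact: z_cont.
have FF : Filter (nbhs_ge0 t) by exact: within_filter.
have h3 : \forall s \near nbhs_ge0 t, 0 <= s by exact: withinT.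
move/cvgr0Pnorm_le : c1 => /(_ _ e3) c1; apply: filterS2 c1 h3 => s cs s0; split => //.
have {}cs : k2 * nr mu (fun x => z s x - z t x) ^+ 2 <= e / 3.
 by rewrite expr2; apply: le_trans (ler_norm _) cs.
have LB := L2B (Lz s0) (Lz t0); have [_ jB] := LB.
have [js Is] := tail_estimate q1 K0 s0 (intg_tail K0).
have [jt It] := tail_estimate q1 K0 t0 (intg_tail K0).
(* Integrable majorant: the two tails, then the bound of [min_powR_le] with its constant term
   confined to [U], outside of which both functions vanish. *)
pose g x := 3 `^ q * ((hinge K (w s x) `^ q + hinge K (w t x) `^ q) +
 (m `^ q * \1_U x + (K *+ 2) `^ q * m^-1 ^+ 2 * (z s x - z t x) ^+ 2)).
have j1 := intgD js jt; have j2 := intgD (intgZ (m `^ q) jU) (intgZ ((K *+ 2) `^ q * m^-1 ^+ 2) jB).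
have jg : intg mu g by exact: (intgZ _ (intgD j1 j2)).
apply: (@le_trans _ _ (\int[mu]_x g x)).
 apply: Rint_le => //; first exact: intg_zBq.
 move=> x; have [Ux|nUx] := pselect (U x); last first.
 have zs : z s x = 0 by apply/eqP; rewrite -normr_le0 -[leRHS](normr0 R) -(w_off s0 nUx); exact: z_le.
 have zt : z t x = 0 by apply/eqP; rewrite -normr_le0 -[leRHS](normr0 R) -(w_off t0 nUx); exact: z_le.
 rewrite zs zt subrr normr0 powR0 ?gt_eqF// /g; apply: mulr_ge0; first exact: powR_ge0.
 apply: addr_ge0; first by rewrite addr_ge0// powR_ge0.
 apply: addr_ge0; first by rewrite mulr_ge0 ?powR_ge0// indicE.
 by rewrite zs zt subrr expr0n mulr0.
 apply: (@le_trans _ _ ((hinge K (z s x) + hinge K (z t x) + Num.min `|z s x - z t x| (K *+ 2)) `^ q)).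
 apply: ge0_ler_powR; rewrite ?nnegrE ?(ltW q0)//; last exact: dist_hinge_le.
 by rewrite !addr_ge0 ?hinge_ge0// le_min normr_ge0 mulrn_wge0.
 apply: le_trans (powR_add3 (ltW q0) (hinge_ge0 _ _) (hinge_ge0 _ _) _) _.
 by rewrite le_min normr_ge0 mulrn_wge0.
 apply: ler_wpM2l; first exact: powR_ge0.
 have hh r : 0 <= r -> hinge K (z r x) `^ q <= hinge K (w r x) `^ q.
 move=> r0; apply: ge0_ler_powR; rewrite ?nnegrE ?hinge_ge0 ?(ltW q0)//.
 by apply: hinge_le; exact: z_le.
 apply: lerD; first by apply: lerD; exact: hh.
 rewrite indicE mem_set// mulr1.
 apply: le_trans (min_powR_le (ltW q0) m0 _ (normr_ge0 _)) _; first exact: mulrn_wge0.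
 by rewrite real_normK ?num_real.
rewrite (RintZl (intgD j1 j2)) (RintD j1 j2) (RintD js jt).
rewrite (RintD (intgZ (m `^ q) jU) (intgZ ((K *+ 2) `^ q * m^-1 ^+ 2) jB)).
rewrite (RintZl jU) (RintZl jB) -nr_sqE -/mU.
have bt r : mr * \int[mu]_x (hinge K (w r x) `^ q) <= Mr * tau -> \int[mu]_x (hinge K (w r x) `^ q) <= Mr / mr * tau.
 by move=> h; rewrite mulrAC ler_pdivlMr// mulrC.
have E1 : 3 `^ q * (\int[mu]_x (hinge K (w s x) `^ q) + \int[mu]_x (hinge K (w t x) `^ q)) <= e / 3.
 apply: le_trans htau; rewrite /k1 -mulrA; apply: ler_wpM2l; first exact: powR_ge0.
 have -> : 2 * (Mr / mr) * tau = Mr / mr * tau + Mr / mr * tau by rewrite -mulrA mulr_natl mulr2n.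
 by apply: lerD; [exact: (bt s Is)|exact: (bt t It)].
have alg (a1 a2 a3 a4 a5 : R) : a1 * (a2 + (a3 + a4 * a5)) = a1 * a2 + a1 * a3 + a1 * a4 * a5.
 by rewrite !mulrDr !addrA !mulrA.
rewrite alg [leRHS](_ : e = e / 3 + e / 3 + e / 3); last by field.
by apply: lerD => //; exact: lerD.
Qed.

End Lq_estimates.

(** * The essential supremum norm *)

Section Linfty.
Context {R : realType} {d : nat}.
Notation V := 'rV[R]_d.
Notation mu := (@lebesgue_rV R d).

Lemma Lpnorm_infty_le (U : set V) f g (a : R) : 0 <= a -> repr U f g ->
 {ae mu, forall x, `|g x| <= a} -> (Lpnorm U +oo%E f <= a%:E)%E.
Proof.
move=> a0 [_ fg] ga; rewrite /Lpnorm unlock; case: ifPn => _; last by rewrite lee_fin.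
apply/ess_sup_inf.ess_supP; apply: (ae_mono2 fg ga) => x /= -> h.
by rewrite lee_fin.
Qed.

Lemma Lpnorm_infty_ae (U : set V) f g : repr U f g -> (0 < mu setT)%E -> (Lpnorm U +oo%E f < +oo)%E ->
 exists a : R, [/\ 0 <= a, Lpnorm U +oo%E f = a%:E & {ae mu, forall x, `|g x| <= a}].
Proof.
move=> [_ fg] mu0 h; have p0 : (0 <= Lpnorm U +oo%E f)%E by exact: Lnorm_ge0.
have fin : Lpnorm U +oo%E f \is a fin_num by rewrite ge0_fin_numE.
exists (fine (Lpnorm U +oo%E f)); rewrite fineK//; split => //; first exact: fine_ge0.
have : (Lpnorm U +oo%E f <= (fine (Lpnorm U +oo%E f))%:E)%E by rewrite fineK.
rewrite {1}/Lpnorm unlock mu0 => /ess_sup_inf.ess_supP h2.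
by apply: (ae_mono2 fg h2) => x /= ->; rewrite lee_fin.
Qed.

Lemma Lpnorm_infty_null (U : set V) f : ~~ (0 < mu setT)%E -> Lpnorm U +oo%E f = 0%E.
Proof. by move=> mu0; rewrite /Lpnorm unlock (negbTE mu0). Qed.

End Linfty.

Lemma scaled_root_le (R : realType) (e I K J q : R) : 0 < q -> 0 <= e -> 0 <= I -> 0 <= K -> 0 <= J ->
 I <= K * J -> (e `^ q * I) `^ q^-1 <= K `^ q^-1 * e * J `^ q^-1.
Proof.
move=> q0 e0 I0 K0 J0 IKJ; have q'0 : 0 <= q^-1 by rewrite invr_ge0 ltW.
rewrite powRM ?powR_ge0// -powRrM mulfV ?gt_eqF// powRr1// mulrAC mulrC.
apply: ler_wpM2r => //; rewrite -powRM//.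
by apply: ge0_ler_powR => //; rewrite nnegrE// mulr_ge0.
Qed.

(** * The estimates for the solution *)

Theorem theorem1p1 (R : realType) (d : nat) (U : set 'rV[R]_d) (x0 : 'rV[R]_d)
    (r p M lambda : R) (H : 'rV[R]_d -> 'rV[R]_d) (h : 'rV[R]_d -> R)
    (A : 'rV[R]_d -> 'M[R]_d) (theta s : R) (c g : 'rV[R]_d -> R) (T : R)
    (u : R -> 'rV[R]_d -> R) (K1 : R) :
  (2 <= d)%N -> 0 < r -> d%:R < p -> 0 < M -> 0 < lambda ->
  structural_hypotheses lambda M r p U x0 A H h ->
  0 <= theta ->
  (d = 2%N -> 1 < s) -> ((3 <= d)%N -> s = d%:R / 2) ->
  in_Lp U s%:E c ->
  {ae @lebesgue_rV R d, forall x, U x -> 0 <= c x} ->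
  in_Lp U 2%:E g ->
  0 < T ->
  global_weak_solution U A H c theta g u ->
  is_K1 d lambda M r p (Lpnorm U p%:E h) K1 ->
  let kappa := theta + d%:R ^+ 2 * lambda /
    (4 * K1 * (d%:R - 1) ^+ 2 * fine (lebesgue_rV d U) `^ (2 / d%:R)) in
  [/\ (L2_H10norm U T u <=
         ((K1 / (2 * lambda)) `^ 2^-1)%:E * Lpnorm U 2%:E g)%E,
      (forall t, 0 < t ->
        (Lpnorm U 2%:E (u t) <=
           (K1 `^ 2^-1 * expR (- kappa * t))%:E * Lpnorm U 2%:E g)%E),
      (forall q : R, 1 <= q -> in_Lp U q%:E g ->
        continuous_Lp U q%:E u /\
        (forall t, 0 < t ->
          (Lpnorm U q%:E (u t) <=
             (K1 `^ q^-1 * expR (- theta * t))%:E * Lpnorm U q%:E g)%E)) &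
      (in_Lp U +oo%E g -> forall t, 0 < t ->
        (Lpnorm U +oo%E (u t) <=
           (expR (- theta * t))%:E * Lpnorm U +oo%E g)%E)].
Proof.
move=> d2 r0 dp M0 lambda0 hyps theta0 s2 s3 Lc cp Lg T0 hsol hK1 kappa.
have [[oU bU cU] _] := hyps.
have mU := open_meas oU; have fU := lebesgue_rV_bounded_fin mU bU.
have d0 : (0 < d)%N by exact: leq_trans d2.
have K11 : 1 <= K1 by have [] := hK1.
have K10 : 0 < K1 by exact: lt_le_trans K11.
have [ur [GR [rho [mr [Mr [hur hrho EI]]]]]] :=
 solution_energy d2 r0 dp M0 hyps theta0 s2 s3 Lc cp hsol hK1.
pose w := wcurve theta ur; pose Gw := Gcurve theta GR.
have [Lrho jrho rho0 [rhomr mr0 MrK]] := hrho.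
have Mr0 : 0 <= Mr by have /andP[a b] := rho0 0; exact: le_trans a b.
have Lw t : 0 <= t -> L2 (lebesgue_rV d) (w t) by exact: curve_L2 hur t.
have w_off t : 0 <= t -> forall x, ~ U x -> w t x = 0.
 by move=> t0 x nUx; have [_ _ hh _] := hur t t0; rewrite /w /wcurve hh// mulr0.
have cont := curve_cont hsol hur.
have poinc v G : h10p U v G -> nr (lebesgue_rV d) v <= fine (lebesgue_rV d U) `^ d%:R^-1 * gnr G.
 exact: poincare_pair.
have pw T' : 0 < T' -> {ae @lebesgue_measure R, forall t : R, `]0, T'[%classic t -> h10p U (w t) (Gw t)}.
 by move=> T'0; apply: (ae_mono (curve_pair hsol hur T'0)) => t hh Dt; have [] := hh Dt.
have aw T' : 0 < T' -> approx_curve U T' Gw by move=> T'0; exact: (curve_approx oU fU theta0 hsol hur T'0).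
have gw T' : 0 < T' -> exists qg : measurableTypeR R -> R,
 [/\ mfun qg,
 {ae @lebesgue_measure R, forall t : R, `]0, T'[%classic t -> gnr (GR t) = qg t /\ gnr (Gw t) = expR (theta * t) * qg t},
 L2 (@lebesgue_measure R) (fun t => \1_`]0, T'[ t * qg t) &
 L2_H10norm U T' u = (nr (@lebesgue_measure R) (fun t => \1_`]0, T'[ t * qg t))%:E].
 move=> T'0; have [qg [m1 m2 m3 m4]] := curve_gradient_norm oU fU poinc theta0 hsol hur T'0.
 exists qg; split => //; apply: (ae_mono2 m2 (curve_pair hsol hur T'0)) => t h1 h2 Dt.
 have [[_ LG _] _] := h2 Dt; split; first exact: h1.
 rewrite -h1// /gnr; under eq_bigr do rewrite nrZ// exprMn.
 by rewrite -mulr_sumr sqrtrM ?sqr_ge0// sqrtr_sqr normr_id ger0_norm ?expR_ge0.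
have gradw T' : 0 < T' -> exists2 q : measurableTypeR R -> R,
 {ae @lebesgue_measure R, forall t : R, `]0, T'[%classic t -> gnr (Gw t) = q t} &
 L2 (@lebesgue_measure R) (fun t => \1_`]0, T'[ t * q t).
 move=> T'0; have [qg [m1 m2 m3 _]] := gw T' T'0.
 exists (fun t => expR (theta * t) * qg t); first by apply: (ae_mono m2) => t hh Dt; have [] := hh Dt.
 have mex : mfun (fun t : measurableTypeR R => expR (theta * t)).
 apply: (mcomp (@measurable_expR R)).
 by apply: mfunM => //; exact: mcst.
 apply: (@L2_le _ (measurableTypeR R) R (@lebesgue_measure R) _ (fun t => expR (theta * T') * (\1_`]0, T'[ t * qg t))).
 - by apply: mfunM; [apply: mindic; exact: mitv|exact: mfunM].
 - move=> t; rewrite indicE; case: (boolP (t \in _)) => [|_]; last by rewrite !mul0r mulr0.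
 rewrite inE /= in_itv/= => /andP[t0 tT]; rewrite !mul1r !normrM; apply: ler_wpM2r => //.
 by rewrite !ger0_norm ?expR_ge0// ler_expR ler_wpM2l// ltW.
 - exact: L2Z.
have quad := quadratic_decay oU lambda0 hrho Lw cont EI poinc pw aw gradw.
have quad0 := quadratic_nonincreasing lambda0 hrho Lw cont EI poinc pw aw gradw.
have hinge_mono a t : 0 <= a -> 0 <= t -> \int[lebesgue_rV d]_x (rho x * hinge a (w t x)) <=
 \int[lebesgue_rV d]_x (rho x * hinge a (w 0 x)).
 exact: (hinge_nonincreasing lambda0 hrho Lw cont EI).
have [hc2 ug _] := hsol.
have [ru0 Lu0 uoff0 _] := hur 0 (lexx 0).
have w00 : w 0 = ur 0 by apply/funext => x; rewrite /w /wcurve mulr0 expR0 mul1r.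
have rg : repr U g (ur 0).
 have [m1 hh] := ru0; split => //; apply: (ae_mono2 hh ug) => x hx hg; rewrite -hx.
 by have [Ux|nUx] := pselect (U x); [rewrite !zextE// hg|rewrite !zext0].
have ng : Lpnorm U 2%:E g = (nr (lebesgue_rV d) (ur 0))%:E := Lpnorm_repr rg Lu0.
have n00 := nr_ge0 (lebesgue_rV d) (ur 0).
have urE t : ur t = (fun x => expR (- theta * t) * w t x).
 by apply/funext => x; rewrite /w /wcurve mulrA -expRD mulNr addNr expR0 mul1r.
split.
- have [qg [m1 m2 m3 ->]] := gw T T0; rewrite ng -EFinM lee_fin.
 (* [qg] is the gradient norm of the solution; the rescaled curve has a larger one, by the factor
    [exp (theta t) >= 1]. *)
 have qG : {ae @lebesgue_measure R, forall t : R, `]0, T[%classic t -> 0 <= qg t <= gnr (Gw t)}.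
 apply: (ae_mono m2) => t hh Dt; have [h1 h2] := hh Dt; rewrite h2 -h1 gnr_ge0/=.
 rewrite ler_peMl ?gnr_ge0// -expR0 ler_expR mulr_ge0//.
 by move: Dt; rewrite /= in_itv/= => /andP[/ltW].
 have := gradient_estimate oU lambda0 hrho Lw cont EI poinc pw aw gradw T0 qG m3.
 rewrite w00; set N := nr _ _; set n0 := nr _ _ => hh.
 have N0 : 0 <= N by exact: nr_ge0.
 have n0p : 0 <= n0 by exact: nr_ge0.
 rewrite powR12_sqrt; last by rewrite divr_ge0 ?mulr_ge0 ?ltW.
 rewrite -(ger0_norm N0) -sqrtr_sqr -(ger0_norm n0p) -sqrtr_sqr -sqrtrM; last by rewrite divr_ge0 ?mulr_ge0 ?ltW.
 apply: ler_wsqrtr; rewrite mulrAC ler_pdivlMr ?mulr_gt0//.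
 have h2 : mr * (N ^+ 2 * (2 * lambda)) <= mr * (K1 * n0 ^+ 2).
 apply: (@le_trans _ _ (2 * lambda * mr * N ^+ 2)); first by rewrite le_eqVlt; apply/orP; left; apply/eqP; ring.
 apply: le_trans hh _; rewrite mulrA; apply: ler_wpM2r; first exact: sqr_ge0.
 by rewrite mulrC.
 by rewrite ler_pM2l in h2.
- move=> t t0; have t0' := ltW t0; have [rt Lt _ _] := hur t t0'.
 rewrite (Lpnorm_repr rt Lt) ng -EFinM lee_fin.
 pose m := fine (lebesgue_rV d U).
 have m0 : 0 <= m by rewrite fine_ge0.
 (* If [U] is null, the inverse of zero being zero makes [kappa] equal to [theta], and monotonicity
    suffices. Otherwise [be] is the rate given by the Poincare constant [m^(1/d)]. *)
 pose be := if m == 0 then 0 else lambda / (K1 * (m `^ d%:R^-1) ^+ 2).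
 have be1 : kappa <= theta + be.
 rewrite /kappa -/m lerD2l /be; case: ifPn => [/eqP ->|mn0].
  have dn0 : (2 / d%:R : R) != 0 by rewrite mulf_neq0 ?invr_neq0 ?pnatr_eq0// -lt0n.
  by rewrite powR0// mulr0 invr0 mulr0.
 have mp : 0 < m by rewrite lt_def mn0.
 have -> : (m `^ d%:R^-1) ^+ 2 = m `^ (2 / d%:R) by rewrite -powR_mulrn ?powR_ge0// -powRrM mulrC.
 have X0 : 0 < m `^ (2 / d%:R) by exact: powR_gt0.
 set X := m `^ _ in X0 *.
 have dR : 2 <= d%:R :> R by rewrite (ler_nat R 2 d).
 have e0 : 0 < (d%:R - 1 : R) by lra.
 rewrite ler_pdivrMr ?mulr_gt0 ?exprn_gt0//.
 (* The claimed rate is [be] times [d^2 / (4 (d - 1)^2)], a factor at most 1 because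
    [d <= 2 (d - 1)] for [d >= 2]. *)
 have -> : lambda / (K1 * X) * (4 * K1 * (d%:R - 1) ^+ 2 * X) = lambda * (2 * (d%:R - 1)) ^+ 2.
  by field; rewrite !gt_eqF.
 rewrite mulrC; apply: ler_wpM2l; first exact: ltW.
 by apply: lerXn2r; rewrite ?nnegrE; lra.
 have be2 : wsq rho (w t) <= expR (- (2 * be * t)) * wsq rho (w 0).
 rewrite /be; case: ifPn => [_|mn0]; last by apply: quad => //; apply: powR_gt0; rewrite lt_def mn0.
 by rewrite mulr0 mul0r oppr0 expR0 mul1r; exact: quad0.
 have h1 := wsq_ge hrho (Lw t t0') (w_off t t0').
 have /andP[_ h2] := wsq_le hrho (Lw 0 (lexx 0)); rewrite w00 in h2 be2.
 set n0 := nr _ (ur 0) in h2 n00 ng *.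
 have h3 : nr (lebesgue_rV d) (w t) ^+ 2 <= K1 * (expR (- (be * t)) * n0) ^+ 2.
 have h4 : mr * nr (lebesgue_rV d) (w t) ^+ 2 <= mr * (K1 * (expR (- (be * t)) * n0) ^+ 2).
  apply: le_trans h1 _; apply: le_trans be2 _.
  have -> : expR (- (2 * be * t)) = expR (- (be * t)) ^+ 2 by rewrite expr2 -expRD; congr expR; ring.
  apply: le_trans (ler_wpM2l (sqr_ge0 _) h2) _.
  rewrite (_ : mr * _ = expR (- (be * t)) ^+ 2 * ((K1 * mr) * n0 ^+ 2)); last by ring.
  by apply: ler_wpM2l; [exact: sqr_ge0|apply: ler_wpM2r => //; exact: sqr_ge0].
 by rewrite ler_pM2l in h4.
 have h5 : nr (lebesgue_rV d) (w t) <= K1 `^ 2^-1 * (expR (- (be * t)) * n0).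
 rewrite powR12_sqrt ?(ltW K10)//.
 have p0 : 0 <= expR (- (be * t)) * n0 by rewrite mulr_ge0 ?expR_ge0.
 rewrite -(ger0_norm (nr_ge0 _ (w t))) -sqrtr_sqr -(ger0_norm p0) -sqrtr_sqr -sqrtrM ?(ltW K10)//.
 exact: ler_wsqrtr.
 rewrite urE nrZ; last exact: Lw.
 rewrite ger0_norm ?expR_ge0//; apply: le_trans (ler_wpM2l (expR_ge0 _) h5) _.
 rewrite (_ : expR (- theta * t) * _ = K1 `^ 2^-1 * (expR (- theta * t) * expR (- (be * t))) * n0); last by ring.
 rewrite -expRD; apply: ler_wpM2r => //; apply: ler_wpM2l; first exact: powR_ge0.
 rewrite ler_expR (_ : - theta * t + - (be * t) = - ((theta + be) * t)); last by ring.
 by rewrite mulNr lerN2; apply: ler_wpM2r.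
- move=> q q1 [_ gq]; have q0 : 0 < q := lt_le_trans ltr01 q1.
 have jw0 : intg (lebesgue_rV d) (fun x => `|w 0 x| `^ q).
 by rewrite w00; exact: Lpnorm_repr_intg rg q0 gq.
 have Lur t : 0 <= t -> L2 (lebesgue_rV d) (ur t) by move=> t0; have [] := hur t t0.
 have et t : 0 <= t -> expR (- theta * t) <= 1.
 by move=> t0; rewrite -expR0 ler_expR mulNr oppr_le0 mulr_ge0.
 have ule t : 0 <= t -> forall x, `|ur t x| <= `|w t x|.
 move=> t0 x; rewrite urE normrM ger0_norm ?expR_ge0// ler_piMl//; exact: et.
 have ucont := curve_cont0 hsol hur.
 (* Here [z] is the solution itself and [w] the rescaled curve: hinges decrease along [w], and
    [|ur t| <= |w t|] transfers integrability and tails. *)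
 have jz t t0 := intg_zq hrho Lw w_off hinge_mono Lur ule q1 jw0 (t := t) t0.
 have jzB s' t s0 t0 := intg_zBq hrho Lw w_off hinge_mono Lur ule q1 jw0 (s := s') (t := t) s0 t0.
 split; last first.
 move=> t t0; have t0' := ltW t0; have [rt _ _ _] := hur t t0'.
 have [jt It] := power_estimate hrho Lw w_off hinge_mono q1 jw0 t0'.
 rewrite (Lpnorm_reprE rt (jz t t0')) (Lpnorm_reprE rg); last by rewrite w00 in jw0.
 rewrite -EFinM lee_fin.
 have -> : \int[lebesgue_rV d]_x (`|ur t x| `^ q) = expR (- theta * t) `^ q * \int[lebesgue_rV d]_x (`|w t x| `^ q).
  rewrite -(RintZl jt); apply: eq_Rintegral => x _.
  by rewrite urE normrM ger0_norm ?expR_ge0// powRM ?expR_ge0.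
 have I0 : 0 <= \int[lebesgue_rV d]_x (`|w t x| `^ q) by apply: Rint_ge0 => x; exact: powR_ge0.
 rewrite w00 in It.
 have J00 : 0 <= \int[lebesgue_rV d]_x (`|ur 0 x| `^ q) by apply: Rint_ge0 => x; exact: powR_ge0.
 apply: (scaled_root_le q0 (expR_ge0 _) I0 (ltW K10) J00).
 have h2 : mr * (\int[lebesgue_rV d]_x (`|w t x| `^ q)) <= mr * (K1 * \int[lebesgue_rV d]_x (`|ur 0 x| `^ q)).
  by apply: le_trans It _; rewrite mulrA (mulrC mr); exact: ler_wpM2r.
 by rewrite ler_pM2l in h2.
 split.
 by move=> t t0; have [rt _ _ _] := hur t t0; exact: repr_in_Lp rt (jz t t0).
 move=> t t0; have [rt _ _ _] := hur t t0.
 have FF : Filter (nbhs_ge0 t) by exact: within_filter.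
 have h3 : \forall s \near nbhs_ge0 t, 0 <= s by exact: withinT.
 have E s' : 0 <= s' -> Lpnorm U q%:E (u s' \- u t) = ((\int[lebesgue_rV d]_x (`|ur s' x - ur t x| `^ q)) `^ q^-1)%:E.
 move=> s'0; have [rs _ _ _] := hur s' s'0.
 exact: Lpnorm_reprE (reprB rs rt) (jzB s' t s'0 t0).
 apply/fine_cvgP; split; first by apply: filterS h3 => s' s'0; rewrite E.
 apply/cvgr0Pnorm_le => e e0.
 have eq0 : 0 < e `^ q by exact: powR_gt0.
 apply: filterS (power_continuous oU fU hrho Lw w_off hinge_mono Lur ule ucont q1 jw0 t0 eq0) => s' [s'0 hh] /=.
 rewrite E//= ger0_norm ?powR_ge0//.
 have -> : e = (e `^ q) `^ q^-1 by rewrite -powRrM mulfV ?gt_eqF// powRr1// ltW.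
 apply: ge0_ler_powR; rewrite ?nnegrE ?invr_ge0 ?(ltW q0) ?(ltW eq0)//.
 by apply: Rint_ge0 => x; exact: powR_ge0.
- move=> [_ goo] t t0; have t0' := ltW t0; have [rt _ uoff _] := hur t t0'.
 (* [Lnorm] at infinity is defined by cases on whether the whole space is null; in the null case
    both sides are zero. *)
 have [mupos|mu0] := boolP (0 < lebesgue_rV d [set: 'rV[R]_d])%E; last by rewrite !Lpnorm_infty_null// mule0.
 have [a [a0 -> ga]] := Lpnorm_infty_ae rg mupos goo.
 rewrite -EFinM; apply: (Lpnorm_infty_le _ rt); first by rewrite mulr_ge0 ?expR_ge0.
 have mw s' : 0 <= s' -> mfun (fun x => rho x * hinge a (w s' x)).
 by move=> s'0; exact: intg_meas (intg_hinge hrho Lw a0 s'0).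
 have I0 : \int[lebesgue_rV d]_x (rho x * hinge a (w 0 x)) = 0.
 rewrite (@ae_eq_Rint _ _ _ _ _ (fun=> 0)) ?Rint0_eq//; first exact: mw.
 apply: (ae_mono ga) => x hh; rewrite w00 /hinge max_l ?mulr0// subr_le0//.
 have hr x : 0 <= rho x * hinge a (w t x) by have /andP[p1 p2] := rho0 x; rewrite mulr_ge0 ?hinge_ge0.
 have It : \int[lebesgue_rV d]_x (rho x * hinge a (w t x)) = 0.
 apply/eqP; rewrite eq_le; apply/andP; split; last exact: Rint_ge0.
 by rewrite -I0; exact: hinge_mono.
 apply: (ae_mono (Rint_eq0_ae (intg_hinge hrho Lw a0 t0') hr It)) => x hx.
 have [Ux|nUx] := pselect (U x); last by rewrite uoff// normr0 mulr_ge0 ?expR_ge0.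
 rewrite urE normrM ger0_norm ?expR_ge0//; apply: ler_wpM2l; first exact: expR_ge0.
 have rp : rho x != 0 by rewrite gt_eqF// (lt_le_trans mr0)// rhomr.
 move/eqP : hx; rewrite mulf_eq0 (negbTE rp)/= => /eqP hh.
 by rewrite -subr_le0 -[leRHS]hh le_max lexx orbT.
Qed.
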